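(* Assume the Riemann Hypothesis. Let $s=\sigma+it$ with $1/2<\sigma\le3/2$, let $t_0\ge2\gamma_1$, $t\ge\max\{2\exp(e^2),t_0\}$, and $0<\lambda\le (t_0/2)\log\log(3t_0/2)$. Then \[ \left|\log|\zeta(s)|\right|\le 2\left(\frac{\phi_1(3t/2)\log(3t/2)}{\log\log(3t/2)}+\frac{1}{75t}\right)\log\left(1+\frac{2\lambda}{(\sigma-\frac12)\log\log(3t/2)}\right)+\Omega(t_0,\lambda;t) \] and \[ \log|\zeta(s)|\le\frac{\lambda\log(3t/2)}{\pi\log\log(3t/2)}+\Omega(t_0,\lambda;t), \] where \begin{align*} \Omega(t_0,\lambda;t)={}&\frac{a_1(t_0)\phi_2(3t/2)\log(3t/2)}{\lambda\log\log(3t/2)}+\frac{a_2(t_0)\log\log(3t/2)}{\lambda}+a_3(t_0)\\ &+12\left(\frac{\phi_1(t/2)\log(t/2)}{t\log\log(t/2)}+\frac{1}{75t^2}\right)\frac{\lambda}{\log\log(3t/2)}+\frac{a_4(t_0)\phi_2(3t/2)}{(\log\log(3t/2))^2}. \end{align*}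
   Context: $\zeta$ is the Riemann zeta-function; RH asserts all its nontrivial zeros have real part $1/2$. $\gamma_1\approx14.1347$ is the positive ordinate of the first nontrivial zero. $\xi(s)=\frac12 s(s-1)\pi^{-s/2}\Gamma(s/2)\zeta(s)$. $\delta(t_0)=(1+1/t_0)^2$, and $\mathcal{R}_1(t_0)=\left|\log|\xi(\tfrac12)|\right|+\frac14\log\frac{2e}{\pi}+\frac{\delta(t_0)}{\pi}\int_0^{\gamma_1}\frac{|\log(2\pi e/u)|}{1-(u/t_0)^2}du+\frac78\left|\log\left(\frac{1}{\gamma_1^2}-\frac{1}{t_0^2}\right)\right|+\frac{7+2t_0}{4}\log\frac{2t_0}{2t_0-1}+\frac{1}{6t_0}+\frac{4}{45t_0^3}$. With $\delta=\delta(t_0)$: $a_1(t_0)=\delta\left(\frac{117}{4}+3\delta+(3+\delta)\left(\frac{t_0}{e^{e^2}}+\frac{3+e}{e}\right)\right)$, $a_2(t_0)=\frac{\delta}{75}\left(\frac{t_0}{2\gamma_1}+1+\frac1e\right)$, $a_3(t_0)=\frac{3(1+t_0)^2}{\gamma_1(t_0^2-\gamma_1^2)}+0.81\delta(3+\delta)+\mathcal{R}_1(t_0)$, $a_4(t_0)=\frac{4\delta}{5e}\left(3+\frac{\delta}{4}\right)$. For $a,b,c>0$ let $\mathcal{M}(a,b,c;t)=a+\frac{b}{(\log t)^c\log\log t}$, $\mathcal{M}_1(t)=\mathcal{M}(0.759282,20.1911,0.285;t)$, $\mathcal{M}_2(t)=\mathcal{M}(0.653,60.12,0.2705;t)$.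 Define $\phi_1(t)=0.96$ for $2\pi\le t<10^{2465}$ and $\phi_1(t)=\mathcal{M}_1(t)+0.96-\mathcal{M}_1(10^{2465})$ for $t\ge10^{2465}$; $\phi_2(t)=2.491$ for $2\pi\le t<10^{208}$ and $\phi_2(t)=\mathcal{M}_2(t)+2.491-\mathcal{M}_2(10^{208})$ for $t\ge10^{208}$. (Known from the literature under RH, with $S(t)=\frac1\pi\arg\zeta(\frac12+it)$ and $S_1(t)=\int_0^tS(u)du$: $|S(t)|\le\phi_1(t)\log t/\log\log t$ and $|S_1(t)|\le\phi_2(t)\log t/(\log\log t)^2$ for $t\ge2\pi$.) *)

(* Defs.v *)
From Stdlib Require Import Reals.
From Coquelicot Require Import Coquelicot.
Open Scope R_scope.

(* The tail integral  int_1^oo {x} x^{-s-1} dx  (componentwise, for x > 0: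
   x^{-s-1} = x^{-sigma-1} (cos(t ln x) - i sin(t ln x))). *)
Definition zeta_tail (s : C) : C :=
  (real (Lim_seq (fun N : nat => RInt (fun x =>
      frac_part x * Rpower x (- Re s - 1) * cos (Im s * ln x)) 1 (INR N))),
   - real (Lim_seq (fun N : nat => RInt (fun x =>
      frac_part x * Rpower x (- Re s - 1) * sin (Im s * ln x)) 1 (INR N)))).

(* Riemann zeta function, via its standard analytic continuation to Re s > 0:
   zeta(s) = s/(s-1) - s * int_1^oo {x} x^{-s-1} dx   (Re s > 0, s <> 1). *)
Definition zeta (s : C) : C :=
  Cminus (Cdiv s (Cminus s (RtoC 1))) (Cmult s (zeta_tail s)).

Definition RH : Prop :=
  forall s : C, 0 < Re s < 1 -> zeta s = RtoC 0 -> Re s = 1 / 2.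

Definition gamma1 : R :=
  real (Glb_Rbar (fun t => 0 < t /\ exists sg, 0 < sg < 1 /\ zeta (sg, t) = RtoC 0)).

Definition Gamma_R (x : R) : R :=
  real (Lim_seq (fun N : nat =>
    RInt (fun u => Rpower u (x - 1) * exp (- u)) (/ INR (S N)) (INR (S N)))).

(* xi(x) = 1/2 x (x-1) pi^{-x/2} Gamma(x/2) zeta(x), for real 0 < x < 1
   (zeta is real there). *)
Definition xi_real (x : R) : R :=
  1 / 2 * x * (x - 1) * Rpower PI (- x / 2) * Gamma_R (x / 2) * Re (zeta (RtoC x)).

Definition delta (t0 : R) : R := (1 + 1 / t0) ^ 2.

Definition R1_integral (t0 : R) : R :=
  real (Lim_seq (fun n : nat =>
    RInt (fun u => Rabs (ln (2 * PI * exp 1 / u)) / (1 - (u / t0) ^ 2))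
         (gamma1 / INR (S n)) gamma1)).

Definition R1 (t0 : R) : R :=
  Rabs (ln (Rabs (xi_real (1 / 2)))) + 1 / 4 * ln (2 * exp 1 / PI)
  + delta t0 / PI * R1_integral t0
  + 7 / 8 * Rabs (ln (1 / gamma1 ^ 2 - 1 / t0 ^ 2))
  + (7 + 2 * t0) / 4 * ln (2 * t0 / (2 * t0 - 1))
  + 1 / (6 * t0) + 4 / (45 * t0 ^ 3).

Definition a1 (t0 : R) : R :=
  let d := delta t0 in
  d * (117 / 4 + 3 * d + (3 + d) * (t0 / exp (exp 2) + (3 + exp 1) / exp 1)).

Definition a2 (t0 : R) : R :=
  delta t0 / 75 * (t0 / (2 * gamma1) + 1 + 1 / exp 1).

Definition a3 (t0 : R) : R :=
  let d := delta t0 in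
  3 * (1 + t0) ^ 2 / (gamma1 * (t0 ^ 2 - gamma1 ^ 2)) + 0.81 * d * (3 + d) + R1 t0.

Definition a4 (t0 : R) : R :=
  let d := delta t0 in 4 * d / (5 * exp 1) * (3 + d / 4).

Definition Mfun (a b c t : R) : R := a + b / (Rpower (ln t) c * ln (ln t)).
Definition M1 (t : R) : R := Mfun 0.759282 20.1911 0.285 t.
Definition M2 (t : R) : R := Mfun 0.653 60.12 0.2705 t.

Definition phi1 (t : R) : R :=
  if Rlt_dec t (10 ^ 2465) then 0.96 else M1 t + 0.96 - M1 (10 ^ 2465).
Definition phi2 (t : R) : R :=
  if Rlt_dec t (10 ^ 208) then 2.491 else M2 t + 2.491 - M2 (10 ^ 208).

Definition Omega (t0 lam t : R) : R :=
  let T := 3 * t / 2 in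
  a1 t0 * phi2 T * ln T / (lam * ln (ln T))
  + a2 t0 * ln (ln T) / lam + a3 t0
  + 12 * (phi1 (t / 2) * ln (t / 2) / (t * ln (ln (t / 2))) + 1 / (75 * t ^ 2))
       * lam / ln (ln T)
  + a4 t0 * phi2 T / (ln (ln T)) ^ 2.

(* Main.v *)
(* Let X(s) = s (s - 1) zeta(s) M(s), where M(s) is the integral of exp(-pi e^(2v)) e^(sv) over the real line.
   By the functional equation |X(s - h)| = |X(s + h)| on the critical line.  Under RH the quotient
   X(s - h) / X(s + h) is holomorphic to the right of that line, and by Harnack's inequality it grows polynomially,
   so Phragmen-Lindelof gives |X(s - h)| <= |X(s + h)| for Re s >= 1/2.  Hence log |X(s + h) / X(s - h)| is a
   nonnegative harmonic function on a disc of radius 4 that almost touches the critical line.  It is the sum of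
   the contribution h log(t / 2 pi) + O(h / t) of the gamma factors and of log |zeta(s + h) / zeta(s - h)|, and the
   Fourier coefficients of the latter can be read off a concentric circle inside Re s > 1, where the Euler product
   bounds it.  Comparing the Poisson kernel with nonnegative trigonometric polynomials of degree less than N bounds
   log |zeta(s + h) / zeta(s - h)| near the edge of the disc.  Summing over steps of length 2h from sigma to 3/2 and
   letting h tend to 0 yields
     | log |zeta(sigma + it)| | <= log 3 + 0.01 + K + (4 / N) (log(t / 2 pi) + 0.007 + 2 K) log(1 + 8 / (N (sigma - 1/2)))
   with K of size (4/3)^N / N.  With T = 3t/2, taking N about 3 log log T makes this smaller than the claimed bound for
   every lambda: of Omega only the term with a_1 and the inequality a_3 >= 3.24 are needed. *)
Require Import Defs.
From Stdlib Require Import Reals.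
From Coquelicot Require Import Coquelicot.
From Stdlib Require Import Lra Lia Psatz.
From Stdlib Require Import ClassicalEpsilon Bool.
Open Scope R_scope.

(** * Holomorphic approximants *)

(** [zeta] is given only as a limit of real integrals, so function theory is developed for the
    formal expressions [hexp] alone. Zeta enters through the exponential sums [kN], which
    approximate (s - 1) zeta(s) uniformly on bounded sets, and each estimate is passed to the limit
    afterwards. For the same reason the logarithmic derivative of X is replaced by quotients with a
    finite shift h: the positivity of log |X(s + h) / X(s - h)| takes the place of the positivity of
    Re X'/X, which is usually read off the Hadamard product. About 1 / h steps are added up, so the
    errors of a single step have to be small multiples of h. The disc is centred near 9/2 + it:
    radius 4 reaches almost to the critical line, while the circle of radius 3 stays in Re s >= 3/2.
    The n-th Fourier coefficient grows by (4/3)^n from the smaller circle to the larger one, so the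
    Poisson kernel itself cannot be transported and is replaced by kernels of finite degree N. Since
    3 log(4/3) < 1, a degree near 3 log log T keeps (4/3)^N below log T. *)

Ltac pos := first
  [ lra | assumption | apply exp_pos | apply pow2_ge_0 | apply Rabs_pos | apply Cmod_ge_0
  | apply Rinv_0_lt_compat; pos | apply Rlt_le, Rinv_0_lt_compat; pos
  | apply Rdiv_lt_0_compat; pos | apply Rlt_le, Rdiv_lt_0_compat; pos
  | apply Rmult_lt_0_compat; pos | apply Rle_ge; pos | apply Rmult_le_pos; pos
  | apply pow_lt; pos | apply pow_le; pos | apply Rlt_le, exp_pos ].

Ltac dcont := match goal with |- continuous ?f _ =>
  apply (ex_derive_continuous f); eexists; auto_derive; [easy|reflexivity] end.

Definition cexp (z : C) : C := (exp (Re z) * cos (Im z), exp (Re z) * sin (Im z)).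

Lemma cexp_0 : cexp (RtoC 0) = RtoC 1.
Proof. unfold cexp, RtoC; simpl; rewrite exp_0, cos_0, sin_0; f_equal; ring. Qed.

Lemma cexp_plus (z w : C) : cexp (z + w) = Cmult (cexp z) (cexp w).
Proof.
  destruct z as [a b], w as [c d]; unfold cexp, Cmult, Cplus; simpl.
  rewrite exp_plus, cos_plus, sin_plus; f_equal; ring.
Qed.

Lemma Cmod_cexp (z : C) : Cmod (cexp z) = exp (Re z).
Proof.
  unfold Cmod, cexp; simpl fst; simpl snd.
  pose proof (sin2_cos2 (Im z)) as H; unfold Rsqr in H.
  replace (_ ^ 2 + _ ^ 2) with (exp (Re z) ^ 2 * (sin (Im z) * sin (Im z) + cos (Im z) * cos (Im z))) by ring.
  rewrite H, Rmult_1_r; apply sqrt_pow2; left; apply exp_pos.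
Qed.

Lemma im_le_Cmod (z : C) : Rabs (Im z) <= Cmod z.
Proof. exact (Rle_trans _ _ _ (Rmax_r _ _) (Rmax_Cmod z)). Qed.

Lemma Cmod_le_sum (z : C) : Cmod z <= Rabs (Re z) + Rabs (Im z).
Proof.
  unfold Cmod; destruct z as [a b]; simpl.
  apply Rsqr_incr_0_var.
  - unfold Rsqr; rewrite sqrt_def by nra.
    pose proof (Rabs_pos a); pose proof (Rabs_pos b).
    pose proof (Rsqr_abs a); pose proof (Rsqr_abs b); unfold Rsqr in *; nra.
  - pose proof (Rabs_pos a); pose proof (Rabs_pos b); lra.
Qed.

Lemma Cmod_sub_sym (z w : C) : Cmod (z - w) = Cmod (w - z).
Proof. rewrite <- Cmod_opp; f_equal; ring. Qed.

Lemma Cmod_rev_triangle (z w : C) : Cmod z - Cmod w <= Cmod (z - w).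
Proof.
  pose proof (Cmod_triangle (z - w) w) as H.
  replace (z - w + w)%C with z in H by ring; lra.
Qed.

Lemma Cmod_sq (z : C) : Cmod z ^ 2 = Re z ^ 2 + Im z ^ 2.
Proof. apply Cmod2_alt. Qed.

Lemma Re_plus (z w : C) : Re (z + w) = Re z + Re w. Proof. reflexivity. Qed.
Lemma Im_plus (z w : C) : Im (z + w) = Im z + Im w. Proof. reflexivity. Qed.
Lemma Re_minus (z w : C) : Re (z - w) = Re z - Re w. Proof. reflexivity. Qed.
Lemma Im_minus (z w : C) : Im (z - w) = Im z - Im w. Proof. reflexivity. Qed.
Lemma Re_mult (z w : C) : Re (z * w) = Re z * Re w - Im z * Im w. Proof. reflexivity. Qed.
Lemma Im_mult (z w : C) : Im (z * w) = Re z * Im w + Im z * Re w. Proof. reflexivity. Qed.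

(** * Complex differentiability, paths and the exponential function *)

(** A first-order estimate with a non-strict bound, trivially true at w = z; no difference quotient
    in C has to be formed. *)
Definition cdiff (f : C -> C) (z l : C) : Prop :=
  forall eps, 0 < eps -> exists del, 0 < del /\ forall w, Cmod (w - z) < del ->
    Cmod (f w - f z - l * (w - z)) <= eps * Cmod (w - z).

Definition ccont (f : C -> C) (z : C) : Prop :=
  forall eps, 0 < eps -> exists del, 0 < del /\ forall w, Cmod (w - z) < del ->
    Cmod (f w - f z) <= eps.

Lemma cdiff_lip (f : C -> C) (z l : C) : cdiff f z l ->
  exists del, 0 < del /\ forall w, Cmod (w - z) < del ->
    Cmod (f w - f z) <= (Cmod l + 1) * Cmod (w - z).
Proof.
  intros H; destruct (H 1 Rlt_0_1) as [del [Hd H1]].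
  exists del; split; [easy|]; intros w Hw; specialize (H1 w Hw).
  replace (f w - f z)%C with ((f w - f z - l * (w - z)) + l * (w - z))%C by ring.
  eapply Rle_trans; [apply Cmod_triangle|]. rewrite Cmod_mult; lra.
Qed.

Lemma cdiff_ccont (f : C -> C) (z l : C) : cdiff f z l -> ccont f z.
Proof.
  intros H eps He; destruct (cdiff_lip _ _ _ H) as [del [Hd H1]].
  pose proof (Cmod_ge_0 l) as Hl.
  assert (Hp : 0 < eps / (Cmod l + 1)) by pos.
  exists (Rmin del (eps / (Cmod l + 1))); split; [now apply Rmin_pos|].
  intros w Hw.
  pose proof (Rlt_le_trans _ _ _ Hw (Rmin_l _ _)); pose proof (Rlt_le_trans _ _ _ Hw (Rmin_r _ _)).
  eapply Rle_trans; [now apply H1|].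
  apply Rle_trans with ((Cmod l + 1) * (eps / (Cmod l + 1))).
  - apply Rmult_le_compat_l; lra.
  - right; field; lra.
Qed.

Lemma cdiff_const (a z : C) : cdiff (fun _ => a) z (RtoC 0).
Proof.
  intros eps He; exists 1; split; [lra|]; intros w _.
  replace (a - a - RtoC 0 * (w - z))%C with (RtoC 0) by ring.
  rewrite Cmod_0; apply Rmult_le_pos; [lra|apply Cmod_ge_0].
Qed.

Lemma cdiff_id (z : C) : cdiff (fun w => w) z (RtoC 1).
Proof.
  intros eps He; exists 1; split; [lra|]; intros w _.
  replace (w - z - RtoC 1 * (w - z))%C with (RtoC 0) by ring.
  rewrite Cmod_0; apply Rmult_le_pos; [lra|apply Cmod_ge_0].
Qed.

Lemma cdiff_plus (f g : C -> C) (z l m : C) : cdiff f z l -> cdiff g z m ->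
  cdiff (fun w => f w + g w)%C z (l + m)%C.
Proof.
  intros Hf Hg eps He.
  destruct (Hf (eps / 2)) as [d1 [P1 H1]]; [lra|]; destruct (Hg (eps / 2)) as [d2 [P2 H2]]; [lra|].
  exists (Rmin d1 d2); split; [now apply Rmin_pos|]; intros w Hw.
  specialize (H1 w (Rlt_le_trans _ _ _ Hw (Rmin_l _ _))).
  specialize (H2 w (Rlt_le_trans _ _ _ Hw (Rmin_r _ _))).
  replace (f w + g w - (f z + g z) - (l + m) * (w - z))%C
    with ((f w - f z - l * (w - z)) + (g w - g z - m * (w - z)))%C by ring.
  eapply Rle_trans; [apply Cmod_triangle|]; lra.
Qed.

Lemma cdiff_mult (f g : C -> C) (z l m : C) : cdiff f z l -> cdiff g z m ->
  cdiff (fun w => f w * g w)%C z (l * g z + f z * m)%C.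
Proof.
  intros Hf Hg eps He.
  pose proof (Cmod_ge_0 (g z)) as G0; pose proof (Cmod_ge_0 l) as L0;
  pose proof (Cmod_ge_0 (f z)) as F0.
  set (A := Cmod (g z) + 1); set (B := Cmod l + 1); set (D := Cmod (f z) + 1).
  destruct (Hf (eps / (3 * A))) as [d1 [P1 H1]]; [apply Rdiv_lt_0_compat; unfold A; lra|].
  destruct (Hg (eps / (3 * D))) as [d2 [P2 H2]]; [apply Rdiv_lt_0_compat; unfold D; lra|].
  destruct (cdiff_ccont _ _ _ Hg (Rmin 1 (eps / (3 * B)))) as [d3 [P3 H3]].
  { apply Rmin_pos; [lra|apply Rdiv_lt_0_compat; unfold B; lra]. }
  exists (Rmin d1 (Rmin d2 d3)); split; [repeat apply Rmin_pos; easy|]; intros w Hw.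
  assert (W1 : Cmod (w - z) < d1) by exact (Rlt_le_trans _ _ _ Hw (Rmin_l _ _)).
  assert (W' : Cmod (w - z) < Rmin d2 d3) by exact (Rlt_le_trans _ _ _ Hw (Rmin_r _ _)).
  assert (W2 : Cmod (w - z) < d2) by exact (Rlt_le_trans _ _ _ W' (Rmin_l _ _)).
  assert (W3 : Cmod (w - z) < d3) by exact (Rlt_le_trans _ _ _ W' (Rmin_r _ _)).
  specialize (H1 w W1); specialize (H2 w W2); specialize (H3 w W3).
  pose proof (Rle_trans _ _ _ H3 (Rmin_l _ _)) as H3a.
  pose proof (Rle_trans _ _ _ H3 (Rmin_r _ _)) as H3b.
  set (h := Cmod (w - z)) in *; assert (Hh : 0 <= h) by apply Cmod_ge_0.
  replace (f w * g w - f z * g z - (l * g z + f z * m) * (w - z))%C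
    with ((f w - f z - l * (w - z)) * g w + (l * (w - z)) * (g w - g z)
          + f z * (g w - g z - m * (w - z)))%C by ring.
  eapply Rle_trans; [apply Cmod_triangle|].
  eapply Rle_trans; [apply Rplus_le_compat_r, Cmod_triangle|].
  rewrite !Cmod_mult; fold h.
  assert (Gw : Cmod (g w) <= A).
  { pose proof (Cmod_rev_triangle (g w) (g z)); unfold A; lra. }
  assert (E1 : Cmod (f w - f z - l * (w - z)) * Cmod (g w) <= eps / 3 * h).
  { apply Rle_trans with ((eps / (3 * A) * h) * A).
    - apply Rmult_le_compat; [apply Cmod_ge_0|apply Cmod_ge_0|easy|easy].
    - right; field; unfold A; lra. }
  assert (E2 : Cmod l * h * Cmod (g w - g z) <= eps / 3 * h).
  { apply Rle_trans with ((B * h) * (eps / (3 * B))).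
    - apply Rmult_le_compat; [now apply Rmult_le_pos|apply Cmod_ge_0| |easy].
      apply Rmult_le_compat_r; unfold B; lra.
    - right; field; unfold B; lra. }
  assert (E3 : Cmod (f z) * Cmod (g w - g z - m * (w - z)) <= eps / 3 * h).
  { apply Rle_trans with (D * (eps / (3 * D) * h)).
    - apply Rmult_le_compat; [easy|apply Cmod_ge_0|unfold D; lra|easy].
    - right; field; unfold D; lra. }
  lra.
Qed.

Lemma ccont_neq_0 (f : C -> C) (z : C) : ccont f z -> f z <> RtoC 0 ->
  exists del, 0 < del /\ forall w, Cmod (w - z) < del -> Cmod (f z) / 2 <= Cmod (f w).
Proof.
  intros Hf Hz; apply Cmod_gt_0 in Hz.
  destruct (Hf (Cmod (f z) / 2)) as [d [Pd H]]; [lra|].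
  exists d; split; [easy|]; intros w Hw; specialize (H w Hw).
  pose proof (Cmod_rev_triangle (f z) (f w)); rewrite Cmod_sub_sym in H; lra.
Qed.

Lemma Cmod_pos_neq (z : C) : 0 < Cmod z -> z <> RtoC 0.
Proof. intros H E; rewrite E, Cmod_0 in H; lra. Qed.

Lemma cdiff_inv (f : C -> C) (z l : C) : cdiff f z l -> f z <> RtoC 0 ->
  cdiff (fun w => / f w)%C z (- (l * / f z * / f z))%C.
Proof.
  intros Hf Hz eps He.
  destruct (ccont_neq_0 _ _ (cdiff_ccont _ _ _ Hf) Hz) as [d1 [P1 H1]].
  pose proof (proj1 (Cmod_gt_0 _) Hz) as F0.
  pose proof (Cmod_ge_0 l) as L0.
  set (F := Cmod (f z)) in *.
  destruct (Hf (eps * F * F / 4)) as [d2 [P2 H2]]; [unfold Rdiv; repeat apply Rmult_lt_0_compat; lra|].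
  destruct (cdiff_ccont _ _ _ Hf (eps * F * F * F / (4 * (Cmod l + 1)))) as [d3 [P3 H3]].
  { apply Rdiv_lt_0_compat; [|lra]. repeat apply Rmult_lt_0_compat; lra. }
  exists (Rmin d1 (Rmin d2 d3)); split; [repeat apply Rmin_pos; easy|]; intros w Hw.
  assert (W1 : Cmod (w - z) < d1) by exact (Rlt_le_trans _ _ _ Hw (Rmin_l _ _)).
  assert (W' : Cmod (w - z) < Rmin d2 d3) by exact (Rlt_le_trans _ _ _ Hw (Rmin_r _ _)).
  assert (W2 : Cmod (w - z) < d2) by exact (Rlt_le_trans _ _ _ W' (Rmin_l _ _)).
  assert (W3 : Cmod (w - z) < d3) by exact (Rlt_le_trans _ _ _ W' (Rmin_r _ _)).
  specialize (H1 w W1); specialize (H2 w W2); specialize (H3 w W3).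
  assert (Fw : f w <> RtoC 0) by (apply Cmod_pos_neq; fold F in H1; lra).
  set (h := Cmod (w - z)) in *; assert (Hh : 0 <= h) by apply Cmod_ge_0.
  replace (/ f w - / f z - - (l * / f z * / f z) * (w - z))%C
    with ((- (f w - f z - l * (w - z)) * f z + l * (w - z) * (f w - f z)) * (/ f w * / f z * / f z))%C
    by (field; now split).
  rewrite !Cmod_mult, !Cmod_inv by easy; fold F.
  assert (I1 : / Cmod (f w) <= 2 / F).
  { unfold Rdiv; rewrite <- (Rinv_inv 2), <- Rinv_mult.
    apply Rinv_le_contravar; [lra|]. fold F in H1; lra. }
  assert (I0 : 0 < / Cmod (f w)) by (apply Rinv_0_lt_compat; fold F in H1; lra).
  assert (Num : Cmod (- (f w - f z - l * (w - z)) * f z + l * (w - z) * (f w - f z)) <= eps * F * F * F / 2 * h).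
  { eapply Rle_trans; [apply Cmod_triangle|]; rewrite !Cmod_mult, Cmod_opp; fold F h.
    assert (E2 : Cmod l * h * Cmod (f w - f z) <= eps * F * F * F / 4 * h).
    { apply Rle_trans with ((Cmod l + 1) * h * (eps * F * F * F / (4 * (Cmod l + 1)))).
      - apply Rmult_le_compat; [now apply Rmult_le_pos|apply Cmod_ge_0| |easy].
        apply Rmult_le_compat_r; lra.
      - right; field; lra. }
    assert (E1 : Cmod (f w - f z - l * (w - z)) * F <= eps * F * F / 4 * h * F)
      by (apply Rmult_le_compat_r; lra).
    lra. }
  apply Rle_trans with ((eps * F * F * F / 2 * h) * (2 / F * / F * / F)).
  - apply Rmult_le_compat; [apply Cmod_ge_0| |easy|].
    + repeat apply Rmult_le_pos; lra.
    + apply Rmult_le_compat_r; [lra|]. apply Rmult_le_compat_r; lra.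
  - right; field; lra.
Qed.

Lemma derivable_pt_lim_dom (f : R -> R) (x l : R) : is_derive f x l ->
  forall eps, 0 < eps -> exists del, 0 < del /\
   forall y, Rabs (y - x) < del -> Rabs (f y - f x - l * (y - x)) <= eps * Rabs (y - x).
Proof.
  intros H eps He; apply is_derive_Reals in H; destruct (H eps He) as [d Hd].
  exists d; split; [apply cond_pos|]; intros y Hy.
  destruct (Req_dec y x) as [->|Hne].
  - replace (f x - f x - l * (x - x)) with 0 by ring; replace (x - x) with 0 by ring.
    rewrite Rabs_R0; lra.
  - specialize (Hd (y - x) ltac:(lra) Hy).
    replace (x + (y - x)) with y in Hd by ring.
    replace (f y - f x - l * (y - x)) with (((f y - f x) / (y - x) - l) * (y - x)) by (field; lra).
    rewrite Rabs_mult; apply Rmult_le_compat_r; [apply Rabs_pos|lra].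
Qed.

Lemma is_derive_of_dom (f : R -> R) (x l : R) :
  (forall eps, 0 < eps -> exists del, 0 < del /\
   forall y, Rabs (y - x) < del -> Rabs (f y - f x - l * (y - x)) <= eps * Rabs (y - x)) ->
  is_derive f x l.
Proof.
  intros H; apply is_derive_Reals; intros eps He.
  destruct (H (eps / 2)) as [d [Pd Hd]]; [lra|].
  exists (mkposreal d Pd); simpl; intros h Hne Hh.
  specialize (Hd (x + h)); replace (x + h - x) with h in Hd by ring; specialize (Hd Hh).
  replace ((f (x + h) - f x) / h - l) with ((f (x + h) - f x - l * h) / h) by (field; easy).
  unfold Rdiv; rewrite Rabs_mult, Rabs_inv.
  assert (0 < Rabs h) by now apply Rabs_pos_lt.
  apply Rle_lt_trans with (eps / 2 * Rabs h * / Rabs h).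
  - apply Rmult_le_compat_r; [pos|easy].
  - rewrite Rmult_assoc, Rinv_r by lra; lra.
Qed.

(** Split into components so that the mean value theorem and integration of real functions apply
    directly. *)
Definition cpath (g : R -> C) (x : R) (d : C) : Prop :=
  is_derive (fun y => Re (g y)) x (Re d) /\ is_derive (fun y => Im (g y)) x (Im d).

Lemma cpath_dom (g : R -> C) (x : R) (d : C) : cpath g x d ->
  forall eps, 0 < eps -> exists del, 0 < del /\
   forall y, Rabs (y - x) < del -> Cmod (g y - g x - d * RtoC (y - x)) <= eps * Rabs (y - x).
Proof.
  intros [H1 H2] eps He.
  destruct (derivable_pt_lim_dom _ _ _ H1 (eps / 2)) as [d1 [P1 D1]]; [lra|].
  destruct (derivable_pt_lim_dom _ _ _ H2 (eps / 2)) as [d2 [P2 D2]]; [lra|].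
  exists (Rmin d1 d2); split; [now apply Rmin_pos|]; intros y Hy.
  specialize (D1 y (Rlt_le_trans _ _ _ Hy (Rmin_l _ _))).
  specialize (D2 y (Rlt_le_trans _ _ _ Hy (Rmin_r _ _))).
  eapply Rle_trans; [apply Cmod_le_sum|].
  replace (Re (g y - g x - d * RtoC (y - x))) with (Re (g y) - Re (g x) - Re d * (y - x))
    by (unfold RtoC, Re; simpl; ring).
  replace (Im (g y - g x - d * RtoC (y - x))) with (Im (g y) - Im (g x) - Im d * (y - x))
    by (unfold RtoC, Im; simpl; ring).
  lra.
Qed.

Lemma cpath_of_dom (g : R -> C) (x : R) (d : C) :
  (forall eps, 0 < eps -> exists del, 0 < del /\
   forall y, Rabs (y - x) < del -> Cmod (g y - g x - d * RtoC (y - x)) <= eps * Rabs (y - x)) ->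
  cpath g x d.
Proof.
  intros H; split; apply is_derive_of_dom; intros eps He; destruct (H eps He) as [del [Pd Hd]];
  exists del; (split; [easy|]); intros y Hy; (eapply Rle_trans; [|apply (Hd y Hy)]).
  - eapply Rle_trans; [|apply re_le_Cmod]; right; f_equal; unfold RtoC, Re; simpl; ring.
  - eapply Rle_trans; [|apply im_le_Cmod]; right; f_equal; unfold RtoC, Im; simpl; ring.
Qed.

Lemma cpath_comp (f : C -> C) (g : R -> C) (x : R) (l d : C) :
  cdiff f (g x) l -> cpath g x d -> cpath (fun y => f (g y)) x (l * d)%C.
Proof.
  intros Hf Hg; apply cpath_of_dom; intros eps He.
  pose proof (Cmod_ge_0 d) as D0; pose proof (Cmod_ge_0 l) as L0.
  set (e1 := eps / (2 * (Cmod d + 1))).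
  assert (Pe1 : 0 < e1) by pos.
  set (e2 := Rmin 1 (eps / (2 * (Cmod l + 1)))).
  assert (Pe2 : 0 < e2) by (apply Rmin_pos; [lra|pos]).
  destruct (Hf e1 Pe1) as [d1 [P1 H1]].
  destruct (cpath_dom _ _ _ Hg e2 Pe2) as [d2 [P2 H2]].
  assert (P3 : 0 < d1 / (Cmod d + 1)) by pos.
  exists (Rmin d2 (d1 / (Cmod d + 1))); split; [now apply Rmin_pos|]; intros y Hy.
  pose proof (Rlt_le_trans _ _ _ Hy (Rmin_l _ _)) as Y2.
  pose proof (Rlt_le_trans _ _ _ Hy (Rmin_r _ _)) as Y1.
  specialize (H2 y Y2).
  set (a := Rabs (y - x)) in *; assert (A0 : 0 <= a) by apply Rabs_pos.
  assert (E2a : e2 <= 1) by apply Rmin_l.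
  assert (E2b : e2 <= eps / (2 * (Cmod l + 1))) by apply Rmin_r.
  assert (Hgy : Cmod (g y - g x) <= (Cmod d + 1) * a).
  { replace (g y - g x)%C with ((g y - g x - d * RtoC (y - x)) + d * RtoC (y - x))%C by ring.
    eapply Rle_trans; [apply Cmod_triangle|]; rewrite Cmod_mult, Cmod_R; fold a; nra. }
  assert (Hlt : Cmod (g y - g x) < d1).
  { eapply Rle_lt_trans; [apply Hgy|].
    apply Rlt_le_trans with ((Cmod d + 1) * (d1 / (Cmod d + 1))); [apply Rmult_lt_compat_l; lra|right; field; lra]. }
  specialize (H1 (g y) Hlt).
  replace (f (g y) - f (g x) - l * d * RtoC (y - x))%C
    with ((f (g y) - f (g x) - l * (g y - g x)) + l * (g y - g x - d * RtoC (y - x)))%C by ring.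
  eapply Rle_trans; [apply Cmod_triangle|]; rewrite (Cmod_mult l).
  apply Rle_trans with (e1 * ((Cmod d + 1) * a) + (Cmod l + 1) * (eps / (2 * (Cmod l + 1)) * a)).
  - apply Rplus_le_compat.
    + eapply Rle_trans; [apply H1|]; apply Rmult_le_compat_l; [lra|easy].
    + apply Rmult_le_compat; [easy|apply Cmod_ge_0|lra|].
      eapply Rle_trans; [apply H2|]; now apply Rmult_le_compat_r.
  - unfold e1; right; field; lra.
Qed.

Lemma MVT_abs_le (f f' : R -> R) (a b M : R) : a <= b ->
  (forall x, a <= x <= b -> is_derive f x (f' x)) ->
  (forall x, a <= x <= b -> Rabs (f' x) <= M) ->
  Rabs (f b - f a) <= M * (b - a).
Proof.
  intros Hab Hd Hb.
  destruct (MVT_gen f a b f') as [c [Hc E]].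
  - intros x Hx; apply Hd; rewrite Rmin_left, Rmax_right in Hx by lra; lra.
  - intros x Hx; rewrite Rmin_left, Rmax_right in Hx by lra.
    apply continuity_pt_filterlim.
    exact (ex_derive_continuous f x (ex_intro _ _ (Hd x Hx))).
  - rewrite Rmin_left, Rmax_right in Hc by lra.
    rewrite E, Rabs_mult, (Rabs_right (b - a)) by lra.
    apply Rmult_le_compat_r; [lra|now apply Hb].
Qed.

Lemma cexp_line (h : C) (x : R) : cpath (fun y => cexp (RtoC y * h)) x (h * cexp (RtoC x * h))%C.
Proof.
  destruct h as [a b]; split.
  - apply (is_derive_ext (fun y => exp (y * a) * cos (y * b))).
    { intros y; unfold cexp; simpl; f_equal; f_equal; ring. }
    unfold cexp; simpl.
    auto_derive; [easy|]. replace (x * a - 0 * b) with (x * a) by ring.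
    replace (x * b + 0 * a) with (x * b) by ring; ring.
  - apply (is_derive_ext (fun y => exp (y * a) * sin (y * b))).
    { intros y; unfold cexp; simpl; f_equal; f_equal; ring. }
    unfold cexp; simpl.
    auto_derive; [easy|]. replace (x * a - 0 * b) with (x * a) by ring.
    replace (x * b + 0 * a) with (x * b) by ring; ring.
Qed.

Lemma exp_le (a b : R) : a <= b -> exp a <= exp b.
Proof. intros [H| ->]; [left; now apply exp_increasing|lra]. Qed.

(** The mean value theorem on the segment from 0 to h, used for the real and the imaginary part
    separately; this costs the factor 2. *)
Lemma cexp_sub_1 (h : C) : Cmod (cexp h - RtoC 1) <= 2 * Cmod h * exp (Cmod h).
Proof.
  assert (Hx : forall x, 0 <= x <= 1 -> Cmod (h * cexp (RtoC x * h)) <= Cmod h * exp (Cmod h)).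
  { intros x Hx; rewrite Cmod_mult, Cmod_cexp; apply Rmult_le_compat_l; [apply Cmod_ge_0|].
    apply exp_le; replace (Re (RtoC x * h)) with (x * Re h) by (unfold RtoC, Re; simpl; ring).
    pose proof (re_le_Cmod h); pose proof (Rle_abs (Re h)); pose proof (Cmod_ge_0 h); nra. }
  assert (E0 : cexp (RtoC 0 * h) = RtoC 1) by (replace (RtoC 0 * h)%C with (RtoC 0) by ring; apply cexp_0).
  assert (E1 : cexp (RtoC 1 * h) = cexp h) by (f_equal; ring).
  eapply Rle_trans; [apply Cmod_le_sum|].
  assert (A : Rabs (Re (cexp (RtoC 1 * h)) - Re (cexp (RtoC 0 * h))) <= Cmod h * exp (Cmod h) * (1 - 0)).
  { apply (MVT_abs_le (fun y => Re (cexp (RtoC y * h))) (fun x => Re (h * cexp (RtoC x * h))%C)); [lra| |].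
    - intros x _; apply cexp_line.
    - intros x Hx'; eapply Rle_trans; [apply re_le_Cmod|now apply Hx]. }
  assert (B : Rabs (Im (cexp (RtoC 1 * h)) - Im (cexp (RtoC 0 * h))) <= Cmod h * exp (Cmod h) * (1 - 0)).
  { apply (MVT_abs_le (fun y => Im (cexp (RtoC y * h))) (fun x => Im (h * cexp (RtoC x * h))%C)); [lra| |].
    - intros x _; apply cexp_line.
    - intros x Hx'; eapply Rle_trans; [apply im_le_Cmod|now apply Hx]. }
  rewrite E0, E1 in A, B. rewrite Re_minus, Im_minus. lra.
Qed.

(** The derivative of exp(xh) - 1 - xh in x is h (exp(xh) - 1), so one more mean value step on top
    of [cexp_sub_1] gains a second factor |h|. *)
Lemma cexp_sub_lin (h : C) : Cmod (cexp h - RtoC 1 - h) <= 4 * Cmod h ^ 2 * exp (Cmod h).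
Proof.
  assert (H0 := Cmod_ge_0 h).
  assert (Hx : forall x, 0 <= x <= 1 -> Cmod (h * (cexp (RtoC x * h) - RtoC 1)) <= 2 * Cmod h ^ 2 * exp (Cmod h)).
  { intros x Hx; rewrite Cmod_mult.
    apply Rle_trans with (Cmod h * (2 * Cmod h * exp (Cmod h))); [|right; ring].
    apply Rmult_le_compat_l; [easy|].
    eapply Rle_trans; [apply cexp_sub_1|].
    assert (E : Cmod (RtoC x * h) <= Cmod h) by (rewrite Cmod_mult, Cmod_R, Rabs_right by lra; nra).
    pose proof (Cmod_ge_0 (RtoC x * h)).
    apply Rmult_le_compat; [lra|pos|lra|now apply exp_le]. }
  assert (E0 : cexp (RtoC 0 * h) = RtoC 1) by (replace (RtoC 0 * h)%C with (RtoC 0) by ring; apply cexp_0).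
  assert (E1 : cexp (RtoC 1 * h) = cexp h) by (f_equal; ring).
  eapply Rle_trans; [apply Cmod_le_sum|].
  assert (A : Rabs ((Re (cexp (RtoC 1 * h)) - 1 * Re h) - (Re (cexp (RtoC 0 * h)) - 0 * Re h)) <= 2 * Cmod h ^ 2 * exp (Cmod h) * (1 - 0)).
  { apply (MVT_abs_le (fun y => Re (cexp (RtoC y * h)) - y * Re h) (fun x => Re (h * (cexp (RtoC x * h) - RtoC 1))%C)); [lra| |].
    - intros x _. replace (Re (h * (cexp (RtoC x * h) - RtoC 1))) with (Re (h * cexp (RtoC x * h)) - 1 * Re h)
        by (unfold RtoC, Re, Im; simpl; ring).
      apply @is_derive_minus; [apply cexp_line|]. auto_derive; [easy|ring].
    - intros x Hx'; eapply Rle_trans; [apply re_le_Cmod|now apply Hx]. }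
  assert (B : Rabs ((Im (cexp (RtoC 1 * h)) - 1 * Im h) - (Im (cexp (RtoC 0 * h)) - 0 * Im h)) <= 2 * Cmod h ^ 2 * exp (Cmod h) * (1 - 0)).
  { apply (MVT_abs_le (fun y => Im (cexp (RtoC y * h)) - y * Im h) (fun x => Im (h * (cexp (RtoC x * h) - RtoC 1))%C)); [lra| |].
    - intros x _. replace (Im (h * (cexp (RtoC x * h) - RtoC 1))) with (Im (h * cexp (RtoC x * h)) - 1 * Im h)
        by (unfold RtoC, Re, Im; simpl; ring).
      apply @is_derive_minus; [apply cexp_line|]. auto_derive; [easy|ring].
    - intros x Hx'; eapply Rle_trans; [apply im_le_Cmod|now apply Hx]. }
  rewrite E0, E1 in A, B.
  replace (Re (cexp h - RtoC 1 - h)) with (Re (cexp h) - 1 * Re h - (Re (RtoC 1) - 0 * Re h)) by (unfold RtoC, Re; simpl; ring).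
  replace (Im (cexp h - RtoC 1 - h)) with (Im (cexp h) - 1 * Im h - (Im (RtoC 1) - 0 * Im h)) by (unfold RtoC, Im; simpl; ring).
  lra.
Qed.

Lemma cdiff_cexp (a : R) (z : C) :
  cdiff (fun w => cexp (RtoC a * w)) z (RtoC a * cexp (RtoC a * z))%C.
Proof.
  intros eps He.
  set (E := exp (Re (RtoC a * z))). assert (PE : 0 < E) by apply exp_pos.
  set (K := 4 * E * (Rabs a + 1) ^ 2 * exp 1).
  pose proof (Rabs_pos a) as Ha.
  assert (PK : 0 < K) by (unfold K; repeat apply Rmult_lt_0_compat; try lra; apply exp_pos).
  exists (Rmin (/ (Rabs a + 1)) (eps / K)); split.
  { apply Rmin_pos; [pos|pos]. }
  intros w Hw.
  pose proof (Rlt_le_trans _ _ _ Hw (Rmin_l _ _)) as W1.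
  pose proof (Rlt_le_trans _ _ _ Hw (Rmin_r _ _)) as W2.
  set (h := (RtoC a * (w - z))%C).
  assert (Hh : Cmod h <= (Rabs a + 1) * Cmod (w - z)).
  { unfold h; rewrite Cmod_mult, Cmod_R; pose proof (Cmod_ge_0 (w - z)); nra. }
  assert (H1 : Cmod h <= 1).
  { eapply Rle_trans; [apply Hh|].
    apply Rle_trans with ((Rabs a + 1) * / (Rabs a + 1)); [apply Rmult_le_compat_l; lra|right; field; lra]. }
  replace (cexp (RtoC a * w) - cexp (RtoC a * z) - RtoC a * cexp (RtoC a * z) * (w - z))%C
    with (cexp (RtoC a * z) * (cexp h - RtoC 1 - h))%C.
  2:{ replace (RtoC a * w)%C with (RtoC a * z + h)%C by (unfold h; ring).
      rewrite cexp_plus; unfold h; ring. }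
  rewrite Cmod_mult, Cmod_cexp; fold E.
  pose proof (Cmod_ge_0 (w - z)) as W0. pose proof (Cmod_ge_0 h) as h0.
  apply Rle_trans with (E * (4 * ((Rabs a + 1) * Cmod (w - z)) ^ 2 * exp 1)).
  - apply Rmult_le_compat_l; [lra|]; eapply Rle_trans; [apply cexp_sub_lin|].
    apply Rmult_le_compat; [nra|pos| |now apply exp_le].
    apply Rmult_le_compat_l; [lra|]. apply pow_incr; lra.
  - apply Rle_trans with (K * Cmod (w - z) * Cmod (w - z)); [right; unfold K; ring|].
    apply Rmult_le_compat_r; [easy|].
    apply Rle_trans with (K * (eps / K)); [apply Rmult_le_compat_l; lra|right; field; lra].
Qed.

(* Syntax for the elementary analytic functions that approximate zeta and the Gamma quotients; derivatives of all orders come for free. *)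
Inductive hexp : Type :=
| HConst (a : C) | HVar | HExp (a : R)
| HAdd (e1 e2 : hexp) | HMul (e1 e2 : hexp) | HInv (e : hexp).

Fixpoint heval (e : hexp) (z : C) : C :=
  match e with
  | HConst a => a
  | HVar => z
  | HExp a => cexp (RtoC a * z)
  | HAdd e1 e2 => Cplus (heval e1 z) (heval e2 z)
  | HMul e1 e2 => Cmult (heval e1 z) (heval e2 z)
  | HInv e => Cinv (heval e z)
  end.

Fixpoint hwf (e : hexp) (z : C) : Prop :=
  match e with
  | HConst _ | HVar | HExp _ => True
  | HAdd e1 e2 | HMul e1 e2 => hwf e1 z /\ hwf e2 z
  | HInv e => hwf e z /\ heval e z <> RtoC 0
  end.

Fixpoint hder (e : hexp) : hexp :=
  match e with
  | HConst _ => HConst (RtoC 0)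
  | HVar => HConst (RtoC 1)
  | HExp a => HMul (HConst (RtoC a)) (HExp a)
  | HAdd e1 e2 => HAdd (hder e1) (hder e2)
  | HMul e1 e2 => HAdd (HMul (hder e1) e2) (HMul e1 (hder e2))
  | HInv e => HMul (HConst (RtoC (-1))) (HMul (HMul (hder e) (HInv e)) (HInv e))
  end.

Lemma hder_wf (e : hexp) (z : C) : hwf e z -> hwf (hder e) z.
Proof. induction e; simpl; tauto. Qed.

Lemma heval_cdiff (e : hexp) (z : C) : hwf e z -> cdiff (heval e) z (heval (hder e) z).
Proof.
  induction e; simpl; intros H.
  - apply cdiff_const.
  - apply cdiff_id.
  - apply cdiff_cexp.
  - destruct H; apply cdiff_plus; auto.
  - destruct H; apply cdiff_mult; auto.
  - destruct H as [H1 H2].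
    replace (RtoC (-1) * (heval (hder e) z * / heval e z * / heval e z))%C
      with (- (heval (hder e) z * / heval e z * / heval e z))%C
      by (replace (RtoC (-1)) with (- RtoC 1)%C by (unfold RtoC, Copp; simpl; f_equal; ring); ring).
    apply cdiff_inv; auto.
Qed.

Lemma heval_ccont (e : hexp) (z : C) : hwf e z -> ccont (heval e) z.
Proof. intros H; eapply cdiff_ccont, heval_cdiff, H. Qed.

(** * Harmonic functions on circles *)

(* Coquelicot's extensionality lemmas leave equations at the type of a normed module. *)
Ltac rring := match goal with |- ?a = ?b => change (@eq R a b); ring end.

Definition cis (th : R) : C := (cos th, sin th).
(* The angle is measured from the leftmost point of the circle, the one nearest to the critical line. *)
Definition pt (c : C) (r th : R) : C := (c - RtoC r * cis th)%C.

Lemma Cmod_cis (th : R) : Cmod (cis th) = 1.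
Proof.
  unfold Cmod, cis; simpl fst; simpl snd.
  pose proof (sin2_cos2 th) as H; unfold Rsqr in H.
  replace (_ ^ 2 + _ ^ 2) with 1 by (rewrite <- H; ring). apply sqrt_1.
Qed.

Lemma Cmod_pt (c : C) (r th : R) : Cmod (pt c r th - c) = Rabs r.
Proof.
  unfold pt; replace (c - RtoC r * cis th - c)%C with (- (RtoC r * cis th))%C by ring.
  rewrite Cmod_opp, Cmod_mult, Cmod_cis, Cmod_R; ring.
Qed.

Lemma cis_pow (th : R) (n : nat) : Cpow (cis th) n = cis (INR n * th).
Proof.
  induction n as [|n IH].
  - simpl; unfold cis, RtoC; rewrite Rmult_0_l, cos_0, sin_0; reflexivity.
  - change (Cpow (cis th) (S n)) with (cis th * Cpow (cis th) n)%C.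
    rewrite IH, S_INR; unfold cis, Cmult; simpl.
    replace ((INR n + 1) * th) with (th + INR n * th) by ring.
    rewrite cos_plus, sin_plus; f_equal; ring.
Qed.

Lemma pt_path_r (c : C) (r th : R) : cpath (fun x => pt c x th) r (- cis th)%C.
Proof.
  split; unfold pt, cis, Re, Im; simpl; auto_derive; try easy; ring.
Qed.

Lemma pt_path_th (c : C) (r th : R) : cpath (fun x => pt c r x) th (Ci * (pt c r th - c))%C.
Proof.
  split; unfold pt, cis, Re, Im; simpl; auto_derive; try easy; ring.
Qed.

Lemma Re_2d (f : C -> C) (g : R -> R -> C) (x y : R) : ccont f (g x y) ->
  continuity_2d_pt (fun u v => Re (g u v)) x y -> continuity_2d_pt (fun u v => Im (g u v)) x y ->
  continuity_2d_pt (fun u v => Re (f (g u v))) x y /\ continuity_2d_pt (fun u v => Im (f (g u v))) x y.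
Proof.
  intros Hf H1 H2.
  assert (K : forall eps : posreal, locally_2d (fun u v => Cmod (f (g u v) - f (g x y)) < eps) x y).
  { intros eps; destruct (Hf (eps / 2)) as [del [Pd Hd]]; [apply is_pos_div_2|].
    destruct (H1 (mkposreal (del / 2) ltac:(lra))) as [d1 D1].
    destruct (H2 (mkposreal (del / 2) ltac:(lra))) as [d2 D2].
    exists (mkposreal (Rmin d1 d2) (Rmin_pos _ _ (cond_pos d1) (cond_pos d2))); simpl; intros u v Hu Hv.
    specialize (D1 u v (Rlt_le_trans _ _ _ Hu (Rmin_l _ _)) (Rlt_le_trans _ _ _ Hv (Rmin_l _ _))).
    specialize (D2 u v (Rlt_le_trans _ _ _ Hu (Rmin_r _ _)) (Rlt_le_trans _ _ _ Hv (Rmin_r _ _))).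
    simpl in D1, D2.
    eapply Rle_lt_trans; [apply Hd|pose proof (cond_pos eps); lra].
    eapply Rle_lt_trans; [apply Cmod_le_sum|]. rewrite Re_minus, Im_minus; lra. }
  split; intros eps; destruct (K eps) as [d D]; exists d; intros u v Hu Hv; specialize (D u v Hu Hv).
  - eapply Rle_lt_trans; [|apply D]. rewrite <- Re_minus; apply re_le_Cmod.
  - eapply Rle_lt_trans; [|apply D]. rewrite <- Im_minus; apply im_le_Cmod.
Qed.

Lemma continuity_pt_2d_1 (f : R -> R) (x y : R) : continuity_pt f x ->
  continuity_2d_pt (fun u _ => f u) x y.
Proof. intros H; apply (continuity_1d_2d_pt_comp f (fun u _ => u)); [easy|apply continuity_2d_pt_id1]. Qed.

Lemma continuity_pt_2d_2 (f : R -> R) (x y : R) : continuity_pt f y ->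
  continuity_2d_pt (fun _ v => f v) x y.
Proof. intros H; apply (continuity_1d_2d_pt_comp f (fun _ v => v)); [easy|apply continuity_2d_pt_id2]. Qed.

Lemma pt_2d (c : C) (r th : R) :
  continuity_2d_pt (fun u v => Re (pt c u v)) r th /\ continuity_2d_pt (fun u v => Im (pt c u v)) r th.
Proof.
  split.
  - apply (continuity_2d_pt_ext (fun u v => Re c - u * cos v)).
    { intros u v; unfold pt, cis, Re; simpl; ring. }
    apply continuity_2d_pt_minus; [apply continuity_2d_pt_const|].
    apply continuity_2d_pt_mult; [apply continuity_2d_pt_id1|].
    apply continuity_pt_2d_2, continuity_cos.
  - apply (continuity_2d_pt_ext (fun u v => Im c - u * sin v)).
    { intros u v; unfold pt, cis, Im; simpl; ring. }
    apply continuity_2d_pt_minus; [apply continuity_2d_pt_const|].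
    apply continuity_2d_pt_mult; [apply continuity_2d_pt_id1|].
    apply continuity_pt_2d_2, continuity_sin.
Qed.

Lemma continuity_2d_to_1 (f : R -> R -> R) (x y : R) : continuity_2d_pt f x y -> continuous (f x) y.
Proof.
  intros H; apply filterlim_locally; intros eps; destruct (H eps) as [d Hd].
  exists d; intros v Hv; apply Hd; [|exact Hv].
  replace (x - x) with 0 by ring; rewrite Rabs_R0; apply cond_pos.
Qed.

Lemma ex_RInt_cont (f : R -> R) (a b : R) : (forall x, continuous f x) -> ex_RInt f a b.
Proof. intros H; apply (@ex_RInt_continuous R_CompleteNormedModule); intros; apply H. Qed.

Lemma RIntR_scal (f : R -> R) (k a b : R) : ex_RInt f a b -> RInt (fun x => k * f x) a b = k * RInt f a b.
Proof. exact (RInt_scal (V := R_CompleteNormedModule) f a b k). Qed.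
Lemma RIntR_plus (f g : R -> R) (a b : R) : ex_RInt f a b -> ex_RInt g a b ->
  RInt (fun x => f x + g x) a b = RInt f a b + RInt g a b.
Proof. exact (RInt_plus (V := R_CompleteNormedModule) f g a b). Qed.
Lemma RIntR_minus (f g : R -> R) (a b : R) : ex_RInt f a b -> ex_RInt g a b ->
  RInt (fun x => f x - g x) a b = RInt f a b - RInt g a b.
Proof. exact (RInt_minus (V := R_CompleteNormedModule) f g a b). Qed.
Lemma continuousR_mult (f g : R -> R) (x : R) : continuous f x -> continuous g x ->
  continuous (fun y => f y * g y) x.
Proof. exact (continuous_mult f g x). Qed.
Lemma continuousR_minus (f g : R -> R) (x : R) : continuous f x -> continuous g x ->
  continuous (fun y => f y - g y) x.
Proof. exact (continuous_minus (V := R_NormedModule) f g x). Qed.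
Lemma continuousR_plus (f g : R -> R) (x : R) : continuous f x -> continuous g x ->
  continuous (fun y => f y + g y) x.
Proof. exact (continuous_plus (V := R_NormedModule) f g x). Qed.

Lemma derive_RInt_2d (F F' : R -> R -> R) (a b r0 d : R) : 0 < d ->
  (forall r th, Rabs (r - r0) < d -> is_derive (fun x => F x th) r (F' r th)) ->
  (forall th, continuity_2d_pt F' r0 th) ->
  (forall r th, Rabs (r - r0) < d -> continuous (F r) th) ->
  is_derive (fun r => RInt (F r) a b) r0 (RInt (F' r0) a b).
Proof.
  intros Pd HD HC HF.
  rewrite (RInt_ext (F' r0) (fun t => Derive (fun u => F u t) r0)).
  2:{ intros x _; symmetry; apply is_derive_unique, HD.
      replace (r0 - r0) with 0 by ring; now rewrite Rabs_R0. }
  apply is_derive_RInt_param.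
  - exists (mkposreal d Pd); intros y Hy t _; exists (F' y t); now apply HD.
  - intros t _; apply (continuity_2d_pt_ext_loc F'); [|apply HC].
    exists (mkposreal d Pd); intros u v Hu _; symmetry; now apply is_derive_unique, HD.
  - exists (mkposreal d Pd); intros y Hy; apply ex_RInt_cont; intros x; now apply HF.
Qed.

Lemma RInt_deriv (f f' : R -> R) (a b : R) :
  (forall x, is_derive f x (f' x)) -> (forall x, continuous f' x) -> RInt f' a b = f b - f a.
Proof.
  intros H1 H2; apply (is_RInt_unique (V := R_CompleteNormedModule)).
  exact (is_RInt_derive f f' a b (fun x _ => H1 x) (fun x _ => H2 x)).
Qed.

Lemma pt_PI (c : C) (r : R) : pt c r PI = pt c r (- PI).
Proof. unfold pt, cis; rewrite cos_neg, sin_neg, sin_PI, Ropp_0; reflexivity. Qed.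

Lemma RInt_cos_sin (a b : R) : RInt (fun th => a * cos th + b * sin th) (- PI) PI = 0.
Proof.
  rewrite (RInt_deriv (fun th => a * sin th - b * cos th)).
  - rewrite sin_neg, cos_neg, sin_PI; lra.
  - intros x; auto_derive; [easy|ring].
  - intros x; apply (ex_derive_continuous (fun th => a * cos th + b * sin th)); auto_derive; easy.
Qed.

Section Circle.
Variables (e : hexp) (c : C) (R1 : R).
Hypothesis Hwf : forall z, Cmod (z - c) < R1 -> hwf e z.

Lemma wf_pt (r th : R) : Rabs r < R1 -> hwf e (pt c r th).
Proof. intros H; apply Hwf; now rewrite Cmod_pt. Qed.

Lemma Re_circle_2d (r th : R) : Rabs r < R1 ->
  continuity_2d_pt (fun u v => Re (heval e (pt c u v))) r th /\
  continuity_2d_pt (fun u v => Im (heval e (pt c u v))) r th.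
Proof.
  intros H; apply Re_2d; [apply heval_ccont; now apply wf_pt|apply pt_2d|apply pt_2d].
Qed.

End Circle.

Lemma near_lt (r r0 R1 : R) : Rabs r0 < R1 -> Rabs (r - r0) < R1 - Rabs r0 -> Rabs r < R1.
Proof.
  intros H0 H; pose proof (Rabs_triang (r - r0) r0); replace (r - r0 + r0) with r in * by ring; lra.
Qed.

(** The circular mean has derivative 0 in the radius: by the Cauchy-Riemann equations the radial
    derivative of Re f is 1 / r times the angular derivative of Im f, which integrates to 0 over a
    period. *)
Lemma circle_mean (e : hexp) (c : C) (R1 r : R) :
  (forall z, Cmod (z - c) < R1 -> hwf e z) -> 0 <= r < R1 ->
  RInt (fun th => Re (heval e (pt c r th))) (- PI) PI = 2 * PI * Re (heval e c).
Proof.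
  intros Hwf Hr.
  assert (Hwf' : forall z, Cmod (z - c) < R1 -> hwf (hder e) z) by (intros; now apply hder_wf, Hwf).
  set (psi := fun r => RInt (fun th => Re (heval e (pt c r th))) (- PI) PI).
  assert (D : forall x, 0 <= x <= r -> is_derive psi x 0).
  { intros x Hx.
    assert (Hx1 : Rabs x < R1) by (rewrite Rabs_right; lra).
    replace 0 with (RInt (fun th => Re (heval (hder e) (pt c x th) * - cis th)) (- PI) PI).
    - apply (derive_RInt_2d _ (fun u v => Re (heval (hder e) (pt c u v) * - cis v)) _ _ _ (R1 - Rabs x)); [lra| | |].
      + intros y th Hy. pose proof (near_lt _ _ _ Hx1 Hy) as Hy1.
        apply (cpath_comp (heval e) (fun x => pt c x th)); [|apply pt_path_r].
        apply heval_cdiff; now apply (wf_pt e c R1).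
      + intros th; destruct (Re_circle_2d _ _ _ Hwf' x th Hx1) as [A B].
        apply (continuity_2d_pt_ext (fun u v => Im (heval (hder e) (pt c u v)) * sin v - Re (heval (hder e) (pt c u v)) * cos v)).
        { intros; unfold cis; rewrite Re_mult; unfold Re, Im; simpl; ring. }
        apply continuity_2d_pt_minus; apply continuity_2d_pt_mult; try easy; apply continuity_pt_2d_2;
          [apply continuity_sin|apply continuity_cos].
      + intros y th Hy. pose proof (near_lt _ _ _ Hx1 Hy) as Hy1.
        apply (continuity_2d_to_1 (fun u v => Re (heval e (pt c u v)))). now apply (Re_circle_2d e c R1).
    (* At radius 0 the division by x is impossible, but the integrand is then a combination of cos
       and sin. *)
    - destruct (Req_dec x 0) as [->|Hne].
      + transitivity (RInt (fun th => - Re (heval (hder e) c) * cos th + Im (heval (hder e) c) * sin th) (- PI) PI);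
          [|apply RInt_cos_sin].
        apply RInt_ext; intros th _.
        replace (pt c 0 th) with c by (unfold pt; ring).
        unfold cis; rewrite Re_mult; unfold Re, Im; simpl; ring.
      + assert (Hd : forall th, is_derive (fun v => Im (heval e (pt c x v)) / x) th
                      (Re (heval (hder e) (pt c x th) * - cis th))).
        { intros th.
          assert (P : cpath (fun v => heval e (pt c x v)) th (heval (hder e) (pt c x th) * (Ci * (pt c x th - c)))).
          { apply (cpath_comp (heval e) (pt c x)); [|apply pt_path_th].
            apply heval_cdiff; now apply (wf_pt e c R1). }
          destruct P as [_ P].
          replace (Re (heval (hder e) (pt c x th) * - cis th)) with (/ x * Im (heval (hder e) (pt c x th) * (Ci * (pt c x th - c)))).
          2:{ replace (pt c x th - c)%C with (- (RtoC x * cis th))%C by (unfold pt; ring).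
              unfold cis; rewrite Im_mult, Re_mult; unfold Re, Im; simpl; field; easy. }
          apply (is_derive_ext (fun v => / x * Im (heval e (pt c x v)))).
          { intros v; unfold Rdiv; rring. }
          now apply @is_derive_scal. }
        rewrite (RInt_deriv (fun v => Im (heval e (pt c x v)) / x)).
        * rewrite pt_PI; rring.
        * apply Hd.
        * intros th.
          destruct (Re_circle_2d _ _ _ Hwf' x th Hx1) as [A B].
          apply (continuity_2d_to_1 (fun u v => Re (heval (hder e) (pt c u v) * - cis v))).
          apply (continuity_2d_pt_ext (fun u v => Im (heval (hder e) (pt c u v)) * sin v - Re (heval (hder e) (pt c u v)) * cos v)).
          { intros; unfold cis; rewrite Re_mult; unfold Re, Im; simpl; ring. }
          apply continuity_2d_pt_minus; apply continuity_2d_pt_mult; try easy; apply continuity_pt_2d_2;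
          [apply continuity_sin|apply continuity_cos]. }
  assert (E : Rabs (psi r - psi 0) <= 0 * (r - 0)).
  { apply (MVT_abs_le psi (fun _ => 0)); [lra|easy|]. intros; rewrite Rabs_R0; lra. }
  assert (E0 : psi 0 = 2 * PI * Re (heval e c)).
  { unfold psi. rewrite (RInt_ext _ (fun _ => Re (heval e c))).
    - rewrite RInt_const; unfold scal; simpl; unfold mult; simpl; ring.
    - intros th _; replace (pt c 0 th) with c by (unfold pt; ring); reflexivity. }
  change (psi r = 2 * PI * Re (heval e c)).
  pose proof (Rabs_pos (psi r - psi 0)).
  assert (Z : Rabs (psi r - psi 0) = 0) by lra.
  apply Rabs_eq_0 in Z; lra.
Qed.

(** * Fourier coefficients of log |f| on concentric circles *)

Definition logmod (e : hexp) (z : C) : R := ln (Cmod (heval e z)).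

(** Half the logarithm of the sum of squares is differentiated; it agrees with log |g| on a
    neighbourhood of x where g does not vanish, and finding this neighbourhood is the main work. *)
Lemma is_derive_ln_Cmod (g : R -> C) (x : R) (d : C) : cpath g x d -> g x <> RtoC 0 ->
  is_derive (fun y => ln (Cmod (g y))) x (Re (d / g x)).
Proof.
  intros [H1 H2] Hx.
  apply Cmod_gt_0 in Hx.
  assert (Q : 0 < Re (g x) ^ 2 + Im (g x) ^ 2) by (rewrite <- Cmod_sq; apply pow_lt; lra).
  assert (L : is_derive (fun y => / 2 * ln (Re (g y) ^ 2 + Im (g y) ^ 2)) x
     (/ 2 * ((INR 2 * Re d * Re (g x) ^ 1 + INR 2 * Im d * Im (g x) ^ 1) * / (Re (g x) ^ 2 + Im (g x) ^ 2)))).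
  { apply @is_derive_scal.
    apply (is_derive_comp ln (fun y => Re (g y) ^ 2 + Im (g y) ^ 2)).
    - now apply is_derive_ln.
    - apply @is_derive_plus; apply is_derive_pow; easy. }
  apply (is_derive_ext_loc (fun y => / 2 * ln (Re (g y) ^ 2 + Im (g y) ^ 2))).
  - destruct (cpath_dom g x d (conj H1 H2) 1 Rlt_0_1) as [del [Pd Hd]].
    set (B := Cmod d + 1). assert (PB : 0 < B) by (unfold B; pose proof (Cmod_ge_0 d); lra).
    assert (Pm : 0 < Rmin del (Cmod (g x) / B)) by (apply Rmin_pos; [easy|pos]).
    exists (mkposreal _ Pm); intros y Hy; change (Rabs (y - x) < Rmin del (Cmod (g x) / B)) in Hy.
    pose proof (Rlt_le_trans _ _ _ Hy (Rmin_l _ _)) as Y1.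
    pose proof (Rlt_le_trans _ _ _ Hy (Rmin_r _ _)) as Y2.
    specialize (Hd y Y1).
    assert (N : 0 < Cmod (g y)).
    { assert (E : Cmod (g y - g x) <= B * Rabs (y - x)).
      { replace (g y - g x)%C with ((g y - g x - d * RtoC (y - x)) + d * RtoC (y - x))%C by ring.
        eapply Rle_trans; [apply Cmod_triangle|]; rewrite Cmod_mult, Cmod_R; unfold B; lra. }
      assert (B * Rabs (y - x) < Cmod (g x)).
      { apply Rlt_le_trans with (B * (Cmod (g x) / B)); [now apply Rmult_lt_compat_l|right; field; lra]. }
      pose proof (Cmod_rev_triangle (g x) (g y)); rewrite Cmod_sub_sym in E; lra. }
    rewrite <- Cmod_sq.
    replace (Cmod (g y) ^ 2) with (Cmod (g y) * Cmod (g y)) by ring.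
    rewrite ln_mult by easy; lra.
  - replace (Re (d / g x)) with ((/ 2 * ((INR 2 * Re d * Re (g x) ^ 1 + INR 2 * Im d * Im (g x) ^ 1) * / (Re (g x) ^ 2 + Im (g x) ^ 2)))); [exact L|].
    unfold Cdiv, Cinv; rewrite Re_mult; simpl INR; unfold Re, Im in *; simpl in *. field; nra.
Qed.

(** The existential is informative because its witness later enters the definition of the damping
    factor [damp]. *)
Lemma heval_pow (e : hexp) (n : nat) : { p : hexp | (forall z, heval p z = Cpow (heval e z) n) /\ (forall z, hwf e z -> hwf p z) }.
Proof.
  induction n as [|n [p [E W]]].
  - exists (HConst (RtoC 1)); split; [reflexivity|easy].
  - exists (HMul e p); split; intros z; simpl; [now rewrite E|auto].
Qed.

Lemma continuous_cosn (n : nat) (x : R) : continuous (fun th => cos (INR n * th)) x.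
Proof. apply (ex_derive_continuous (fun th => cos (INR n * th))); auto_derive; easy. Qed.

Lemma continuous_sinn (n : nat) (x : R) : continuous (fun th => sin (INR n * th)) x.
Proof. apply (ex_derive_continuous (fun th => sin (INR n * th))); auto_derive; easy. Qed.

Lemma sin_nPI (n : nat) : sin (INR n * PI) = 0.
Proof.
  induction n as [|n IH]; [simpl; rewrite Rmult_0_l; apply sin_0|].
  rewrite S_INR; replace ((INR n + 1) * PI) with (INR n * PI + PI) by ring.
  rewrite neg_sin, IH; ring.
Qed.

Section LogFourier.
Variables (f : hexp) (c : C) (R1 : R).
Hypothesis Hwf : forall z, Cmod (z - c) < R1 -> hwf f z.
Hypothesis Hnz : forall z, Cmod (z - c) < R1 -> heval f z <> RtoC 0.

Let q := HMul (hder f) (HInv f).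

Lemma q_wf (z : C) : Cmod (z - c) < R1 -> hwf q z.
Proof. intros H; repeat split; [apply hder_wf|apply Hwf|apply Hnz]; auto. Qed.

Lemma nz_pt (r th : R) : Rabs r < R1 -> heval f (pt c r th) <> RtoC 0.
Proof. intros H; apply Hnz; now rewrite Cmod_pt. Qed.

Lemma logmod_dr (r th : R) : Rabs r < R1 ->
  is_derive (fun x => logmod f (pt c x th)) r (Re (heval q (pt c r th) * - cis th)).
Proof.
  intros H.
  replace (heval q (pt c r th) * - cis th)%C with ((heval (hder f) (pt c r th) * - cis th) / heval f (pt c r th))%C
    by (simpl; unfold Cdiv; ring).
  apply is_derive_ln_Cmod; [|now apply nz_pt].
  apply (cpath_comp (heval f) (fun x => pt c x th)); [|apply pt_path_r].
  apply heval_cdiff; now apply (wf_pt f c R1).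
Qed.

Lemma logmod_dth (r th : R) : Rabs r < R1 ->
  is_derive (fun x => logmod f (pt c r x)) th (- Im (heval q (pt c r th) * (pt c r th - c))).
Proof.
  intros H.
  replace (- Im (heval q (pt c r th) * (pt c r th - c)))
    with (Re ((heval (hder f) (pt c r th) * (Ci * (pt c r th - c))) / heval f (pt c r th))%C).
  2:{ replace ((heval (hder f) (pt c r th) * (Ci * (pt c r th - c))) / heval f (pt c r th))%C
        with (Ci * (heval q (pt c r th) * (pt c r th - c)))%C by (simpl; unfold Cdiv; ring).
      rewrite Re_mult; unfold Ci, Re, Im; simpl; ring. }
  apply is_derive_ln_Cmod; [|now apply nz_pt].
  apply (cpath_comp (heval f) (pt c r)); [|apply pt_path_th].
  apply heval_cdiff; now apply (wf_pt f c R1).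
Qed.

Lemma logmod_cont (r th : R) : Rabs r < R1 -> continuous (fun x => logmod f (pt c r x)) th.
Proof.
  intros H; apply (ex_derive_continuous (fun x => logmod f (pt c r x))).
  eexists; now apply logmod_dth.
Qed.

Definition fcoef (n : nat) (r : R) : R :=
  RInt (fun th => logmod f (pt c r th) * cos (INR n * th)) (- PI) PI.

(** Differential form of the fact that the n-th coefficient of a harmonic function is a multiple of
    r^n. With Q = (z - c) f'/f the two sides differ, up to a nonzero factor, by the mean of Re(Q (z
    - c)^n), and this function is holomorphic and vanishes at c. *)
Lemma fcoef_deriv (n : nat) (r : R) : 0 < r < R1 -> is_derive (fcoef n) r (INR n / r * fcoef n r).
Proof.
  intros Hr.
  assert (Hr1 : Rabs r < R1) by (rewrite Rabs_right; lra).
  assert (C2 : forall th, continuity_2d_pt (fun u v => Re (heval q (pt c u v))) r th /\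
                          continuity_2d_pt (fun u v => Im (heval q (pt c u v))) r th).
  { intros th; apply (Re_circle_2d q c R1); [apply q_wf|easy]. }
  set (Q := fun th => (heval q (pt c r th) * (pt c r th - c))%C).
  assert (CQ : forall th, continuous (fun v => Re (Q v)) th /\ continuous (fun v => Im (Q v)) th).
  { intros th; destruct (C2 th) as [A B]; destruct (pt_2d c r th) as [P1 P2]; split.
    - apply (continuity_2d_to_1 (fun u v => Re (heval q (pt c u v) * (pt c u v - c)))).
      apply (continuity_2d_pt_ext (fun u v => Re (heval q (pt c u v)) * (Re (pt c u v) - Re c) - Im (heval q (pt c u v)) * (Im (pt c u v) - Im c))).
      { intros; rewrite Re_mult, Re_minus, Im_minus; reflexivity. }
      repeat first [assumption|apply continuity_2d_pt_const|apply continuity_2d_pt_minus|apply continuity_2d_pt_mult].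
    - apply (continuity_2d_to_1 (fun u v => Im (heval q (pt c u v) * (pt c u v - c)))).
      apply (continuity_2d_pt_ext (fun u v => Re (heval q (pt c u v)) * (Im (pt c u v) - Im c) + Im (heval q (pt c u v)) * (Re (pt c u v) - Re c))).
      { intros; rewrite Im_mult, Re_minus, Im_minus; reflexivity. }
      repeat first [assumption|apply continuity_2d_pt_const|apply continuity_2d_pt_plus|apply continuity_2d_pt_minus|apply continuity_2d_pt_mult]. }
  assert (D1 : is_derive (fcoef n) r (RInt (fun th => Re (heval q (pt c r th) * - cis th) * cos (INR n * th)) (- PI) PI)).
  {
    apply (derive_RInt_2d (fun u v => logmod f (pt c u v) * cos (INR n * v))
             (fun u v => Re (heval q (pt c u v) * - cis v) * cos (INR n * v)) _ _ _ (R1 - Rabs r)); [lra| | |].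
    - intros y th Hy. pose proof (near_lt _ _ _ Hr1 Hy) as Hy1.
      apply (is_derive_ext (fun x => cos (INR n * th) * logmod f (pt c x th))); [intros; rring|].
      rewrite (Rmult_comm _ (cos (INR n * th))). apply @is_derive_scal. now apply logmod_dr.
    - intros th; destruct (C2 th) as [A B].
      apply continuity_2d_pt_mult.
      + apply (continuity_2d_pt_ext (fun u v => Im (heval q (pt c u v)) * sin v - Re (heval q (pt c u v)) * cos v)).
        { intros; unfold cis; rewrite Re_mult; unfold Re, Im; simpl; ring. }
        apply continuity_2d_pt_minus; apply continuity_2d_pt_mult; try easy; apply continuity_pt_2d_2;
          [apply continuity_sin|apply continuity_cos].
      + apply (continuity_pt_2d_2 (fun v => cos (INR n * v))), continuity_pt_filterlim, continuous_cosn.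
    - intros y th Hy. pose proof (near_lt _ _ _ Hr1 Hy) as Hy1.
      apply (continuous_mult (fun v => logmod f (pt c y v)) (fun v => cos (INR n * v)));
        [now apply logmod_cont|apply continuous_cosn]. }
  replace (INR n / r * fcoef n r)
    with (RInt (fun th => Re (heval q (pt c r th) * - cis th) * cos (INR n * th)) (- PI) PI); [exact D1|].
  (* r a' - n a = int Re (Q e^{i n th}) = 0 *)
  assert (I1 : RInt (fun th => Re (heval q (pt c r th) * - cis th) * cos (INR n * th)) (- PI) PI
      = / r * RInt (fun th => Re (Q th) * cos (INR n * th)) (- PI) PI).
  { rewrite <- RIntR_scal.
    - apply RInt_ext; intros th _.
      unfold Q; replace (pt c r th - c)%C with (RtoC r * - cis th)%C by (unfold pt; ring).
      replace (heval q (pt c r th) * (RtoC r * - cis th))%C with (RtoC r * (heval q (pt c r th) * - cis th))%C by ring. generalize (heval q (pt c r th) * - cis th)%C; intros w.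
      unfold RtoC, Re, Im; simpl. field; lra.
    - apply ex_RInt_cont; intros x. apply (continuousR_mult (fun v => Re (Q v)) (fun v => cos (INR n * v)));
        [exact (proj1 (CQ x))|apply continuous_cosn]. }
  assert (I2 : INR n * fcoef n r = RInt (fun th => Im (Q th) * sin (INR n * th)) (- PI) PI).
  { assert (CW : forall x, continuous (fun v => INR n * (logmod f (pt c r v) * cos (INR n * v))) x).
    { intros x; apply continuousR_mult; [apply continuous_const|].
      apply continuousR_mult; [now apply logmod_cont|apply continuous_cosn]. }
    assert (CS : forall x, continuous (fun v => Im (Q v) * sin (INR n * v)) x).
    { intros x; apply continuousR_mult; [exact (proj2 (CQ x))|apply continuous_sinn]. }
    unfold fcoef; rewrite <- RIntR_scal.
    2:{ apply ex_RInt_cont; intros x; apply continuousR_mult; [now apply logmod_cont|apply continuous_cosn]. }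
    assert (E : RInt (fun th => INR n * (logmod f (pt c r th) * cos (INR n * th)) - Im (Q th) * sin (INR n * th)) (- PI) PI = 0).
    { rewrite (RInt_deriv (fun th => logmod f (pt c r th) * sin (INR n * th))).
      - replace (INR n * - PI) with (- (INR n * PI)) by ring.
        rewrite sin_neg, sin_nPI; rring.
      - intros th.
        replace (INR n * (logmod f (pt c r th) * cos (INR n * th)) - Im (Q th) * sin (INR n * th))
          with (- Im (Q th) * sin (INR n * th) + logmod f (pt c r th) * (INR n * cos (INR n * th))) by ring.
        apply (is_derive_mult (fun v => logmod f (pt c r v)) (fun v => sin (INR n * v)));
          [now apply logmod_dth|auto_derive; [easy|ring]|exact Rmult_comm].
      - intros x; now apply continuousR_minus. }
    rewrite RIntR_minus in E by (apply ex_RInt_cont; assumption). lra. }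
  assert (I3 : RInt (fun th => Re (Q th) * cos (INR n * th)) (- PI) PI = RInt (fun th => Im (Q th) * sin (INR n * th)) (- PI) PI).
  { destruct (heval_pow (HAdd HVar (HConst (- c)%C)) n) as [p [Ep Wp]].
    pose proof (circle_mean (HMul (HMul q (HAdd HVar (HConst (- c)%C))) p) c R1 r) as MM.
    assert (E0 : RInt (fun th => (- r) ^ n * (Re (Q th) * cos (INR n * th) - Im (Q th) * sin (INR n * th))) (- PI) PI = 0).
    { transitivity (2 * PI * Re (heval (HMul (HMul q (HAdd HVar (HConst (- c)%C))) p) c)).
      - rewrite <- MM; [|intros z Hz; repeat split; try (now apply q_wf); now apply Wp|lra].
        apply RInt_ext; intros th _. simpl heval. rewrite Ep. simpl heval.
        replace (pt c r th + - c)%C with (pt c r th - c)%C by ring.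
        fold q. replace (heval (hder f) (pt c r th) * / heval f (pt c r th) * (pt c r th - c))%C with (Q th) by (unfold Q; simpl; ring).
        replace (pt c r th - c)%C with (RtoC (- r) * cis th)%C by (unfold pt; rewrite RtoC_opp; ring).
        rewrite Cpow_mult_l, cis_pow, <- RtoC_pow, !Re_mult, Im_mult.
        unfold RtoC, cis, Re, Im; simpl; ring.
      - replace (c + - c)%C with (RtoC 0) by ring.
        replace (heval (hder f) c * / heval f c * RtoC 0 * heval p c)%C with (RtoC 0) by ring.
        simpl; ring. }
    assert (Pr : (- r) ^ n <> 0) by (apply pow_nonzero; lra).
    assert (EX1 : ex_RInt (fun th => Re (Q th) * cos (INR n * th)) (- PI) PI).
    { apply ex_RInt_cont; intros x. apply (continuous_mult (fun v => Re (Q v)) (fun v => cos (INR n * v)));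
          [exact (proj1 (CQ x))|apply continuous_cosn]. }
    assert (EX2 : ex_RInt (fun th => Im (Q th) * sin (INR n * th)) (- PI) PI).
    { apply ex_RInt_cont; intros x. apply (continuous_mult (fun v => Im (Q v)) (fun v => sin (INR n * v)));
          [exact (proj2 (CQ x))|apply continuous_sinn]. }
    assert (E1 : (- r) ^ n * RInt (fun th => Re (Q th) * cos (INR n * th) - Im (Q th) * sin (INR n * th)) (- PI) PI = 0).
    { rewrite <- E0; symmetry; apply RIntR_scal; apply @ex_RInt_minus; easy. }
    apply Rmult_integral in E1; destruct E1 as [E1|E1]; [easy|].
    rewrite RIntR_minus in E1 by easy; lra. }
  rewrite I1, I3, <- I2; match goal with |- ?a = ?b => change (@eq R a b) end; field; lra.
Qed.

(** By [fcoef_deriv] the quotient of the coefficient by r^n has derivative 0. This is the tool for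
    moving coefficients from one circle to a concentric one. *)
Lemma fcoef_scale (n : nat) (r R0 : R) : 0 < r <= R0 -> R0 < R1 -> fcoef n R0 * r ^ n = fcoef n r * R0 ^ n.
Proof.
  intros Hr HR.
  assert (D : forall x, r <= x <= R0 -> is_derive (fun y => fcoef n y * / y ^ n) x 0).
  { intros x Hx.
    assert (Pn : x ^ n <> 0) by (apply pow_nonzero; lra).
    replace 0 with (INR n / x * fcoef n x * / x ^ n + fcoef n x * - ((INR n * 1 * x ^ pred n) / (x ^ n) ^ 2)).
    - apply (is_derive_mult (fcoef n) (fun y => / y ^ n)); [apply fcoef_deriv; lra| |exact Rmult_comm].
      replace (- (INR n * 1 * x ^ Init.Nat.pred n / (x ^ n) ^ 2)) with (- (INR n * 1 * x ^ pred n) / (x ^ n) ^ 2) by (field; easy).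
      apply is_derive_inv; [|easy]. apply is_derive_pow, @is_derive_id.
    - destruct n as [|n]; [simpl; field; lra|].
      simpl pred. replace (x ^ S n) with (x * x ^ n) in * by reflexivity.
      assert (x ^ n <> 0) by (apply pow_nonzero; lra).
      field; split; [easy|lra]. }
  assert (E : Rabs (fcoef n R0 * / R0 ^ n - fcoef n r * / r ^ n) <= 0 * (R0 - r)).
  { apply (MVT_abs_le (fun y => fcoef n y * / y ^ n) (fun _ => 0)); [lra|exact D|intros; rewrite Rabs_R0; lra]. }
  pose proof (Rabs_pos (fcoef n R0 * / R0 ^ n - fcoef n r * / r ^ n)) as E2.
  assert (E3 : Rabs (fcoef n R0 * / R0 ^ n - fcoef n r * / r ^ n) = 0) by lra.
  apply Rabs_eq_0 in E3.
  assert (R0 ^ n <> 0) by (apply pow_nonzero; lra). assert (r ^ n <> 0) by (apply pow_nonzero; lra).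
  replace (fcoef n R0) with (fcoef n R0 * / R0 ^ n * R0 ^ n) by (field; easy).
  replace (fcoef n R0 * / R0 ^ n) with (fcoef n r * / r ^ n) by lra.
  field; easy.
Qed.

End LogFourier.

(** * Trigonometric kernels *)

(** The even trigonometric polynomial with two-sided coefficients k_|n|, in real form; [tcoef] below
    is its pairing with a sequence of cosine coefficients. *)
Fixpoint tpart (k : nat -> R) (m : nat) (th : R) : R :=
  match m with
  | O => k O
  | S n => tpart k n th + 2 * k (S n) * cos (INR (S n) * th)
  end.

Fixpoint tcoef (k a : nat -> R) (m : nat) : R :=
  match m with
  | O => k O * a O
  | S n => tcoef k a n + 2 * k (S n) * a (S n)
  end.

Lemma tpart_S (k : nat -> R) (m : nat) (th : R) :
  tpart k (S m) th = tpart k m th + 2 * k (S m) * cos (INR (S m) * th).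
Proof. reflexivity. Qed.
Lemma tcoef_S (k a : nat -> R) (m : nat) : tcoef k a (S m) = tcoef k a m + 2 * k (S m) * a (S m).
Proof. reflexivity. Qed.

(** Multiplication by 2A - 2 cos th turns the coefficients into second differences, which the
    recurrence makes vanish; boundary terms remain. One identity serves three kernels: Fejer (linear
    coefficients, A = 1), truncated Poisson (exponential coefficients) and [kernel] (hyperbolic
    sines), the last two with A = cosh tau. *)
Lemma tpart_telescope (k : nat -> R) (A : R) (m : nat) (th : R) :
  (forall n, k (S (S n)) + k n = 2 * A * k (S n)) ->
  (2 * A - 2 * cos th) * tpart k m th
  = 2 * A * k O - 2 * k 1%nat + 2 * k (S m) * cos (INR m * th) - 2 * k m * cos (INR (S m) * th).
Proof.
  intros Hk; induction m as [|m IH].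
  - simpl tpart; simpl INR; rewrite Rmult_0_l, cos_0, Rmult_1_l; ring.
  - rewrite tpart_S, Rmult_plus_distr_l, IH.
    assert (E : cos (INR (S (S m)) * th) + cos (INR m * th) = 2 * cos th * cos (INR (S m) * th)).
    { rewrite !S_INR.
      replace ((INR m + 1 + 1) * th) with ((INR m + 1) * th + th) by ring.
      replace (INR m * th) with ((INR m + 1) * th - th) by ring.
      rewrite cos_plus, cos_minus; ring. }
    specialize (Hk m).
    replace (cos (INR (S (S m)) * th)) with (2 * cos th * cos (INR (S m) * th) - cos (INR m * th)) by lra.
    replace (k (S (S m))) with (2 * A * k (S m) - k m) by lra.
    ring.
Qed.

Lemma tpart_cont (k : nat -> R) (m : nat) (x : R) : continuous (tpart k m) x.
Proof.
  induction m as [|m IH]; simpl tpart; [apply continuous_const|].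
  apply (continuousR_plus (tpart k m)); [easy|].
  apply continuousR_mult; [apply continuous_const|apply (continuous_cosn (S m))].
Qed.

Lemma RInt_tpart (g : R -> R) (k : nat -> R) (m : nat) (a b : R) : (forall x, continuous g x) ->
  RInt (fun th => g th * tpart k m th) a b = tcoef k (fun n => RInt (fun th => g th * cos (INR n * th)) a b) m.
Proof.
  intros Hg; induction m as [|m IH].
  - simpl tcoef; simpl tpart; rewrite <- RIntR_scal.
    + apply RInt_ext; intros x _; simpl INR; rewrite Rmult_0_l, cos_0; rring.
    + apply ex_RInt_cont; intros x; apply continuousR_mult; [easy|apply (continuous_cosn 0)].
  - rewrite tcoef_S, <- IH, <- RIntR_scal, <- RIntR_plus.
    + apply RInt_ext; intros x _; rewrite tpart_S; rring.
    + apply ex_RInt_cont; intros x; apply continuousR_mult; [easy|apply tpart_cont].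
    + apply ex_RInt_cont; intros x; apply continuousR_mult; [apply continuous_const|].
      apply continuousR_mult; [easy|apply (continuous_cosn (S m))].
    + apply ex_RInt_cont; intros x; apply continuousR_mult; [easy|apply (continuous_cosn (S m))].
Qed.

Lemma cont_bounded (f : R -> R) (a b : R) : a <= b -> (forall x, continuous f x) ->
  exists M, 0 < M /\ forall x, a <= x <= b -> Rabs (f x) <= M.
Proof.
  intros Hab Hf.
  assert (Hc : forall x, a <= x <= b -> continuity_pt (fun y => Rabs (f y)) x).
  { intros x _; apply (continuity_pt_comp f Rabs); [|apply Rcontinuity_abs].
    apply continuity_pt_filterlim, Hf. }
  destruct (continuity_ab_maj _ a b Hab Hc) as [x [Hx _]].
  exists (Rabs (f x) + 1); split; [pose proof (Rabs_pos (f x)); lra|].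
  intros y Hy; specialize (Hx y Hy); lra.
Qed.

(** 1 - cos th = 2 sin^2(th / 2), and sin x >= x / 3 on [0, 2] by the Taylor polynomial of degree
    7. *)
Lemma sqr_le_one_minus_cos (th : R) : - PI <= th <= PI -> th ^ 2 <= 18 * (1 - cos th).
Proof.
  intros H.
  assert (S : forall x, 0 <= x <= 2 -> x <= PI -> x / 3 <= sin x).
  { intros x H1 H2. destruct (SIN x) as [L _]; [lra|easy|].
    unfold sin_lb, sin_approx, sin_term in L; simpl in L.
    eapply Rle_trans; [|apply L].
    assert (x * x <= 4) by nra.
    assert (0 <= (x * x) * (x * x)) by nra.
    assert (0 <= (x * x) * (x * x) * (1 - x * x / 42)) by pos.
    replace (_ + _) with (x * (1 - x * x / 6 + (x * x) * (x * x) * (1 - x * x / 42) / 120)) by field.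
    apply Rle_trans with (x * (1 / 3)); [lra|]. apply Rmult_le_compat_l; lra. }
  assert (Hp := PI_4); assert (Hp0 := PI_RGT_0).
  assert (K : forall y, 0 <= y <= PI -> y ^ 2 <= 18 * (1 - cos y)).
  { intros y Hy. specialize (S (y / 2) ltac:(lra) ltac:(lra)).
    replace (cos y) with (1 - 2 * sin (y / 2) * sin (y / 2)).
    - nra.
    - replace y with (2 * (y / 2)) at 3 by field. rewrite cos_2a_sin; ring. }
  destruct (Rle_dec 0 th) as [P|P]; [apply K; lra|].
  rewrite <- cos_neg. replace (th ^ 2) with ((- th) ^ 2) by ring. apply K; lra.
Qed.

Lemma RInt_tpart_const (k : nat -> R) (m : nat) : RInt (tpart k m) (- PI) PI = 2 * PI * k O.
Proof.
  rewrite (RInt_ext _ (fun th => 1 * tpart k m th)) by (intros; rring).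
  rewrite (RInt_tpart (fun _ => 1)) by (intros; apply continuous_const).
  induction m as [|m IH].
  - simpl tcoef; rewrite (RInt_ext _ (fun _ => 1)) by (intros; simpl INR; rewrite Rmult_0_l, cos_0; rring).
    rewrite RInt_const; unfold scal; simpl; unfold mult; simpl; ring.
  - rewrite tcoef_S, IH. rewrite (RInt_deriv (fun th => / INR (S m) * sin (INR (S m) * th))).
    + replace (INR (S m) * - PI) with (- (INR (S m) * PI)) by ring.
      rewrite sin_neg, sin_nPI; rring.
    + intros x; assert (Ha : INR (S m) <> 0) by (apply not_0_INR; lia).
      revert Ha; generalize (INR (S m)); intros a Ha; auto_derive; [easy|field; easy].
    + intros x; apply continuousR_mult; [apply continuous_const|apply (continuous_cosn (S m))].
Qed.

Lemma RInt_reflect (f : R -> R) (a : R) : (forall x, continuous f x) ->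
  RInt (fun x => f (- x)) (- a) a = RInt f (- a) a.
Proof.
  intros Hf.
  assert (Cf : forall x, continuous (fun y => f (-1 * y + 0)) x).
  { intros x; apply (continuous_comp (fun y => -1 * y + 0) f); [|apply Hf].
    apply (ex_derive_continuous (fun y => -1 * y + 0)); auto_derive; easy. }
  assert (E1 : RInt (fun x => f (- x)) (- a) a = RInt (fun y => f (-1 * y + 0)) (- a) a).
  { apply RInt_ext; intros x _; f_equal; ring. }
  assert (E2 : RInt (fun y => -1 * f (-1 * y + 0)) a (- a) = RInt f (-1 * a + 0) (-1 * - a + 0)).
  { apply (RInt_comp_lin (V := R_CompleteNormedModule) f (-1) 0 a (- a)); now apply ex_RInt_cont. }
  assert (E3 : - RInt (fun y => -1 * f (-1 * y + 0)) (- a) a = RInt (fun y => -1 * f (-1 * y + 0)) a (- a)).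
  { apply (opp_RInt_swap (V := R_CompleteNormedModule)).
    apply (ex_RInt_cont (fun y => -1 * f (-1 * y + 0))); intros x; apply continuousR_mult; [apply continuous_const|easy]. }
  rewrite RIntR_scal in E3 by (now apply ex_RInt_cont).
  replace (-1 * a + 0) with (- a) in E2 by ring; replace (-1 * - a + 0) with a in E2 by ring.
  lra.
Qed.

(** The Fejer kernel without its factor 1 / (m + 1), so its mass over a period is 2 pi (m + 1). *)
Definition fejer (m : nat) : R -> R := tpart (fun n => INR (S m) - INR n) m.

Lemma fejer_mul (m : nat) (th : R) : fejer m th * (1 - cos th) = 1 - cos (INR (S m) * th).
Proof.
  pose proof (tpart_telescope (fun n => INR (S m) - INR n) 1 m th) as E.
  fold (fejer m) in E.
  assert (E' := E ltac:(intros n; rewrite !S_INR; ring)); clear E. rewrite !S_INR in E'. rewrite !S_INR. nra.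
Qed.

Lemma tpart_neg (k : nat -> R) (m : nat) (th : R) : tpart k m (- th) = tpart k m th.
Proof.
  induction m as [|m IH]; [easy|rewrite !tpart_S, IH].
  replace (INR (S m) * - th) with (- (INR (S m) * th)) by ring; now rewrite cos_neg.
Qed.

Lemma RInt_abs_le (f : R -> R) (a b M : R) : a <= b -> (forall x, continuous f x) ->
  (forall x, a <= x <= b -> Rabs (f x) <= M) -> Rabs (RInt f a b) <= M * (b - a).
Proof.
  intros Hab Hf HM. rewrite Rmult_comm.
  apply (norm_RInt_le_const (V := R_NormedModule) f a b _ M Hab HM).
  apply (RInt_correct (V := R_CompleteNormedModule)); now apply ex_RInt_cont.
Qed.

(** The kernel is even, so g may be symmetrised; the second difference bound then cancels the
    denominator 1 - cos th of the kernel. The error stays bounded while the main term grows like m +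
    1, which is enough to identify limits without any theorem on pointwise convergence of Fourier
    series. *)
Lemma fejer_eval (g : R -> R) (K : R) (m : nat) : (forall x, continuous g x) ->
  (forall th, - PI <= th <= PI -> Rabs (g th + g (- th) - 2 * g 0) <= K * (1 - cos th)) ->
  Rabs (RInt (fun th => g th * fejer m th) (- PI) PI - 2 * PI * INR (S m) * g 0) <= 2 * PI * K.
Proof.
  intros Hg HK.
  assert (Hp0 := PI_RGT_0).
  assert (CF : forall x, continuous (fejer m) x) by apply tpart_cont.
  assert (Cg' : forall x, continuous (fun y => g (- y)) x).
  { intros x; apply (continuous_comp (fun y => - y) g); [|apply Hg].
    apply (ex_derive_continuous (fun y => - y)); auto_derive; easy. }
  assert (E1 : RInt (fun th => g th * fejer m th) (- PI) PI = RInt (fun th => g (- th) * fejer m th) (- PI) PI).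
  { rewrite <- RInt_reflect by (intros x; now apply continuousR_mult).
    apply RInt_ext; intros x _; unfold fejer; now rewrite tpart_neg. }
  assert (E2 : RInt (fun th => 2 * g 0 * fejer m th) (- PI) PI = 2 * g 0 * (2 * PI * INR (S m))).
  { rewrite RIntR_scal by (apply ex_RInt_cont; apply CF). unfold fejer; rewrite RInt_tpart_const; change (INR 0) with 0; rring. }
  assert (E3 : RInt (fun th => (g th + g (- th) - 2 * g 0) * fejer m th) (- PI) PI
    = 2 * (RInt (fun th => g th * fejer m th) (- PI) PI - 2 * PI * INR (S m) * g 0)).
  { rewrite (RInt_ext _ (fun th => (g th * fejer m th + g (- th) * fejer m th) - 2 * g 0 * fejer m th)) by (intros; rring).
    rewrite RIntR_minus, RIntR_plus, <- E1, E2; [rring| | | |]; apply ex_RInt_cont; intros x;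
      repeat first [apply Hg|apply Cg'|apply CF|apply continuous_const|apply continuousR_plus|apply continuousR_mult]. }
  assert (B : Rabs (RInt (fun th => (g th + g (- th) - 2 * g 0) * fejer m th) (- PI) PI) <= 2 * K * (PI - - PI)).
  { assert (NN : forall th, - PI <= th <= PI -> 0 <= (1 - cos th)) by (intros th _; pose proof (COS_bound th); lra).
    apply RInt_abs_le; [lra| |].
    - intros x; apply continuousR_mult; [|apply CF]. apply continuousR_minus; [|apply continuous_const]. now apply continuousR_plus.
    - intros th Hth; rewrite Rabs_mult.
      apply Rle_trans with (K * (1 - cos th) * Rabs (fejer m th)).
      + apply Rmult_le_compat_r; [apply Rabs_pos|now apply HK].
      + rewrite Rmult_assoc, <- (Rabs_right (1 - cos th)) at 1 by (apply Rle_ge; now apply NN).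
        rewrite <- Rabs_mult, (Rmult_comm (1 - cos th)), fejer_mul.
        assert (K0 : 0 <= K).
        { specialize (HK PI ltac:(lra)). rewrite cos_PI in HK.
          pose proof (Rabs_pos (g PI + g (- PI) - 2 * g 0)); lra. }
        rewrite (Rmult_comm 2); apply Rmult_le_compat_l; [easy|].
        pose proof (COS_bound (INR (S m) * th)); apply Rabs_le; lra. }
  rewrite E3, Rabs_mult, (Rabs_right 2) in B by lra. lra.
Qed.

(** * The Poisson kernel, its polynomial comparison kernels and the Poisson formula *)

(** The Poisson kernel for the ratio exp(-tau) of radii, in hyperbolic form. *)
Definition poisson (tau th : R) : R := sinh tau / (cosh tau - cos th).

Lemma cosh_gt_1 (x : R) : 0 < x -> 1 < cosh x.
Proof.
  intros H; unfold cosh.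
  assert (E : exp x * exp (- x) = 1) by (rewrite <- exp_plus, Rplus_opp_r; apply exp_0).
  pose proof (exp_increasing 0 x H) as P; rewrite exp_0 in P. nra.
Qed.

Lemma sinh_pos (x : R) : 0 < x -> 0 < sinh x.
Proof. intros H; unfold sinh; pose proof (exp_increasing (- x) x ltac:(lra)); lra. Qed.

Lemma poisson_den (tau th : R) : 0 < tau -> 0 < cosh tau - cos th.
Proof. intros H; pose proof (cosh_gt_1 _ H); pose proof (COS_bound th); lra. Qed.

Lemma poisson_cont (tau th : R) : 0 < tau -> continuous (poisson tau) th.
Proof.
  intros H; unfold poisson.
  apply (ex_derive_continuous (fun th => sinh tau / (cosh tau - cos th))).
  auto_derive. pose proof (poisson_den tau th H); lra.
Qed.

Lemma exp_pow (n : nat) (x : R) : exp x ^ n = exp (INR n * x).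
Proof.
  induction n as [|n IH]; [simpl; rewrite Rmult_0_l, exp_0; reflexivity|].
  rewrite S_INR, <- tech_pow_Rmult, IH, <- exp_plus; f_equal; ring.
Qed.

Lemma poisson_partial (tau th : R) (j : nat) : 0 < tau ->
  Rabs (tpart (fun n => exp (- tau) ^ n) j th - poisson tau th) <= 2 / (cosh tau - 1) * exp (- tau) ^ j.
Proof.
  intros H.
  pose proof (tpart_telescope (fun n => exp (- tau) ^ n) (cosh tau) j th) as E.
  set (r := exp (- tau)) in *.
  assert (Hr : 0 < r) by apply exp_pos.
  assert (Er : exp tau * r = 1) by (unfold r; rewrite <- exp_plus, Rplus_opp_r; apply exp_0).
  assert (Hr1 : r <= 1) by (rewrite <- exp_0; apply exp_le; lra).
  assert (E' := E ltac:(intros n; simpl; unfold cosh; fold r; replace (2 * ((exp tau + r) / 2) * (r * r ^ n)) with ((exp tau * r + r * r) * r ^ n) by field; rewrite Er; ring)); clear E.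
  pose proof (poisson_den tau th H) as D. pose proof (cosh_gt_1 tau H) as D1.
  set (P := tpart _ j th) in *.
  assert (Pw : 0 < r ^ j) by now apply pow_lt.
  assert (EE : P - poisson tau th = (r * r ^ j * cos (INR j * th) - r ^ j * cos (INR (S j) * th)) / (cosh tau - cos th)).
  { unfold poisson.
    apply Rmult_eq_reg_r with (2 * cosh tau - 2 * cos th); [|lra].
    replace ((P - sinh tau / (cosh tau - cos th)) * (2 * cosh tau - 2 * cos th))
      with ((2 * cosh tau - 2 * cos th) * P - 2 * sinh tau) by (field; lra).
    rewrite E'. simpl pow. unfold sinh, cosh; fold r. field. unfold cosh in D; fold r in D; lra. }
  rewrite EE. unfold Rdiv; rewrite Rabs_mult, Rabs_inv, (Rabs_right (cosh tau - cos th)) by lra.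
  pose proof (COS_bound (INR j * th)); pose proof (COS_bound (INR (S j) * th)); pose proof (COS_bound th).
  assert (N : Rabs (r * r ^ j * cos (INR j * th) - r ^ j * cos (INR (S j) * th)) <= 2 * r ^ j).
  { replace (r * r ^ j * cos (INR j * th) - r ^ j * cos (INR (S j) * th)) with (r ^ j * (r * cos (INR j * th) - cos (INR (S j) * th))) by ring.
    rewrite Rabs_mult, (Rabs_right (r ^ j)), (Rmult_comm 2) by lra.
    apply Rmult_le_compat_l; [lra|]. apply Rabs_le; nra. }
  apply Rle_trans with (2 * r ^ j * / (cosh tau - 1)); [|right; ring].
  apply Rmult_le_compat; [apply Rabs_pos| |easy|].
  - pos.
  - apply Rinv_le_contravar; lra.
Qed.

(** The coefficients satisfy the same recurrence as those of the Poisson kernel but vanish at n = N.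
    Telescoping therefore yields the Poisson kernel times cosh(N tau) - cos(N th), a trigonometric
    polynomial of degree below N that is nonnegative and comparable to the Poisson kernel. *)
Definition kernel (N : nat) (tau : R) : R -> R := tpart (fun n => sinh ((INR N - INR n) * tau)) (pred N).

Lemma sinh_rec (a b : R) : sinh (a - b) + sinh (a + b) = 2 * cosh b * sinh a.
Proof.
  unfold sinh, cosh.
  replace (- (a - b)) with (- a + b) by ring; replace (- (a + b)) with (- a + - b) by ring.
  replace (a - b) with (a + - b) by ring.
  rewrite !exp_plus; field.
Qed.

Lemma kernel_poisson (N : nat) (tau th : R) : (1 <= N)%nat -> 0 < tau ->
  kernel N tau th = poisson tau th * (cosh (INR N * tau) - cos (INR N * th)).
Proof.
  intros HN H. destruct N as [|m]; [lia|].
  pose proof (tpart_telescope (fun n => sinh ((INR (S m) - INR n) * tau)) (cosh tau) m th) as E.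
  assert (E' := E ltac:(intros n; rewrite !S_INR;
     replace ((INR m + 1 - (INR n + 1 + 1)) * tau) with ((INR m - INR n) * tau - tau) by ring;
     replace ((INR m + 1 - INR n) * tau) with ((INR m - INR n) * tau + tau) by ring;
     replace ((INR m + 1 - (INR n + 1)) * tau) with ((INR m - INR n) * tau) by ring; apply sinh_rec)); clear E.
  pose proof (poisson_den tau th H) as D.
  set (P := tpart _ m th) in *. cbv beta in E'.
  unfold poisson.
  replace ((INR (S m) - INR (S m)) * tau) with 0 in E' by ring.
  replace ((INR (S m) - INR m) * tau) with tau in E' by (rewrite S_INR; ring).
  assert (Z : sinh 0 = 0) by (unfold sinh; rewrite Ropp_0; field).
  assert (E2 : 2 * cosh tau * sinh ((INR (S m) - INR 0) * tau) - 2 * sinh ((INR (S m) - INR 1) * tau) = 2 * sinh tau * cosh (INR (S m) * tau)).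
  { simpl (INR 0); simpl (INR 1). rewrite Rminus_0_r.
    replace ((INR (S m) - 1) * tau) with (INR (S m) * tau + - tau) by ring.
    unfold sinh, cosh. rewrite Ropp_plus_distr, Ropp_involutive, !exp_plus. field. }
  rewrite E2, Z in E'.
  apply Rmult_eq_reg_r with (2 * cosh tau - 2 * cos th); [|lra].
  rewrite (Rmult_comm P), E'. field; lra.
Qed.

Lemma poisson_le_kernel (N : nat) (tau th : R) : (1 <= N)%nat -> 0 < tau ->
  poisson tau th * (cosh (INR N * tau) - 1) <= kernel N tau th <= poisson tau th * (cosh (INR N * tau) + 1).
Proof.
  intros HN H; rewrite kernel_poisson by easy.
  assert (0 < poisson tau th) by (apply Rdiv_lt_0_compat; [now apply sinh_pos|now apply poisson_den]).
  pose proof (COS_bound (INR N * th)); nra.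
Qed.

Lemma INR_bounded_0 (x B : R) : (forall m : nat, INR (S m) * Rabs x <= B) -> x = 0.
Proof.
  intros H; destruct (Req_dec x 0) as [|Hx]; [easy|].
  apply Rabs_pos_lt in Hx.
  destruct (INR_unbounded (B / Rabs x)) as [n Hn].
  specialize (H n); rewrite S_INR in H.
  assert (B < INR n * Rabs x).
  { apply Rmult_lt_reg_r with (/ Rabs x); [pos|].
    rewrite Rmult_assoc, Rinv_r by lra. unfold Rdiv in Hn; lra. }
  lra.
Qed.

(** The weight m + 1 - n counts the partial sums of order at most m that contain the n-th term. *)
Lemma tcoef_cesaro (b : nat -> R) (m : nat) :
  tcoef (fun n => INR (S m) - INR n) b m = sum_f_R0 (tcoef (fun _ => 1) b) m.
Proof.
  assert (Lin : forall j (k1 k2 : nat -> R), tcoef (fun n => k1 n + k2 n) b j = tcoef k1 b j + tcoef k2 b j).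
  { induction j as [|j IH]; intros; simpl; [ring|rewrite IH; ring]. }
  assert (Ext : forall j (k1 k2 : nat -> R), (forall n, k1 n = k2 n) -> tcoef k1 b j = tcoef k2 b j).
  { induction j as [|j IH]; intros k1 k2 E; simpl; rewrite !E; [ring|rewrite (IH k1 k2 E); ring]. }
  induction m as [|m IH].
  - simpl; ring.
  - rewrite tech5, <- IH.
    rewrite (Ext (S m) _ (fun n => (INR (S m) - INR n) + 1)) by (intros; rewrite (S_INR (S m)); ring).
    rewrite Lin, tcoef_S at 1. ring.
Qed.

Section PoissonFormula.
Variables (f : hexp) (c : C) (R1 : R).
Hypothesis Hwf : forall z, Cmod (z - c) < R1 -> hwf f z.
Hypothesis Hnz : forall z, Cmod (z - c) < R1 -> heval f z <> RtoC 0.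

(** Supplies the hypothesis of [fejer_eval]: the angular second derivative of log |f| is bounded on
    the circle, so the symmetric second difference is O(th^2) and hence O(1 - cos th). *)
Lemma logmod_second_diff (r : R) : 0 <= r < R1 -> exists K, forall th, - PI <= th <= PI ->
  Rabs (logmod f (pt c r th) + logmod f (pt c r (- th)) - 2 * logmod f (pt c r 0)) <= K * (1 - cos th).
Proof.
  intros Hr. assert (Hr1 : Rabs r < R1) by (rewrite Rabs_right; lra).
  set (q := HMul (hder f) (HInv f)).
  set (lin := HAdd HVar (HConst (- c)%C)).
  set (e := HMul q lin). set (e2 := HMul (hder e) (HMul (HConst Ci) lin)).
  assert (We : forall z, Cmod (z - c) < R1 -> hwf e z) by (intros z Hz; split; [now apply (q_wf f c R1)|repeat split]).
  assert (We2 : forall z, Cmod (z - c) < R1 -> hwf e2 z) by (intros z Hz; split; [now apply hder_wf, We|repeat split]).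
  set (w := fun th => logmod f (pt c r th)).
  set (w1 := fun th => - Im (heval e (pt c r th))).
  set (w2 := fun th => - Im (heval e2 (pt c r th))).
  assert (D1 : forall th, is_derive w th (w1 th)).
  { intros th. replace (w1 th) with (- Im (heval q (pt c r th) * (pt c r th - c))) by (unfold w1; simpl heval; reflexivity).
    now apply (logmod_dth f c R1). }
  assert (D2 : forall th, is_derive w1 th (w2 th)).
  { intros th. apply @is_derive_opp.
    replace (heval e2 (pt c r th)) with (heval (hder e) (pt c r th) * (Ci * (pt c r th - c)))%C
      by (simpl heval; unfold Cminus; ring).
    apply (cpath_comp (heval e) (pt c r)); [|apply pt_path_th].
    apply heval_cdiff; now apply (wf_pt e c R1). }
  assert (Cw2 : forall th, continuous w2 th).
  { intros th; apply (continuous_opp (V := R_NormedModule) (fun th => Im (heval e2 (pt c r th)))).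
    apply (continuity_2d_to_1 (fun u v => Im (heval e2 (pt c u v)))). now apply (Re_circle_2d e2 c R1). }
  assert (Hp := PI_RGT_0).
  destruct (cont_bounded w2 (- PI) PI) as [M [PM HM]]; [lra|easy|].
  assert (L : forall th, 0 <= th <= PI -> Rabs (w1 th - w1 (- th)) <= 2 * M * th).
  { intros th Hth. replace (2 * M * th) with (M * (th - - th)) by ring.
    apply (MVT_abs_le w1 w2); [lra|intros; apply D2|intros; apply HM; lra]. }
  assert (B : forall th, 0 <= th <= PI -> Rabs (w th + w (- th) - 2 * w 0) <= 36 * M * (1 - cos th)).
  { intros th Hth.
    apply Rle_trans with (2 * M * th * (th - 0)).
    - replace (w th + w (- th) - 2 * w 0) with ((w th + w (- th)) - (w 0 + w (- 0))) by (rewrite Ropp_0; ring).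
      apply (MVT_abs_le (fun x => w x + w (- x)) (fun x => w1 x - w1 (- x))); [lra| |].
      + intros x _. replace (w1 x - w1 (- x)) with (w1 x + -1 * w1 (- x)) by ring.
        apply @is_derive_plus; [apply D1|].
        apply (is_derive_comp w (fun x => - x)); [apply D1|auto_derive; [easy|ring]].
      + intros x Hx; eapply Rle_trans; [apply L; lra|nra].
    - pose proof (sqr_le_one_minus_cos th ltac:(lra)). nra. }
  exists (36 * M); intros th Hth.
  destruct (Rle_dec 0 th) as [P|P]; [apply B; lra|].
  specialize (B (- th) ltac:(lra)). rewrite Ropp_involutive, cos_neg in B.
  rewrite (Rplus_comm (logmod f (pt c r th))). exact B.
Qed.

(** With x = exp(-tau), the partial sums S_j of the Poisson series converge geometrically to the
    integral Lam. On the other hand S_0 + ... + S_m is the Fejer pairing on the circle of radius r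
    x, equal to 2 pi (m + 1) times the value at angle 0 up to a bounded error. So (m + 1) |Lam - 2
    pi g0| is bounded in m, and the difference is 0. *)
Lemma poisson_formula (r tau : R) : 0 < r < R1 -> 0 < tau ->
  RInt (fun th => logmod f (pt c r th) * poisson tau th) (- PI) PI
  = 2 * PI * logmod f (pt c (r * exp (- tau)) 0).
Proof.
  intros Hr Ht. assert (Hp := PI_RGT_0).
  set (x := exp (- tau)). assert (Px : 0 < x) by apply exp_pos.
  assert (Px1 : x < 1) by (rewrite <- exp_0; apply exp_increasing; lra).
  set (r0 := r * x). assert (Hr0 : 0 < r0 < r) by (unfold r0; split; nra).
  set (W := fun th => logmod f (pt c r th)).
  assert (CW : forall th, continuous W th) by (intros; apply (logmod_cont f c R1); [easy|easy|rewrite Rabs_right; lra]).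
  set (a := fun n => fcoef f c n r).
  assert (Ea : forall n, fcoef f c n r0 = x ^ n * a n).
  { intros n. pose proof (fcoef_scale f c R1 Hwf Hnz n r0 r ltac:(lra) ltac:(lra)) as E.
    unfold a; unfold r0 in E at 1; rewrite Rpow_mult_distr in E.
    apply Rmult_eq_reg_r with (r ^ n); [|apply pow_nonzero; lra]. rewrite <- E; ring. }
  destruct (logmod_second_diff r0 ltac:(lra)) as [K HK].
  set (Lam := RInt (fun th => W th * poisson tau th) (- PI) PI).
  set (S := fun j => tcoef (fun n => x ^ n) a j).
  assert (ES : forall j, S j = RInt (fun th => W th * tpart (fun n => x ^ n) j th) (- PI) PI).
  { intros j; rewrite RInt_tpart by easy; reflexivity. }
  destruct (cont_bounded W (- PI) PI) as [M [PM HM]]; [lra|easy|].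
  set (D := 2 / (cosh tau - 1)). pose proof (cosh_gt_1 tau Ht) as Hc.
  assert (PD : 0 < D) by pos.
  assert (BS : forall j, Rabs (S j - Lam) <= M * D * (2 * PI) * x ^ j).
  { intros j. unfold Lam; rewrite ES, <- RIntR_minus.
    2,3: apply ex_RInt_cont; intros y; apply continuousR_mult; [easy|first [apply tpart_cont|now apply poisson_cont]].
    replace (M * D * (2 * PI) * x ^ j) with (M * (D * x ^ j) * (PI - - PI)) by ring.
    apply RInt_abs_le; [lra| |].
    - intros y; apply continuousR_minus; apply continuousR_mult; try easy; [apply tpart_cont|now apply poisson_cont].
    - intros th Hth. replace (W th * tpart (fun n => x ^ n) j th - W th * poisson tau th)
        with (W th * (tpart (fun n => x ^ n) j th - poisson tau th)) by ring.
      rewrite Rabs_mult; apply Rmult_le_compat; try apply Rabs_pos; [now apply HM|].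
      unfold D, x; now apply poisson_partial. }
  set (g0 := logmod f (pt c r0 0)).
  assert (Z : Lam - 2 * PI * g0 = 0).
  { apply (INR_bounded_0 _ (M * D * (2 * PI) / (1 - x) + 2 * PI * K)); intros m.
    assert (F : Rabs (sum_f_R0 S m - 2 * PI * INR (Datatypes.S m) * g0) <= 2 * PI * K).
    { pose proof (fejer_eval (fun th => logmod f (pt c r0 th)) K m) as FE.
      unfold fejer in FE; rewrite RInt_tpart in FE.
      2:{ intros; apply (logmod_cont f c R1); [easy|easy|rewrite Rabs_right; lra]. }
      rewrite tcoef_cesaro in FE.
      replace (sum_f_R0 S m) with (sum_f_R0 (tcoef (fun _ => 1) (fun n => fcoef f c n r0)) m); [apply FE|].
      - intros; apply (logmod_cont f c R1); [easy|easy|rewrite Rabs_right; lra].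
      - exact HK.
      - apply sum_eq; intros j _. unfold S.
        induction j as [|j IH]; simpl; rewrite Ea; [simpl; ring|]. rewrite IH; simpl; ring. }
    assert (G : Rabs (sum_f_R0 S m - INR (Datatypes.S m) * Lam) <= M * D * (2 * PI) / (1 - x) * (1 - x ^ (Datatypes.S m))).
    { clear F. induction m as [|m IH].
      - specialize (BS O). rewrite Rmult_1_l.
        eapply Rle_trans; [apply BS|]. right; simpl; field; lra.
      - rewrite tech5, (S_INR (Datatypes.S m)).
        replace (sum_f_R0 S m + S (Datatypes.S m) - (INR (Datatypes.S m) + 1) * Lam)
          with ((sum_f_R0 S m - INR (Datatypes.S m) * Lam) + (S (Datatypes.S m) - Lam)) by ring.
        eapply Rle_trans; [apply Rabs_triang|].
        eapply Rle_trans; [apply Rplus_le_compat; [apply IH|apply BS]|].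
        right; simpl; field; lra. }
    assert (Q : M * D * (2 * PI) / (1 - x) * (1 - x ^ (Datatypes.S m)) <= M * D * (2 * PI) / (1 - x)).
    { assert (0 < M * D * (2 * PI) / (1 - x)) by pos.
      pose proof (pow_lt x (Datatypes.S m) Px). nra. }
    rewrite <- (Rabs_right (INR (Datatypes.S m))) by (apply Rle_ge, pos_INR).
    rewrite <- Rabs_mult.
    replace (INR (Datatypes.S m) * (Lam - 2 * PI * g0)) with
      (- (sum_f_R0 S m - INR (Datatypes.S m) * Lam) + (sum_f_R0 S m - 2 * PI * INR (Datatypes.S m) * g0)) by ring.
    eapply Rle_trans; [apply Rabs_triang|]. rewrite Rabs_Ropp; lra. }
  change (Lam = 2 * PI * g0); lra.
Qed.

Lemma kernel_sandwich (N : nat) (r tau : R) : (1 <= N)%nat -> 0 < r < R1 -> 0 < tau ->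
  (forall th, 0 <= logmod f (pt c r th)) ->
  2 * PI * logmod f (pt c (r * exp (- tau)) 0) * (cosh (INR N * tau) - 1)
   <= RInt (fun th => logmod f (pt c r th) * kernel N tau th) (- PI) PI
   <= 2 * PI * logmod f (pt c (r * exp (- tau)) 0) * (cosh (INR N * tau) + 1).
Proof.
  intros HN Hr Ht H0. assert (Hp := PI_RGT_0).
  assert (CW : forall th, continuous (fun th => logmod f (pt c r th)) th) by (intros; apply (logmod_cont f c R1); [easy|easy|rewrite Rabs_right; lra]).
  rewrite <- poisson_formula by easy.
  set (I := RInt _ _ _).
  assert (CP : forall th, continuous (fun th => logmod f (pt c r th) * poisson tau th) th)
    by (intros; apply continuousR_mult; [easy|now apply poisson_cont]).
  assert (CK : forall th, continuous (fun th => logmod f (pt c r th) * kernel N tau th) th)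
    by (intros; apply continuousR_mult; [easy|apply tpart_cont]).
  rewrite !(Rmult_comm I). unfold I; rewrite <- !RIntR_scal by now apply ex_RInt_cont.
  split; apply RInt_le; try lra; try (apply ex_RInt_cont; intros; first [apply CK|apply continuousR_mult; [apply continuous_const|apply CP]]);
    intros th _; pose proof (poisson_le_kernel N tau th HN Ht); specialize (H0 th); nra.
Qed.

End PoissonFormula.

(** * The maximum modulus principle on rectangles *)

(** A maximal y is chosen for each x, and the partial maximum is then maximised over x; it is
    continuous by uniform continuity of g on the rectangle. *)
Lemma attains_max_2d (g : R -> R -> R) (a b c d : R) : a <= b -> c <= d ->
  (forall x y, a <= x <= b -> c <= y <= d -> continuity_2d_pt g x y) ->
  exists x0 y0, a <= x0 <= b /\ c <= y0 <= d /\ forall x y, a <= x <= b -> c <= y <= d -> g x y <= g x0 y0.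
Proof.
  intros Hab Hcd Hg.
  assert (M : forall x, { y | a <= x <= b -> c <= y <= d /\ forall y', c <= y' <= d -> g x y' <= g x y }).
  { intros x; apply constructive_indefinite_description.
    destruct (excluded_middle_informative (a <= x <= b)) as [Hx|Hx]; [|exists 0; easy].
    destruct (continuity_ab_maj (g x) c d Hcd) as [y [H1 H2]]; [|exists y; auto].
    intros y Hy; apply continuity_pt_filterlim, continuity_2d_to_1, Hg; easy. }
  (* Clamping x to [a, b] extends the partial maximum to the whole line, so two-sided continuity
     also holds at the endpoints. *)
  set (cl := fun x => Rmax a (Rmin b x)).
  assert (Hcl : forall x, a <= cl x <= b).
  { intros x; split; [apply Rmax_l|apply Rmax_lub; [easy|apply Rmin_l]]. }
  assert (Hcl1 : forall x, a <= x <= b -> cl x = x) by (intros x Hx; unfold cl; rewrite Rmin_right, Rmax_right; lra).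
  assert (Hcl2 : forall x y, Rabs (cl x - cl y) <= Rabs (x - y)).
  { intros x y; unfold cl, Rmax, Rmin; repeat destruct Rle_dec; unfold Rabs; repeat destruct Rcase_abs; lra. }
  set (m := fun x => g (cl x) (proj1_sig (M (cl x)))).
  assert (Hm : forall x y, c <= y <= d -> g (cl x) y <= m x).
  { intros x y Hy; unfold m; destruct (M (cl x)) as [y1 H1]; simpl; now apply H1. }
  assert (Hmy : forall x, c <= proj1_sig (M (cl x)) <= d) by (intros x; destruct (M (cl x)) as [y1 H1]; simpl; now apply H1).
  assert (Cm : forall x, a <= x <= b -> continuity_pt m x).
  { intros x _; apply continuity_pt_filterlim, filterlim_locally; intros eps.
    destruct (uniform_continuity_2d g a b c d Hg eps) as [del Hd].
    exists del; intros y Hy; change (Rabs (y - x) < del) in Hy; change (Rabs (m y - m x) < eps).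
    assert (E1 := Hd (cl x) (proj1_sig (M (cl y))) (cl y) (proj1_sig (M (cl y))) (Hcl x) (Hmy y) (Hcl y) (Hmy y)
       (Rle_lt_trans _ _ _ (Hcl2 y x) Hy) ltac:(rewrite Rminus_diag, Rabs_R0; apply cond_pos)).
    assert (E2 := Hd (cl x) (proj1_sig (M (cl x))) (cl y) (proj1_sig (M (cl x))) (Hcl x) (Hmy x) (Hcl y) (Hmy x)
       (Rle_lt_trans _ _ _ (Hcl2 y x) Hy) ltac:(rewrite Rminus_diag, Rabs_R0; apply cond_pos)).
    pose proof (Hm x _ (Hmy y)) as F1. pose proof (Hm y _ (Hmy x)) as F2.
    change (g (cl y) (proj1_sig (M (cl y)))) with (m y) in E1.
    change (g (cl x) (proj1_sig (M (cl x)))) with (m x) in E2.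
    apply Rabs_def2 in E1; apply Rabs_def2 in E2; apply Rabs_def1; lra. }
  destruct (continuity_ab_maj m a b Hab Cm) as [x0 [H1 H2]].
  exists x0, (proj1_sig (M (cl x0))); split; [easy|split; [apply Hmy|]].
  intros x y Hx Hy. specialize (H1 x Hx). pose proof (Hm x y Hy) as H3. rewrite Hcl1 in H3 by easy.
  unfold m in H1 at 2; rewrite (Hcl1 x0 H2) in H1. rewrite (Hcl1 x0 H2). lra.
Qed.

Lemma RInt_zero_nonneg (g : R -> R) (a b : R) : a < b -> (forall x, continuous g x) ->
  (forall x, a <= x <= b -> 0 <= g x) -> RInt g a b = 0 -> forall x, a <= x <= b -> g x = 0.
Proof.
  intros Hab Hc Hg HI.
  assert (EX : forall u v, ex_RInt g u v) by (intros; now apply ex_RInt_cont).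
  assert (P : forall u v, a <= u -> u <= v -> v <= b -> RInt g u v = 0).
  { intros u v H1 H2 H3.
    assert (N : forall p q, a <= p -> p <= q -> q <= b -> 0 <= RInt g p q).
    { intros p q; intros; apply RInt_ge_0; [easy|apply EX|intros; apply Hg; lra]. }
    assert (E : RInt g a b = RInt g a u + RInt g u v + RInt g v b).
    { rewrite <- (RInt_Chasles (V := R_CompleteNormedModule) g a u b), <- (RInt_Chasles (V := R_CompleteNormedModule) g u v b) by apply EX.
      unfold plus; simpl; rring. }
    pose proof (N a u); pose proof (N u v); pose proof (N v b); lra. }
  intros x Hx.
  destruct (Rle_lt_or_eq_dec 0 (g x)) as [Q|Q]; [now apply Hg| |now symmetry].
  exfalso.
  destruct (proj1 (filterlim_locally _ _) (Hc x) (mkposreal (g x / 2) ltac:(lra))) as [del Hd].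
  pose proof (cond_pos del) as Pd.
  set (u := Rmax a (x - del / 2)). set (v := Rmin b (x + del / 2)).
  assert (Hu : a <= u <= x) by (split; [apply Rmax_l|apply Rmax_lub; lra]).
  assert (Hu2 : x - del / 2 <= u) by apply Rmax_r.
  assert (Hv : x <= v <= b) by (split; [apply Rmin_glb; lra|apply Rmin_l]).
  assert (Hv2 : v <= x + del / 2) by apply Rmin_r.
  assert (Huv : u < v).
  { destruct (Rlt_le_dec u x); [lra|]. assert (E : u = x) by lra.
    destruct (Rle_lt_or_eq_dec x v) as [|E2]; [easy|lra|].
    unfold u in E. unfold v in E2.
    assert (x = a) by (unfold Rmax in E; destruct Rle_dec; lra).
    assert (x = b) by (unfold Rmin in E2; destruct Rle_dec; lra). lra. }
  assert (L : RInt (fun _ => g x / 2) u v <= RInt g u v).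
  { apply RInt_le; [lra|apply ex_RInt_const|apply EX|].
    intros y Hy. specialize (Hd y).
    assert (B : ball x del y) by (change (Rabs (y - x) < del); apply Rabs_def1; lra).
    specialize (Hd B). change (Rabs (g y - g x) < g x / 2) in Hd. apply Rabs_def2 in Hd; lra. }
  rewrite (P u v) in L by lra.
  rewrite RInt_const in L; unfold scal in L; simpl in L; unfold mult in L; simpl in L. nra.
Qed.

Definition in_rect (a b c d : R) (z : C) : Prop := a <= Re z <= b /\ c <= Im z <= d.
Definition on_bdry (a b c d : R) (z : C) : Prop :=
  in_rect a b c d z /\ (Re z = a \/ Re z = b \/ Im z = c \/ Im z = d).

(** Around a maximum point z0 the largest circle inside the rectangle touches its boundary. Over
    this circle Re(conj(f(z0)) f) has mean |f(z0)|^2, which is also a pointwise upper bound, so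
    equality holds everywhere on it and in particular where it touches. If z0 is itself on the
    boundary the radius is 0. The margin [eta] provides the open disc that [circle_mean]
    requires. *)
Lemma max_modulus (e : hexp) (a b c d eta B : R) : 0 < eta -> a < b -> c < d ->
  (forall z, in_rect (a - eta) (b + eta) (c - eta) (d + eta) z -> hwf e z) ->
  (forall z, on_bdry a b c d z -> Cmod (heval e z) <= B) ->
  forall z, in_rect a b c d z -> Cmod (heval e z) <= B.
Proof.
  intros Pe Hab Hcd Hwf HB.
  set (g := fun x y => Re (heval e (x, y)) ^ 2 + Im (heval e (x, y)) ^ 2).
  assert (Eg : forall x y, g x y = Cmod (heval e (x, y)) ^ 2) by (intros; unfold g; now rewrite Cmod_sq).
  destruct (attains_max_2d g a b c d) as [x0 [y0 [Hx0 [Hy0 Hmax]]]]; [lra|lra| |].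
  { intros x y Hx Hy.
    destruct (Re_2d (heval e) (fun x y => (x, y)) x y) as [A1 A2].
    - apply heval_ccont, Hwf; unfold in_rect, Re, Im; simpl; lra.
    - apply continuity_2d_pt_id1.
    - apply continuity_2d_pt_id2.
    - apply (continuity_2d_pt_ext (fun x y => Re (heval e (x, y)) * Re (heval e (x, y)) + Im (heval e (x, y)) * Im (heval e (x, y)))).
      { intros; unfold g; ring. }
      apply continuity_2d_pt_plus; now apply continuity_2d_pt_mult. }
  set (z0 := (x0, y0) : C). set (f0 := heval e z0).
  assert (Hz0 : forall z, in_rect a b c d z -> Cmod (heval e z) <= Cmod f0).
  { intros [x y] [Hx Hy]. specialize (Hmax x y Hx Hy). rewrite !Eg in Hmax.
    apply Rsqr_incr_0; [unfold Rsqr; fold z0 f0 in Hmax; nra|apply Cmod_ge_0|apply Cmod_ge_0]. }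
  enough (Cmod f0 <= B) by (intros z Hz; specialize (Hz0 z Hz); lra).
  set (r := Rmin (Rmin (x0 - a) (b - x0)) (Rmin (y0 - c) (d - y0))).
  assert (Hr : r <= x0 - a /\ r <= b - x0 /\ r <= y0 - c /\ r <= d - y0).
  { unfold r; repeat split.
    - eapply Rle_trans; [apply Rmin_l|apply Rmin_l].
    - eapply Rle_trans; [apply Rmin_l|apply Rmin_r].
    - eapply Rle_trans; [apply Rmin_r|apply Rmin_l].
    - eapply Rle_trans; [apply Rmin_r|apply Rmin_r]. }
  assert (Hrt : r = x0 - a \/ r = b - x0 \/ r = y0 - c \/ r = d - y0).
  { unfold r. unfold Rmin; repeat destruct Rle_dec; auto. }
  assert (Hp := PI_RGT_0).
  assert (Hin : forall th, in_rect a b c d (pt z0 r th)).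
  { intros th. unfold in_rect, pt, cis, Re, Im; simpl.
    pose proof (COS_bound th); pose proof (SIN_bound th). nra. }
  set (e2 := HMul (HConst (Cconj f0)) e).
  assert (Wd : forall z, Cmod (z - z0) < r + eta -> hwf e2 z).
  { intros z Hz; split; [easy|]. apply Hwf.
    pose proof (re_le_Cmod (z - z0)) as A1; pose proof (im_le_Cmod (z - z0)) as A2. unfold z0 in A1, A2, Hz; unfold Re in A1; unfold Im in A2; simpl in A1, A2.
    apply Rabs_le_between in A1; apply Rabs_le_between in A2. unfold in_rect, Re, Im; lra. }
  pose proof (circle_mean e2 z0 (r + eta) r Wd ltac:(lra)) as MM.
  assert (E0 : Re (heval e2 z0) = Cmod f0 ^ 2).
  { rewrite Cmod_sq. unfold e2; simpl heval. fold f0. unfold Cconj, Re, Im; simpl. ring. }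
  set (G := fun th => Cmod f0 ^ 2 - Re (heval e2 (pt z0 r th))).
  assert (CR : forall th, continuous (fun th => Re (heval e2 (pt z0 r th))) th).
  { intros th; apply (continuity_2d_to_1 (fun u v => Re (heval e2 (pt z0 u v)))).
    apply (Re_circle_2d e2 z0 (r + eta)); [easy|rewrite Rabs_right; lra]. }
  assert (CG : forall th, continuous G th) by (intros th; apply continuousR_minus; [apply continuous_const|apply CR]).
  assert (NG : forall th, 0 <= G th).
  { intros th; unfold G. pose proof (re_le_Cmod (heval e2 (pt z0 r th))) as A.
    pose proof (Rle_abs (Re (heval e2 (pt z0 r th)))).
    assert (Cmod (heval e2 (pt z0 r th)) <= Cmod f0 * Cmod f0).
    { unfold e2; simpl heval; rewrite Cmod_mult, Cmod_conj. apply Rmult_le_compat_l; [apply Cmod_ge_0|now apply Hz0]. }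
    lra. }
  assert (ZG : RInt G (- PI) PI = 0).
  { unfold G. rewrite RIntR_minus, MM, E0, RInt_const.
    - unfold scal; simpl; unfold mult; simpl; rring.
    - apply ex_RInt_const.
    - now apply ex_RInt_cont. }
  assert (Z : forall th, - PI <= th <= PI -> G th = 0).
  { apply RInt_zero_nonneg; [lra|easy|intros; apply NG|easy]. }
  assert (Touch : exists th, - PI <= th <= PI /\ on_bdry a b c d (pt z0 r th)).
  { assert (K : forall th, Re (pt z0 r th) = x0 - r * cos th /\ Im (pt z0 r th) = y0 - r * sin th).
    { intros th; unfold pt, cis, Re, Im; simpl; split; ring. }
    destruct Hrt as [T|[T|[T|T]]].
    - exists 0; split; [lra|]; split; [apply Hin|]. left. rewrite (proj1 (K 0)), cos_0; lra.
    - exists PI; split; [lra|]; split; [apply Hin|]. right; left. rewrite (proj1 (K PI)), cos_PI; lra.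
    - exists (PI / 2); split; [lra|]; split; [apply Hin|]. right; right; left. rewrite (proj2 (K (PI / 2))), sin_PI2; lra.
    - exists (- (PI / 2)); split; [lra|]; split; [apply Hin|]. right; right; right. rewrite (proj2 (K (- (PI / 2)))), sin_neg, sin_PI2; lra. }
  destruct Touch as [th [Hth Hb]].
  specialize (Z th Hth). specialize (HB _ Hb). unfold G in Z.
  assert (A : Rabs (Re (heval e2 (pt z0 r th))) <= Cmod f0 * Cmod (heval e (pt z0 r th))).
  { eapply Rle_trans; [apply re_le_Cmod|]. unfold e2; simpl heval; rewrite Cmod_mult, Cmod_conj; lra. }
  pose proof (Rle_abs (Re (heval e2 (pt z0 r th)))) as A1.
  pose proof (Cmod_ge_0 f0) as F0. pose proof (Cmod_ge_0 (heval e (pt z0 r th))) as F1.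
  destruct (Req_dec (Cmod f0) 0) as [E|E]; [lra|].
  assert (Cmod f0 <= Cmod (heval e (pt z0 r th))); [|lra].
  apply Rmult_le_reg_l with (Cmod f0); [lra|]. lra.
Qed.

(** * The zeta function to the right of the imaginary axis *)

Definition rpw (x : R) (s : C) : C := cexp (s * RtoC (ln x)).

Lemma Cmod_rpw (x : R) (s : C) : Cmod (rpw x s) = Rpower x (Re s).
Proof. unfold rpw; rewrite Cmod_cexp; unfold Rpower; f_equal; unfold RtoC, Re; simpl; ring. Qed.

Lemma rpw_plus (x : R) (s w : C) : rpw x (s + w) = (rpw x s * rpw x w)%C.
Proof. unfold rpw; rewrite <- cexp_plus; f_equal; ring. Qed.

Lemma cexp_RtoC (x : R) : cexp (RtoC x) = RtoC (exp x).
Proof. unfold cexp, RtoC; simpl; rewrite cos_0, sin_0; f_equal; ring. Qed.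

Lemma rpw_1 (x : R) : 0 < x -> rpw x (RtoC 1) = RtoC x.
Proof.
  intros H; unfold rpw. replace (RtoC 1 * RtoC (ln x))%C with (RtoC (ln x)) by ring.
  rewrite cexp_RtoC, exp_ln; easy.
Qed.

Lemma rpw_one (s : C) : rpw 1 s = RtoC 1.
Proof. unfold rpw; rewrite ln_1. replace (s * RtoC 0)%C with (RtoC 0) by ring. apply cexp_0. Qed.

Lemma rpw_path (x : R) (s : C) : 0 < x -> cpath (fun y => rpw y s) x (s * rpw x (s - RtoC 1))%C.
Proof.
  intros H.
  assert (E : rpw x (s - RtoC 1) = (rpw x s * RtoC (/ x))%C).
  { replace (s - RtoC 1)%C with (s + - RtoC 1)%C by ring. rewrite rpw_plus; f_equal.
    unfold rpw. replace (- RtoC 1 * RtoC (ln x))%C with (RtoC (- ln x)) by (rewrite RtoC_opp; ring).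
    rewrite cexp_RtoC, exp_Ropp, exp_ln; easy. }
  rewrite E. destruct s as [a b].
  assert (F : forall y, rpw y (a, b) = (exp (a * ln y) * cos (b * ln y), exp (a * ln y) * sin (b * ln y))).
  { intros y; unfold rpw, cexp, RtoC, Re, Im; simpl.
    replace (a * ln y - b * 0) with (a * ln y) by ring. replace (a * 0 + b * ln y) with (b * ln y) by ring. reflexivity. }
  split.
  - apply (is_derive_ext (fun y => exp (a * ln y) * cos (b * ln y))); [intros y; now rewrite F|].
    rewrite F; unfold RtoC, Re, Im; simpl. auto_derive; [easy|]. field; lra.
  - apply (is_derive_ext (fun y => exp (a * ln y) * sin (b * ln y))); [intros y; now rewrite F|].
    rewrite F; unfold RtoC, Re, Im; simpl. auto_derive; [easy|]. field; lra.
Qed.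

Lemma seq_cauchy_rate (u e : nat -> R) (N0 : nat) :
  (forall N M, (N0 <= N)%nat -> (N <= M)%nat -> Rabs (u M - u N) <= e N) -> is_lim_seq e 0 ->
  exists l : R, is_lim_seq u l /\ forall N, (N0 <= N)%nat -> Rabs (l - u N) <= e N.
Proof.
  intros H He.
  assert (X : ex_finite_lim_seq u).
  { apply ex_lim_seq_cauchy_corr; intros eps.
    apply is_lim_seq_spec in He. destruct (He (pos_div_2 eps)) as [N1 H1].
    set (N := Nat.max N0 N1).
    specialize (H1 N ltac:(unfold N; lia)). rewrite Rminus_0_r in H1. simpl in H1.
    pose proof (Rle_abs (e N)) as A.
    exists N; intros n m Hn Hm.
    pose proof (H N n ltac:(unfold N; lia) Hn). pose proof (H N m ltac:(unfold N; lia) Hm) as Q2.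
    replace (u n - u m) with ((u n - u N) + - (u m - u N)) by ring.
    eapply Rle_lt_trans; [apply Rabs_triang|]. rewrite Rabs_Ropp. lra. }
  destruct X as [l Hl]. exists l; split; [easy|]; intros N HN.
  apply (is_lim_seq_le_loc (fun M => Rabs (u M - u N)) (fun _ => e N) (Rabs (l - u N)) (e N)).
  - exists N; intros M HM; now apply H.
  - apply (is_lim_seq_abs (fun M => u M - u N) (l - u N)).
    apply is_lim_seq_minus'; [easy|apply is_lim_seq_const].
  - apply is_lim_seq_const.
Qed.

Lemma Rpower_lim_0 (a : R) : 0 < a -> is_lim_seq (fun N => Rpower (INR (S N)) (- a)) 0.
Proof.
  intros Ha. apply is_lim_seq_spec; intros eps.
  destruct (INR_unbounded (Rpower eps (- / a))) as [N HN].
  exists N; intros n Hn. rewrite Rminus_0_r, Rabs_right by pos.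
  assert (P : Rpower eps (- / a) < INR (S n)).
  { apply Rlt_le_trans with (INR N); [easy|apply le_INR; lia]. }
  assert (Pp : 0 < Rpower eps (- / a)) by apply exp_pos.
  assert (E : Rpower (Rpower eps (- / a)) (- a) = eps).
  { rewrite Rpower_mult. replace (- / a * - a) with 1 by (field; lra). apply Rpower_1, cond_pos. }
  apply Rlt_le_trans with (Rpower (Rpower eps (- / a)) (- a)); [|right; exact E].
  rewrite (Rpower_Ropp (INR (S n))), (Rpower_Ropp (Rpower eps (- / a))).
  apply Rinv_lt_contravar; [apply Rmult_lt_0_compat; apply exp_pos|].
  apply Rlt_Rpower_l; easy.
Qed.

Section ZetaTail.
Variables (sg t : R).
Hypothesis Hsg : 0 < sg.
Let s : C := (sg, t).

Definition tail_c (x : R) : R := frac_part x * Rpower x (- sg - 1) * cos (t * ln x).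
Definition tail_s (x : R) : R := frac_part x * Rpower x (- sg - 1) * sin (t * ln x).

Lemma frac_part_on (n : nat) (x : R) : INR n < x < INR (S n) -> frac_part x = x - INR n.
Proof.
  intros H. unfold frac_part. f_equal. rewrite S_INR in H.
  replace (Int_part x) with (Z.of_nat n); [now rewrite INR_IZR_INZ|].
  unfold Int_part. rewrite <- (tech_up x (Z.of_nat n + 1)); [lia| |]; rewrite plus_IZR, <- INR_IZR_INZ; lra.
Qed.

Lemma rpw_comp (x : R) : rpw x (- s - RtoC 1) = (Rpower x (- sg - 1) * cos (t * ln x), - (Rpower x (- sg - 1) * sin (t * ln x))).
Proof.
  unfold rpw, cexp, Rpower, s, RtoC, Re, Im; simpl.
  replace ((- sg + - (1)) * ln x - (- t + - 0) * 0) with ((- sg - 1) * ln x) by ring.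
  replace ((- sg + - (1)) * 0 + (- t + - 0) * ln x) with (- (t * ln x)) by ring.
  rewrite cos_neg, sin_neg. f_equal; ring.
Qed.

Lemma rpw_re_cont (x : R) : 0 < x -> continuous (fun y => Rpower y (- sg - 1) * cos (t * ln y)) x /\
  continuous (fun y => Rpower y (- sg - 1) * sin (t * ln y)) x.
Proof.
  intros H; split.
  - apply (ex_derive_continuous (fun y => Rpower y (- sg - 1) * cos (t * ln y))); unfold Rpower; auto_derive; easy.
  - apply (ex_derive_continuous (fun y => Rpower y (- sg - 1) * sin (t * ln y))); unfold Rpower; auto_derive; easy.
Qed.

Definition piece_c (n : nat) : R := RInt (fun x => (x - INR n) * (Rpower x (- sg - 1) * cos (t * ln x))) (INR n) (INR (S n)).
Definition piece_s (n : nat) : R := RInt (fun x => (x - INR n) * (Rpower x (- sg - 1) * sin (t * ln x))) (INR n) (INR (S n)).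

Lemma piece_ex (n : nat) : (1 <= n)%nat ->
  ex_RInt (fun x => (x - INR n) * (Rpower x (- sg - 1) * cos (t * ln x))) (INR n) (INR (S n)) /\
  ex_RInt (fun x => (x - INR n) * (Rpower x (- sg - 1) * sin (t * ln x))) (INR n) (INR (S n)).
Proof.
  intros Hn; pose proof (lt_0_INR n ltac:(lia)); pose proof (le_INR n (S n) ltac:(lia)).
  split; apply (@ex_RInt_continuous R_CompleteNormedModule); intros x Hx; rewrite Rmin_left in Hx by easy;
   (apply continuousR_mult; [apply continuousR_minus; [apply continuous_id|apply continuous_const]|apply rpw_re_cont; lra]).
Qed.

Lemma tail_piece (n : nat) : (1 <= n)%nat ->
  is_RInt tail_c (INR n) (INR (S n)) (piece_c n) /\ is_RInt tail_s (INR n) (INR (S n)) (piece_s n).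
Proof.
  intros Hn; destruct (piece_ex n Hn) as [E1 E2]; pose proof (le_INR n (S n) ltac:(lia)) as L.
  split; (eapply is_RInt_ext; [|apply (RInt_correct (V := R_CompleteNormedModule)); eassumption]);
    intros x Hx; rewrite Rmin_left, Rmax_right in Hx by easy; unfold tail_c, tail_s; rewrite (frac_part_on n x Hx); rring.
Qed.

Lemma tail_sum (N : nat) :
  is_RInt tail_c 1 (INR (S N)) (sum_n_m piece_c 1 N) /\ is_RInt tail_s 1 (INR (S N)) (sum_n_m piece_s 1 N).
Proof.
  induction N as [|N [I1 I2]].
  - rewrite !sum_n_m_zero by lia. simpl INR. split; apply (is_RInt_point (V := R_NormedModule)).
  - rewrite !sum_n_Sm by lia. destruct (tail_piece (S N) ltac:(lia)) as [J1 J2].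
    split; eapply (is_RInt_Chasles (V := R_NormedModule)); eassumption.
Qed.

(** The integrand is dominated by x^(-sg - 1), whose integral from N to infinity is N^(-sg) / sg. *)
Lemma tail_bound (N M : nat) : (1 <= N)%nat -> (N <= M)%nat ->
  Rabs (RInt tail_c 1 (INR M) - RInt tail_c 1 (INR N)) <= Rpower (INR N) (- sg) / sg /\
  Rabs (RInt tail_s 1 (INR M) - RInt tail_s 1 (INR N)) <= Rpower (INR N) (- sg) / sg.
Proof.
  intros HN HM.
  assert (P0 : 0 < INR N) by (apply lt_0_INR; lia). pose proof (le_INR N M HM) as L.
  assert (EX : forall K, (1 <= K)%nat -> ex_RInt tail_c 1 (INR K) /\ ex_RInt tail_s 1 (INR K)).
  { intros K HK; destruct K as [|K]; [lia|]. destruct (tail_sum K) as [A B]; split; eexists; eassumption. }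
  destruct (EX N HN) as [C1 S1]; destruct (EX M ltac:(lia)) as [C2 S2].
  assert (CN : ex_RInt tail_c (INR N) (INR M)).
  { apply (ex_RInt_Chasles (V := R_NormedModule)) with 1; [now apply ex_RInt_swap|easy]. }
  assert (SN : ex_RInt tail_s (INR N) (INR M)).
  { apply (ex_RInt_Chasles (V := R_NormedModule)) with 1; [now apply ex_RInt_swap|easy]. }
  assert (D1 : RInt tail_c 1 (INR M) - RInt tail_c 1 (INR N) = RInt tail_c (INR N) (INR M)).
  { rewrite <- (RInt_Chasles (V := R_CompleteNormedModule) tail_c 1 (INR N) (INR M)) by easy. unfold plus; simpl; rring. }
  assert (D2 : RInt tail_s 1 (INR M) - RInt tail_s 1 (INR N) = RInt tail_s (INR N) (INR M)).
  { rewrite <- (RInt_Chasles (V := R_CompleteNormedModule) tail_s 1 (INR N) (INR M)) by easy. unfold plus; simpl; rring. }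
  assert (IB : is_RInt (fun x => Rpower x (- sg - 1)) (INR N) (INR M) (Rpower (INR N) (- sg) / sg - Rpower (INR M) (- sg) / sg)).
  { replace (Rpower (INR N) (- sg) / sg - Rpower (INR M) (- sg) / sg)
      with (minus (- (Rpower (INR M) (- sg) / sg)) (- (Rpower (INR N) (- sg) / sg))) by (unfold minus, plus, opp; simpl; ring).
    apply (is_RInt_derive (fun x => - (Rpower x (- sg) / sg))); intros x Hx; rewrite Rmin_left in Hx by easy.
    - unfold Rpower; auto_derive; [lra|].
      replace ((- sg - 1) * ln x) with (- sg * ln x + - ln x) by ring.
      rewrite exp_plus, exp_Ropp, exp_ln by lra. field; lra.
    - apply (ex_derive_continuous (fun x => Rpower x (- sg - 1))); unfold Rpower; auto_derive; lra. }
  assert (PM : 0 <= Rpower (INR M) (- sg) / sg) by pos.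
  assert (FB : forall x y, Rabs y <= 1 -> Rabs (frac_part x * Rpower x (- sg - 1) * y) <= Rpower x (- sg - 1)).
  { intros x y Hy. destruct (base_fp x) as [F1 F2]. assert (0 < Rpower x (- sg - 1)) by apply exp_pos.
    rewrite !Rabs_mult, (Rabs_right (frac_part x)), (Rabs_right (Rpower x (- sg - 1))) by lra.
    pose proof (Rabs_pos y).
    apply Rle_trans with (1 * Rpower x (- sg - 1) * 1); [|lra].
    apply Rmult_le_compat; [pos|easy| |easy]. apply Rmult_le_compat_r; lra. }
  rewrite D1, D2; split; (apply Rle_trans with (Rpower (INR N) (- sg) / sg - Rpower (INR M) (- sg) / sg); [|lra]);
    eapply (norm_RInt_le (V := R_NormedModule)); try exact IB; try exact L;
    try (apply (RInt_correct (V := R_CompleteNormedModule)); assumption);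
    intros x Hx; apply FB; apply Rabs_le; [apply COS_bound|apply SIN_bound].
Qed.

(** The limits in [zeta_tail] really exist, so the total functions [Lim_seq] and [real] return
    genuine values there, and the rate of convergence is explicit. *)
Lemma tail_lim : exists lc ls,
  zeta_tail s = (lc, - ls) /\
  forall N, (1 <= N)%nat -> Rabs (lc - RInt tail_c 1 (INR N)) <= Rpower (INR N) (- sg) / sg /\
                            Rabs (ls - RInt tail_s 1 (INR N)) <= Rpower (INR N) (- sg) / sg.
Proof.
  assert (LE : is_lim_seq (fun N => Rpower (INR N) (- sg) / sg) 0).
  { apply is_lim_seq_incr_1. replace (Finite 0) with (Finite (0 / sg)) by (f_equal; field; lra).
    apply is_lim_seq_div'; [now apply Rpower_lim_0|apply is_lim_seq_const|lra]. }
  destruct (seq_cauchy_rate (fun N => RInt tail_c 1 (INR N)) _ 1 (fun N M HN HM => proj1 (tail_bound N M HN HM)) LE) as [lc [Lc Bc]].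
  destruct (seq_cauchy_rate (fun N => RInt tail_s 1 (INR N)) _ 1 (fun N M HN HM => proj2 (tail_bound N M HN HM)) LE) as [ls [Ls Bs]].
  exists lc, ls; split; [|intros N HN; split; auto].
  unfold zeta_tail, s, Re, Im; simpl.
  apply is_lim_seq_unique in Lc; apply is_lim_seq_unique in Ls.
  unfold tail_c in Lc; unfold tail_s in Ls. rewrite Lc, Ls. reflexivity.
Qed.

Definition piece (n : nat) : C := (piece_c n, - piece_s n).
Definition tail_int (N : nat) : C := (RInt tail_c 1 (INR N), - RInt tail_s 1 (INR N)).

End ZetaTail.

Fixpoint dsum (N : nat) (s : C) : C :=
  match N with O => RtoC 0 | S n => (dsum n s + rpw (INR (S n)) (- s))%C end.

(** (s - 1) zeta(s) truncated with the first Euler-Maclaurin term N^(1 - s). It is an entire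
    exponential sum, and thanks to the extra term it converges for all Re s > 0. *)
Definition kN (N : nat) (s : C) : C := ((s - RtoC 1) * dsum N s + rpw (INR N) (RtoC 1 - s))%C.

(* [(s - 1) zeta s], written so that it also makes sense at [s = 1]. *)
Definition kz (s : C) : C := (s - s * (s - RtoC 1) * zeta_tail s)%C.

Lemma kz_zeta (s : C) : s <> RtoC 1 -> kz s = ((s - RtoC 1) * zeta s)%C.
Proof.
  intros H; unfold kz, zeta. field. intros E; apply H.
  replace s with (s - RtoC 1 + RtoC 1)%C by ring. rewrite E; ring.
Qed.

(** On [n, n + 1] the fractional part is x - n, and -s x^(1 - s) + n (s - 1) x^(-s) is an
    antiderivative of s (s - 1) (x - n) x^(-s - 1). The factor s (s - 1) clears all denominators, so
    s = 1 is included. *)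
Lemma piece_antideriv (sg t : R) (n : nat) : (1 <= n)%nat -> let s := (sg, t) : C in
  (s * (s - RtoC 1) * piece sg t n)%C
  = (- s * (rpw (INR (S n)) (RtoC 1 - s) - rpw (INR n) (RtoC 1 - s))
     + RtoC (INR n) * (s - RtoC 1) * (rpw (INR (S n)) (- s) - rpw (INR n) (- s)))%C.
Proof.
  intros Hn s.
  pose proof (lt_0_INR n ltac:(lia)) as P0; pose proof (le_INR n (S n) ltac:(lia)) as L.
  set (A := fun x => (- s * rpw x (RtoC 1 - s) + RtoC (INR n) * (s - RtoC 1) * rpw x (- s))%C).
  set (V := fun x => ((x - INR n) * (Rpower x (- sg - 1) * cos (t * ln x)), - ((x - INR n) * (Rpower x (- sg - 1) * sin (t * ln x)))) : C).
  assert (D : forall x, 0 < x -> cpath A x (s * (s - RtoC 1) * V x)).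
  { intros x Hx.
    assert (E : (s * (s - RtoC 1) * V x)%C =
       (- s * ((RtoC 1 - s) * rpw x (RtoC 1 - s - RtoC 1)) + RtoC (INR n) * (s - RtoC 1) * (- s * rpw x (- s - RtoC 1)))%C).
    { replace (RtoC 1 - s - RtoC 1)%C with ((- s - RtoC 1) + RtoC 1)%C by ring.
      rewrite rpw_plus, (rpw_1 x Hx).
      assert (EV : V x = (RtoC (x - INR n) * rpw x (- s - RtoC 1))%C).
      { unfold s; rewrite rpw_comp. unfold V, RtoC, Cmult; simpl; f_equal; ring. }
      rewrite EV, RtoC_minus. ring. }
    rewrite E.
    destruct (rpw_path x (RtoC 1 - s) Hx) as [A1 A2]; destruct (rpw_path x (- s) Hx) as [B1 B2].
    assert (Lin : forall a b : C, cpath (fun y => (a * rpw y (RtoC 1 - s) + b * rpw y (- s))%C) x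
        (a * ((RtoC 1 - s) * rpw x (RtoC 1 - s - RtoC 1)) + b * (- s * rpw x (- s - RtoC 1)))%C).
    { intros a b; split.
      - apply (is_derive_ext (fun y => (Re a * Re (rpw y (RtoC 1 - s)) - Im a * Im (rpw y (RtoC 1 - s))) + (Re b * Re (rpw y (- s)) - Im b * Im (rpw y (- s)))));
          [intros; rewrite Re_plus, !Re_mult; reflexivity|].
        rewrite Re_plus, (Re_mult a), (Re_mult b).
        apply @is_derive_plus; apply @is_derive_minus; apply @is_derive_scal; easy.
      - apply (is_derive_ext (fun y => (Re a * Im (rpw y (RtoC 1 - s)) + Im a * Re (rpw y (RtoC 1 - s))) + (Re b * Im (rpw y (- s)) + Im b * Re (rpw y (- s)))));
          [intros; rewrite Im_plus, !Im_mult; reflexivity|].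
        rewrite Im_plus, (Im_mult a), (Im_mult b).
        apply @is_derive_plus; apply @is_derive_plus; apply @is_derive_scal; easy. }
    apply Lin. }
  assert (CV1 : forall x, 0 < x -> continuous (fun x => Re (V x)) x).
  { intros x Hx. apply (continuousR_mult (fun x => x - INR n) (fun y => Rpower y (- sg - 1) * cos (t * ln y))); [|exact (proj1 (rpw_re_cont sg t x Hx))].
    apply continuousR_minus; [apply continuous_id|apply continuous_const]. }
  assert (CV2 : forall x, 0 < x -> continuous (fun x => Im (V x)) x).
  { intros x Hx. apply (continuous_opp (V := R_NormedModule) (fun x => (x - INR n) * (Rpower x (- sg - 1) * sin (t * ln x)))).
    apply (continuousR_mult (fun x => x - INR n) (fun y => Rpower y (- sg - 1) * sin (t * ln y))); [|exact (proj2 (rpw_re_cont sg t x Hx))].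
    apply continuousR_minus; [apply continuous_id|apply continuous_const]. }
  destruct (piece_ex sg t n Hn) as [X1 X2].
  assert (X3 : ex_RInt (fun x => Im (V x)) (INR n) (INR (S n))) by (apply (ex_RInt_opp (V := R_NormedModule)); exact X2).
  assert (EI : RInt (fun x => Im (V x)) (INR n) (INR (S n)) = - piece_s sg t n).
  { apply (RInt_opp (V := R_CompleteNormedModule)); exact X2. }
  assert (ER : RInt (fun x => Re (V x)) (INR n) (INR (S n)) = piece_c sg t n) by reflexivity.
  set (w := (s * (s - RtoC 1))%C) in *.
  replace (- s * (rpw (INR (S n)) (RtoC 1 - s) - rpw (INR n) (RtoC 1 - s))
     + RtoC (INR n) * (s - RtoC 1) * (rpw (INR (S n)) (- s) - rpw (INR n) (- s)))%C with (A (INR (S n)) - A (INR n))%C by (unfold A; ring).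
  assert (HR : Re (w * piece sg t n) = Re (A (INR (S n)) - A (INR n))).
  { rewrite Re_mult, Re_minus. change (Re (piece sg t n)) with (piece_c sg t n).
    change (Im (piece sg t n)) with (- piece_s sg t n).
    rewrite <- EI, <- ER, <- !RIntR_scal by easy. rewrite <- RIntR_minus by (apply (ex_RInt_scal (V := R_NormedModule)); easy).
    apply (is_RInt_unique (V := R_CompleteNormedModule)).
    apply (is_RInt_derive (fun x => Re (A x))); intros x Hx; rewrite Rmin_left in Hx by easy.
    - exact (proj1 (D x ltac:(lra))).
    - apply continuousR_minus; apply continuousR_mult; try apply continuous_const; [apply CV1|apply CV2]; lra. }
  assert (HI : Im (w * piece sg t n) = Im (A (INR (S n)) - A (INR n))).
  { rewrite Im_mult, Im_minus. change (Re (piece sg t n)) with (piece_c sg t n).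
    change (Im (piece sg t n)) with (- piece_s sg t n).
    rewrite <- EI, <- ER, <- !RIntR_scal by easy. rewrite <- RIntR_plus by (apply (ex_RInt_scal (V := R_NormedModule)); easy).
    apply (is_RInt_unique (V := R_CompleteNormedModule)).
    apply (is_RInt_derive (fun x => Im (A x))); intros x Hx; rewrite Rmin_left in Hx by easy.
    - exact (proj2 (D x ltac:(lra))).
    - apply continuousR_plus; apply continuousR_mult; try apply continuous_const; [apply CV2|apply CV1]; lra. }
  destruct (w * piece sg t n)%C, (A (INR (S n)) - A (INR n))%C; unfold Re, Im in HR, HI; simpl in HR, HI; congruence.
Qed.

(** Adding one cell at a time, the boundary terms of [piece_antideriv] combine into a new term of
    the Dirichlet sum and the change of N^(1 - s). *)
Lemma kN_integral (sg t : R) (N : nat) : let s := (sg, t) : C in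
  kN (S N) s = (s - s * (s - RtoC 1) * tail_int sg t (S N))%C.
Proof.
  intros s.
  assert (ET : forall N, tail_int sg t (S N) = (sum_n_m (piece_c sg t) 1 N, - sum_n_m (piece_s sg t) 1 N)).
  { intros M; destruct (tail_sum sg t M) as [A B]; unfold tail_int.
    apply (is_RInt_unique (V := R_CompleteNormedModule)) in A; apply (is_RInt_unique (V := R_CompleteNormedModule)) in B.
    rewrite A, B; reflexivity. }
  induction N as [|N IH].
  - rewrite ET, !sum_n_m_zero by lia. unfold kN, dsum. change (INR 1) with 1. rewrite !rpw_one.
    unfold zero; simpl. rewrite Ropp_0. change (0, 0) with (RtoC 0). ring.
  - rewrite ET, !sum_n_Sm by lia.
    replace (plus (sum_n_m (piece_c sg t) 1 N) (piece_c sg t (S N)), - plus (sum_n_m (piece_s sg t) 1 N) (piece_s sg t (S N)))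
      with (tail_int sg t (S N) + piece sg t (S N))%C
      by (rewrite ET; unfold Cplus, plus; simpl; f_equal; ring).
    pose proof (piece_antideriv sg t (S N) ltac:(lia)) as PA; cbv zeta in PA; fold s in PA.
    replace (s - s * (s - RtoC 1) * (tail_int sg t (S N) + piece sg t (S N)))%C
      with ((s - s * (s - RtoC 1) * tail_int sg t (S N)) - s * (s - RtoC 1) * piece sg t (S N))%C by ring.
    rewrite <- IH, PA. unfold kN.
    change (dsum (S (S N)) s) with (dsum (S N) s + rpw (INR (S (S N))) (- s))%C.
    replace (RtoC 1 - s)%C with (RtoC 1 + - s)%C by ring. rewrite !rpw_plus, !rpw_1 by (apply lt_0_INR; lia).
    rewrite (S_INR (S N)), RtoC_plus. ring.
Qed.

(** By [kN_integral] the difference is s (s - 1) times the tail of the integral beyond N; the factor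
    2 accounts for its two components. *)
Lemma kz_approx (s : C) (N : nat) : 0 < Re s -> (1 <= N)%nat ->
  Cmod (kz s - kN N s) <= Cmod s * Cmod (s - RtoC 1) * (2 * (Rpower (INR N) (- Re s) / Re s)).
Proof.
  destruct s as [sg t]; intros Hs HN; unfold Re in *; simpl in Hs |- *.
  destruct N as [|N]; [lia|]. rewrite kN_integral. unfold kz.
  destruct (tail_lim sg t Hs) as [lc [ls [E B]]].
  destruct (B (S N) HN) as [B1 B2].
  rewrite E.
  match goal with |- Cmod (?x - ?p * ?a - (?x - ?p * ?b)) <= _ =>
    replace (x - p * a - (x - p * b))%C with (- (p * (a - b)))%C by ring end.
  rewrite Cmod_opp, !Cmod_mult.
  apply Rmult_le_compat_l; [apply Rmult_le_pos; apply Cmod_ge_0|].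
  eapply Rle_trans; [apply Cmod_le_sum|].
  set (I1 := RInt (tail_c sg t) 1 (INR (S N))) in *. set (I2 := RInt (tail_s sg t) 1 (INR (S N))) in *.
  replace (Re ((lc, - ls) - tail_int sg t (S N))) with (lc - I1) by reflexivity.
  replace (Im ((lc, - ls) - tail_int sg t (S N))) with (- (ls - I2)).
  2:{ change (Im ((lc, - ls) - tail_int sg t (S N))) with (- ls - - I2). ring. }
  rewrite Rabs_Ropp; lra.
Qed.

(** * Euler product and absence of zeros on the line Re s = 1 *)

Definition clim (u : nat -> C) (l : C) : Prop :=
  forall eps, 0 < eps -> exists N0, forall N, (N0 <= N)%nat -> Cmod (u N - l) <= eps.

Lemma clim_ext (u v : nat -> C) (l : C) : (forall n, u n = v n) -> clim u l -> clim v l.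
Proof. intros E H eps He; destruct (H eps He) as [N0 H0]; exists N0; intros N HN; rewrite <- E; auto. Qed.

Lemma clim_minus (u v : nat -> C) (a b : C) : clim u a -> clim v b -> clim (fun n => u n - v n)%C (a - b)%C.
Proof.
  intros H1 H2 eps He; destruct (H1 (eps / 2)) as [N1 K1]; [lra|]; destruct (H2 (eps / 2)) as [N2 K2]; [lra|].
  exists (Nat.max N1 N2); intros N HN; specialize (K1 N ltac:(lia)); specialize (K2 N ltac:(lia)).
  replace (u N - v N - (a - b))%C with ((u N - a) + - (v N - b))%C by ring.
  eapply Rle_trans; [apply Cmod_triangle|]; rewrite Cmod_opp; lra.
Qed.

Lemma clim_scal (u : nat -> C) (a k : C) : clim u a -> clim (fun n => k * u n)%C (k * a)%C.
Proof.
  intros H eps He. pose proof (Cmod_ge_0 k).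
  destruct (H (eps / (Cmod k + 1))) as [N0 K]; [pos|].
  exists N0; intros N HN; specialize (K N HN).
  replace (k * u N - k * a)%C with (k * (u N - a))%C by ring; rewrite Cmod_mult.
  apply Rle_trans with ((Cmod k + 1) * (eps / (Cmod k + 1))); [|right; field; lra].
  apply Rmult_le_compat; [easy|apply Cmod_ge_0|lra|easy].
Qed.

Lemma clim_sub (u : nat -> C) (l : C) (f : nat -> nat) : clim u l ->
  (forall M, exists N0, forall N, (N0 <= N)%nat -> (M <= f N)%nat) -> clim (fun n => u (f n)) l.
Proof.
  intros H Hf eps He; destruct (H eps He) as [N1 K]; destruct (Hf N1) as [N0 K0].
  exists N0; intros N HN; apply K, K0, HN.
Qed.

Lemma clim_Cmod_le (u : nat -> C) (l a : C) (B : R) : clim u l ->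
  (exists N0, forall N, (N0 <= N)%nat -> Cmod (u N - a) <= B) -> Cmod (l - a) <= B.
Proof.
  intros H [N1 K]; apply le_epsilon; intros eps He; destruct (H eps He) as [N0 K0].
  specialize (K (Nat.max N0 N1) ltac:(lia)); specialize (K0 (Nat.max N0 N1) ltac:(lia)).
  replace (l - a)%C with (- (u (Nat.max N0 N1) - l) + (u (Nat.max N0 N1) - a))%C by ring.
  eapply Rle_trans; [apply Cmod_triangle|]; rewrite Cmod_opp; lra.
Qed.

Definition term (n : nat) (s : C) : C := rpw (INR n) (- s).

Lemma Cmod_term (n : nat) (s : C) : Cmod (term n s) = Rpower (INR n) (- Re s).
Proof. apply Cmod_rpw. Qed.

Lemma term_mult (p m : nat) (s : C) : (1 <= p)%nat -> (1 <= m)%nat -> term (p * m) s = (term p s * term m s)%C.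
Proof.
  intros Hp Hm; unfold term, rpw. rewrite mult_INR, ln_mult by (apply lt_0_INR; lia).
  rewrite <- cexp_plus; f_equal; rewrite RtoC_plus; ring.
Qed.

Fixpoint dsumA (A : nat -> bool) (N : nat) (s : C) : C :=
  match N with O => RtoC 0 | S n => (dsumA A n s + if A (S n) then term (S n) s else RtoC 0)%C end.

(* [sieve j n]: no divisor of n lies between 2 and j+1. *)
Fixpoint sieve (j n : nat) : bool :=
  match j with O => true | S k => sieve k n && negb (Nat.eqb (Nat.modulo n (k + 2)) 0) end.

Lemma sieve_spec (j n : nat) : sieve j n = true <-> forall d, (2 <= d <= j + 1)%nat -> ~ Nat.divide d n.
Proof.
  induction j as [|j IH]; simpl.
  - split; [intros _ d Hd; lia|easy].
  - rewrite andb_true_iff, IH, negb_true_iff, Nat.eqb_neq. split.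
    + intros [H1 H2] d Hd. destruct (Nat.eq_dec d (j + 2)) as [->|Hne]; [|apply H1; lia].
      intros D; apply H2. now apply Nat.Lcm0.mod_divide.
    + intros H; split; [intros d Hd; apply H; lia|]. intros E. apply (H (j + 2)%nat); [lia|].
      now apply Nat.Lcm0.mod_divide.
Qed.

(** If j + 2 has a smaller divisor, its multiples have been removed in an earlier round. *)
Lemma sieve_composite (j n : nat) : sieve j (j + 2) = false -> sieve (S j) n = sieve j n.
Proof.
  intros H. simpl. destruct (sieve j n) eqn:E; [simpl|easy].
  rewrite negb_true_iff, Nat.eqb_neq. intros M. apply Nat.Lcm0.mod_divide in M.
  rewrite <- not_true_iff_false in H; apply H, sieve_spec; intros d Hd D.
  apply (proj1 (sieve_spec j n) E d Hd). now apply Nat.divide_trans with (j + 2)%nat.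
Qed.

(** The hypothesis says that p = j + 2 is prime. Every d in the tested range is then coprime to p,
    and Gauss's lemma moves divisibility from p m to m. *)
Lemma sieve_prime (j m : nat) : sieve j (j + 2) = true -> sieve j ((j + 2) * m) = sieve j m.
Proof.
  intros H. apply Bool.eq_iff_eq_true. rewrite !sieve_spec. split; intros K d Hd D; apply (K d Hd).
  - now apply Nat.divide_mul_r.
  - apply Nat.gauss with (j + 2)%nat; [easy|].
    destruct (Nat.eq_dec (Nat.gcd d (j + 2)) 1) as [|Hg]; [easy|exfalso].
    pose proof (Nat.gcd_divide_l d (j + 2)) as G1; pose proof (Nat.gcd_divide_r d (j + 2)) as G2.
    assert (Nat.gcd d (j + 2) <> 0)%nat by (intros Z; apply Nat.gcd_eq_0 in Z; lia).
    apply Nat.divide_pos_le in G1; [|lia].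
    apply (proj1 (sieve_spec j (j + 2)) H (Nat.gcd d (j + 2))); [lia|easy].
Qed.

Lemma dsumA_S (A : nat -> bool) (N : nat) (s : C) :
  dsumA A (S N) s = (dsumA A N s + if A (S N) then term (S N) s else RtoC 0)%C.
Proof. reflexivity. Qed.

(** One round of the sieve of Eratosthenes: the integers removed are p m with m <= N / p and m a
    survivor of the previous rounds. *)
Lemma dsumA_step (j N : nat) (s : C) : sieve j (j + 2) = true ->
  dsumA (sieve (S j)) N s = (dsumA (sieve j) N s - term (j + 2) s * dsumA (sieve j) (N / (j + 2)) s)%C.
Proof.
  intros H; set (p := (j + 2)%nat) in *.
  induction N as [|N IH].
  - rewrite Nat.Div0.div_0_l. simpl; ring.
  - rewrite (dsumA_S (sieve (S j))), (dsumA_S (sieve j) N), IH.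
    change (sieve (S j) (S N)) with (sieve j (S N) && negb (Nat.eqb (Nat.modulo (S N) p) 0)).
    destruct (Nat.eqb (S N mod p) 0) eqn:E.
    + apply Nat.eqb_eq in E. apply Nat.Lcm0.mod_divide in E. destruct E as [m Em].
      assert (E1 : (S N / p = m)%nat) by (rewrite Em; apply Nat.div_mul; lia).
      destruct m as [|m]; [lia|].
      assert (E2 : (N / p = m)%nat).
      { symmetry; apply (Nat.div_unique N p m (p - 1)); lia. }
      rewrite E1, E2, dsumA_S, andb_false_r.
      replace (S N) with (p * S m)%nat by lia. unfold p at 3; rewrite sieve_prime by easy. fold p.
      destruct (sieve j (S m)); [rewrite term_mult by lia|]; ring.
    + apply Nat.eqb_neq in E. rewrite andb_true_r.
      assert (E2 : (S N / p = N / p)%nat).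
      { pose proof (Nat.div_mod_eq (S N) p). pose proof (Nat.mod_upper_bound (S N) p ltac:(lia)).
        apply (Nat.div_unique N p (S N / p) (S N mod p - 1)); lia. }
      rewrite E2. ring.
Qed.

Lemma dsumA_true (N : nat) (s : C) : dsumA (sieve 0) N s = dsum N s.
Proof. induction N as [|N IH]; [easy|]. rewrite dsumA_S, IH. reflexivity. Qed.

(** Zeta with the Euler factors of all primes up to j + 1 divided out. It tends to 1, so no infinite
    product has to be formed: [euler_compare] transfers inequalities between single factors to zeta
    itself. *)
Fixpoint euler (j : nat) (s : C) : C :=
  match j with
  | O => zeta s
  | S k => if sieve k (k + 2) then (euler k s * (RtoC 1 - term (k + 2) s))%C else euler k s
  end.

Lemma Re_gt_1_neq (s : C) : 1 < Re s -> (s - RtoC 1)%C <> RtoC 0.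
Proof.
  intros H E. assert (Re (s - RtoC 1) = 0) by now rewrite E. unfold RtoC, Re in *; simpl in *; lra.
Qed.

Lemma dsum_lim (s : C) : 1 < Re s -> clim (fun N => dsum N s) (zeta s).
Proof.
  intros Hs. pose proof (Re_gt_1_neq s Hs) as Hn.
  pose proof (proj1 (Cmod_gt_0 _) Hn) as P1. set (m := Cmod (s - RtoC 1)) in *.
  assert (Hs1 : s <> RtoC 1) by (intros E; apply Hn; rewrite E; ring).
  pose proof (Cmod_ge_0 s) as S0.
  set (K := Cmod s * m * (2 / Re s) + 1). assert (PK : 0 < K).
  { unfold K. assert (0 <= Cmod s * m * (2 / Re s)); [|lra].
    repeat apply Rmult_le_pos; try lra; pos. }
  intros eps He.
  assert (L := Rpower_lim_0 (Re s - 1) ltac:(lra)). apply is_lim_seq_spec in L.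
  assert (Pd : 0 < eps * m / K) by pos.
  destruct (L (mkposreal _ Pd)) as [N0 HN0].
  exists (S N0); intros N HN. destruct N as [|N]; [lia|].
  specialize (HN0 N ltac:(lia)).
  rewrite Rminus_0_r, Rabs_right in HN0 by pos.
  replace (- (Re s - 1)) with (1 - Re s) in HN0 by ring.
  pose proof (kz_approx s (S N) ltac:(lra) ltac:(lia)) as A. rewrite (kz_zeta s Hs1) in A. unfold kN in A.
  replace ((s - RtoC 1) * zeta s - ((s - RtoC 1) * dsum (S N) s + rpw (INR (S N)) (RtoC 1 - s)))%C
    with (- ((s - RtoC 1) * (dsum (S N) s - zeta s)) - rpw (INR (S N)) (RtoC 1 - s))%C in A by ring.
  assert (B : m * Cmod (dsum (S N) s - zeta s) <= K * Rpower (INR (S N)) (1 - Re s)).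
  { unfold m; rewrite <- Cmod_mult, <- Cmod_opp.
    pose proof (Cmod_rev_triangle (- ((s - RtoC 1) * (dsum (S N) s - zeta s))) (rpw (INR (S N)) (RtoC 1 - s))) as T.
    rewrite Cmod_rpw in T. replace (Re (RtoC 1 - s)) with (1 - Re s) in T by reflexivity.
    assert (C1 : Rpower (INR (S N)) (- Re s) <= Rpower (INR (S N)) (1 - Re s)).
    { apply Rle_Rpower; [|lra]. pose proof (pos_INR N); rewrite S_INR; lra. }
    assert (C2 : Cmod s * m * (2 * (Rpower (INR (S N)) (- Re s) / Re s)) <= Cmod s * m * (2 / Re s) * Rpower (INR (S N)) (1 - Re s)).
    { replace (Cmod s * m * (2 * (Rpower (INR (S N)) (- Re s) / Re s))) with (Cmod s * m * (2 / Re s) * Rpower (INR (S N)) (- Re s)) by (field; lra).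
      apply Rmult_le_compat_l; [unfold K in PK|easy].
      repeat apply Rmult_le_pos; try lra; pos. }
    fold m in A. unfold K. lra. }
  apply Rmult_le_reg_l with m; [easy|].
  eapply Rle_trans; [apply B|]. left.
  apply Rlt_le_trans with (K * (eps * m / K)); [now apply Rmult_lt_compat_l|right; field; lra].
Qed.

Lemma euler_lim (j : nat) (s : C) : 1 < Re s -> clim (fun N => dsumA (sieve j) N s) (euler j s).
Proof.
  intros Hs; induction j as [|j IH].
  - apply (clim_ext (fun N => dsum N s)); [intros; symmetry; apply dsumA_true|now apply dsum_lim].
  - simpl euler. destruct (sieve j (j + 2)) eqn:E.
    + apply (clim_ext (fun N => dsumA (sieve j) N s - term (j + 2) s * dsumA (sieve j) (N / (j + 2)) s)%C).
      { intros N; now rewrite dsumA_step. }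
      replace (euler j s * (RtoC 1 - term (j + 2) s))%C with (euler j s - term (j + 2) s * euler j s)%C by ring.
      apply clim_minus; [easy|]. apply clim_scal. apply (clim_sub _ _ (fun N => (N / (j + 2))%nat) IH).
      intros M; exists (M * (j + 2))%nat; intros N HN. apply Nat.div_le_lower_bound; lia.
    + apply (clim_ext (fun N => dsumA (sieve j) N s)); [|easy].
      intros N; induction N as [|N IHN]; [easy|]. rewrite !dsumA_S, IHN, sieve_composite by easy. reflexivity.
Qed.

Lemma Rpower_tail (a : R) (n : nat) : 1 < a -> (1 <= n)%nat ->
  Rpower (INR (S n)) (- a) <= (Rpower (INR n) (1 - a) - Rpower (INR (S n)) (1 - a)) / (a - 1).
Proof.
  intros Ha Hn. pose proof (lt_0_INR n ltac:(lia)) as P0. rewrite S_INR.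
  destruct (MVT_gen (fun x => Rpower x (1 - a)) (INR n) (INR n + 1) (fun x => (1 - a) * Rpower x (- a))) as [c [Hc E]].
  - intros x Hx; rewrite Rmin_left in Hx by lra. unfold Rpower; auto_derive; [lra|].
    replace ((1 - a) * ln x) with (ln x + - a * ln x) by ring. rewrite exp_plus, exp_ln by lra. field; lra.
  - intros x Hx; rewrite Rmin_left in Hx by lra. apply continuity_pt_filterlim.
    apply (ex_derive_continuous (fun x => Rpower x (1 - a))); unfold Rpower; auto_derive; lra.
  - rewrite Rmin_left, Rmax_right in Hc by lra.
    replace (Rpower (INR n) (1 - a) - Rpower (INR n + 1) (1 - a)) with ((a - 1) * Rpower c (- a)) by lra.
    replace ((a - 1) * Rpower c (- a) / (a - 1)) with (Rpower c (- a)) by (field; lra).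
    rewrite !Rpower_Ropp. apply Rinv_le_contravar; [apply exp_pos|]. apply Rle_Rpower_l; lra.
Qed.

(** After j rounds only 1 and integers beyond j + 1 survive; the latter are bounded by the tail of
    the series, compared with an integral through [Rpower_tail]. *)
Lemma euler_near_1 (j : nat) (s : C) : 1 < Re s ->
  Cmod (euler j s - RtoC 1) <= Rpower (INR (S j)) (1 - Re s) / (Re s - 1).
Proof.
  intros Hs. apply (clim_Cmod_le _ _ _ _ (euler_lim j s Hs)).
  assert (PR : forall n, 0 < Rpower (INR n) (1 - Re s) / (Re s - 1)) by (intros; apply Rdiv_lt_0_compat; [apply exp_pos|lra]).
  exists 1%nat; intros N HN.
  assert (T1 : term 1 s = RtoC 1) by (unfold term; apply rpw_one).
  assert (S1 : sieve j 1 = true).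
  { apply sieve_spec; intros d Hd D. apply Nat.divide_pos_le in D; lia. }
  assert (SF : forall n, (2 <= n <= j + 1)%nat -> sieve j n = false).
  { intros n Hn. apply not_true_iff_false; intros E. apply (proj1 (sieve_spec j n) E n Hn), Nat.divide_refl. }
  assert (A : forall N, (1 <= N <= j + 1)%nat -> dsumA (sieve j) N s = RtoC 1).
  { intros M HM. induction M as [|M IH]; [lia|]. destruct M as [|M].
    - rewrite dsumA_S, S1, T1. simpl; ring.
    - rewrite dsumA_S, IH, SF by lia. ring. }
  assert (B : forall M, Cmod (dsumA (sieve j) (S j + M) s - RtoC 1) <=
     Rpower (INR (S j)) (1 - Re s) / (Re s - 1) - Rpower (INR (S j + M)) (1 - Re s) / (Re s - 1)).
  { intros M. induction M as [|M IH].
    - rewrite Nat.add_0_r, A by lia. replace (RtoC 1 - RtoC 1)%C with (RtoC 0) by ring. rewrite Cmod_0. lra.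
    - rewrite Nat.add_succ_r.
      rewrite dsumA_S.
      replace (dsumA (sieve j) (S j + M) s + (if sieve j (S (S j + M)) then term (S (S j + M)) s else RtoC 0) - RtoC 1)%C
        with ((dsumA (sieve j) (S j + M) s - RtoC 1) + (if sieve j (S (S j + M)) then term (S (S j + M)) s else RtoC 0))%C by ring.
      eapply Rle_trans; [apply Cmod_triangle|].
      assert (Q : Cmod (if sieve j (S (S j + M)) then term (S (S j + M)) s else RtoC 0) <= Rpower (INR (S (S j + M))) (- Re s)).
      { destruct (sieve j (S (S j + M))); [rewrite Cmod_term; lra|rewrite Cmod_0; left; apply exp_pos]. }
      pose proof (Rpower_tail (Re s) (S j + M) Hs ltac:(lia)) as T.
      replace ((Rpower (INR (S j + M)) (1 - Re s) - Rpower (INR (S (S j + M))) (1 - Re s)) / (Re s - 1))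
        with (Rpower (INR (S j + M)) (1 - Re s) / (Re s - 1) - Rpower (INR (S (S j + M))) (1 - Re s) / (Re s - 1)) in T by (field; lra).
      lra. }
  destruct (Nat.le_gt_cases (S j) N) as [H|H].
  - specialize (B (N - S j)%nat). replace (S j + (N - S j))%nat with N in B by lia. pose proof (PR N); lra.
  - rewrite A by lia. replace (RtoC 1 - RtoC 1)%C with (RtoC 0) by ring. rewrite Cmod_0. pose proof (PR (S j)); lra.
Qed.

Lemma euler_Cmod_lim (s : C) : 1 < Re s -> is_lim_seq (fun j => Cmod (euler j s)) 1.
Proof.
  intros Hs. apply is_lim_seq_spec; intros eps.
  assert (L := Rpower_lim_0 (Re s - 1) ltac:(lra)). apply is_lim_seq_spec in L.
  assert (Pd : 0 < eps * (Re s - 1)) by (apply Rmult_lt_0_compat; [apply cond_pos|lra]).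
  destruct (L (mkposreal _ Pd)) as [N0 HN0]. exists N0; intros n Hn. specialize (HN0 n Hn). cbn [pos] in HN0.
  rewrite Rminus_0_r, Rabs_right in HN0 by pos.
  replace (- (Re s - 1)) with (1 - Re s) in HN0 by ring.
  pose proof (euler_near_1 n s Hs) as E.
  assert (Rpower (INR (S n)) (1 - Re s) / (Re s - 1) < eps).
  { apply Rmult_lt_reg_r with (Re s - 1); [lra|]. replace (Rpower (INR (S n)) (1 - Re s) / (Re s - 1) * (Re s - 1)) with (Rpower (INR (S n)) (1 - Re s)) by (field; lra). easy. }
  pose proof (Cmod_rev_triangle (euler n s) (RtoC 1)) as T1. pose proof (Cmod_rev_triangle (RtoC 1) (euler n s)) as T2.
  rewrite Cmod_sub_sym in T2. rewrite Cmod_1 in T1, T2. apply Rabs_def1; lra.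
Qed.

(* Partial Euler products are compared factor by factor; both sides tend to 1. *)
Lemma euler_compare (x y : nat -> R) : is_lim_seq x 1 -> is_lim_seq y 1 ->
  (forall j, 0 <= x j) -> (forall j, 0 <= y j) ->
  (forall j, exists f g, 0 <= g <= f /\ x (S j) = x j * f /\ y (S j) = y j * g) -> x O <= y O.
Proof.
  intros Lx Ly Px Py H.
  assert (K : forall j, x O * y j <= y O * x j).
  { induction j as [|j IH]; [lra|]. destruct (H j) as [f [g [[G F] [-> ->]]]].
    apply Rle_trans with (y O * x j * g); [rewrite <- Rmult_assoc; now apply Rmult_le_compat_r|].
    rewrite <- Rmult_assoc. apply Rmult_le_compat_l; [apply Rmult_le_pos; auto|easy]. }
  pose proof (is_lim_seq_le _ _ (Finite (x O * 1)) (Finite (y O * 1)) K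
    (is_lim_seq_scal_l y (x O) 1 Ly) (is_lim_seq_scal_l x (y O) 1 Lx)) as Q.
  simpl in Q; lra.
Qed.

Lemma euler_S (j : nat) (s : C) : euler (S j) s = (euler j s * (if sieve j (j + 2) then RtoC 1 - term (j + 2) s else RtoC 1))%C.
Proof. simpl; destruct (sieve j (j + 2)); ring. Qed.

Lemma Cmod_one_minus (a th : R) : Cmod (RtoC 1 - RtoC a * cis th) ^ 2 = 1 - 2 * a * cos th + a ^ 2.
Proof.
  rewrite Cmod_sq. unfold cis, RtoC, Re, Im; simpl.
  pose proof (sin2_cos2 th) as H; unfold Rsqr in H. nra.
Qed.

Lemma term_polar (n : nat) (sg t : R) : term n (sg, t) = (RtoC (Rpower (INR n) (- sg)) * cis (- t * ln (INR n)))%C.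
Proof.
  unfold term, rpw, cexp, Rpower, cis, RtoC, Cmult, Re, Im; simpl. f_equal.
  - replace (- sg * ln (INR n) - - t * 0) with (- sg * ln (INR n)) by ring.
    replace (- sg * 0 + - t * ln (INR n)) with (- t * ln (INR n)) by ring. ring.
  - replace (- sg * ln (INR n) - - t * 0) with (- sg * ln (INR n)) by ring.
    replace (- sg * 0 + - t * ln (INR n)) with (- t * ln (INR n)) by ring. ring.
Qed.

Lemma term_lt_half (n : nat) (sg : R) : 1 < sg -> (2 <= n)%nat -> 0 < Rpower (INR n) (- sg) <= 1 / 2.
Proof.
  intros H Hn; split; [apply exp_pos|]. apply le_INR in Hn. change (INR 2) with 2 in Hn.
  rewrite Rpower_Ropp. replace (1 / 2) with (/ 2) by field. apply Rinv_le_contravar; [lra|].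
  apply Rle_trans with (Rpower (INR n) 1); [rewrite Rpower_1; lra|]. apply Rle_Rpower; lra.
Qed.

Lemma Cmod_one_minus_term (n : nat) (sg t : R) :
  Cmod (RtoC 1 - term n (sg, t)) ^ 2 = 1 - 2 * Rpower (INR n) (- sg) * cos (t * ln (INR n)) + Rpower (INR n) (- sg) ^ 2.
Proof.
  rewrite term_polar, Cmod_one_minus. replace (- t * ln (INR n)) with (- (t * ln (INR n))) by ring. now rewrite cos_neg.
Qed.

Lemma sq_le (a b : R) : 0 <= b -> a ^ 2 <= b ^ 2 -> a <= b.
Proof. intros; nra. Qed.

(** Integrated form of the bound |Re zeta'/zeta(s + it)| <= -zeta'/zeta(s) over s1 <= s <= s2,
    checked one Euler factor at a time instead of through derivatives. After squaring, the first
    factor inequality is linear in cos(t log p), with equality when the cosine is 1. *)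
Lemma zeta_ratio (s1 s2 t : R) : 1 < s1 -> s1 <= s2 ->
  Cmod (zeta (s1, t)) * Cmod (zeta (s2, 0)) <= Cmod (zeta (s2, t)) * Cmod (zeta (s1, 0)) /\
  Cmod (zeta (s2, t)) * Cmod (zeta (s2, 0)) <= Cmod (zeta (s1, t)) * Cmod (zeta (s1, 0)).
Proof.
  intros H1 H2.
  assert (L : forall s t, 1 < s -> is_lim_seq (fun j => Cmod (euler j (s, t))) 1) by (intros; now apply euler_Cmod_lim).
  assert (LL : forall s t s' t', 1 < s -> 1 < s' -> is_lim_seq (fun j => Cmod (euler j (s, t)) * Cmod (euler j (s', t'))) 1).
  { intros s t' s' t'' A B. replace (Finite 1) with (Finite (1 * 1)) by (f_equal; ring). apply is_lim_seq_mult'; now apply L. }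
  split.
  - apply (euler_compare (fun j => Cmod (euler j (s1, t)) * Cmod (euler j (s2, 0))) (fun j => Cmod (euler j (s2, t)) * Cmod (euler j (s1, 0))));
      try (apply LL; lra); try (intros; apply Rmult_le_pos; apply Cmod_ge_0).
    intros j. rewrite !euler_S, !Cmod_mult. destruct (sieve j (j + 2)).
    2:{ exists 1, 1. rewrite !Cmod_1; repeat split; lra. }
    set (n := (j + 2)%nat).
    exists (Cmod (RtoC 1 - term n (s1, t)) * Cmod (RtoC 1 - term n (s2, 0))), (Cmod (RtoC 1 - term n (s2, t)) * Cmod (RtoC 1 - term n (s1, 0))).
    repeat split; try ring; [apply Rmult_le_pos; apply Cmod_ge_0|].
    apply sq_le; [apply Rmult_le_pos; apply Cmod_ge_0|].
    rewrite !Rpow_mult_distr, !Cmod_one_minus_term, !Rmult_0_l, !cos_0.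
    pose proof (term_lt_half n s1 H1 ltac:(unfold n; lia)) as A.
    assert (AB : Rpower (INR n) (- s2) <= Rpower (INR n) (- s1)).
    { apply Rle_Rpower; [|lra]. change 1 with (INR 1); apply le_INR; unfold n; lia. }
    pose proof (COS_bound (t * ln (INR n))) as CB.
    set (a := Rpower (INR n) (- s1)) in *; set (b := Rpower (INR n) (- s2)) in *; set (c := cos _) in *.
    assert (0 <= 2 * (1 - c) * (a * (1 - b) ^ 2 - b * (1 - a) ^ 2)).
    { apply Rmult_le_pos; [lra|]. assert ((1 - a) ^ 2 <= (1 - b) ^ 2) by nra. assert (0 <= (1 - a) ^ 2) by nra. nra. }
    nra.
  - apply (euler_compare (fun j => Cmod (euler j (s2, t)) * Cmod (euler j (s2, 0))) (fun j => Cmod (euler j (s1, t)) * Cmod (euler j (s1, 0))));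
      try (apply LL; lra); try (intros; apply Rmult_le_pos; apply Cmod_ge_0).
    intros j. rewrite !euler_S, !Cmod_mult. destruct (sieve j (j + 2)).
    2:{ exists 1, 1. rewrite !Cmod_1; repeat split; lra. }
    set (n := (j + 2)%nat).
    exists (Cmod (RtoC 1 - term n (s2, t)) * Cmod (RtoC 1 - term n (s2, 0))), (Cmod (RtoC 1 - term n (s1, t)) * Cmod (RtoC 1 - term n (s1, 0))).
    repeat split; try ring; [apply Rmult_le_pos; apply Cmod_ge_0|].
    apply sq_le; [apply Rmult_le_pos; apply Cmod_ge_0|].
    rewrite !Rpow_mult_distr, !Cmod_one_minus_term, !Rmult_0_l, !cos_0.
    pose proof (term_lt_half n s1 H1 ltac:(unfold n; lia)) as A. pose proof (term_lt_half n s2 ltac:(lra) ltac:(unfold n; lia)) as B.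
    assert (AB : Rpower (INR n) (- s2) <= Rpower (INR n) (- s1)).
    { apply Rle_Rpower; [|lra]. change 1 with (INR 1); apply le_INR; unfold n; lia. }
    pose proof (COS_bound (t * ln (INR n))) as CB.
    set (a := Rpower (INR n) (- s1)) in *; set (b := Rpower (INR n) (- s2)) in *; set (c := cos _) in *.
    (* linear in c, so it is enough to look at c = 1 and c = -1 *)
    assert (E1 : (1 - a) ^ 4 <= (1 - b) ^ 4) by (apply pow_incr; lra).
    assert (E2 : (1 - a ^ 2) ^ 2 <= (1 - b ^ 2) ^ 2) by (apply pow_incr; nra).
    assert (F : forall y, (1 - 2 * y * c + y ^ 2) * (1 - 2 * y * 1 + y ^ 2) = (1 + c) / 2 * (1 - y) ^ 4 + (1 - c) / 2 * (1 - y ^ 2) ^ 2) by (intros; field).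
    rewrite !F. apply Rplus_le_compat; apply Rmult_le_compat_l; lra.
Qed.

Lemma zeta_lower (s t : R) : 1 < s -> 1 <= Cmod (zeta (s, t)) * Cmod (zeta (s, 0)).
Proof.
  intros H1.
  apply (euler_compare (fun _ => 1) (fun j => Cmod (euler j (s, t)) * Cmod (euler j (s, 0)))).
  - apply is_lim_seq_const.
  - replace (Finite 1) with (Finite (1 * 1)) by (f_equal; ring). apply is_lim_seq_mult'; now apply euler_Cmod_lim.
  - intros; lra.
  - intros; apply Rmult_le_pos; apply Cmod_ge_0.
  - intros j. rewrite !euler_S, !Cmod_mult. destruct (sieve j (j + 2)).
    2:{ exists 1, 1. rewrite !Cmod_1; repeat split; lra. }
    set (n := (j + 2)%nat).
    exists 1, (Cmod (RtoC 1 - term n (s, t)) * Cmod (RtoC 1 - term n (s, 0))).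
    repeat split; try ring; [apply Rmult_le_pos; apply Cmod_ge_0|].
    apply sq_le; [lra|].
    rewrite !Rpow_mult_distr, !Cmod_one_minus_term, !Rmult_0_l, !cos_0.
    pose proof (term_lt_half n s H1 ltac:(unfold n; lia)) as A. pose proof (COS_bound (t * ln (INR n))) as CB.
    set (a := Rpower (INR n) (- s)) in *; set (c := cos _) in *.
    assert ((1 - a) ^ 4 <= 1 ^ 4) by (apply pow_incr; lra).
    assert ((1 - a ^ 2) ^ 2 <= 1 ^ 2) by (apply pow_incr; nra).
    replace ((1 - 2 * a * c + a ^ 2) * (1 - 2 * a * 1 + a ^ 2)) with ((1 + c) / 2 * (1 - a) ^ 4 + (1 - c) / 2 * (1 - a ^ 2) ^ 2) by field.
    nra.
Qed.

(** * Growth, uniform approximation and lower bounds of (s - 1) zeta(s) *)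

(** The case N = 1 of [kz_approx], in which [kN] is the identity. *)
Lemma kz_growth (s : C) : 0 < Re s -> Cmod (kz s) <= Cmod s + Cmod s * Cmod (s - RtoC 1) * (2 / Re s).
Proof.
  intros Hs. pose proof (kz_approx s 1 Hs ltac:(lia)) as A.
  assert (E : kN 1 s = s).
  { unfold kN, dsum. rewrite !rpw_one. ring. }
  rewrite E in A. change (INR 1) with 1 in A.
  assert (P : Rpower 1 (- Re s) = 1) by (unfold Rpower; rewrite ln_1, Rmult_0_r; apply exp_0).
  rewrite P in A. replace (2 * (1 / Re s)) with (2 / Re s) in A by (field; lra).
  pose proof (Cmod_rev_triangle (kz s) s); lra.
Qed.

Fixpoint dsum_e (N : nat) : hexp :=
  match N with O => HConst (RtoC 0) | S n => HAdd (dsum_e n) (HExp (- ln (INR (S n)))) end.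
Definition kN_e (N : nat) : hexp :=
  HAdd (HMul (HAdd HVar (HConst (RtoC (-1)))) (dsum_e N)) (HMul (HConst (RtoC (INR N))) (HExp (- ln (INR N)))).

Lemma dsum_e_eval (N : nat) (s : C) : heval (dsum_e N) s = dsum N s /\ hwf (dsum_e N) s.
Proof.
  induction N as [|N [E W]]; [easy|]; split; [|now split].
  change (heval (dsum_e N) s + cexp (RtoC (- ln (INR (S N))) * s) = dsum N s + rpw (INR (S N)) (- s))%C.
  rewrite E; f_equal. unfold rpw; f_equal. rewrite RtoC_opp; ring.
Qed.

Lemma kN_e_eval (N : nat) (s : C) : (1 <= N)%nat -> heval (kN_e N) s = kN N s /\ hwf (kN_e N) s.
Proof.
  intros HN; destruct (dsum_e_eval N s) as [E W]; split; [|now repeat split].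
  unfold kN_e; simpl heval. rewrite E. unfold kN. f_equal.
  - f_equal. replace (RtoC (-1)) with (- RtoC 1)%C by (unfold RtoC, Copp; simpl; f_equal; ring). ring.
  - replace (RtoC 1 - s)%C with (RtoC 1 + - s)%C by ring. rewrite rpw_plus, rpw_1 by (apply lt_0_INR; lia).
    f_equal. unfold rpw; f_equal. rewrite RtoC_opp; ring.
Qed.

(** The bridge between zeta and [hexp]: statements proved for quotients of [kN] pass to [kz] on
    bounded sets away from the imaginary axis. *)
Lemma kz_unif (s0 B eps : R) : 0 < s0 -> 0 < eps -> exists N0, (1 <= N0)%nat /\ forall N s, (N0 <= N)%nat ->
  s0 <= Re s -> Cmod s <= B -> Cmod (kz s - kN N s) <= eps.
Proof.
  intros H0 He. set (K := Rabs B * (Rabs B + 1) * (2 / s0) + 1).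
  assert (PK : 0 < K).
  { unfold K; pose proof (Rabs_pos B). assert (0 <= Rabs B * (Rabs B + 1) * (2 / s0)); [|lra].
    repeat apply Rmult_le_pos; try lra; pos. }
  assert (L := Rpower_lim_0 s0 H0). apply is_lim_seq_spec in L.
  assert (Pd : 0 < eps / K) by now apply Rdiv_lt_0_compat.
  destruct (L (mkposreal _ Pd)) as [N0 HN0]. exists (S N0); split; [lia|].
  intros N s HN Hs HB. destruct N as [|N]; [lia|]. specialize (HN0 N ltac:(lia)). cbn [pos] in HN0.
  rewrite Rminus_0_r, Rabs_right in HN0 by pos.
  eapply Rle_trans; [apply kz_approx; [lra|lia]|].
  pose proof (Cmod_ge_0 s) as S0. pose proof (Cmod_ge_0 (s - RtoC 1)) as S1. pose proof (Rle_abs B) as AB.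
  assert (S2 : Cmod (s - RtoC 1) <= Rabs B + 1).
  { pose proof (Cmod_triangle s (- RtoC 1)) as T. rewrite Cmod_opp, Cmod_1 in T.
    replace (s + - RtoC 1)%C with (s - RtoC 1)%C in T by ring. lra. }
  assert (R1 : Rpower (INR (S N)) (- Re s) / Re s <= Rpower (INR (S N)) (- s0) / s0).
  { apply Rmult_le_compat; [pos|pos| |apply Rinv_le_contravar; lra].
    apply Rle_Rpower; [|lra]. pose proof (pos_INR N); rewrite S_INR; lra. }
  apply Rle_trans with (Rabs B * (Rabs B + 1) * (2 * (Rpower (INR (S N)) (- s0) / s0))).
  - apply Rmult_le_compat.
    + now apply Rmult_le_pos.
    + apply Rmult_le_pos; [lra|]. left; apply Rdiv_lt_0_compat; [apply exp_pos|lra].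
    + apply Rmult_le_compat; lra.
    + lra.
  - apply Rle_trans with (K * Rpower (INR (S N)) (- s0)).
    + replace (Rabs B * (Rabs B + 1) * (2 * (Rpower (INR (S N)) (- s0) / s0))) with ((K - 1) * Rpower (INR (S N)) (- s0)) by (unfold K; field; lra).
      apply Rmult_le_compat_r; [pos|lra].
    + left; apply Rlt_le_trans with (K * (eps / K)); [now apply Rmult_lt_compat_l|right; field; lra].
Qed.

Lemma kz_ccont (z : C) : 0 < Re z -> ccont kz z.
Proof.
  intros Hz eps He.
  destruct (kz_unif (Re z / 2) (Cmod z + Re z / 2) (eps / 3)) as [N [HN HU]]; [lra|lra|].
  destruct (kN_e_eval N z HN) as [_ W].
  destruct (heval_ccont _ _ W (eps / 3)) as [d [Pd Hd]]; [lra|].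
  exists (Rmin d (Re z / 2)); split; [apply Rmin_pos; lra|]; intros w Hw.
  pose proof (Rlt_le_trans _ _ _ Hw (Rmin_l _ _)) as W1. pose proof (Rlt_le_trans _ _ _ Hw (Rmin_r _ _)) as W2.
  specialize (Hd w W1). rewrite (proj1 (kN_e_eval N w HN)), (proj1 (kN_e_eval N z HN)) in Hd.
  pose proof (re_le_Cmod (w - z)) as R1. rewrite Re_minus in R1. apply Rabs_le_between in R1.
  pose proof (Cmod_rev_triangle w z) as R2.
  pose proof (HU N w ltac:(lia) ltac:(lra) ltac:(lra)) as A1. pose proof (HU N z ltac:(lia) ltac:(lra) ltac:(lra)) as A2.
  replace (kz w - kz z)%C with ((kz w - kN N w) + (kN N w - kN N z) + - (kz z - kN N z))%C by ring.
  eapply Rle_trans; [apply Cmod_triangle|]. rewrite Cmod_opp.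
  eapply Rle_trans; [apply Rplus_le_compat_r, Cmod_triangle|]. lra.
Qed.

Lemma kz_lower_rect (a b c d : R) : 0 < a -> a <= b -> c <= d ->
  (forall z, in_rect a b c d z -> kz z <> RtoC 0) ->
  exists m, 0 < m /\ forall z, in_rect a b c d z -> m <= Cmod (kz z).
Proof.
  intros Ha Hab Hcd Hnz.
  destruct (attains_max_2d (fun x y => - (Re (kz (x, y)) * Re (kz (x, y)) + Im (kz (x, y)) * Im (kz (x, y)))) a b c d Hab Hcd) as [x0 [y0 [Hx [Hy H]]]].
  { intros x y Hx Hy. destruct (Re_2d kz (fun x y => (x, y)) x y) as [A1 A2].
    - apply kz_ccont; unfold Re; simpl; lra.
    - apply continuity_2d_pt_id1.
    - apply continuity_2d_pt_id2.
    - apply continuity_2d_pt_opp, continuity_2d_pt_plus; now apply continuity_2d_pt_mult. }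
  exists (Cmod (kz (x0, y0))); split; [apply Cmod_gt_0, Hnz; split; easy|].
  intros [x y] [Hx' Hy']. specialize (H x y Hx' Hy').
  apply sq_le; [apply Cmod_ge_0|]. rewrite !Cmod_sq. nra.
Qed.

Lemma rate_0 (x y : R) (e : nat -> R) : is_lim_seq e 0 -> (forall N, (1 <= N)%nat -> Rabs (x - y) <= e N) -> x = y.
Proof.
  intros He H. apply Rminus_diag_uniq.
  destruct (Req_dec (x - y) 0) as [|Hn]; [easy|]. apply Rabs_pos_lt in Hn.
  apply is_lim_seq_spec in He. destruct (He (mkposreal _ Hn)) as [N0 HN].
  specialize (HN (S N0) ltac:(lia)). specialize (H (S N0) ltac:(lia)). cbn [pos] in HN.
  rewrite Rminus_0_r in HN. pose proof (Rle_abs (e (S N0))); lra.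
Qed.

Lemma rate_lim (sg k : R) : 0 < sg -> is_lim_seq (fun N => k * (Rpower (INR N) (- sg) / sg)) 0.
Proof.
  intros H. replace (Finite 0) with (Finite (k * (0 / sg))) by (f_equal; field; lra).
  apply (is_lim_seq_scal_l _ k (Finite (0 / sg))), is_lim_seq_div'; [|apply is_lim_seq_const|lra].
  apply is_lim_seq_incr_1; now apply Rpower_lim_0.
Qed.

Lemma tail_ex (sg t : R) (N : nat) : (1 <= N)%nat -> ex_RInt (tail_c sg t) 1 (INR N) /\ ex_RInt (tail_s sg t) 1 (INR N).
Proof. intros HN; destruct N as [|N]; [lia|]. destruct (tail_sum sg t N) as [A B]; split; eexists; eassumption. Qed.

Lemma kz_conj (s : C) : 0 < Re s -> kz (Cconj s) = Cconj (kz s).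
Proof.
  destruct s as [a b]; intros Ha; unfold Re in Ha; simpl in Ha.
  assert (E : zeta_tail (Cconj (a, b)) = Cconj (zeta_tail (a, b))).
  { destruct (tail_lim a b Ha) as [lc [ls [E1 B1]]]. destruct (tail_lim a (- b) Ha) as [lc' [ls' [E2 B2]]].
    change (Cconj (a, b)) with (a, - b). rewrite E1, E2. unfold Cconj; simpl.
    f_equal.
    - apply (rate_0 _ _ _ (rate_lim a 2 Ha)); intros N HN. specialize (B1 N HN); specialize (B2 N HN).
      replace (RInt (tail_c a (- b)) 1 (INR N)) with (RInt (tail_c a b) 1 (INR N)) in B2.
      + replace (lc' - lc) with ((lc' - RInt (tail_c a b) 1 (INR N)) + - (lc - RInt (tail_c a b) 1 (INR N))) by ring.
        eapply Rle_trans; [apply Rabs_triang|]; rewrite Rabs_Ropp; lra.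
      + apply RInt_ext; intros x _; unfold tail_c. rewrite <- (Ropp_mult_distr_l b), cos_neg; reflexivity.
    - apply (rate_0 _ _ _ (rate_lim a 2 Ha)); intros N HN. specialize (B1 N HN); specialize (B2 N HN).
      replace (RInt (tail_s a (- b)) 1 (INR N)) with (- RInt (tail_s a b) 1 (INR N)) in B2.
      + replace (- ls' - - - ls) with (- (ls' - - RInt (tail_s a b) 1 (INR N)) + - (ls - RInt (tail_s a b) 1 (INR N))) by ring.
        eapply Rle_trans; [apply Rabs_triang|]; rewrite !Rabs_Ropp; lra.
      + transitivity (-1 * RInt (tail_s a b) 1 (INR N)); [ring|].
        rewrite <- RIntR_scal by now apply tail_ex.
        apply RInt_ext; intros x _; unfold tail_s. rewrite <- (Ropp_mult_distr_l b), sin_neg; rring. }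
  unfold kz; rewrite E. generalize (zeta_tail (a, b)); intros [u v].
  unfold Cconj, Cmult, Cminus, Cplus, Copp, RtoC; simpl; f_equal; ring.
Qed.

(** The squared Euler factor of the 3-4-1 inequality, with a = p^(-s) and e = 1 + cos(t log p). In
    terms of X = (1 - a)^2 y and D = 1 - X the claim is X^3 y z <= 1; it follows from y z <= 1 + 3D
    + 6D^2, whose right side is the beginning of the series of (1 - D)^(-3). No logarithms occur. *)
Lemma mertens_factor (a e : R) : 0 <= a <= 1 / 2 -> 0 <= e <= 2 ->
  (1 - a) ^ 6 * ((1 + a) ^ 2 - 2 * a * e) ^ 4 * ((1 - a) ^ 2 + 8 * a * e - 4 * a * e ^ 2) <= 1.
Proof.
  intros Ha He.
  set (y := (1 + a) ^ 2 - 2 * a * e). set (z := (1 - a) ^ 2 + 8 * a * e - 4 * a * e ^ 2).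
  set (X := (1 - a) ^ 2 * y).
  assert (Y0 : 0 <= y) by (unfold y; nra).
  assert (X0 : 0 <= X) by (unfold X; apply Rmult_le_pos; [nra|easy]).
  set (D := 1 - X).
  set (m := a ^ 2 * (2 - a ^ 2)). set (n := 2 * a * e * (1 - a) ^ 2).
  assert (ED : D = m + n) by (unfold D, X, y, m, n; ring).
  assert (M0 : 0 <= m) by (unfold m; apply Rmult_le_pos; [apply pow2_ge_0|nra]). assert (N0 : 0 <= n) by (unfold n; apply Rmult_le_pos; [nra|apply pow2_ge_0]).
  assert (D1 : 0 <= D <= 1) by (split; [lra|unfold D; lra]).
  (* (1 - D)^3 (1 + 3D + 6D^2) <= 1 for 0 <= D <= 1 *)
  assert (K : X ^ 3 * (1 + 3 * D + 6 * D ^ 2) <= 1).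
  { replace X with (1 - D) by (unfold D; ring).
    assert (0 <= D ^ 3 * (10 - 15 * D + 6 * D ^ 2)); [|nra].
    apply Rmult_le_pos; [apply pow_le; lra|nra]. }
  assert (Q : y * z <= 1 + 3 * D + 6 * D ^ 2).
  { assert (W : 8 / 5 - 12 / 5 * a <= (2 - a ^ 2) * (1 - a) ^ 2).
    { assert (T1 : 0 <= (a - 2 / 5) ^ 2 * (a + 4 / 5)) by pos. nra. }
    set (w := (2 - a ^ 2) * (1 - a) ^ 2) in *.
    assert (V : 49 / 16 <= (2 - a ^ 2) ^ 2) by (assert (7 / 4 <= 2 - a ^ 2) by nra; nra).
    (* With (2 - a^2)^2 and [w] replaced by their lower bounds 49/16 and 8/5 - 12a/5, what remains
       is a quadratic in e; completing the square reduces it to the discriminant inequality [BC]. *)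
    assert (F : 0 <= 2 * a - a ^ 3 + e ^ 2 * (1 + a) ^ 2 - 8 * a * e + 3 / 2 * (49 / 16 * a ^ 3 + 4 * a ^ 2 * e * (8 / 5 - 12 / 5 * a))).
    { set (b := 4 * a - 24 / 5 * a ^ 2 + 36 / 5 * a ^ 3). set (c := 2 * a + 115 / 32 * a ^ 3).
      replace (2 * a - a ^ 3 + e ^ 2 * (1 + a) ^ 2 - 8 * a * e + 3 / 2 * (49 / 16 * a ^ 3 + 4 * a ^ 2 * e * (8 / 5 - 12 / 5 * a)))
        with ((1 + a) ^ 2 * e ^ 2 - 2 * b * e + c) by (unfold b, c; field).
      assert (BC : b ^ 2 <= (1 + a) ^ 2 * c).
      { unfold b, c.
        assert (T : a * (4 - 24 / 5 * a + 36 / 5 * a ^ 2) ^ 2 <= (1 + a) ^ 2 * (2 + 115 / 32 * a ^ 2)).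
        { assert (U : (4 - 24 / 5 * a + 36 / 5 * a ^ 2) ^ 2 <= 16 - 22 * a + 28 * a ^ 2).
          {
            assert (T2 : 0 <= a * (82 / 5 - 1316 / 25 * a + 1728 / 25 * a ^ 2 - 1296 / 25 * a ^ 3)) by (apply Rmult_le_pos; [lra|nra]).
            lra. }
          apply Rle_trans with (a * (16 - 22 * a + 28 * a ^ 2)); [apply Rmult_le_compat_l; lra|].
          assert (T1 : 0 <= (1 / 2 - a) * (a - 7 / 20) ^ 2) by pos. nra. }
        replace ((4 * a - 24 / 5 * a ^ 2 + 36 / 5 * a ^ 3) ^ 2) with (a * (a * (4 - 24 / 5 * a + 36 / 5 * a ^ 2) ^ 2)) by ring.
        replace ((1 + a) ^ 2 * (2 * a + 115 / 32 * a ^ 3)) with (a * ((1 + a) ^ 2 * (2 + 115 / 32 * a ^ 2))) by ring.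
        apply Rmult_le_compat_l; lra. }
      assert (P : 0 < (1 + a) ^ 2) by nra.
      apply Rmult_le_reg_l with ((1 + a) ^ 2); [easy|].
      replace ((1 + a) ^ 2 * ((1 + a) ^ 2 * e ^ 2 - 2 * b * e + c)) with (((1 + a) ^ 2 * e - b) ^ 2 + ((1 + a) ^ 2 * c - b ^ 2)) by ring.
      pose proof (pow2_ge_0 ((1 + a) ^ 2 * e - b)); lra. }
    assert (S1 : a ^ 3 * (49 / 16) <= a ^ 3 * (2 - a ^ 2) ^ 2) by (apply Rmult_le_compat_l; [apply pow_le; lra|easy]).
    assert (S2 : a ^ 2 * e * (8 / 5 - 12 / 5 * a) <= a ^ 2 * e * w) by (apply Rmult_le_compat_l; [nra|easy]).
    assert (D2 : m ^ 2 + 2 * m * n <= D ^ 2) by (rewrite ED; nra).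
    assert (E3 : 0 <= a * e ^ 2 * (2 - e)) by (apply Rmult_le_pos; nra).
    assert (G : 1 + 3 * D - y * z = 4 * a * (2 * a - a ^ 3 - 8 * a * e + e ^ 2 * (1 + 6 * a + a ^ 2) - 2 * a * e ^ 3)).
    { unfold D, X, y, z; ring. }
    assert (H2 : 6 * (m ^ 2 + 2 * m * n) = 4 * a * (3 / 2 * (a ^ 3 * (2 - a ^ 2) ^ 2 + 4 * (a ^ 2 * e * w)))) by (unfold m, n, w; field).
    assert (H3 : 0 <= 4 * a * (2 * a - a ^ 3 + e ^ 2 * (1 + a) ^ 2 - 8 * a * e + 3 / 2 * (a ^ 3 * (2 - a ^ 2) ^ 2 + 4 * (a ^ 2 * e * w)))) by pos.
    assert (H4 : 0 <= 8 * a * (a * e ^ 2 * (2 - e))) by pos.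
    lra. }
  replace ((1 - a) ^ 6 * y ^ 4 * z) with (X ^ 3 * (y * z)) by (unfold X; ring).
  apply Rle_trans with (X ^ 3 * (1 + 3 * D + 6 * D ^ 2)); [|easy].
  apply Rmult_le_compat_l; [now apply pow_le|easy].
Qed.

Lemma three_four_one (s t : R) : 1 < s ->
  1 <= Cmod (zeta (s, 0)) ^ 3 * Cmod (zeta (s, t)) ^ 4 * Cmod (zeta (s, 2 * t)).
Proof.
  intros H1.
  set (y := fun j => Cmod (euler j (s, 0)) ^ 3 * Cmod (euler j (s, t)) ^ 4 * Cmod (euler j (s, 2 * t))).
  assert (Py : forall j, 0 <= y j) by (intros j; unfold y; repeat first [apply Cmod_ge_0|apply pow_le|apply Rmult_le_pos]).
  apply (euler_compare (fun _ => 1) y); try easy.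
  - apply is_lim_seq_const.
  - replace (Finite 1) with (Finite (1 * (1 * (1 * 1)) * (1 * (1 * (1 * (1 * 1)))) * 1)) by (f_equal; ring).
    repeat apply is_lim_seq_mult'; try apply is_lim_seq_const; now apply euler_Cmod_lim.
  - intros; lra.
  - intros j. unfold y; rewrite !euler_S, !Cmod_mult. destruct (sieve j (j + 2)).
    2:{ exists 1, 1. rewrite !Cmod_1; repeat split; try lra; ring. }
    set (n := (j + 2)%nat).
    exists 1, (Cmod (RtoC 1 - term n (s, 0)) ^ 3 * Cmod (RtoC 1 - term n (s, t)) ^ 4 * Cmod (RtoC 1 - term n (s, 2 * t))).
    repeat split; try ring; [repeat first [apply Cmod_ge_0|apply pow_le|apply Rmult_le_pos]|].
    apply sq_le; [lra|].
    assert (A := term_lt_half n s H1 ltac:(unfold n; lia)).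
    rewrite !Rpow_mult_distr, <- !pow_mult, (Nat.mul_comm 3 2), (Nat.mul_comm 4 2), !pow_mult, !Cmod_one_minus_term, Rmult_0_l, cos_0.
    replace (2 * t * ln (INR n)) with (2 * (t * ln (INR n))) by ring. rewrite cos_2a_cos.
    pose proof (COS_bound (t * ln (INR n))) as CB.
    set (a := Rpower (INR n) (- s)) in *; set (c := cos _) in *.
    pose proof (mertens_factor a (1 + c) ltac:(lra) ltac:(lra)) as M.
    replace (1 ^ 2) with 1 by ring. eapply Rle_trans; [|apply M]. right; ring.
Qed.

(** A Lipschitz bound to the right of sg = 1, uniform in N and t, which therefore passes to
    [zeta_tail]. In [kz_line_1] it stands in for differentiability of zeta at a hypothetical
    zero. *)
Lemma tail_lip (sg t : R) (N : nat) : 1 <= sg -> (1 <= N)%nat ->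
  Rabs (RInt (tail_c sg t) 1 (INR N) - RInt (tail_c 1 t) 1 (INR N)) <= 2 * (sg - 1) /\
  Rabs (RInt (tail_s sg t) 1 (INR N) - RInt (tail_s 1 t) 1 (INR N)) <= 2 * (sg - 1).
Proof.
  intros Hs HN.
  destruct (tail_ex sg t N HN) as [C1 S1]; destruct (tail_ex 1 t N HN) as [C2 S2].
  assert (LN : 1 <= INR N) by (change 1 with (INR 1); now apply le_INR).
  (* 0 <= x^-2 - x^(-sg-1) <= (sg-1) ln x / x^2 <= (sg-1) x^(-3/2) *)
  assert (LB : forall x, 0 < x -> ln x <= 2 * exp (/ 2 * ln x) - 2).
  { intros x Hx. pose proof (exp_ineq1_le (/ 2 * ln x)). lra. }
  assert (PW : forall x y, 1 <= x -> Rabs y <= 1 ->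
     Rabs (frac_part x * Rpower x (- sg - 1) * y - frac_part x * Rpower x (- 1 - 1) * y) <= (sg - 1) * (2 * (exp (- (3 / 2) * ln x) - exp (- 2 * ln x)))).
  { intros x y Hx Hy. destruct (base_fp x) as [F1 F2].
    replace (frac_part x * Rpower x (- sg - 1) * y - frac_part x * Rpower x (- 1 - 1) * y) with (frac_part x * (Rpower x (- sg - 1) - Rpower x (- 1 - 1)) * y) by ring.
    rewrite !Rabs_mult, (Rabs_right (frac_part x)) by lra.
    assert (L0 : 0 <= ln x) by (rewrite <- ln_1; apply ln_le; lra).
    unfold Rpower. replace ((- sg - 1) * ln x) with (- 2 * ln x + - ((sg - 1) * ln x)) by ring. replace ((- 1 - 1) * ln x) with (- 2 * ln x) by ring.
    rewrite exp_plus.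
    assert (E2 : 0 < exp (- 2 * ln x)) by apply exp_pos.
    pose proof (exp_ineq1_le (- ((sg - 1) * ln x))) as E3.
    assert (E0 : 0 <= (sg - 1) * ln x) by pos.
    assert (E4 : exp (- ((sg - 1) * ln x)) <= 1) by (apply Rle_trans with (exp 0); [apply exp_le; lra|rewrite exp_0; lra]).
    assert (E5 : Rabs (exp (-2 * ln x) * exp (- ((sg - 1) * ln x)) - exp (-2 * ln x)) <= (sg - 1) * (2 * (exp (- (3 / 2) * ln x) - exp (- 2 * ln x)))).
    { replace (exp (- (3 / 2) * ln x)) with (exp (- 2 * ln x) * exp (/ 2 * ln x)) by (rewrite <- exp_plus; f_equal; field).
      rewrite Rabs_left1 by nra. specialize (LB x ltac:(lra)).
      assert (ln x * (sg - 1) <= (2 * exp (/ 2 * ln x) - 2) * (sg - 1)) by (apply Rmult_le_compat_r; lra).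
      assert (exp (-2 * ln x) * (1 - exp (- ((sg - 1) * ln x))) <= exp (-2 * ln x) * ((2 * exp (/ 2 * ln x) - 2) * (sg - 1))) by (apply Rmult_le_compat_l; lra).
      lra. }
    pose proof (Rabs_pos y). pose proof (Rabs_pos (exp (-2 * ln x) * exp (- ((sg - 1) * ln x)) - exp (-2 * ln x))) as A0.
    apply Rle_trans with (1 * Rabs (exp (-2 * ln x) * exp (- ((sg - 1) * ln x)) - exp (-2 * ln x)) * 1); [|lra].
    apply Rmult_le_compat; [pos|easy|apply Rmult_le_compat_r; lra|easy]. }
  assert (IB : is_RInt (fun x => (sg - 1) * (2 * (exp (- (3 / 2) * ln x) - exp (- 2 * ln x)))) 1 (INR N)
     ((sg - 1) * (2 * (- 2 * exp (- / 2 * ln (INR N)) + exp (- ln (INR N)))) - (sg - 1) * (2 * (- 2 * exp (- / 2 * ln 1) + exp (- ln 1))))).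
  { apply (is_RInt_derive (fun x => (sg - 1) * (2 * (- 2 * exp (- / 2 * ln x) + exp (- ln x))))); intros x Hx; rewrite Rmin_left in Hx by easy.
    - auto_derive; [lra|]. replace (- (3 / 2) * ln x) with (- / 2 * ln x + - ln x) by field. replace (- 2 * ln x) with (- ln x + - ln x) by ring.
      rewrite !exp_plus, exp_Ropp, exp_ln by lra. field; lra.
    - apply (ex_derive_continuous (fun x => (sg - 1) * (2 * (exp (- (3 / 2) * ln x) - exp (- 2 * ln x))))); auto_derive; lra. }
  assert (VB : (sg - 1) * (2 * (- 2 * exp (- / 2 * ln (INR N)) + exp (- ln (INR N)))) - (sg - 1) * (2 * (- 2 * exp (- / 2 * ln 1) + exp (- ln 1))) <= 2 * (sg - 1)).
  { rewrite ln_1, Ropp_0, Rmult_0_r, exp_0. replace (- ln (INR N)) with (- / 2 * ln (INR N) + - / 2 * ln (INR N)) by field. rewrite exp_plus.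
    set (q := exp (- / 2 * ln (INR N))). assert (Q0 : 0 < q) by apply exp_pos.
    assert (Q1 : q <= 1). { unfold q; rewrite <- exp_0; apply exp_le. assert (0 <= ln (INR N)) by (rewrite <- ln_1; apply ln_le; lra). lra. }
    assert (0 <= (sg - 1) * (2 * (2 * q - q * q))) by (apply Rmult_le_pos; nra). lra. }
  rewrite <- !RIntR_minus by easy.
  split; (eapply Rle_trans; [|exact VB]); eapply (norm_RInt_le (V := R_NormedModule)); try exact IB; try exact LN;
    try (apply (RInt_correct (V := R_CompleteNormedModule)); apply (ex_RInt_minus (V := R_NormedModule)); assumption);
    intros x Hx; apply (PW x); try lra; apply Rabs_le; [apply COS_bound|apply SIN_bound].
Qed.

Lemma zeta_le_real (s t : R) : 1 < s -> Cmod (zeta (s, t)) <= Cmod (zeta (s, 0)).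
Proof.
  intros H1.
  apply (euler_compare (fun j => Cmod (euler j (s, t))) (fun j => Cmod (euler j (s, 0)))); try now apply euler_Cmod_lim.
  1,2: intros; apply Cmod_ge_0.
  intros j. rewrite !euler_S, !Cmod_mult. destruct (sieve j (j + 2)).
  2:{ exists 1, 1. rewrite !Cmod_1; repeat split; lra. }
  set (n := (j + 2)%nat).
  exists (Cmod (RtoC 1 - term n (s, t))), (Cmod (RtoC 1 - term n (s, 0))).
  repeat split; [apply Cmod_ge_0|].
  apply sq_le; [apply Cmod_ge_0|]. rewrite !Cmod_one_minus_term, Rmult_0_l, cos_0.
  pose proof (term_lt_half n s H1 ltac:(unfold n; lia)). pose proof (COS_bound (t * ln (INR n))). nra.
Qed.

Definition Itail (s : R) : R := Re (zeta_tail (s, 0)).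

Lemma zeta_tail_real (s : R) : 0 < s -> zeta_tail (s, 0) = RtoC (Itail s) /\
  forall N, (1 <= N)%nat -> Rabs (Itail s - RInt (tail_c s 0) 1 (INR N)) <= Rpower (INR N) (- s) / s.
Proof.
  intros Hs. destruct (tail_lim s 0 Hs) as [lc [ls [E B]]].
  assert (Z : ls = 0).
  { apply (rate_0 _ _ _ (rate_lim s 1 Hs)); intros N HN. destruct (B N HN) as [_ B2]. rewrite Rmult_1_l.
    replace (RInt (tail_s s 0) 1 (INR N)) with 0 in B2; [easy|].
    rewrite (RInt_ext _ (fun _ => 0)).
    - rewrite RInt_const; unfold scal; simpl; unfold mult; simpl; rring.
    - intros x _; unfold tail_s; rewrite Rmult_0_l, sin_0; rring. }
  unfold Itail; rewrite E, Z, Ropp_0. split; [reflexivity|]. intros N HN; apply (B N HN).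
Qed.

(** On each cell the fractional part has mean 1/2 and increases, while x^(-s - 1) decreases.
    Replacing the power by its midpoint value in the deviation term (x - m) x^(-s - 1) can therefore
    only enlarge the integral, and the enlarged deviation integrates to 0. *)
Lemma RInt_tail_half (s : R) (N : nat) : 0 < s -> RInt (tail_c s 0) 1 (INR (S N)) <= (1 - Rpower (INR (S N)) (- s)) / (2 * s).
Proof.
  intros Hs. destruct (tail_sum s 0 N) as [A _]. apply (is_RInt_unique (V := R_CompleteNormedModule)) in A. rewrite A.
  assert (PB : forall n, (1 <= n)%nat -> piece_c s 0 n <= (Rpower (INR n) (- s) - Rpower (INR (S n)) (- s)) / (2 * s)).
  { intros n Hn. pose proof (lt_0_INR n ltac:(lia)) as P0. pose proof (le_INR n (S n) ltac:(lia)) as L.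
    set (m := INR n + / 2).
    set (k := fun x => / 2 * Rpower x (- s - 1) + (x - m) * Rpower m (- s - 1)).
    assert (IK : is_RInt k (INR n) (INR (S n)) ((Rpower (INR n) (- s) - Rpower (INR (S n)) (- s)) / (2 * s))).
    { replace ((Rpower (INR n) (- s) - Rpower (INR (S n)) (- s)) / (2 * s)) with
        (minus (- Rpower (INR (S n)) (- s) / (2 * s) + (INR (S n) - m) ^ 2 / 2 * Rpower m (- s - 1)) (- Rpower (INR n) (- s) / (2 * s) + (INR n - m) ^ 2 / 2 * Rpower m (- s - 1))).
      2:{ unfold minus, plus, opp; simpl. unfold m.
          change (match n with O => 1 | S _ => INR n + 1 end) with (INR (S n)). rewrite S_INR. field; lra. }
      apply (is_RInt_derive (fun x => - Rpower x (- s) / (2 * s) + (x - m) ^ 2 / 2 * Rpower m (- s - 1))); intros x Hx; rewrite Rmin_left in Hx by easy.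
      - unfold k, Rpower at 1 3; auto_derive; [lra|].
        replace ((- s - 1) * ln x) with (- s * ln x + - ln x) by ring. rewrite exp_plus, exp_Ropp, exp_ln by lra. field; lra.
      - apply (ex_derive_continuous k); unfold k, Rpower at 1; auto_derive; lra. }
    rewrite <- (is_RInt_unique (V := R_CompleteNormedModule) _ _ _ _ IK).
    apply RInt_le; [lra|apply (piece_ex s 0 n Hn)|eexists; exact IK|].
    intros x Hx. unfold k. rewrite Rmult_0_l, cos_0, Rmult_1_r.
    assert (M : (x - m) * Rpower x (- s - 1) <= (x - m) * Rpower m (- s - 1)).
    { replace (- s - 1) with (- (s + 1)) by ring. rewrite !Rpower_Ropp.
      assert (Pm : 0 < m) by (unfold m; lra).
      destruct (Rle_dec m x) as [D|D].
      - apply Rmult_le_compat_l; [lra|]. apply Rinv_le_contravar; [apply exp_pos|]. apply Rle_Rpower_l; lra.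
      - assert (/ Rpower m (s + 1) <= / Rpower x (s + 1)).
        { apply Rinv_le_contravar; [apply exp_pos|]. apply Rle_Rpower_l; lra. }
        nra. }
    unfold m in *. lra. }
  clear A. induction N as [|N IH].
  - rewrite sum_n_m_zero by lia. unfold zero; simpl. unfold Rpower; rewrite ln_1, Rmult_0_r, exp_0. right; field; lra.
  - rewrite sum_n_Sm by lia. specialize (PB (S N) ltac:(lia)).
    change (sum_n_m (piece_c s 0) 1 N + piece_c s 0 (S N) <= (1 - Rpower (INR (S (S N))) (- s)) / (2 * s)).
    replace ((1 - Rpower (INR (S (S N))) (- s)) / (2 * s)) with ((1 - Rpower (INR (S N)) (- s)) / (2 * s) + (Rpower (INR (S N)) (- s) - Rpower (INR (S (S N))) (- s)) / (2 * s)) by (field; lra).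
    lra.
Qed.

Lemma le_of_rate (x y : R) (e : nat -> R) : is_lim_seq e 0 -> (forall N, (1 <= N)%nat -> x <= y + e N) -> x <= y.
Proof.
  intros He H. apply le_epsilon; intros eps Pe. apply is_lim_seq_spec in He. destruct (He (mkposreal _ Pe)) as [N0 HN].
  specialize (HN (S N0) ltac:(lia)); specialize (H (S N0) ltac:(lia)). cbn [pos] in HN. rewrite Rminus_0_r in HN.
  pose proof (Rle_abs (e (S N0))); lra.
Qed.

Lemma Itail_bounds (s : R) : 0 < s -> 0 <= Itail s <= / (2 * s).
Proof.
  intros Hs. destruct (zeta_tail_real s Hs) as [_ B]. split.
  - apply (le_of_rate _ _ _ (rate_lim s 1 Hs)); intros N HN. specialize (B N HN). apply Rabs_le_between in B.
    assert (0 <= RInt (tail_c s 0) 1 (INR N)).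
    { apply RInt_ge_0; [exact (le_INR 1 N HN)|exact (proj1 (tail_ex s 0 N HN))|].
      intros x _. unfold tail_c. rewrite Rmult_0_l, cos_0, Rmult_1_r. apply Rmult_le_pos; [pose proof (base_fp x); lra|pos]. }
    lra.
  - apply (le_of_rate _ _ _ (rate_lim s 1 Hs)); intros N HN. specialize (B N HN). apply Rabs_le_between in B.
    destruct N as [|N]; [lia|]. pose proof (RInt_tail_half s N Hs) as T.
    assert (P : 0 < Rpower (INR (S N)) (- s)) by apply exp_pos.
    assert ((1 - Rpower (INR (S N)) (- s)) / (2 * s) <= / (2 * s)).
    { unfold Rdiv. rewrite <- (Rmult_1_l (/ (2 * s))) at 2. apply Rmult_le_compat_r; [pos|lra]. }
    lra.
Qed.

Lemma Itail_decr (s1 s2 : R) : 0 < s1 -> s1 <= s2 -> Itail s2 <= Itail s1.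
Proof.
  intros H1 H2. destruct (zeta_tail_real s1 H1) as [_ B1]. destruct (zeta_tail_real s2 ltac:(lra)) as [_ B2].
  assert (L : is_lim_seq (fun N => 1 * (Rpower (INR N) (- s1) / s1) + 1 * (Rpower (INR N) (- s2) / s2)) 0).
  { replace (Finite 0) with (Finite (0 + 0)) by (f_equal; ring). apply is_lim_seq_plus'; apply rate_lim; lra. }
  apply (le_of_rate _ _ _ L); intros N HN. specialize (B1 N HN); specialize (B2 N HN).
  apply Rabs_le_between in B1; apply Rabs_le_between in B2.
  assert (RInt (tail_c s2 0) 1 (INR N) <= RInt (tail_c s1 0) 1 (INR N)).
  { apply RInt_le; [exact (le_INR 1 N HN)|exact (proj1 (tail_ex s2 0 N HN))|exact (proj1 (tail_ex s1 0 N HN))|].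
    intros x Hx. unfold tail_c. rewrite !Rmult_0_l, cos_0, !Rmult_1_r. apply Rmult_le_compat_l; [pose proof (base_fp x); lra|].
    apply Rle_Rpower; lra. }
  lra.
Qed.

Lemma zeta_real (s : R) : 1 < s -> Cmod (zeta (s, 0)) * (s - 1) = s - s * (s - 1) * Itail s /\ s - s * (s - 1) * Itail s <= s /\ (s + 1) / 2 <= s - s * (s - 1) * Itail s.
Proof.
  intros Hs. pose proof (Itail_bounds s ltac:(lra)) as [I0 I1].
  assert (N : (s, 0) <> RtoC 1 :> C) by (intros E; apply (f_equal Re) in E; unfold Re, RtoC in E; simpl in E; lra).
  assert (K : kz (s, 0) = RtoC (s - s * (s - 1) * Itail s)).
  { unfold kz. rewrite (proj1 (zeta_tail_real s ltac:(lra))). unfold RtoC, Cminus, Cmult, Cplus, Copp; simpl; f_equal; ring. }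
  pose proof (kz_zeta (s, 0) N) as E. rewrite K in E. apply (f_equal Cmod) in E.
  rewrite Cmod_mult, Cmod_R in E.
  replace ((s, 0) - RtoC 1)%C with (RtoC (s - 1)) in E by (unfold RtoC, Cminus, Cplus, Copp; simpl; f_equal; ring).
  rewrite Cmod_R, (Rabs_right (s - 1)) in E by lra.
  assert (B0 : 0 <= s * (s - 1) * Itail s) by (repeat apply Rmult_le_pos; lra).
  assert (B1 : s * (s - 1) * Itail s <= (s - 1) / 2).
  { apply Rle_trans with (s * (s - 1) * / (2 * s)); [apply Rmult_le_compat_l; [nra|easy]|right; field; lra]. }
  rewrite Rabs_right in E by lra. lra.
Qed.

Lemma zeta_pos (s t : R) : 1 < s -> 0 < Cmod (zeta (s, t)).
Proof.
  intros H. pose proof (zeta_lower s t H) as L. pose proof (Cmod_ge_0 (zeta (s, t))) as A.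
  destruct (Req_dec (Cmod (zeta (s, t))) 0) as [E|E]; [rewrite E in L; lra|lra].
Qed.

(** [zeta_ratio] reduces the claim to the real axis, where (s - 1) zeta(s) does not decrease from s1
    to s2 because [Itail] is at most 1 / (2 s1). The condition s2 <= s1 + 1 enters through s1 + s2 -
    1 <= 2 s1. The result is the integrated form of -zeta'/zeta(s) <= 1 / (s - 1), with the sharp
    constant 1. *)
Lemma log_zeta_ratio (s1 s2 t : R) : 1 < s1 -> s1 <= s2 <= s1 + 1 ->
  Rabs (ln (Cmod (zeta (s1, t))) - ln (Cmod (zeta (s2, t)))) <= (s2 - s1) / (s1 - 1).
Proof.
  intros H1 H2. destruct (zeta_ratio s1 s2 t H1 ltac:(lra)) as [A B].
  destruct (zeta_real s1 H1) as [E1 [U1 L1]]. destruct (zeta_real s2 ltac:(lra)) as [E2 [U2 L2]].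
  pose proof (zeta_pos s1 t H1) as P1. pose proof (zeta_pos s2 t ltac:(lra)) as P2.
  pose proof (zeta_pos s1 0 H1) as Q1. pose proof (zeta_pos s2 0 ltac:(lra)) as Q2.
  pose proof (Itail_bounds s1 ltac:(lra)) as [I0 I1]. pose proof (Itail_decr s1 s2 ltac:(lra) ltac:(lra)) as I2.
  set (z1 := Cmod (zeta (s1, 0))) in *. set (z2 := Cmod (zeta (s2, 0))) in *.
  assert (M : z1 * (s1 - 1) <= z2 * (s2 - 1)).
  {
    assert (X1 : s2 * (s2 - 1) * Itail s2 <= s2 * (s2 - 1) * Itail s1) by (apply Rmult_le_compat_l; [nra|easy]).
    assert (X2 : (s2 - s1) * ((s1 + s2 - 1) * Itail s1) <= (s2 - s1) * 1).
    { apply Rmult_le_compat_l; [lra|]. apply Rle_trans with ((2 * s1) * / (2 * s1)); [apply Rmult_le_compat; lra|right; field; lra]. }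
    nra. }
  assert (R : ln z1 - ln z2 <= (s2 - s1) / (s1 - 1)).
  { assert (T : ln (z1 * (s1 - 1)) <= ln (z2 * (s2 - 1))) by (apply ln_le; [pos|easy]).
    rewrite !ln_mult in T by lra.
    assert (T2 : ln (s2 - 1) - ln (s1 - 1) <= (s2 - s1) / (s1 - 1)).
    { rewrite <- ln_div by lra. replace ((s2 - 1) / (s1 - 1)) with (1 + (s2 - s1) / (s1 - 1)) by (field; lra).
      assert (0 <= (s2 - s1) / (s1 - 1)) by pos.
      pose proof (exp_ineq1_le ((s2 - s1) / (s1 - 1))) as EI. apply ln_le in EI; [rewrite ln_exp in EI; lra|lra]. }
    lra. }
  apply ln_le in A; [|pos]. apply ln_le in B; [|pos].
  rewrite !ln_mult in A, B by easy. apply Rabs_le; lra.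
Qed.

Lemma log_zeta_bound (s t : R) : 1 < s -> Rabs (ln (Cmod (zeta (s, t)))) <= ln (s / (s - 1)).
Proof.
  intros H. destruct (zeta_real s H) as [E [U _]]. pose proof (zeta_pos s t H) as P. pose proof (zeta_pos s 0 H) as Q.
  assert (Z : Cmod (zeta (s, 0)) <= s / (s - 1)).
  { apply Rmult_le_reg_r with (s - 1); [lra|]. replace (s / (s - 1) * (s - 1)) with s by (field; lra). lra. }
  pose proof (zeta_le_real s t H) as A. pose proof (zeta_lower s t H) as B.
  apply ln_le in Z; [|easy]. apply ln_le in A; [|easy]. apply ln_le in B; [|lra].
  rewrite ln_mult, ln_1 in B by easy. apply Rabs_le; lra.
Qed.

Lemma kz_line_1 (t : R) : t <> 0 -> kz (1, t) <> RtoC 0.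
Proof.
  intros Ht E0.
  set (T := Rabs t). assert (PT : 0 < T) by now apply Rabs_pos_lt.
  (* a zero on the line would force kz(s + it) = O(s - 1) *)
  destruct (tail_lim 1 t ltac:(lra)) as [c1 [d1 [Z1 B1]]].
  assert (Lip : forall s, 1 < s <= 2 -> Cmod (zeta_tail (s, t) - zeta_tail (1, t)) <= 4 * (s - 1)).
  { intros s Hs. destruct (tail_lim s t ltac:(lra)) as [c2 [d2 [Z2 B2]]]. rewrite Z1, Z2.
    assert (K : Rabs (c2 - c1) <= 2 * (s - 1) /\ Rabs (d2 - d1) <= 2 * (s - 1)).
    { assert (L : is_lim_seq (fun N => 1 * (Rpower (INR N) (- 1) / 1) + 1 * (Rpower (INR N) (- s) / s)) 0).
      { replace (Finite 0) with (Finite (0 + 0)) by (f_equal; ring). apply is_lim_seq_plus'; apply rate_lim; lra. }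
      split; apply (le_of_rate _ _ _ L); intros N HN; destruct (B1 N HN) as [X1 Y1]; destruct (B2 N HN) as [X2 Y2];
        destruct (tail_lip s t N ltac:(lra) HN) as [X3 Y3].
      - replace (c2 - c1) with ((c2 - RInt (tail_c s t) 1 (INR N)) + (RInt (tail_c s t) 1 (INR N) - RInt (tail_c 1 t) 1 (INR N)) + - (c1 - RInt (tail_c 1 t) 1 (INR N))) by ring.
        eapply Rle_trans; [apply Rabs_triang|]. rewrite Rabs_Ropp. eapply Rle_trans; [apply Rplus_le_compat_r, Rabs_triang|]. replace (- 1) with (Ropp 1) in * by ring. lra.
      - replace (d2 - d1) with ((d2 - RInt (tail_s s t) 1 (INR N)) + (RInt (tail_s s t) 1 (INR N) - RInt (tail_s 1 t) 1 (INR N)) + - (d1 - RInt (tail_s 1 t) 1 (INR N))) by ring.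
        eapply Rle_trans; [apply Rabs_triang|]. rewrite Rabs_Ropp. eapply Rle_trans; [apply Rplus_le_compat_r, Rabs_triang|]. replace (- 1) with (Ropp 1) in * by ring. lra. }
    eapply Rle_trans; [apply Cmod_le_sum|].
    replace (Re ((c2, - d2) - (c1, - d1))) with (c2 - c1) by reflexivity.
    replace (Im ((c2, - d2) - (c1, - d1))) with (- (d2 - d1)) by (unfold Im; simpl; ring).
    rewrite Rabs_Ropp; lra. }
  set (z1 := zeta_tail (1, t)) in *.
  assert (K1 : exists A, 0 < A /\ forall s, 1 < s <= 2 -> Cmod (kz (s, t)) <= A * (s - 1)).
  { exists (1 + (2 + 2 * T) * Cmod z1 + (2 + T) * (1 + T) * 4). pose proof (Cmod_ge_0 z1) as C0.
    split; [assert (0 <= (2 + 2 * T) * Cmod z1) by pos; nra|]. intros s Hs.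
    replace (kz (s, t)) with (kz (s, t) - kz (1, t))%C by (rewrite E0; ring).
    unfold kz. fold z1.
    replace ((s, t) - (s, t) * ((s, t) - RtoC 1) * zeta_tail (s, t) - ((1, t) - (1, t) * ((1, t) - RtoC 1) * z1))%C
      with (RtoC (s - 1) + - (RtoC (s - 1) * (RtoC s + RtoC 2 * (RtoC t * Ci)) * z1) + - ((s, t) * ((s, t) - RtoC 1) * (zeta_tail (s, t) - z1)))%C.
    2:{ replace (s, t) with (RtoC s + RtoC t * Ci)%C by (unfold RtoC, Ci, Cplus, Cmult; simpl; f_equal; ring).
        replace (1, t) with (RtoC 1 + RtoC t * Ci)%C by (unfold RtoC, Ci, Cplus, Cmult; simpl; f_equal; ring).
        rewrite RtoC_minus. generalize (zeta_tail (RtoC s + RtoC t * Ci)); intros w. ring. }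
    assert (M1 : Cmod (RtoC s + RtoC 2 * (RtoC t * Ci)) <= 2 + 2 * T).
    { eapply Rle_trans; [apply Cmod_triangle|]. rewrite !Cmod_mult, !Cmod_R, Cmod_Ci. fold T. rewrite !Rabs_right by lra. lra. }
    assert (M2 : Cmod (s, t) <= 2 + T).
    { eapply Rle_trans; [apply Cmod_le_sum|]. unfold Re, Im; simpl; fold T. rewrite Rabs_right by lra. lra. }
    assert (M3 : Cmod ((s, t) - RtoC 1) <= 1 + T).
    { eapply Rle_trans; [apply Cmod_le_sum|]. rewrite Re_minus, Im_minus. unfold Re, Im, RtoC; simpl. rewrite Rminus_0_r. fold T. rewrite Rabs_right by lra. lra. }
    specialize (Lip s Hs).
    eapply Rle_trans; [apply Cmod_triangle|]. eapply Rle_trans; [apply Rplus_le_compat_r, Cmod_triangle|].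
    rewrite !Cmod_opp, !Cmod_mult, Cmod_R, (Rabs_right (s - 1)) by lra.
    assert (N1 : (s - 1) * Cmod (RtoC s + RtoC 2 * (RtoC t * Ci)) * Cmod z1 <= (s - 1) * ((2 + 2 * T) * Cmod z1)).
    { rewrite Rmult_assoc; apply Rmult_le_compat_l; [lra|]. now apply Rmult_le_compat_r. }
    assert (N2 : Cmod (s, t) * Cmod ((s, t) - RtoC 1) * Cmod (zeta_tail (s, t) - z1) <= (2 + T) * (1 + T) * (4 * (s - 1))).
    { apply Rmult_le_compat; [apply Rmult_le_pos; apply Cmod_ge_0|apply Cmod_ge_0| |easy]. apply Rmult_le_compat; try apply Cmod_ge_0; easy. }
    lra. }
  destruct K1 as [A [PA KA]].
  set (B := ((2 + 2 * T) + (2 + 2 * T) * (1 + 2 * T) * 2) / (2 * T)).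
  assert (PB : 0 < B) by (apply Rdiv_lt_0_compat; nra).
  assert (ZQ : forall s v, 1 < s -> v <> 0 -> Cmod (zeta (s, v)) <= Cmod (kz (s, v)) / Rabs v).
  { intros s v H1 Hv. assert (PV : 0 < Rabs v) by now apply Rabs_pos_lt.
    assert (ND : (s, v) <> RtoC 1) by (intros E; injection E; intros; lra).
    rewrite (kz_zeta _ ND), Cmod_mult. apply Rmult_le_reg_r with (Rabs v); [easy|].
    unfold Rdiv; rewrite Rmult_assoc, Rinv_l, Rmult_1_r by lra. rewrite (Rmult_comm _ (Cmod (zeta _))).
    apply Rmult_le_compat_l; [apply Cmod_ge_0|]. pose proof (im_le_Cmod ((s, v) - RtoC 1)) as I.
    rewrite Im_minus in I. now rewrite Rminus_0_r in I. }
  assert (KB : forall s, 1 < s <= 2 -> Cmod (zeta (s, 2 * t)) <= B).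
  { intros s Hs. eapply Rle_trans; [apply ZQ; lra|].
    assert (Rabs (2 * t) = 2 * T) by (rewrite Rabs_mult, (Rabs_right 2) by lra; easy).
    unfold B; rewrite H. unfold Rdiv; apply Rmult_le_compat_r; [pos|].
    eapply Rle_trans; [apply kz_growth; simpl; lra|]. simpl Re.
    assert (M2 : Cmod (s, 2 * t) <= 2 + 2 * T).
    { eapply Rle_trans; [apply Cmod_le_sum|]. unfold Re, Im; simpl. rewrite H, Rabs_right by lra. lra. }
    assert (M3 : Cmod ((s, 2 * t) - RtoC 1) <= 1 + 2 * T).
    { eapply Rle_trans; [apply Cmod_le_sum|]. rewrite Re_minus, Im_minus. unfold Re, Im, RtoC; simpl. rewrite Rminus_0_r, H, Rabs_right by lra. lra. }
    assert (2 / s <= 2) by (apply Rle_div_l; lra).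
    apply Rplus_le_compat; [easy|]. apply Rmult_le_compat; [apply Rmult_le_pos; apply Cmod_ge_0| | |easy].
    - pos.
    - apply Rmult_le_compat; try apply Cmod_ge_0; easy. }
  (* The cube of zeta(s) contributes (s - 1)^(-3), the supposed zero (s - 1)^4, and the value at s +
     2it stays bounded, so the product in [three_four_one] would be O(s - 1). *)
  assert (Q : forall s, 1 < s <= 2 -> 1 <= 8 * (A / T) ^ 4 * B * (s - 1)).
  { intros s Hs. eapply Rle_trans; [apply (three_four_one s t); lra|].
    assert (X1 : Cmod (zeta (s, 0)) <= 2 / (s - 1)).
    { destruct (zeta_real s ltac:(lra)) as [E [U _]]. apply Rle_div_r; lra. }
    assert (X2 : Cmod (zeta (s, t)) <= A / T * (s - 1)).
    { eapply Rle_trans; [apply ZQ; [lra|easy]|]. fold T. replace (A / T * (s - 1)) with (A * (s - 1) / T) by (field; lra).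
      unfold Rdiv; apply Rmult_le_compat_r; [pos|]. now apply KA. }
    pose proof (Cmod_ge_0 (zeta (s, 0))). pose proof (Cmod_ge_0 (zeta (s, t))). pose proof (Cmod_ge_0 (zeta (s, 2 * t))).
    replace (8 * (A / T) ^ 4 * B * (s - 1)) with ((2 / (s - 1)) ^ 3 * (A / T * (s - 1)) ^ 4 * B) by (field; lra).
    apply Rmult_le_compat; [apply Rmult_le_pos; now apply pow_le|easy| |now apply KB].
    apply Rmult_le_compat; try (now apply pow_le); apply pow_incr; easy. }
  set (D := 8 * (A / T) ^ 4 * B) in *.
  assert (PD : 0 < D) by pos.
  assert (PX : 0 < / (2 * D + 1) <= 1).
  { split; [pos|]. rewrite <- Rinv_1. apply Rinv_le_contravar; lra. }
  specialize (Q (1 + / (2 * D + 1)) ltac:(lra)).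
  replace (D * (1 + / (2 * D + 1) - 1)) with (D * / (2 * D + 1)) in Q by ring.
  apply (Rmult_le_compat_r (2 * D + 1)) in Q; [|lra]. rewrite Rmult_assoc, Rinv_l in Q; lra.
Qed.

(** [RH] speaks of the open strip only. The line Re s = 1 is covered by [kz_line_1], the half-plane
    to its right by the Euler product, and at s = 1 the value is 1. *)
Lemma kz_nonzero (s : C) : RH -> 1 / 2 < Re s -> kz s <> RtoC 0.
Proof.
  intros HRH Hs E. destruct s as [sg t]; simpl in Hs.
  destruct (Req_dec sg 1) as [Es|Es].
  { subst sg. destruct (Req_dec t 0) as [Et|Et]; [|now apply (kz_line_1 t Et)].
    subst t. apply (f_equal fst) in E. simpl in E. lra. }
  assert (ND : (sg, t) <> RtoC 1) by (intros F; injection F; intros; lra).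
  rewrite (kz_zeta _ ND) in E. apply (f_equal Cmod) in E. rewrite Cmod_mult, Cmod_0 in E.
  apply Rmult_integral in E; destruct E as [E|E].
  { apply Cmod_eq_0 in E. injection E; intros. apply Es; lra. }
  destruct (Rlt_dec 1 sg) as [G|G]; [pose proof (zeta_pos sg t G); lra|].
  apply Cmod_eq_0 in E. apply HRH in E; simpl in *; lra.
Qed.

(** * Harnack's inequality and a polynomial lower bound for (s - 1) zeta(s) *)

Lemma sinh_cosh_ratio (d r : R) : 0 < d < r ->
  let tau := ln (r / d) in 0 < tau /\ r * exp (- tau) = d /\
  sinh tau * (r - d) = (cosh tau - 1) * (r + d) /\ sinh tau * (r + d) = (cosh tau + 1) * (r - d) /\ 0 < sinh tau.
Proof.
  intros H tau. assert (Q : 1 < r / d) by (apply Rlt_div_r; lra).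
  assert (P : 0 < tau) by (unfold tau; rewrite <- ln_1; apply ln_increasing; lra).
  assert (E1 : exp tau = r / d) by (apply exp_ln; lra).
  assert (E2 : exp (- tau) = d / r) by (rewrite exp_Ropp, E1; field; lra).
  repeat split; [easy|rewrite E2; field; lra| | |now apply sinh_pos]; unfold sinh, cosh; rewrite E1, E2; field; lra.
Qed.

(** For N = 1 the comparison kernel is the constant sinh tau, so [kernel_sandwich] compares the
    values at both distances with one and the same circular mean. *)
Lemma harnack (f : hexp) (c : C) (R1 r d d' : R) :
  (forall z, Cmod (z - c) < R1 -> hwf f z) -> (forall z, Cmod (z - c) < R1 -> heval f z <> RtoC 0) ->
  r < R1 -> 0 < d < r -> 0 < d' < r -> (forall th, 0 <= logmod f (pt c r th)) ->
  logmod f (pt c d 0) <= (r + d) / (r - d) * ((r + d') / (r - d')) * logmod f (pt c d' 0).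
Proof.
  intros Hwf Hnz Hr Hd Hd' Hw.
  destruct (sinh_cosh_ratio d r Hd) as [T1 [E1 [F1 [G1 S1]]]]. destruct (sinh_cosh_ratio d' r Hd') as [T2 [E2 [F2 [G2 S2]]]].
  set (ta := ln (r / d)) in *. set (tb := ln (r / d')) in *.
  destruct (kernel_sandwich f c R1 Hwf Hnz 1 r ta ltac:(lia) ltac:(lra) T1 Hw) as [A _].
  destruct (kernel_sandwich f c R1 Hwf Hnz 1 r tb ltac:(lia) ltac:(lra) T2 Hw) as [_ B].
  rewrite E1 in A. rewrite E2 in B.
  assert (K : forall tau, RInt (fun th => logmod f (pt c r th) * kernel 1 tau th) (- PI) PI = sinh tau * RInt (fun th => logmod f (pt c r th)) (- PI) PI).
  { intros tau. rewrite <- RIntR_scal by (apply ex_RInt_cont; intros; apply (logmod_cont f c R1 Hwf Hnz); rewrite Rabs_right; lra).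
    apply RInt_ext; intros x _. unfold kernel; simpl. rewrite Rminus_0_r, Rmult_1_l. rring. }
  rewrite K in A, B. set (J := RInt _ _ _) in *. rewrite Rmult_1_l in A, B.
  set (w := logmod f (pt c d 0)) in *. set (w' := logmod f (pt c d' 0)) in *.
  pose proof PI_RGT_0 as PP.
  assert (C1 : cosh ta - 1 = sinh ta * ((r - d) / (r + d))).
  { apply Rmult_eq_reg_r with (r + d); [|lra]. rewrite <- F1. field; lra. }
  assert (C2 : cosh tb + 1 = sinh tb * ((r + d') / (r - d'))).
  { apply Rmult_eq_reg_r with (r - d'); [|lra]. rewrite <- G2. field; lra. }
  rewrite C1 in A. rewrite C2 in B.
  assert (A' : 2 * PI * w * ((r - d) / (r + d)) <= J).
  { apply Rmult_le_reg_l with (sinh ta); [easy|]. lra. }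
  assert (B' : J <= 2 * PI * w' * ((r + d') / (r - d'))).
  { apply Rmult_le_reg_l with (sinh tb); [easy|]. lra. }
  assert (Q : 0 < (r - d) / (r + d)) by pos.
  apply Rmult_le_reg_l with (2 * PI * ((r - d) / (r + d))); [pos|].
  replace (2 * PI * ((r - d) / (r + d)) * ((r + d) / (r - d) * ((r + d') / (r - d')) * w')) with (2 * PI * w' * ((r + d') / (r - d'))) by (field; lra).
  lra.
Qed.

Lemma kz_lower_right (s : C) : 3 / 2 <= Re s -> 1 / 6 <= Cmod (kz s).
Proof.
  intros H. destruct s as [sg t]; simpl in H.
  assert (ND : (sg, t) <> RtoC 1) by (intros F; injection F; intros; lra).
  rewrite (kz_zeta _ ND), Cmod_mult.
  assert (M : sg - 1 <= Cmod ((sg, t) - RtoC 1)).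
  { eapply Rle_trans; [|apply re_le_Cmod]. simpl. rewrite Rabs_right; lra. }
  pose proof (zeta_lower sg t ltac:(lra)) as L. destruct (zeta_real sg ltac:(lra)) as [E [U _]].
  pose proof (Cmod_ge_0 (zeta (sg, t))). nra.
Qed.

(** Harnack's inequality for log(G / |kN|) on a disc about 2 + iy, where G bounds [kN]. At real part
    3/2 this function is at most log(12 G), since the Euler product gives |kz| >= 1/6 there and the
    approximation loses at most 1/12. The Harnack constant is at most (6 / h) 3 = 18 / h at every
    height, so the exponent depends on h alone, and G grows quadratically in y. *)
Lemma kz_inv_growth (h : R) : RH -> 0 < h <= 1 / 4 -> exists (K : nat) (A : R), 0 < A /\
  forall s, 1 / 2 + h <= Re s -> 1 <= A * (1 + Cmod s) ^ K * Cmod (kz s).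
Proof.
  intros HRH Hh.
  destruct (nfloor_ex (18 / h)) as [k Hk]; [pos|].
  set (K := S k). assert (HK : 18 / h <= INR K) by (unfold K; rewrite S_INR; lra).
  exists (2 * K)%nat, (Rpower 3200 (INR K) * 6).
  assert (R1 : 1 <= Rpower 3200 (INR K)).
  { rewrite <- (Rpower_O 3200) by lra. apply Rle_Rpower; [lra|apply pos_INR]. }
  split; [lra|]. intros s Hs. pose proof (Cmod_ge_0 s) as P0.
  destruct (Rle_lt_dec (3 / 2) (Re s)) as [Big|Small].
  { pose proof (kz_lower_right s Big). assert (1 <= (1 + Cmod s) ^ (2 * K)) by (apply pow_R1_Rle; lra).
    assert (6 <= Rpower 3200 (INR K) * 6 * (1 + Cmod s) ^ (2 * K)) by nra. nra. }
  destruct s as [sg y]; simpl in Hs, Small. set (c := (2, y) : C).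
  set (E := 5 * (5 + Rabs y) ^ 2). pose proof (Rabs_pos y) as Py.
  assert (PE : 125 <= E) by (unfold E; nra).
  set (R1' := 3 / 2 - h / 4). set (r := 3 / 2 - h / 2).
  assert (InR : forall z, Cmod (z - c) < R1' -> in_rect (1 / 2 + h / 4) 4 (y - 2) (y + 2) z).
  { intros z Hz. pose proof (re_le_Cmod (z - c)) as A. pose proof (im_le_Cmod (z - c)) as B.
    rewrite Re_minus in A. rewrite Im_minus in B. unfold c in A, B; simpl in A, B. fold c in A, B.
    apply Rabs_le_between in A. apply Rabs_le_between in B. unfold R1' in Hz. split; split; lra. }
  destruct (kz_lower_rect (1 / 2 + h / 4) 4 (y - 2) (y + 2)) as [m [Pm Hm]]; try lra.
  { intros z [[A _] _]. apply kz_nonzero; [easy|lra]. }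
  assert (UB : forall z, in_rect (1 / 2 + h / 4) 4 (y - 2) (y + 2) z -> Cmod z <= 6 + Rabs y /\ Cmod (kz z) <= 5 * (7 + Rabs y) ^ 2).
  { intros z [A B]. assert (Y : Rabs (Im z) <= Rabs y + 2).
    { replace (Im z) with (y + (Im z - y)) by ring. eapply Rle_trans; [apply Rabs_triang|]. apply Rplus_le_compat_l. apply Rabs_le; lra. }
    assert (C1 : Cmod z <= 6 + Rabs y).
    { eapply Rle_trans; [apply Cmod_le_sum|]. rewrite (Rabs_right (Re z)) by lra. lra. }
    split; [easy|]. assert (C2 : Cmod (z - RtoC 1) <= 7 + Rabs y).
    { eapply Rle_trans; [apply Cmod_triangle|]. rewrite Cmod_opp, Cmod_1. lra. }
    eapply Rle_trans; [apply kz_growth; lra|].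
    assert (Q : 2 / Re z <= 4) by (apply Rle_div_l; lra).
    pose proof (Cmod_ge_0 z). pose proof (Cmod_ge_0 (z - RtoC 1)).
    assert (0 <= Cmod z * Cmod (z - RtoC 1)) by pos.
    nra. }
  set (G := 5 * (7 + Rabs y) ^ 2 + 1).
  destruct (kz_unif (1 / 2 + h / 4) (6 + Rabs y) (Rmin (1 / 12) (m / 2)) ltac:(lra)) as [N [HN Appr]].
  { apply Rmin_glb_lt; lra. }
  pose proof (Rmin_l (1 / 12) (m / 2)) as Ml. pose proof (Rmin_r (1 / 12) (m / 2)) as Mr.
  assert (Ap : forall z, in_rect (1 / 2 + h / 4) 4 (y - 2) (y + 2) z -> Cmod (kN N z) <= G /\ Cmod (kN N z) <= 2 * Cmod (kz z) /\ Cmod (kz z) - 1 / 12 <= Cmod (kN N z) /\ 0 < Cmod (kN N z)).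
  { intros z Hz. destruct (UB z Hz) as [U1 U2]. pose proof (Hm z Hz) as L. destruct Hz as [[A _] _].
    pose proof (Appr N z (le_n N) A U1) as D. pose proof (Cmod_rev_triangle (kz z) (kN N z)) as T1.
    pose proof (Cmod_rev_triangle (kN N z) (kz z)) as T2. rewrite Cmod_sub_sym in T2. unfold G; lra. }
  assert (PG : 0 < G) by (unfold G; nra).
  set (f := HMul (HConst (RtoC G)) (HInv (kN_e N))).
  assert (fE : forall z, heval f z = (RtoC G * / kN N z)%C).
  { intros z. change (heval f z) with (RtoC G * / heval (kN_e N) z)%C. now rewrite (proj1 (kN_e_eval N z HN)). }
  assert (fL : forall z, in_rect (1 / 2 + h / 4) 4 (y - 2) (y + 2) z -> logmod f z = ln G - ln (Cmod (kN N z))).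
  { intros z Hz. destruct (Ap z Hz) as [_ [_ [_ L]]]. unfold logmod. rewrite fE, Cmod_mult, Cmod_R, Cmod_inv by now apply Cmod_pos_neq.
    rewrite Rabs_right by lra. rewrite ln_mult, ln_Rinv; [ring|easy|easy|pos]. }
  assert (D1 : 0 < 2 - sg < r) by (unfold r; lra).
  assert (D2 : 0 < 1 / 2 < r) by (unfold r; lra).
  assert (P1 : forall d, 0 <= d -> pt c d 0 = (2 - d, y)).
  { intros d _. unfold pt, cis, c, RtoC, Cminus, Copp, Cplus, Cmult; simpl. rewrite cos_0, sin_0. f_equal; ring. }
  assert (InP : forall d th, 0 <= d < R1' -> in_rect (1 / 2 + h / 4) 4 (y - 2) (y + 2) (pt c d th)).
  { intros d th Hd. apply InR. rewrite Cmod_pt, Rabs_right; lra. }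
  pose proof (harnack f c R1' r (2 - sg) (1 / 2)) as HA.
  rewrite !fL in HA by (apply InP; unfold R1'; lra).
  rewrite !P1 in HA by lra. replace (2 - (2 - sg)) with sg in HA by ring. replace (2 - 1 / 2) with (3 / 2) in HA by field.
  assert (I1 : in_rect (1 / 2 + h / 4) 4 (y - 2) (y + 2) (sg, y)) by (unfold in_rect; simpl; lra).
  assert (I2 : in_rect (1 / 2 + h / 4) 4 (y - 2) (y + 2) (3 / 2, y)) by (unfold in_rect; simpl; lra).
  destruct (Ap _ I1) as [_ [X1 [_ X2]]]. destruct (Ap _ I2) as [X3 [_ [X4 X5]]].
  pose proof (kz_lower_right (3 / 2, y) ltac:(simpl; lra)) as X6.
  assert (HA' : ln G - ln (Cmod (kN N (sg, y))) <= INR K * (ln G - ln (Cmod (kN N (3 / 2, y))))).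
  { eapply Rle_trans; [apply HA|].
    - intros z Hz. change (True /\ (hwf (kN_e N) z /\ heval (kN_e N) z <> RtoC 0)). destruct (kN_e_eval N z HN) as [E1 W1]. rewrite E1. split; [easy|split; [easy|]].
      apply Cmod_pos_neq. apply (Ap z (InR z Hz)).
    - intros z Hz. rewrite fE. apply Cmod_pos_neq. rewrite Cmod_mult, Cmod_R, Cmod_inv by (apply Cmod_pos_neq, (Ap z (InR z Hz))).
      apply Rmult_lt_0_compat; [apply Rabs_pos_lt; lra|]. apply Rinv_0_lt_compat, (Ap z (InR z Hz)).
    - unfold r, R1'; lra.
    - easy.
    - easy.
    - intros th. assert (Hin : in_rect (1 / 2 + h / 4) 4 (y - 2) (y + 2) (pt c r th)) by (apply InP; unfold r, R1'; lra).
      rewrite (fL _ Hin). destruct (Ap _ Hin) as [Y1 [_ [_ Y2]]]. apply ln_le in Y1; lra.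
    - apply Rmult_le_compat_r; [apply ln_le in X3; lra|]. eapply Rle_trans; [|apply HK].
      replace (18 / h) with (6 / h * 3) by (field; lra). apply Rmult_le_compat.
      + pos.
      + pos.
      + apply Rle_div_l; [unfold r; lra|]. replace (6 / h * (r - (2 - sg))) with (6 * ((r - (2 - sg)) / h)) by (field; lra).
        assert (1 / 2 * h <= r - (2 - sg)) by (unfold r; lra). assert (1 / 2 <= (r - (2 - sg)) / h) by (apply (Rle_div_r (1 / 2) _ h); [lra|assumption]). assert (r <= 3 / 2) by (unfold r; lra). lra.
      + apply Rle_div_l; unfold r; lra. }
  assert (Y1 : - ln (Cmod (kN N (3 / 2, y))) <= ln 12).
  { rewrite <- ln_Rinv by easy. apply ln_le; [pos|]. rewrite <- (Rinv_inv 12). apply Rinv_le_contravar; lra. }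
  assert (LG : 0 <= ln G) by (rewrite <- ln_1; apply ln_le; unfold G; nra).
  assert (FIN : - ln (Cmod (kN N (sg, y))) <= INR K * ln (G * 12)).
  { rewrite ln_mult by lra. pose proof (pos_INR K).
    assert (INR K * (ln G - ln (Cmod (kN N (3 / 2, y)))) <= INR K * (ln G + ln 12)) by (apply Rmult_le_compat_l; lra). lra. }
  assert (INV : 1 <= Rpower (G * 12) (INR K) * Cmod (kN N (sg, y))).
  { unfold Rpower. rewrite <- (exp_ln (Cmod (kN N (sg, y)))) at 1 by easy. rewrite <- exp_plus. apply Rle_trans with (exp 0); [rewrite exp_0; lra|].
    apply exp_le. lra. }
  set (X := 1 + Cmod (sg, y)) in *.
  assert (GB : G * 12 <= 3200 * X ^ 2).
  { assert (YY : Rabs y <= X - 1) by (unfold X; pose proof (im_le_Cmod (sg, y)) as Q; simpl in Q; lra). unfold G. nra. }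
  assert (PX : 1 <= X) by (unfold X; lra).
  assert (FB : Rpower (G * 12) (INR K) <= Rpower 3200 (INR K) * X ^ (2 * K)).
  { replace (X ^ (2 * K)) with (Rpower (X ^ 2) (INR K)) by (rewrite Rpower_pow by (apply pow_lt; lra); now rewrite pow_mult).
    rewrite Rpower_mult_distr by pos. apply Rle_Rpower_l; [apply pos_INR|lra]. }
  assert (PQ : 0 < Rpower (G * 12) (INR K)) by apply exp_pos.
  apply Rle_trans with (Rpower (G * 12) (INR K) * (2 * Cmod (kz (sg, y)))).
  { eapply Rle_trans; [exact INV|]. apply Rmult_le_compat_l; [lra|easy]. }
  apply Rle_trans with (Rpower 3200 (INR K) * X ^ (2 * K) * (2 * Cmod (kz (sg, y)))).
  { apply Rmult_le_compat_r; [|easy]. lra. }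
  assert (0 <= Rpower 3200 (INR K) * X ^ (2 * K) * Cmod (kz (sg, y))); [|lra].
  apply Rmult_le_pos; [|apply Cmod_ge_0]. lra.
Qed.

(** * The theta relation *)

Lemma derR_eq (f : R -> R) (x a b : R) : is_derive f x a -> a = b -> is_derive f x b.
Proof. now intros H <-. Qed.

Lemma derR_mult (f g : R -> R) (x a b : R) : is_derive f x a -> is_derive g x b ->
  is_derive (fun y => f y * g y) x (a * g x + f x * b).
Proof. intros F G. apply (is_derive_mult f g x a b F G). intros; apply Rmult_comm. Qed.

Lemma derR_plus (f g : R -> R) (x a b : R) : is_derive f x a -> is_derive g x b ->
  is_derive (fun y => f y + g y) x (a + b).
Proof. intros F G. exact (is_derive_plus f g x a b F G). Qed.

Lemma derR_comp (f g : R -> R) (x a b : R) : is_derive f (g x) a -> is_derive g x b ->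
  is_derive (fun y => f (g y)) x (b * a).
Proof. intros F G. exact (is_derive_comp f g x a b F G). Qed.

Definition gauss (y : R) : R := exp (- PI * y ^ 2).

Lemma gauss_deriv (y : R) : is_derive gauss y (- 2 * PI * y * gauss y).
Proof. unfold gauss. auto_derive; [easy|]. simpl; ring. Qed.

Lemma gauss_cont (y : R) : continuous gauss y.
Proof. apply (ex_derive_continuous gauss). eexists; apply gauss_deriv. Qed.

Lemma gauss_pos (y : R) : 0 < gauss y.
Proof. apply exp_pos. Qed.

Lemma gauss_neg (y : R) : gauss (- y) = gauss y.
Proof. unfold gauss; f_equal; ring. Qed.

Lemma gauss_decr (x y : R) : 0 <= x <= y -> gauss y <= gauss x.
Proof. intros H. apply exp_le. pose proof PI_RGT_0. assert (x ^ 2 <= y ^ 2) by (apply pow_incr; lra). nra. Qed.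

Lemma gauss_0 : gauss 0 = 1.
Proof. unfold gauss. rewrite pow_i by lia. rewrite Rmult_0_r. apply exp_0. Qed.

Lemma cosk_cont (b y : R) : continuous (fun y => cos (b * y)) y.
Proof. dcont. Qed.

Definition gaussFT (A b : R) : R := RInt (fun y => gauss y * cos (2 * PI * b * y)) (- A) A.


Lemma gaussFT_deriv (A b : R) :
  is_derive (gaussFT A) b (RInt (fun y => gauss y * (- (2 * PI * y) * sin (2 * PI * b * y))) (- A) A).
Proof.
  apply (derive_RInt_2d (fun b y => gauss y * cos (2 * PI * b * y)) (fun b y => gauss y * (- (2 * PI * y) * sin (2 * PI * b * y))) (- A) A b 1); [lra| | |].
  - intros r y _. auto_derive; [easy|]. ring.
  - intros y.
    apply continuity_2d_pt_mult; [apply continuity_pt_2d_2, continuity_pt_filterlim, gauss_cont|].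
    apply continuity_2d_pt_mult; [apply continuity_pt_2d_2; reg|].
    apply (continuity_1d_2d_pt_comp sin (fun u v => 2 * PI * u * v)); [apply continuity_pt_filterlim, continuous_sin|].
    apply continuity_2d_pt_mult; [apply continuity_pt_2d_1; reg|apply continuity_pt_2d_2; reg].
  - intros r y _. apply continuousR_mult; [apply gauss_cont|apply cosk_cont].
Qed.

Lemma gaussFT_ode (A b : R) :
  RInt (fun y => gauss y * (- (2 * PI * y) * sin (2 * PI * b * y))) (- A) A
  = 2 * gauss A * sin (2 * PI * b * A) - 2 * PI * b * gaussFT A b.
Proof.
  assert (CF : forall x, continuous (fun y => gauss y * (- (2 * PI * y) * sin (2 * PI * b * y))) x).
  { intros x. apply continuousR_mult; [apply gauss_cont|].
    dcont. }
  assert (CG : forall x, continuous (fun y => 2 * PI * b * (gauss y * cos (2 * PI * b * y))) x).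
  { intros x. apply (continuousR_mult (fun _ => 2 * PI * b)); [apply continuous_const|].
    apply continuousR_mult; [apply gauss_cont|apply cosk_cont]. }
  pose proof (RInt_deriv (fun y => gauss y * sin (2 * PI * b * y))
    (fun y => gauss y * (- (2 * PI * y) * sin (2 * PI * b * y)) + 2 * PI * b * (gauss y * cos (2 * PI * b * y))) (- A) A) as D.
  rewrite RIntR_plus, RIntR_scal in D; try (apply ex_RInt_cont; easy).
  2:{ apply ex_RInt_cont. intros x. apply continuousR_mult; [apply gauss_cont|apply cosk_cont]. }
  change (RInt (fun y => gauss y * cos (2 * PI * b * y)) (- A) A) with (gaussFT A b) in D.
  replace (2 * PI * b * - A) with (- (2 * PI * b * A)) in D by ring. rewrite sin_neg, gauss_neg in D.
  assert (D' := D ltac:(intros x; pose proof (gauss_deriv x) as G;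
    eapply derR_eq; [apply derR_mult; [exact G|auto_derive; [easy|reflexivity]]|cbv beta; ring])
    ltac:(intros x; apply continuousR_plus; [apply CF|apply CG])).
  lra.
Qed.

(** By [gaussFT_ode] the derivative of exp(pi b^2) [gaussFT] A b consists of the boundary terms at A
    only, so this product is almost constant. Truncation at A keeps every integral proper. *)
Lemma gaussFT_eval (A b : R) : 0 <= A -> 0 <= b ->
  Rabs (gaussFT A b - exp (- PI * b ^ 2) * gaussFT A 0) <= 2 * b * gauss A.
Proof.
  intros HA Hb.
  set (F := fun b => exp (PI * b ^ 2) * gaussFT A b).
  assert (DF : forall x, is_derive F x (exp (PI * x ^ 2) * (2 * gauss A * sin (2 * PI * x * A)))).
  { intros x. pose proof (gaussFT_deriv A x) as D. rewrite gaussFT_ode in D. eapply derR_eq; [apply derR_mult; [auto_derive; [easy|reflexivity]|exact D]|simpl; ring]. }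
  pose proof PI_RGT_0 as PP.
  pose proof (MVT_abs_le F _ 0 b (exp (PI * b ^ 2) * (2 * gauss A)) Hb (fun x _ => DF x)) as M.
  assert (M' := M ltac:(idtac;
    intros x Hx; cbv beta; rewrite Rabs_mult, (Rabs_right (exp _)) by pos;
    apply Rmult_le_compat; [pos|apply Rabs_pos|
      apply exp_le; apply Rmult_le_compat_l; [lra|]; apply pow_incr; lra|];
    rewrite Rabs_mult; pose proof (gauss_pos A); rewrite (Rabs_right (2 * gauss A)) by lra;
    assert (Rabs (sin (2 * PI * x * A)) <= 1) by (apply Rabs_le, SIN_bound);
    pose proof (Rabs_pos (sin (2 * PI * x * A))); nra)).
  clear M. unfold F in M'. rewrite pow_i, Rmult_0_r, exp_0, Rmult_1_l, Rminus_0_r in M' by lia.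
  replace (exp (- PI * b ^ 2)) with (/ exp (PI * b ^ 2)) by (rewrite <- exp_Ropp; f_equal; ring).
  pose proof (exp_pos (PI * b ^ 2)) as PE. set (q := exp (PI * b ^ 2)) in *.
  replace (gaussFT A b - / q * gaussFT A 0) with (/ q * (q * gaussFT A b - gaussFT A 0)) by (field; lra).
  rewrite Rabs_mult, (Rabs_right (/ q)) by pos.
  apply Rmult_le_reg_l with q; [easy|]. rewrite <- Rmult_assoc, Rinv_r, Rmult_1_l by lra. lra.
Qed.

Fixpoint gsum (N : nat) (x : R) : R :=
  match N with O => 0 | S n => gsum n x + gauss (INR (S n) * x) end.

Definition gint (x : R) : R := RInt gauss 0 x.

Lemma gint_deriv (x : R) : is_derive gint x (gauss x).
Proof.
  apply (is_derive_RInt gauss gint 0 x).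
  - apply filter_forall; intros y. apply (RInt_correct gauss). apply ex_RInt_cont, gauss_cont.
  - apply gauss_cont.
Qed.

Lemma gint_RInt (a b : R) : RInt gauss a b = gint b - gint a.
Proof. apply RInt_deriv; [intros; apply gint_deriv|apply gauss_cont]. Qed.

Lemma gint_0 : gint 0 = 0.
Proof. exact (RInt_point 0 gauss). Qed.

Lemma gint_mono (a b : R) : a <= b -> gint a <= gint b.
Proof.
  intros H. assert (0 <= RInt gauss a b); [|rewrite gint_RInt in *; lra].
  apply RInt_ge_0; [easy|apply ex_RInt_cont, gauss_cont|]. intros; left; apply gauss_pos.
Qed.

Lemma gint_neg (x : R) : gint (- x) = - gint x.
Proof.
  pose proof (MVT_abs_le (fun y => gint y + gint (- y)) (fun _ => 0)) as M.
  assert (D : forall y, is_derive (fun y => gint y + gint (- y)) y 0).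
  { intros y. pose proof (gint_deriv y) as D1. pose proof (gint_deriv (- y)) as D2. rewrite gauss_neg in D2.
    eapply derR_eq; [apply derR_plus; [exact D1|apply (derR_comp gint); [exact D2|auto_derive; [easy|reflexivity]]]|cbv beta; ring]. }
  assert (Z : forall a b, a <= b -> gint b + gint (- b) = gint a + gint (- a)).
  { intros a b Hab. assert (Q := M a b 0 Hab (fun y _ => D y) ltac:(intros; cbv beta; rewrite Rabs_R0; lra)).
    pose proof (Rabs_pos (gint b + gint (- b) - (gint a + gint (- a)))) as P.
    assert (E : Rabs (gint b + gint (- b) - (gint a + gint (- a))) = 0) by lra. apply Rabs_eq_0 in E; lra. }
  destruct (Rle_lt_dec 0 x) as [L|L].
  - specialize (Z 0 x L). rewrite Ropp_0, gint_0 in Z. lra.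
  - specialize (Z x 0 ltac:(lra)). rewrite Ropp_0, gint_0 in Z. lra.
Qed.

Lemma gint_cell (x : R) (n : nat) : 0 < x ->
  x * gauss (INR (S n) * x) <= gint (INR (S n) * x) - gint (INR n * x) <= x * gauss (INR n * x).
Proof.
  intros Hx. pose proof (pos_INR n) as P. assert (L : INR n * x <= INR (S n) * x) by (rewrite S_INR; nra).
  assert (P0 : 0 <= INR n * x) by nra.
  assert (E : x = INR (S n) * x - INR n * x) by (rewrite S_INR; ring).
  rewrite <- gint_RInt. split.
  - replace (x * gauss (INR (S n) * x)) with (RInt (fun _ => gauss (INR (S n) * x)) (INR n * x) (INR (S n) * x)).
    2:{ rewrite RInt_const. rewrite <- E. easy. }
    apply RInt_le; [easy|apply ex_RInt_const|apply ex_RInt_cont, gauss_cont|]. intros y Hy. apply gauss_decr; lra.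
  - replace (x * gauss (INR n * x)) with (RInt (fun _ => gauss (INR n * x)) (INR n * x) (INR (S n) * x)).
    2:{ rewrite RInt_const. rewrite <- E. easy. }
    apply RInt_le; [easy|apply ex_RInt_cont, gauss_cont|apply ex_RInt_const|]. intros y Hy. apply gauss_decr; lra.
Qed.

Lemma gint_bound (x : R) : 0 <= x -> 0 <= gint x <= 2.
Proof.
  intros Hx. split; [rewrite <- gint_0; now apply gint_mono|].
  pose proof (RInt_deriv (fun y => - exp (1 - 2 * y) / 2) (fun y => exp (1 - 2 * y)) 0 x) as D.
  assert (D' := D ltac:(intros; auto_derive; [easy|cbv beta; unfold Rminus; field]) ltac:(intros; apply (ex_derive_continuous (fun y => exp (1 - 2 * y))); eexists; auto_derive; [easy|reflexivity])).
  apply Rle_trans with (RInt (fun y => exp (1 - 2 * y)) 0 x).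
  - apply RInt_le; [easy|apply ex_RInt_cont, gauss_cont| |].
    + apply ex_RInt_cont. intros y. dcont.
    + intros y Hy. apply exp_le. pose proof PI2_3_2. pose proof (pow2_ge_0 (y - 1)). pose proof (pow2_ge_0 y). assert (0 <= (PI - 1) * y ^ 2) by pos. lra.
  - rewrite D'. replace (1 - 2 * 0) with 1 by ring. pose proof exp_le_3. pose proof (exp_pos (1 - 2 * x)). lra.
Qed.

(* Riemann sums of a decreasing function lie on one side of the integral, within one step. *)
Definition gerr (N : nat) (x : R) : R := gsum N x - gint (INR N * x) / x.

Lemma gerr_step (N M : nat) (x : R) : 0 < x -> (N <= M)%nat ->
  - (gauss (INR N * x) - gauss (INR M * x)) <= gerr M x - gerr N x <= 0.
Proof.
  intros Hx H. induction H as [|m H IH]; [lra|].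
  destruct (gint_cell x m Hx) as [A B].
  assert (E : gerr (S m) x - gerr m x = gauss (INR (S m) * x) - (gint (INR (S m) * x) - gint (INR m * x)) / x).
  { unfold gerr. change (gsum (S m) x) with (gsum m x + gauss (INR (S m) * x)). field; lra. }
  assert (U : gauss (INR (S m) * x) <= (gint (INR (S m) * x) - gint (INR m * x)) / x).
  { apply (Rle_div_r _ _ x); lra. }
  assert (V : (gint (INR (S m) * x) - gint (INR m * x)) / x <= gauss (INR m * x)).
  { apply (Rle_div_l _ _ x); lra. }
  lra.
Qed.

Lemma gauss_lim (x : R) : 0 < x -> is_lim_seq (fun N => gauss (INR N * x)) 0.
Proof.
  intros Hx. apply is_lim_seq_le_le_loc with (fun _ => 0) (fun N => / (x ^ 2) * Rpower (INR N) (- 1)).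
  - exists 1%nat. intros n Hn. pose proof (gauss_pos (INR n * x)). split; [lra|].
    assert (1 <= INR n) by (apply (le_INR 1); lia).
    replace (-1) with (Ropp 1) by ring. rewrite Rpower_Ropp, Rpower_1 by lra. rewrite <- Rinv_mult.
    unfold gauss. replace (- PI * (INR n * x) ^ 2) with (- (PI * (INR n * x) ^ 2)) by ring. rewrite exp_Ropp.
    apply Rinv_le_contravar; [apply Rmult_lt_0_compat; [apply pow_lt; lra|lra]|].
    pose proof (exp_ineq1_le (PI * (INR n * x) ^ 2)). pose proof PI2_3_2.
    assert (0 <= (INR n - 1) * (x ^ 2 * INR n)) by pos.
    replace ((INR n * x) ^ 2) with (x ^ 2 * INR n ^ 2) in * by ring. nra.
  - apply is_lim_seq_const.
  - replace (Finite 0) with (Rbar_mult (/ x ^ 2) 0) by (simpl; f_equal; ring).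
    apply is_lim_seq_scal_l. apply is_lim_seq_incr_1. replace (-1) with (Ropp 1) by ring. apply Rpower_lim_0; lra.
Qed.

Lemma gerr_lim (x : R) : 0 < x -> exists l : R, is_lim_seq (fun N => gerr N x) l /\
  forall N, Rabs (l - gerr N x) <= gauss (INR N * x).
Proof.
  intros Hx. destruct (seq_cauchy_rate (fun N => gerr N x) (fun N => gauss (INR N * x)) 0) as [l [L B]].
  - intros N M _ H. pose proof (gerr_step N M x Hx H). pose proof (gauss_pos (INR M * x)). apply Rabs_le; lra.
  - now apply gauss_lim.
  - exists l; split; [easy|]. intros; apply B; lia.
Qed.

(** * Poisson summation for the Gaussian *)

Lemma exp_second_diff (b : R) : Rabs (exp b + exp (- b) - 2) <= 8 * b ^ 2 * exp (Rabs b).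
Proof.
  assert (H : forall c, Rabs (exp c - 1 - c) <= 4 * c ^ 2 * exp (Rabs c)).
  { intros c. pose proof (cexp_sub_lin (RtoC c)) as L. rewrite cexp_RtoC, <- !RtoC_minus, !Cmod_R, pow2_abs in L. easy. }
  pose proof (H b) as A. pose proof (H (- b)) as B. rewrite Rabs_Ropp in B.
  replace ((- b) ^ 2) with (b ^ 2) in B by ring.
  replace (exp b + exp (- b) - 2) with ((exp b - 1 - b) + (exp (- b) - 1 - - b)) by ring.
  eapply Rle_trans; [apply Rabs_triang|]. lra.
Qed.

Lemma sq_exp_decay (q : R) (n : nat) : 0 < q -> (1 <= n)%nat ->
  INR n ^ 2 * exp (- q * (INR n ^ 2 - INR n)) <= (1 + 16 / q ^ 2) / INR n ^ 2.
Proof.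
  intros Hq Hn. assert (P : 1 <= INR n) by (apply (le_INR 1); lia). assert (P2 : 0 < INR n ^ 2) by (apply pow_lt; lra).
  assert (Q : 0 < q ^ 2) by (apply pow_lt; lra).
  apply (Rle_div_r _ _ (INR n ^ 2)); [easy|].
  destruct (Nat.eq_dec n 1) as [E|E].
  - subst n. change (INR 1) with 1. replace (- q * (1 ^ 2 - 1)) with 0 by ring. rewrite exp_0.
    assert (0 < 16 / q ^ 2) by pos. lra.
  - assert (P3 : 2 <= INR n) by (apply (le_INR 2); lia).
    assert (L : exp (- q * (INR n ^ 2 - INR n)) <= 16 / (q ^ 2 * INR n ^ 4)).
    { apply Rle_trans with (exp (- (q * INR n ^ 2 / 2))).
      { apply exp_le. assert (0 <= q * (INR n * (INR n - 2))) by pos. lra. }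
      set (u := q * INR n ^ 2 / 2). assert (Pu : 0 < u) by (unfold u; apply Rdiv_lt_0_compat; [apply Rmult_lt_0_compat; easy|lra]).
      rewrite exp_Ropp. replace (16 / (q ^ 2 * INR n ^ 4)) with (/ (u ^ 2 / 4)) by (unfold u; field; lra).
      apply Rinv_le_contravar; [apply Rdiv_lt_0_compat; [now apply pow_lt|lra]|].
      pose proof (exp_ineq1_le (u / 2)). replace u with (u / 2 + u / 2) at 2 by field. rewrite exp_plus. nra. }
    apply Rle_trans with (INR n ^ 2 * (16 / (q ^ 2 * INR n ^ 4)) * INR n ^ 2).
    + apply Rmult_le_compat_r; [lra|]. apply Rmult_le_compat_l; lra.
    + replace (INR n ^ 2 * (16 / (q ^ 2 * INR n ^ 4)) * INR n ^ 2) with (16 / q ^ 2) by (field; lra). lra.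
Qed.

(** The periodisation of the Gaussian, truncated to shifts |n| <= N; n and -n are paired so that
    each term is even in th. *)
Fixpoint pgauss (x : R) (N : nat) (th : R) : R :=
  match N with
  | O => gauss (x * (th / (2 * PI)))
  | S n => pgauss x n th + (gauss (x * (INR (S n) + th / (2 * PI))) + gauss (x * (INR (S n) - th / (2 * PI))))
  end.

Lemma pgauss_S (x : R) (n : nat) (th : R) : pgauss x (S n) th =
  pgauss x n th + (gauss (x * (INR (S n) + th / (2 * PI))) + gauss (x * (INR (S n) - th / (2 * PI)))).
Proof. easy. Qed.

Lemma pgauss_0 (x : R) (N : nat) : pgauss x N 0 = 1 + 2 * gsum N x.
Proof.
  induction N as [|n IH].
  - simpl. unfold Rdiv. rewrite Rmult_0_l, Rmult_0_r, gauss_0. ring.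
  - rewrite pgauss_S, IH. change (gsum (S n) x) with (gsum n x + gauss (INR (S n) * x)).
    replace (0 / (2 * PI)) with 0 by (unfold Rdiv; ring). rewrite Rplus_0_r, Rminus_0_r, (Rmult_comm x). ring.
Qed.

Lemma pgauss_even (x : R) (N : nat) (th : R) : pgauss x N (- th) = pgauss x N th.
Proof.
  induction N as [|n IH].
  - simpl. rewrite <- gauss_neg. f_equal. unfold Rdiv; ring.
  - rewrite !pgauss_S, IH. replace (- th / (2 * PI)) with (- (th / (2 * PI))) by (unfold Rdiv; ring).
    replace (INR (S n) + - (th / (2 * PI))) with (INR (S n) - th / (2 * PI)) by ring.
    replace (INR (S n) - - (th / (2 * PI))) with (INR (S n) + th / (2 * PI)) by ring. ring.
Qed.

Lemma gauss_lin_cont (a b th : R) : continuous (fun t => gauss (a * t + b)) th.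
Proof.
  apply (ex_derive_continuous (fun t => gauss (a * t + b))). eexists.
  apply (derR_comp gauss); [apply gauss_deriv|]. auto_derive; [easy|reflexivity].
Qed.

Lemma pgauss_cell_p (x : R) (n : R) (th : R) : gauss (x * (n + th / (2 * PI))) = gauss (x / (2 * PI) * th + x * n).
Proof. f_equal. pose proof PI_RGT_0. field; lra. Qed.

Lemma pgauss_cell_m (x : R) (n : R) (th : R) : gauss (x * (n - th / (2 * PI))) = gauss (x / (2 * PI) * th + - (x * n)).
Proof. rewrite <- gauss_neg. f_equal. pose proof PI_RGT_0. field; lra. Qed.

Lemma pgauss_cont (x : R) (N : nat) (th : R) : continuous (pgauss x N) th.
Proof.
  induction N as [|n IH].
  - apply continuous_ext with (fun t => gauss (x / (2 * PI) * t + x * 0)); [|apply gauss_lin_cont].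
    intros t. rewrite <- pgauss_cell_p, Rplus_0_l. easy.
  - apply (continuousR_plus (pgauss x n)); [easy|].
    apply continuous_ext with (fun t => gauss (x / (2 * PI) * t + x * INR (S n)) + gauss (x / (2 * PI) * t + - (x * INR (S n)))).
    + intros t. now rewrite pgauss_cell_p, pgauss_cell_m.
    + apply continuousR_plus; apply gauss_lin_cont.
Qed.

Lemma gauss_second_diff (x d : R) (n : nat) : 0 < x -> Rabs d <= 1 / 2 -> (1 <= n)%nat ->
  let q := PI * x ^ 2 in
  Rabs (gauss (x * (INR n + d)) + gauss (x * (INR n - d)) - 2 * gauss (x * INR n))
  <= d ^ 2 * ((32 * q ^ 2 + 2 * q) * (1 + 16 / q ^ 2)) / INR n ^ 2.
Proof.
  intros Hx Hd Hn q. assert (Pq : 0 < q) by (apply Rmult_lt_0_compat; [apply PI_RGT_0|now apply pow_lt]).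
  assert (P : 1 <= INR n) by (apply (le_INR 1); lia).
  set (b := 2 * q * INR n * d). set (c := q * d ^ 2).
  assert (Ab : Rabs b <= q * INR n).
  { unfold b. rewrite Rabs_mult, (Rabs_right (2 * q * INR n)) by pos.
    assert (0 <= q * INR n) by pos. pose proof (Rmult_le_compat_l (q * INR n) _ _ H Hd). lra. }
  assert (E1 : gauss (x * (INR n + d)) = exp (- q * INR n ^ 2) * (exp (- c) * exp (- b))).
  { unfold gauss. rewrite <- !exp_plus. f_equal. unfold b, c, q; ring. }
  assert (E2 : gauss (x * (INR n - d)) = exp (- q * INR n ^ 2) * (exp (- c) * exp b)).
  { unfold gauss. rewrite <- !exp_plus. f_equal. unfold b, c, q; ring. }
  assert (E3 : gauss (x * INR n) = exp (- q * INR n ^ 2)) by (unfold gauss, q; f_equal; ring).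
  rewrite E1, E2, E3.
  replace (exp (- q * INR n ^ 2) * (exp (- c) * exp (- b)) + exp (- q * INR n ^ 2) * (exp (- c) * exp b) - 2 * exp (- q * INR n ^ 2))
    with (exp (- q * INR n ^ 2) * ((exp b + exp (- b) - 2) + - ((1 - exp (- c)) * (exp b + exp (- b))))) by ring.
  rewrite Rabs_mult, Rabs_right by pos.
  assert (B1 : forall u, Rabs u <= q * INR n -> exp u <= exp (q * INR n)).
  { intros u Hu. apply exp_le. pose proof (Rle_abs u). lra. }
  pose proof (B1 b Ab) as X1. pose proof (B1 (- b) ltac:(now rewrite Rabs_Ropp)) as X2. pose proof (B1 (Rabs b) ltac:(now rewrite Rabs_Rabsolu)) as X3.
  set (W := exp (q * INR n)) in *.
  assert (C0 : 0 <= c) by (unfold c; apply Rmult_le_pos; [lra|apply pow2_ge_0]).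
  assert (C1 : 0 <= 1 - exp (- c) <= c).
  { pose proof (exp_ineq1_le (- c)). split; [|lra]. assert (exp (- c) <= exp 0) by (apply exp_le; lra). rewrite exp_0 in *; lra. }
  assert (T : Rabs (exp b + exp (- b) - 2 + - ((1 - exp (- c)) * (exp b + exp (- b)))) <= d ^ 2 * INR n ^ 2 * (32 * q ^ 2 + 2 * q) * W).
  { eapply Rle_trans; [apply Rabs_triang|]. rewrite Rabs_Ropp.
    pose proof (exp_second_diff b) as S. pose proof (exp_pos b). pose proof (exp_pos (- b)).
    rewrite (Rabs_right ((1 - exp (- c)) * (exp b + exp (- b)))) by pos.
    assert (S2 : 8 * b ^ 2 * exp (Rabs b) <= 8 * b ^ 2 * W) by (apply Rmult_le_compat_l; [pose proof (pow2_ge_0 b); lra|easy]).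
    assert (S3 : (1 - exp (- c)) * (exp b + exp (- b)) <= c * (W + W)) by (apply Rmult_le_compat; lra).
    replace (8 * b ^ 2 * W) with (d ^ 2 * INR n ^ 2 * (32 * q ^ 2) * W) in S2 by (unfold b; ring).
    assert (S4 : c * (W + W) <= d ^ 2 * INR n ^ 2 * (2 * q) * W).
    { replace (c * (W + W)) with (d ^ 2 * (2 * q) * W * 1) by (unfold c; ring).
      replace (d ^ 2 * INR n ^ 2 * (2 * q) * W) with (d ^ 2 * (2 * q) * W * INR n ^ 2) by ring.
      apply Rmult_le_compat_l; [|nra]. apply Rmult_le_pos; [|lra]. apply Rmult_le_pos; [apply pow2_ge_0|lra]. }
    lra. }
  eapply Rle_trans; [apply Rmult_le_compat_l; [pos|exact T]|].
  replace (exp (- q * INR n ^ 2) * (d ^ 2 * INR n ^ 2 * (32 * q ^ 2 + 2 * q) * W))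
    with (d ^ 2 * (32 * q ^ 2 + 2 * q) * (INR n ^ 2 * exp (- q * (INR n ^ 2 - INR n)))).
  2:{ replace (- q * (INR n ^ 2 - INR n)) with (- q * INR n ^ 2 + q * INR n) by ring. rewrite exp_plus. unfold W; ring. }
  replace (d ^ 2 * ((32 * q ^ 2 + 2 * q) * (1 + 16 / q ^ 2)) / INR n ^ 2) with (d ^ 2 * (32 * q ^ 2 + 2 * q) * ((1 + 16 / q ^ 2) / INR n ^ 2)) by (field; lra).
  apply Rmult_le_compat_l; [|now apply sq_exp_decay].
  apply Rmult_le_pos; [apply pow2_ge_0|]. pose proof (pow2_ge_0 q); lra.
Qed.

(** The constant K must not depend on N, because N tends to infinity inside the Fejer estimate. The
    n-th pair contributes O(d^2 / n^2), and the sum of 1 / n^2 is controlled by the telescoping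
    bound 2 (1/n - 1/(n + 1)). *)
Lemma pgauss_second_diff (x : R) : 0 < x -> exists K, forall N th, - PI <= th <= PI ->
  Rabs (pgauss x N th + pgauss x N (- th) - 2 * pgauss x N 0) <= K * (1 - cos th).
Proof.
  intros Hx. set (q := PI * x ^ 2). assert (Pq : 0 < q) by (apply Rmult_lt_0_compat; [apply PI_RGT_0|now apply pow_lt]).
  set (K1 := (32 * q ^ 2 + 2 * q) * (1 + 16 / q ^ 2)).
  assert (PK : 0 < K1).
  { assert (0 < q ^ 2) by now apply pow_lt. assert (0 < 16 / q ^ 2) by pos. apply Rmult_lt_0_compat; lra. }
  exists (2 * (q + 2 * K1)). intros N th Hth. rewrite pgauss_even.
  set (d := th / (2 * PI)). pose proof PI2_3_2 as P3.
  assert (Hd : Rabs d <= 1 / 2).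
  { unfold d, Rdiv. rewrite Rabs_mult, (Rabs_right (/ (2 * PI))) by (apply Rle_ge; pos).
    apply Rmult_le_reg_r with (2 * PI); [lra|]. rewrite Rmult_assoc, Rinv_l, Rmult_1_r by lra.
    replace (1 * / 2 * (2 * PI)) with PI by field. now apply Rabs_le. }
  assert (D2 : d ^ 2 <= 1 - cos th).
  { pose proof (sqr_le_one_minus_cos th Hth) as S. unfold d. replace ((th / (2 * PI)) ^ 2) with (th ^ 2 / (4 * PI ^ 2)) by (field; lra).
    pose proof (COS_bound th). assert (9 <= PI ^ 2) by nra. apply Rle_div_l; [lra|].
    assert (0 <= (1 - cos th) * (4 * PI ^ 2 - 18)) by pos. lra. }
  assert (B : Rabs (pgauss x N th - pgauss x N 0) <= d ^ 2 * (q + K1 * (2 * (1 - / INR (S N))))).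
  { induction N as [|n IH].
    - simpl pgauss. fold d. unfold Rdiv. change (INR 1) with 1. rewrite Rmult_0_l, Rmult_0_r, gauss_0, Rinv_1.
      unfold gauss. replace (- PI * (x * d) ^ 2) with (- (q * d ^ 2)) by (unfold q; ring).
      assert (0 <= q * d ^ 2) by pos.
      pose proof (exp_ineq1_le (- (q * d ^ 2))). assert (exp (- (q * d ^ 2)) <= exp 0) by (apply exp_le; lra). rewrite exp_0 in *. apply Rabs_le. lra.
    - rewrite !pgauss_S. fold d. replace (0 / (2 * PI)) with 0 by (unfold Rdiv; ring). rewrite Rplus_0_r, Rminus_0_r.
      pose proof (gauss_second_diff x d (S n) Hx Hd ltac:(lia)) as G.
      match goal with |- Rabs ?a <= _ => replace a with ((pgauss x n th - pgauss x n 0) +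
        (gauss (x * (INR (S n) + d)) + gauss (x * (INR (S n) - d)) - 2 * gauss (x * INR (S n)))) by ring end.
      eapply Rle_trans; [apply Rabs_triang|].
      replace (d ^ 2 * (q + K1 * (2 * (1 - / INR (S (S n)))))) with (d ^ 2 * (q + K1 * (2 * (1 - / INR (S n)))) + d ^ 2 * K1 * (2 * (/ INR (S n) - / INR (S (S n))))) by ring.
      apply Rplus_le_compat; [exact IH|]. eapply Rle_trans; [exact G|].
      pose proof (pow2_ge_0 d). assert (0 <= d ^ 2 * K1) by pos. apply Rmult_le_compat_l; [easy|].
      rewrite (S_INR (S n)). assert (1 <= INR (S n)) by (apply (le_INR 1); lia). set (y := INR (S n)) in *.
      apply Rle_trans with (2 * / (y * (y + 1))); [|right; field; lra].
      apply Rle_trans with (2 * / (2 * y ^ 2)); [right; field; lra|]. apply Rmult_le_compat_l; [lra|]. apply Rinv_le_contravar; nra. }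
  replace (pgauss x N th + pgauss x N th - 2 * pgauss x N 0) with (2 * (pgauss x N th - pgauss x N 0)) by ring.
  rewrite Rabs_mult, (Rabs_right 2) by lra.
  assert (0 < / INR (S N)) by (apply Rinv_0_lt_compat, lt_0_INR; lia).
  assert (Q : d ^ 2 * (q + K1 * (2 * (1 - / INR (S N)))) <= (1 - cos th) * (q + 2 * K1)).
  { pose proof (pow2_ge_0 d). assert (/ INR (S N) <= 1) by (rewrite <- Rinv_1; apply Rinv_le_contravar; [lra|apply (le_INR 1); lia]).
    apply Rmult_le_compat; try easy; [|nra]. assert (0 <= K1 * (2 * (1 - / INR (S N)))) by pos. lra. }
  lra.
Qed.

Lemma cos_shift_n (y : R) (m : nat) : cos (y + 2 * PI * INR m) = cos y /\ cos (y - 2 * PI * INR m) = cos y.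
Proof.
  split.
  - rewrite <- (cos_period y m). f_equal; ring.
  - rewrite <- (cos_period (y - 2 * PI * INR m) m). f_equal; ring.
Qed.

(** Unfolding: cos(k th) has period 2 pi, so the 2N + 1 shifted cells join into one integral over
    |y| <= x (N + 1/2). *)
Lemma pgauss_fourier (x : R) (N k : nat) : 0 < x ->
  RInt (fun th => pgauss x N th * cos (INR k * th)) (- PI) PI
  = 2 * PI / x * gaussFT (x * (INR N + 1 / 2)) (INR k / x).
Proof.
  intros Hx. pose proof PI_RGT_0 as PP.
  set (F := fun y => gauss y * cos (2 * PI * (INR k / x) * y)).
  assert (CF : forall y, continuous F y) by (intros; apply continuousR_mult; [apply gauss_cont|apply cosk_cont]).
  assert (Lin : forall (v : R) a b, RInt (fun th => F (x / (2 * PI) * th + v)) a b = 2 * PI / x * RInt F (x / (2 * PI) * a + v) (x / (2 * PI) * b + v)).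
  { intros v a b. rewrite <- (RInt_comp_lin F (x / (2 * PI)) v a b) by (apply ex_RInt_cont, CF).
    rewrite <- (RIntR_scal _ (2 * PI / x)).
    - apply RInt_ext. intros y _. unfold scal; simpl; unfold mult; simpl. match goal with |- ?a = ?b => change (@eq R a b) end. field; lra.
    - apply ex_RInt_cont. intros y. apply (continuousR_mult (fun _ => x / (2 * PI))); [apply continuous_const|].
      apply (continuous_comp (fun t => x / (2 * PI) * t + v) F); [|apply CF].
      dcont. }
  assert (Lc : forall (v : R) y, continuous (fun th => F (x / (2 * PI) * th + v)) y).
  { intros v y. apply (continuous_comp (fun t => x / (2 * PI) * t + v) F); [|apply CF].
      dcont. }
  induction N as [|n IH].
  - rewrite (RInt_ext _ (fun th => F (x / (2 * PI) * th + 0))).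
    + rewrite Lin. unfold gaussFT. fold F. f_equal; f_equal; simpl; field; lra.
    + intros th _. unfold F. simpl pgauss. f_equal; f_equal; field; lra.
  - rewrite (RInt_ext _ (fun th => pgauss x n th * cos (INR k * th) +
      (F (x / (2 * PI) * th + x * INR (S n)) + F (x / (2 * PI) * th + - (x * INR (S n)))))).
    2:{ intros th _. rewrite pgauss_S, pgauss_cell_p, pgauss_cell_m. unfold F.
        replace (2 * PI * (INR k / x) * (x / (2 * PI) * th + x * INR (S n))) with (INR k * th + 2 * PI * INR (k * S n)) by (rewrite mult_INR; field; lra).
        replace (2 * PI * (INR k / x) * (x / (2 * PI) * th + - (x * INR (S n)))) with (INR k * th - 2 * PI * INR (k * S n)) by (rewrite mult_INR; field; lra).
        rewrite (proj1 (cos_shift_n _ _)), (proj2 (cos_shift_n _ _)). rring. }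
    rewrite RIntR_plus, RIntR_plus, IH, !Lin.
    + unfold gaussFT. fold F.
      replace (x / (2 * PI) * - PI + x * INR (S n)) with (x * (INR n + 1 / 2)) by (rewrite S_INR; field; lra).
      replace (x / (2 * PI) * PI + x * INR (S n)) with (x * (INR (S n) + 1 / 2)) by (field; lra).
      replace (x / (2 * PI) * - PI + - (x * INR (S n))) with (- (x * (INR (S n) + 1 / 2))) by (field; lra).
      replace (x / (2 * PI) * PI + - (x * INR (S n))) with (- (x * (INR n + 1 / 2))) by (rewrite S_INR; field; lra).
      set (p := x * (INR n + 1 / 2)). set (p' := x * (INR (S n) + 1 / 2)).
      pose proof (RInt_Chasles F (- p') (- p) p) as C1. pose proof (RInt_Chasles F (- p') p p') as C2.
      assert (C1' := C1 ltac:(apply ex_RInt_cont, CF) ltac:(apply ex_RInt_cont, CF)).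
      assert (C2' := C2 ltac:(apply ex_RInt_cont, CF) ltac:(apply ex_RInt_cont, CF)).
      rewrite <- C2', <- C1'. change plus with Rplus. rring.
    + apply ex_RInt_cont, Lc.
    + apply ex_RInt_cont, Lc.
    + apply ex_RInt_cont; intros; apply continuousR_mult; [apply pgauss_cont|apply continuous_cosn].
    + apply ex_RInt_cont; intros; apply continuousR_plus; apply Lc.
Qed.

Definition gint_inf : R := real (Lim_seq (fun N => gint (INR N))).

Lemma gint_inf_lim : is_lim_seq (fun N => gint (INR N)) gint_inf.
Proof.
  apply Lim_seq_correct'. apply ex_finite_lim_seq_incr with 2.
  - intros n. apply gint_mono. rewrite S_INR; lra.
  - intros n. apply gint_bound, pos_INR.
Qed.

Lemma gint_le_inf (x : R) : gint x <= gint_inf.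
Proof.
  destruct (nfloor_ex (Rabs x) (Rabs_pos x)) as [n Hn].
  apply Rle_trans with (gint (INR (S n))); [apply gint_mono; rewrite S_INR; pose proof (Rle_abs x); lra|].
  apply (is_lim_seq_incr_compare (fun N => gint (INR N)) gint_inf gint_inf_lim).
  intros m. apply gint_mono. rewrite S_INR; lra.
Qed.

Lemma gint_lim (u : nat -> R) (c : R) : 0 < c -> (forall N, INR N * c <= u N) -> is_lim_seq (fun N => gint (u N)) gint_inf.
Proof.
  intros Hc Hu. apply is_lim_seq_spec. intros eps.
  pose proof gint_inf_lim as L. apply is_lim_seq_spec in L. destruct (L eps) as [M HM].
  destruct (nfloor_ex (INR M / c)) as [k Hk]; [apply Rmult_le_pos; [apply pos_INR|pos]|].
  exists (S k). intros n Hn. specialize (HM M (le_n M)). pose proof (gint_le_inf (u n)) as U.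
  apply Rabs_lt_between in HM. assert (gint (INR M) <= gint (u n)).
  { apply gint_mono. apply Rle_trans with (INR n * c); [|apply Hu]. apply le_INR in Hn. rewrite S_INR in Hn.
    apply (Rle_div_l _ _ c); lra. }
  apply Rabs_lt_between. lra.
Qed.

Lemma gaussFT_0 (A : R) : gaussFT A 0 = 2 * gint A.
Proof.
  unfold gaussFT. rewrite (RInt_ext _ gauss).
  - rewrite gint_RInt, gint_neg. ring.
  - intros y _. rewrite !Rmult_0_r, Rmult_0_l, cos_0. rring.
Qed.

Lemma gaussFT_lim (x b : R) : 0 < x -> 0 <= b ->
  is_lim_seq (fun N => gaussFT (x * (INR N + 1 / 2)) b) (exp (- PI * b ^ 2) * (2 * gint_inf)).
Proof.
  intros Hx Hb. set (A := fun N => x * (INR N + 1 / 2)).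
  assert (PA : forall N, INR N * x <= A N) by (intros N; unfold A; pose proof (pos_INR N); lra).
  assert (L1 : is_lim_seq (fun N => exp (- PI * b ^ 2) * (2 * gint (A N))) (exp (- PI * b ^ 2) * (2 * gint_inf))).
  { apply (is_lim_seq_scal_l _ (exp (- PI * b ^ 2)) (2 * gint_inf)). apply (is_lim_seq_scal_l _ 2 gint_inf). now apply (gint_lim A x). }
  assert (L2 : is_lim_seq (fun N => gaussFT (A N) b - exp (- PI * b ^ 2) * (2 * gint (A N))) 0).
  { apply is_lim_seq_abs_0. apply is_lim_seq_le_le with (fun _ => 0) (fun N => 2 * b * gauss (INR N * x)).
    - intros N. split; [apply Rabs_pos|]. rewrite <- gaussFT_0. pose proof (pos_INR N). assert (0 <= INR N * x) by nra. specialize (PA N).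
      eapply Rle_trans; [apply gaussFT_eval; lra|]. apply Rmult_le_compat_l; [lra|]. apply gauss_decr; lra.
    - apply is_lim_seq_const.
    - replace (Finite 0) with (Rbar_mult (2 * b) 0) by (simpl; f_equal; ring). apply is_lim_seq_scal_l. now apply gauss_lim. }
  pose proof (is_lim_seq_plus' _ _ _ _ L1 L2) as L. rewrite Rplus_0_r in L.
  eapply is_lim_seq_ext; [|exact L]. intros n; cbv beta. unfold A; ring.
Qed.

Lemma tcoef_lim (k : nat -> R) (a : nat -> nat -> R) (l : nat -> R) (m : nat) :
  (forall n, is_lim_seq (fun N => a N n) (l n)) -> is_lim_seq (fun N => tcoef k (a N) m) (tcoef k l m).
Proof.
  intros H. induction m as [|m IH].
  - apply (is_lim_seq_scal_l _ (k O) (l O)), H.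
  - eapply is_lim_seq_ext; [intros n; symmetry; apply tcoef_S|].
    apply (is_lim_seq_plus' _ _ (tcoef k l m) (2 * k (S m) * l (S m))); [exact IH|].
    apply (is_lim_seq_scal_l _ (2 * k (S m)) (l (S m))), H.
Qed.

Lemma tcoef_gauss (c y : R) (j : nat) : tcoef (fun _ => 1) (fun n => c * gauss (INR n * y)) j = c * (1 + 2 * gsum j y).
Proof.
  induction j as [|j IH].
  - simpl. rewrite Rmult_0_l, gauss_0. ring.
  - rewrite tcoef_S, IH. change (gsum (S j) y) with (gsum j y + gauss (INR (S j) * y)). ring.
Qed.

(** The Cesaro means tend to l and are O(1 / n). *)
Lemma sum_bounded_lim_0 (a : nat -> R) (l B : R) : is_lim_seq a l -> (forall m, Rabs (sum_f_R0 a m) <= B) -> l = 0.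
Proof.
  intros L HB.
  assert (C1 : Un_cv (fun n => sum_f_R0 a (pred n) / INR n) l) by (apply Cesaro_1, is_lim_seq_Reals, L).
  apply is_lim_seq_Reals in C1.
  assert (C2 : is_lim_seq (fun n => sum_f_R0 a (pred n) / INR n) 0).
  { apply is_lim_seq_abs_0. apply is_lim_seq_le_le_loc with (fun _ => 0) (fun n => B * / INR n).
    - exists 1%nat. intros n Hn. split; [apply Rabs_pos|]. assert (0 < INR n) by (apply lt_0_INR; lia).
      unfold Rdiv. rewrite Rabs_mult, (Rabs_right (/ INR n)) by pos.
      apply Rmult_le_compat_r; [pos|apply HB].
    - apply is_lim_seq_const.
    - replace (Finite 0) with (Rbar_mult B 0) by (simpl; f_equal; ring). apply is_lim_seq_scal_l.
      replace (Finite 0) with (Rbar_inv p_infty) by easy. apply is_lim_seq_inv; [apply is_lim_seq_INR|easy]. }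
  apply is_lim_seq_unique in C1. apply is_lim_seq_unique in C2. rewrite C2 in C1. now injection C1.
Qed.

(** By [fejer_eval] the Fejer sums of the periodised Gaussian differ from m + 1 times its value at 0
    by a bounded amount, uniformly in the truncation N. After N tends to infinity, the sums of the
    differences between partial Fourier sums and that value stay bounded although the differences
    converge, so their limit is 0. The Gaussian integral is still an unknown constant here. *)
Lemma theta_poisson (x l l' : R) : 0 < x -> is_lim_seq (fun N => gsum N x) l -> is_lim_seq (fun N => gsum N (/ x)) l' ->
  1 + 2 * l = 2 * gint_inf / x * (1 + 2 * l').
Proof.
  intros Hx L L'. pose proof PI_RGT_0 as PP.
  destruct (pgauss_second_diff x Hx) as [K HK].
  set (c := 2 * PI / x * (2 * gint_inf)). set (b := fun n => c * gauss (INR n * / x)).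
  assert (B : forall m, Rabs (tcoef (fun n => INR (S m) - INR n) b m - 2 * PI * INR (S m) * (1 + 2 * l)) <= 2 * PI * K).
  { intros m.
    set (u := fun N => tcoef (fun n => INR (S m) - INR n) (fun k => RInt (fun th => pgauss x N th * cos (INR k * th)) (- PI) PI) m - 2 * PI * INR (S m) * (1 + 2 * gsum N x)).
    assert (Lu : is_lim_seq u (tcoef (fun n => INR (S m) - INR n) b m - 2 * PI * INR (S m) * (1 + 2 * l))).
    { apply is_lim_seq_minus'.
      - apply (tcoef_lim _ (fun N k => RInt (fun th => pgauss x N th * cos (INR k * th)) (- PI) PI)). intros n.
        eapply is_lim_seq_ext; [intros N; symmetry; now apply pgauss_fourier|].
        replace (b n) with (2 * PI / x * (exp (- PI * (INR n / x) ^ 2) * (2 * gint_inf))) by (unfold b, c, gauss, Rdiv; ring).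
        apply (is_lim_seq_scal_l _ (2 * PI / x) (exp (- PI * (INR n / x) ^ 2) * (2 * gint_inf))). apply gaussFT_lim; [easy|].
        apply Rmult_le_pos; [apply pos_INR|pos].
      - apply (is_lim_seq_scal_l _ (2 * PI * INR (S m)) (1 + 2 * l)). apply is_lim_seq_plus'; [apply is_lim_seq_const|].
        now apply (is_lim_seq_scal_l _ 2 l). }
    assert (Bu : forall N, Rabs (u N) <= 2 * PI * K).
    { intros N. unfold u. rewrite <- RInt_tpart by apply pgauss_cont. rewrite <- pgauss_0.
      apply (fejer_eval (pgauss x N) K m); [apply pgauss_cont|apply HK]. }
    apply is_lim_seq_abs in Lu. apply (is_lim_seq_le _ (fun _ => 2 * PI * K) _ (2 * PI * K) Bu Lu). apply is_lim_seq_const. }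
  assert (Z : c * (1 + 2 * l') - 2 * PI * (1 + 2 * l) = 0).
  { apply (sum_bounded_lim_0 (fun j => c * (1 + 2 * gsum j (/ x)) - 2 * PI * (1 + 2 * l)) _ (2 * PI * K)).
    - apply is_lim_seq_minus'; [|apply is_lim_seq_const]. apply (is_lim_seq_scal_l _ c (1 + 2 * l')).
      apply is_lim_seq_plus'; [apply is_lim_seq_const|]. now apply (is_lim_seq_scal_l _ 2 l').
    - intros m. specialize (B m). rewrite tcoef_cesaro in B.
      replace (sum_f_R0 (fun j => c * (1 + 2 * gsum j (/ x)) - 2 * PI * (1 + 2 * l)) m)
        with (sum_f_R0 (tcoef (fun _ => 1) b) m - 2 * PI * INR (S m) * (1 + 2 * l)); [easy|].
      rewrite minus_sum. rewrite sum_cte. rewrite (sum_eq (tcoef (fun _ => 1) b) (fun j => c * (1 + 2 * gsum j (/ x)))); [ring|].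
      intros i _. apply tcoef_gauss. }
  unfold c in Z. apply Rmult_eq_reg_l with (2 * PI); [|lra].
  replace (2 * PI * (2 * gint_inf / x * (1 + 2 * l'))) with (2 * PI / x * (2 * gint_inf) * (1 + 2 * l')) by (field; lra). lra.
Qed.

Lemma gsum_lim (x : R) : 0 < x -> exists l : R, is_lim_seq (fun N => gsum N x) (l + gint_inf / x) /\
  forall N, Rabs (l - gerr N x) <= gauss (INR N * x).
Proof.
  intros Hx. destruct (gerr_lim x Hx) as [l [L B]]. exists l; split; [|easy].
  assert (L2 : is_lim_seq (fun N => gint (INR N * x) * / x) (gint_inf * / x)).
  { apply (is_lim_seq_scal_r _ (/ x) gint_inf). apply (gint_lim _ x Hx). intros; lra. }
  eapply is_lim_seq_ext; [|exact (is_lim_seq_plus' _ _ _ _ L L2)].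
  intros n; cbv beta. unfold gerr, Rdiv; ring.
Qed.

(** x = 1 is fixed under inversion, where the theta relation reads q = 2 [gint_inf] q with q > 0.
    The Gaussian integral thus comes out of Poisson summation. *)
Lemma gint_inf_half : gint_inf = 1 / 2.
Proof.
  destruct (gsum_lim 1 ltac:(lra)) as [l [L _]].
  pose proof (theta_poisson 1 (l + gint_inf / 1) (l + gint_inf / 1) ltac:(lra) L) as T. rewrite Rinv_1 in T. specialize (T L).
  assert (P : 0 <= l + gint_inf / 1).
  { apply (is_lim_seq_le (fun _ => 0) (fun N => gsum N 1) 0 (l + gint_inf / 1)); [|apply is_lim_seq_const|exact L].
    intros n. induction n as [|n IH]; [simpl; lra|]. change (gsum (S n) 1) with (gsum n 1 + gauss (INR (S n) * 1)). pose proof (gauss_pos (INR (S n) * 1)); lra. }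
  set (q := 1 + 2 * (l + gint_inf / 1)) in *. assert (0 < q) by (unfold q; lra).
  assert ((1 - 2 * gint_inf) * q = 0) by (replace (2 * gint_inf / 1) with (2 * gint_inf) in T by field; lra).
  apply Rmult_integral in H0. lra.
Qed.

(** Subtracting the integral makes the theta relation homogeneous: its terms 1 and 1 / x cancel
    against the subtracted 1 / (2x) and its reflection, and only truncation errors remain. *)
Lemma gerr_reflect (x : R) (N : nat) : 0 < x ->
  Rabs (gerr N x - / x * gerr N (/ x)) <= gauss (INR N * x) + / x * gauss (INR N * / x).
Proof.
  intros Hx. assert (Px : 0 < / x) by now apply Rinv_0_lt_compat.
  destruct (gsum_lim x Hx) as [l [L B]]. destruct (gsum_lim (/ x) Px) as [l' [L' B']].
  pose proof (theta_poisson x _ _ Hx L L') as T. rewrite gint_inf_half in T.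
  assert (E : l = / x * l').
  { replace (2 * (1 / 2) / x * (1 + 2 * (l' + 1 / 2 / / x))) with (/ x + 2 * (/ x * l') + 1) in T by (field; lra).
    replace (l + 1 / 2 / x) with (l + / x / 2) in T by (field; lra). lra. }
  replace (gerr N x - / x * gerr N (/ x)) with (- (l - gerr N x) + / x * (l' - gerr N (/ x))) by (rewrite E; ring).
  eapply Rle_trans; [apply Rabs_triang|]. rewrite Rabs_Ropp, Rabs_mult, (Rabs_right (/ x)) by lra.
  apply Rplus_le_compat; [apply B|]. apply Rmult_le_compat_l; [lra|apply B'].
Qed.

(** * The gamma factor and the functional equation *)

(** Continuity with exponential decay at both ends: preserved by linear combinations, reflections
    and shifts, and enough for the improper integral [lint] to converge. *)
Definition tame (f : R -> R) : Prop :=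
  (forall x, continuous f x) /\ exists K k, 0 < k /\ forall x, Rabs (f x) <= K * exp (- k * Rabs x).

Definition lint (f : R -> R) : R := real (Lim_seq (fun N => RInt f (- INR N) (INR N))).

Lemma RInt_flip (f : R -> R) (a b : R) : (forall x, continuous f x) -> RInt (fun x => f (- x)) a b = RInt f (- b) (- a).
Proof.
  intros Hc.
  pose proof (RInt_comp_lin f (-1) 0 a b ltac:(apply ex_RInt_cont, Hc)) as H.
  replace (-1 * a + 0) with (- a) in H by ring. replace (-1 * b + 0) with (- b) in H by ring.
  rewrite <- (opp_RInt_swap f) in H by (apply ex_RInt_cont, Hc).
  rewrite (RInt_ext _ (fun y => (-1) * f (- y))) in H.
  - rewrite RIntR_scal in H; [change (-1 * RInt (fun x => f (- x)) a b = - RInt f (- b) (- a)) in H; lra|].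
    apply ex_RInt_cont. intros x. apply (continuous_comp Ropp f); [|apply Hc].
    apply (ex_derive_continuous Ropp). eexists; auto_derive; [easy|reflexivity].
  - intros x _. change (-1 * f (-1 * x + 0) = -1 * f (- x)). f_equal; f_equal; ring.
Qed.

Lemma tail_exp_bound (f : R -> R) (K k a b : R) : (forall x, continuous f x) -> 0 < k -> 0 <= a <= b ->
  (forall x, Rabs (f x) <= K * exp (- k * Rabs x)) -> Rabs (RInt f a b) <= K / k * exp (- k * a).
Proof.
  intros Hc Hk Hab HB.
  assert (PK : 0 <= K).
  { specialize (HB 0). rewrite Rabs_R0, Rmult_0_r, exp_0 in HB. pose proof (Rabs_pos (f 0)); lra. }
  assert (CE : forall x, continuous (fun y => K * exp (- k * y)) x).
  { intros x. dcont. }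
  eapply Rle_trans; [apply (abs_RInt_le f); [easy|apply ex_RInt_cont, Hc]|].
  apply Rle_trans with (RInt (fun y => K * exp (- k * y)) a b).
  - apply RInt_le; [easy| | |].
    + apply ex_RInt_cont. intros x. apply (continuous_comp f Rabs); [apply Hc|apply continuous_Rabs].
    + apply ex_RInt_cont, CE.
    + intros x Hx. specialize (HB x). rewrite (Rabs_right x) in HB by lra. exact HB.
  - rewrite (RInt_deriv (fun y => - K / k * exp (- k * y))); [|intros; auto_derive; [easy|field; lra]|exact CE].
    pose proof (exp_pos (- k * b)). assert (0 <= K / k) by pos.
    assert (0 <= K / k * exp (- k * b)) by pos. lra.
Qed.

Lemma lint_rate (f : R -> R) (K k : R) : (forall x, continuous f x) -> 0 < k -> (forall x, Rabs (f x) <= K * exp (- k * Rabs x)) ->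
  is_lim_seq (fun N => RInt f (- INR N) (INR N)) (lint f).
Proof.
  intros Hc Hk HB.
  destruct (seq_cauchy_rate (fun N => RInt f (- INR N) (INR N)) (fun N => 2 * (K / k) * exp (- k * INR N)) 0) as [l [L _]].
  - intros N M _ H. apply le_INR in H. pose proof (pos_INR N).
    assert (E : RInt f (- INR M) (INR M) = RInt f (- INR M) (- INR N) + RInt f (- INR N) (INR N) + RInt f (INR N) (INR M)).
    { pose proof (RInt_Chasles f (- INR M) (- INR N) (INR N) ltac:(apply ex_RInt_cont, Hc) ltac:(apply ex_RInt_cont, Hc)) as C1.
      pose proof (RInt_Chasles f (- INR M) (INR N) (INR M) ltac:(apply ex_RInt_cont, Hc) ltac:(apply ex_RInt_cont, Hc)) as C2.
      rewrite <- C2, <- C1. easy. }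
    rewrite E. replace (RInt f (- INR M) (- INR N) + RInt f (- INR N) (INR N) + RInt f (INR N) (INR M) - RInt f (- INR N) (INR N))
      with (RInt f (- INR M) (- INR N) + RInt f (INR N) (INR M)) by rring.
    eapply Rle_trans; [apply Rabs_triang|].
    rewrite <- RInt_flip by apply Hc.
    pose proof (tail_exp_bound f K k (INR N) (INR M) Hc Hk ltac:(lra) HB).
    assert (Hc' : forall x, continuous (fun y => f (- y)) x).
    { intros x. apply (continuous_comp Ropp f); [|apply Hc]. apply (ex_derive_continuous Ropp). eexists; auto_derive; [easy|reflexivity]. }
    pose proof (tail_exp_bound (fun y => f (- y)) K k (INR N) (INR M) Hc' Hk ltac:(lra) ltac:(intros x; rewrite <- (Rabs_Ropp x); apply HB)).
    lra.
  - replace (Finite 0) with (Rbar_mult (2 * (K / k)) 0) by (simpl; f_equal; ring). apply is_lim_seq_scal_l.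
    apply is_lim_seq_ext with (fun N => exp (- k) ^ N).
    + intros n. rewrite exp_pow. f_equal; ring.
    + apply is_lim_seq_geom. rewrite Rabs_right by pos. rewrite <- exp_0. apply exp_increasing. lra.
  - unfold lint. rewrite (is_lim_seq_unique _ _ L). exact L.
Qed.

Lemma lint_lim (f : R -> R) : tame f -> is_lim_seq (fun N => RInt f (- INR N) (INR N)) (lint f).
Proof. intros [Hc [K [k [Hk HB]]]]. now apply lint_rate with K k. Qed.

Lemma lint_of_lim (f : R -> R) (l : R) : is_lim_seq (fun N => RInt f (- INR N) (INR N)) l -> lint f = l.
Proof. intros H. unfold lint. now rewrite (is_lim_seq_unique _ _ H). Qed.

Lemma tame_cont (f : R -> R) : tame f -> forall x, continuous f x.
Proof. now intros [H _]. Qed.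

Lemma tame_lin (f g : R -> R) (a b : R) : tame f -> tame g -> tame (fun x => a * f x + b * g x).
Proof.
  intros [F [K [k [Hk HF]]]] [G [L [l [Hl HG]]]]. split.
  - intros x. apply continuousR_plus; apply (continuousR_mult (fun _ => _)); try apply continuous_const; [apply F|apply G].
  - exists (Rabs a * K + Rabs b * L), (Rmin k l). split; [now apply Rmin_glb_lt|]. intros x.
    assert (Mono : forall c B, 0 <= B -> Rmin k l <= c -> B * exp (- c * Rabs x) <= B * exp (- Rmin k l * Rabs x)).
    { intros c B HB Hc. apply Rmult_le_compat_l; [easy|]. apply exp_le. pose proof (Rabs_pos x). nra. }
    assert (PK : 0 <= K) by (specialize (HF 0); rewrite Rabs_R0, Rmult_0_r, exp_0 in HF; pose proof (Rabs_pos (f 0)); lra).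
    assert (PL : 0 <= L) by (specialize (HG 0); rewrite Rabs_R0, Rmult_0_r, exp_0 in HG; pose proof (Rabs_pos (g 0)); lra).
    eapply Rle_trans; [apply Rabs_triang|]. rewrite !Rabs_mult, Rmult_plus_distr_r, !Rmult_assoc.
    apply Rplus_le_compat; (apply Rmult_le_compat_l; [apply Rabs_pos|]).
    + eapply Rle_trans; [apply HF|]. apply Mono; [easy|apply Rmin_l].
    + eapply Rle_trans; [apply HG|]. apply Mono; [easy|apply Rmin_r].
Qed.

Lemma lint_lin (f g : R -> R) (a b : R) : tame f -> tame g -> lint (fun x => a * f x + b * g x) = a * lint f + b * lint g.
Proof.
  intros F G. apply lint_of_lim.
  apply is_lim_seq_ext with (fun N => a * RInt f (- INR N) (INR N) + b * RInt g (- INR N) (INR N)).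
  - intros n. rewrite RIntR_plus, !RIntR_scal; [rring|..]; try (apply ex_RInt_cont; now apply tame_cont);
      apply ex_RInt_cont; intros x; apply (continuousR_mult (fun _ => _)); try apply continuous_const; now apply tame_cont.
  - apply is_lim_seq_plus'; [apply (is_lim_seq_scal_l _ a (lint f))|apply (is_lim_seq_scal_l _ b (lint g))]; now apply lint_lim.
Qed.

Lemma tame_ext (f g : R -> R) : (forall x, f x = g x) -> tame f -> tame g.
Proof.
  intros E [F [K [k [Hk HF]]]]. split.
  - intros x. now apply continuous_ext with f.
  - exists K, k. split; [easy|]. intros x. rewrite <- E. apply HF.
Qed.

Lemma lint_ext (f g : R -> R) : (forall x, f x = g x) -> lint f = lint g.
Proof.
  intros E. unfold lint. f_equal. apply Lim_seq_ext. intros n. apply RInt_ext. intros x _. apply E.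
Qed.

Lemma lint_le (f g : R -> R) : tame f -> tame g -> (forall x, f x <= g x) -> lint f <= lint g.
Proof.
  intros F G H.
  apply (is_lim_seq_le (fun N => RInt f (- INR N) (INR N)) (fun N => RInt g (- INR N) (INR N)) (lint f) (lint g)); [|now apply lint_lim|now apply lint_lim].
  intros n. pose proof (pos_INR n). apply RInt_le; [lra|apply ex_RInt_cont; now apply tame_cont|apply ex_RInt_cont; now apply tame_cont|]. intros; apply H.
Qed.

Lemma continuous_opp_arg (f : R -> R) (x : R) : (forall y, continuous f y) -> continuous (fun y => f (- y)) x.
Proof.
  intros H. apply (continuous_comp Ropp f); [|apply H]. apply (ex_derive_continuous Ropp). eexists; auto_derive; [easy|reflexivity].
Qed.

Lemma lint_flip (f : R -> R) : tame f -> tame (fun x => f (- x)) /\ lint (fun x => f (- x)) = lint f.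
Proof.
  intros [F [K [k [Hk HF]]]]. split.
  - split; [intros x; now apply continuous_opp_arg|]. exists K, k. split; [easy|]. intros x. rewrite <- (Rabs_Ropp x). apply HF.
  - unfold lint. f_equal. apply Lim_seq_ext. intros n. rewrite RInt_flip by apply F. now rewrite Ropp_involutive.
Qed.

Lemma exp_neg_INR_lim (k : R) : 0 < k -> is_lim_seq (fun N => exp (- k * INR N)) 0.
Proof.
  intros Hk. apply is_lim_seq_ext with (fun N => exp (- k) ^ N).
  - intros n. rewrite exp_pow. f_equal; ring.
  - apply is_lim_seq_geom. rewrite Rabs_right by pos. rewrite <- exp_0. apply exp_increasing. lra.
Qed.

Lemma lint_deriv_0 (f f' : R -> R) : (forall x, is_derive f x (f' x)) -> tame f -> tame f' -> lint f' = 0.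
Proof.
  intros D [F [K [k [Hk HF]]]] F'. apply lint_of_lim.
  apply is_lim_seq_abs_0. apply is_lim_seq_le_le with (fun _ => 0) (fun N => 2 * K * exp (- k * INR N)).
  - intros n. split; [apply Rabs_pos|]. rewrite (RInt_deriv f f') by (try easy; apply F'). eapply Rle_trans; [apply Rabs_triang|]. rewrite Rabs_Ropp.
    pose proof (HF (INR n)) as A. pose proof (HF (- INR n)) as B. rewrite Rabs_Ropp in B. rewrite (Rabs_right (INR n)) in A, B by (apply Rle_ge, pos_INR). lra.
  - apply is_lim_seq_const.
  - replace (Finite 0) with (Rbar_mult (2 * K) 0) by (simpl; f_equal; ring). apply is_lim_seq_scal_l. now apply exp_neg_INR_lim.
Qed.

(** f(x + a) - f(x) is the derivative of the integral of f over [x, x + a], which decays like f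
    itself, so its total integral is 0. *)
Lemma lint_shift (f : R -> R) (a : R) : tame f -> tame (fun x => f (x + a)) /\ lint (fun x => f (x + a)) = lint f.
Proof.
  intros T. destruct T as [F [K [k [Hk HF]]]].
  assert (PK : 0 <= K) by (specialize (HF 0); rewrite Rabs_R0, Rmult_0_r, exp_0 in HF; pose proof (Rabs_pos (f 0)); lra).
  assert (HS : forall x, Rabs (f (x + a)) <= K * exp (k * Rabs a) * exp (- k * Rabs x)).
  { intros x. eapply Rle_trans; [apply HF|]. rewrite Rmult_assoc, <- exp_plus. apply Rmult_le_compat_l; [easy|]. apply exp_le.
    assert (Rabs x <= Rabs (x + a) + Rabs a).
    { replace x with ((x + a) + - a) at 1 by ring. eapply Rle_trans; [apply Rabs_triang|]. rewrite Rabs_Ropp. lra. }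
    nra. }
  assert (CS : forall x, continuous (fun y => f (y + a)) x).
  { intros x. apply (continuous_comp (fun y => y + a) f); [|apply F]. dcont. }
  split; [split; [exact CS|]; now exists (K * exp (k * Rabs a)), k|].
  set (P := fun y => RInt f 0 y).
  assert (DP : forall y, is_derive P y (f y)).
  { intros y. apply (is_derive_RInt f P 0 y); [|apply F]. apply filter_forall; intros z. apply (RInt_correct f), ex_RInt_cont, F. }
  assert (E : lint (fun x => f (x + a) - f x) = 0).
  { assert (Q : forall x, is_derive (fun y => P (y + a) - P y) x (f (x + a) - f x)).
    { intros x. eapply derR_eq; [apply (derR_plus (fun y => P (y + a)) (fun y => - P y))|].
      - apply (derR_comp P); [apply DP|auto_derive; [easy|reflexivity]].
      - exact (is_derive_opp P x (f x) (DP x)).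
      - change (opp (f x)) with (- f x). ring. }
    apply (lint_deriv_0 _ _ Q).
    - split; [intros x; apply (ex_derive_continuous (fun y => P (y + a) - P y)); eexists; apply Q|].
      exists (K * exp (k * Rabs a) * Rabs a), k. split; [easy|]. intros x.
      replace (P (x + a) - P x) with (RInt f x (x + a)) by (apply RInt_deriv; [apply DP|apply F]).
      assert (B : forall y, Rmin x (x + a) <= y <= Rmax x (x + a) -> Rabs (f y) <= K * exp (k * Rabs a) * exp (- k * Rabs x)).
      { intros y Hy. eapply Rle_trans; [apply HF|]. rewrite Rmult_assoc, <- exp_plus. apply Rmult_le_compat_l; [easy|]. apply exp_le.
        assert (Rabs (x - y) <= Rabs a).
        {
          unfold Rmin, Rmax in Hy. destruct (Rle_dec x (x + a)); unfold Rabs; destruct (Rcase_abs (x - y)), (Rcase_abs a); lra. }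
        assert (Rabs x <= Rabs y + Rabs (x - y)).
        { replace x with (y + (x - y)) at 1 by ring. apply Rabs_triang. }
        nra. }
      replace (K * exp (k * Rabs a) * Rabs a * exp (- k * Rabs x)) with (K * exp (k * Rabs a) * exp (- k * Rabs x) * Rabs a) by ring.
      destruct (Rle_lt_dec 0 a) as [Ha|Ha].
      + rewrite (Rabs_right a) at 2 by lra. replace a with (x + a - x) at 3 by ring. apply RInt_abs_le; [lra|apply F|].
        intros y Hy. apply B. rewrite Rmin_left, Rmax_right by lra. lra.
      + rewrite <- (opp_RInt_swap f) by (apply ex_RInt_cont, F). rewrite Rabs_Ropp.
        rewrite (Rabs_left a) at 2 by lra. replace (- a) with (x - (x + a)) by ring. apply RInt_abs_le; [lra|apply F|].
        intros y Hy. apply B. rewrite Rmin_right, Rmax_left by lra. lra.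
    - apply tame_ext with (fun x => 1 * f (x + a) + (-1) * f x); [intros; ring|].
      apply (tame_lin (fun x => f (x + a)) f); split; try easy; [now exists (K * exp (k * Rabs a)), k|now exists K, k]. }
  assert (E2 : lint (fun x => f (x + a) - f x) = 1 * lint (fun x => f (x + a)) + (-1) * lint f).
  { rewrite <- lint_lin; [apply lint_ext; intros; ring|split; [exact CS|]; now exists (K * exp (k * Rabs a)), k|split; [exact F|]; now exists K, k]. }
  lra.
Qed.

Definition ctame (F : R -> C) : Prop := tame (fun x => Re (F x)) /\ tame (fun x => Im (F x)).

Definition clint (F : R -> C) : C := (lint (fun x => Re (F x)), lint (fun x => Im (F x))).

Lemma ctame_of (F : R -> C) (g : R -> R) : tame g -> (forall x, continuous (fun x => Re (F x)) x /\ continuous (fun x => Im (F x)) x) ->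
  (forall x, Cmod (F x) <= g x) -> ctame F.
Proof.
  intros [_ [K [k [Hk HB]]]] Hc H. split; (split; [intros; apply Hc|]; exists K, k; split; [easy|]; intros x).
  - eapply Rle_trans; [apply re_le_Cmod|]. eapply Rle_trans; [apply H|]. eapply Rle_trans; [apply Rle_abs|apply HB].
  - eapply Rle_trans; [apply im_le_Cmod|]. eapply Rle_trans; [apply H|]. eapply Rle_trans; [apply Rle_abs|apply HB].
Qed.

Lemma ctame_ext (F G : R -> C) : (forall x, F x = G x) -> ctame F -> ctame G.
Proof. intros E [A B]. split; [eapply tame_ext; [|exact A]|eapply tame_ext; [|exact B]]; intros x; cbv beta; now rewrite E. Qed.

Lemma clint_ext (F G : R -> C) : (forall x, F x = G x) -> clint F = clint G.
Proof. intros E. unfold clint. f_equal; apply lint_ext; intros x; now rewrite E. Qed.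

Lemma ctame_scal (F : R -> C) (a : C) : ctame F -> ctame (fun x => a * F x)%C.
Proof.
  intros [A B]. split.
  - apply tame_ext with (fun x => Re a * Re (F x) + (- Im a) * Im (F x)); [intros; rewrite Re_mult; ring|now apply tame_lin].
  - apply tame_ext with (fun x => Im a * Re (F x) + Re a * Im (F x)); [intros; rewrite Im_mult; ring|now apply tame_lin].
Qed.

Lemma clint_scal (F : R -> C) (a : C) : ctame F -> clint (fun x => a * F x)%C = (a * clint F)%C.
Proof.
  intros [A B]. unfold clint.
  rewrite (lint_ext (fun x => Re (a * F x)) (fun x => Re a * Re (F x) + (- Im a) * Im (F x))) by (intros; rewrite Re_mult; ring).
  rewrite (lint_ext (fun x => Im (a * F x)) (fun x => Im a * Re (F x) + Re a * Im (F x))) by (intros; rewrite Im_mult; ring).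
  rewrite !lint_lin by easy. destruct a; unfold Cmult; simpl. f_equal; ring.
Qed.

Lemma ctame_plus (F G : R -> C) : ctame F -> ctame G -> ctame (fun x => F x + G x)%C.
Proof.
  intros [A B] [A' B']. split.
  - apply tame_ext with (fun x => 1 * Re (F x) + 1 * Re (G x)); [intros; rewrite Re_plus; ring|now apply tame_lin].
  - apply tame_ext with (fun x => 1 * Im (F x) + 1 * Im (G x)); [intros; rewrite Im_plus; ring|now apply tame_lin].
Qed.

Lemma clint_plus (F G : R -> C) : ctame F -> ctame G -> clint (fun x => F x + G x)%C = (clint F + clint G)%C.
Proof.
  intros [A B] [A' B']. unfold clint.
  rewrite (lint_ext (fun x => Re (F x + G x)) (fun x => 1 * Re (F x) + 1 * Re (G x))) by (intros; rewrite Re_plus; ring).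
  rewrite (lint_ext (fun x => Im (F x + G x)) (fun x => 1 * Im (F x) + 1 * Im (G x))) by (intros; rewrite Im_plus; ring).
  rewrite !lint_lin by easy. unfold Cplus; simpl. f_equal; ring.
Qed.

Lemma clint_flip (F : R -> C) : ctame F -> ctame (fun x => F (- x)) /\ clint (fun x => F (- x)) = clint F.
Proof.
  intros [A B]. destruct (lint_flip _ A) as [A1 A2]. destruct (lint_flip _ B) as [B1 B2].
  split; [now split|]. unfold clint. now rewrite A2, B2.
Qed.

Lemma clint_shift (F : R -> C) (a : R) : ctame F -> ctame (fun x => F (x + a)) /\ clint (fun x => F (x + a)) = clint F.
Proof.
  intros [A B]. destruct (lint_shift _ a A) as [A1 A2]. destruct (lint_shift _ a B) as [B1 B2].
  split; [now split|]. unfold clint. now rewrite A2, B2.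
Qed.

Lemma clint_deriv_0 (F F' : R -> C) : (forall x, cpath F x (F' x)) -> ctame F -> ctame F' -> clint F' = RtoC 0.
Proof.
  intros D [A B] [A' B']. unfold clint, RtoC. f_equal.
  - apply (lint_deriv_0 (fun x => Re (F x))); [intros x; apply (D x)|easy|easy].
  - apply (lint_deriv_0 (fun x => Im (F x))); [intros x; apply (D x)|easy|easy].
Qed.

Lemma clint_le (F : R -> C) (g : R -> R) : ctame F -> tame g -> (forall x, Cmod (F x) <= g x) -> Cmod (clint F) <= 2 * lint g.
Proof.
  intros [A B] G H. eapply Rle_trans; [apply Cmod_le_sum|]. unfold clint; simpl.
  assert (Q : forall f, tame f -> (forall x, Rabs (f x) <= g x) -> Rabs (lint f) <= lint g).
  { intros f Tf Hf. apply Rabs_le. split.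
    - assert (E : lint (fun x => (-1) * g x + 0 * g x) = - lint g) by (rewrite lint_lin by easy; ring). rewrite <- E.
      apply lint_le; [now apply tame_lin|easy|]. intros x. specialize (Hf x). apply Rabs_le_between in Hf. lra.
    - apply lint_le; [easy|easy|]. intros x. eapply Rle_trans; [apply Rle_abs|apply Hf]. }
  pose proof (Q _ A ltac:(intros x; eapply Rle_trans; [apply re_le_Cmod|apply H])).
  pose proof (Q _ B ltac:(intros x; eapply Rle_trans; [apply im_le_Cmod|apply H])). lra.
Qed.

Lemma cpath_rmul (g : R -> R) (F : R -> C) (x a : R) (d : C) : is_derive g x a -> cpath F x d ->
  cpath (fun y => RtoC (g y) * F y)%C x (RtoC a * F x + RtoC (g x) * d)%C.
Proof.
  intros G [A B]. split.
  - apply (is_derive_ext (fun y => g y * Re (F y))); [intros; rewrite Re_mult; simpl; rring|].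
    eapply derR_eq; [apply derR_mult; [exact G|exact A]|]. rewrite Re_plus, !Re_mult. simpl. ring.
  - apply (is_derive_ext (fun y => g y * Im (F y))); [intros; rewrite Im_mult; simpl; rring|].
    eapply derR_eq; [apply derR_mult; [exact G|exact B]|]. rewrite Im_plus, !Im_mult. simpl. ring.
Qed.

Lemma cpath_cont (F : R -> C) (x : R) (d : C) : cpath F x d -> continuous (fun x => Re (F x)) x /\ continuous (fun x => Im (F x)) x.
Proof.
  intros [A B]. split; [apply (ex_derive_continuous (fun x => Re (F x)))|apply (ex_derive_continuous (fun x => Im (F x)))]; eexists; [exact A|exact B].
Qed.

(** * The Mellin transform of the Gaussian and the functional equation *)

Definition ker (a v : R) : R := gauss (exp v) * exp (a * v).

Lemma gauss_exp_deriv (c v : R) : is_derive (fun v => gauss (c * exp v)) v (- 2 * PI * c ^ 2 * exp v ^ 2 * gauss (c * exp v)).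
Proof.
  eapply derR_eq; [apply (derR_comp gauss); [apply gauss_deriv|auto_derive; [easy|reflexivity]]|]. ring.
Qed.

Lemma ker_bound (a v : R) : 0 < a -> ker a v <= exp ((a + 1) ^ 2) * exp (- Rmin a 1 * Rabs v).
Proof.
  intros Ha. pose proof (Rmin_l a 1) as M1. pose proof (Rmin_r a 1) as M2. unfold ker, gauss. rewrite <- !exp_plus. apply exp_le.
  pose proof PI2_3_2 as P3. pose proof (pow2_ge_0 (a + 1)).
  destruct (Rle_lt_dec v 0) as [Hv|Hv].
  - rewrite Rabs_left1 by easy. assert (0 <= PI * exp v ^ 2) by pos.
    assert (a * v <= Rmin a 1 * v) by nra. lra.
  - rewrite Rabs_right by lra. pose proof (exp_ineq1_le v) as I. assert (v ^ 2 <= exp v ^ 2) by (apply pow_incr; lra).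
    assert (1 * exp v ^ 2 <= PI * exp v ^ 2) by (apply Rmult_le_compat_r; [apply pow2_ge_0|lra]). nra.
Qed.

Lemma ker_tame (a : R) : 0 < a -> tame (ker a).
Proof.
  intros Ha. split.
  - intros x. apply continuousR_mult.
    + apply (continuous_comp exp gauss); [apply continuous_exp|apply gauss_cont].
    + dcont.
  - exists (exp ((a + 1) ^ 2)), (Rmin a 1). split; [apply Rmin_glb_lt; lra|]. intros x.
    rewrite Rabs_right; [now apply ker_bound|]. apply Rle_ge, Rmult_le_pos; left; apply exp_pos.
Qed.

Definition mel (n : R) (s : C) (v : R) : C := (RtoC (gauss (n * exp v)) * cexp (RtoC v * s))%C.

Lemma Cmod_mel (n : R) (s : C) (v : R) : Cmod (mel n s v) = gauss (n * exp v) * exp (Re s * v).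
Proof.
  unfold mel. rewrite Cmod_mult, Cmod_R, Cmod_cexp, Rabs_right by (left; apply gauss_pos).
  rewrite Re_mult. simpl. f_equal; f_equal; ring.
Qed.

(** Integrated over the line for n = 1, this identity becomes the recurrence [Mel_rec], that is, the
    functional equation of the Gamma function. *)
Lemma mel_path (n : R) (s : C) (v : R) : cpath (mel n s) v (s * mel n s v + RtoC (- 2 * PI * n ^ 2) * mel n (s + RtoC 2) v)%C.
Proof.
  pose proof (cpath_rmul (fun v => gauss (n * exp v)) (fun v => cexp (RtoC v * s)) v _ _ (gauss_exp_deriv n v) (cexp_line s v)) as P.
  replace (s * mel n s v + RtoC (- 2 * PI * n ^ 2) * mel n (s + RtoC 2) v)%C with
    (RtoC (- 2 * PI * n ^ 2 * exp v ^ 2 * gauss (n * exp v)) * cexp (RtoC v * s) + RtoC (gauss (n * exp v)) * (s * cexp (RtoC v * s)))%C; [exact P|].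
  unfold mel. rewrite Cmult_plus_distr_l, cexp_plus.
  replace (cexp (RtoC v * RtoC 2)) with (RtoC (exp v ^ 2)).
  2:{ rewrite <- RtoC_mult, cexp_RtoC. f_equal. rewrite exp_pow. f_equal. simpl; ring. }
  rewrite !RtoC_mult. ring.
Qed.

Lemma mel_tame_1 (s : C) : 0 < Re s -> ctame (mel 1 s).
Proof.
  intros Hs. apply ctame_of with (ker (Re s)); [now apply ker_tame| |].
  - intros x. eapply cpath_cont, mel_path.
  - intros x. rewrite Cmod_mel, Rmult_1_l. apply Rle_refl.
Qed.

(** Equal to pi^(-s/2) Gamma(s/2) / 2, written in the logarithmic variable, where scaling the
    Gaussian is a translation. *)
Definition Mel (s : C) : C := clint (mel 1 s).

Lemma mel_scale (n : R) (s : C) (v : R) : 0 < n -> mel n s v = (rpw n (- s) * mel 1 s (v + ln n))%C.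
Proof.
  intros Hn. unfold mel, rpw. rewrite Rmult_1_l, exp_plus, exp_ln by easy. rewrite (Rmult_comm n).
  replace (RtoC (v + ln n) * s)%C with (RtoC v * s + RtoC (ln n) * s)%C by (rewrite RtoC_plus; ring).
  rewrite cexp_plus.
  assert (E : (cexp (- s * RtoC (ln n)) * cexp (RtoC (ln n) * s))%C = RtoC 1).
  { rewrite <- cexp_plus, <- cexp_0. f_equal. ring. }
  replace (cexp (- s * RtoC (ln n)) * (RtoC (gauss (exp v * n)) * (cexp (RtoC v * s) * cexp (RtoC (ln n) * s))))%C
    with (RtoC (gauss (exp v * n)) * cexp (RtoC v * s) * (cexp (- s * RtoC (ln n)) * cexp (RtoC (ln n) * s)))%C by ring.
  rewrite E. ring.
Qed.

Lemma mel_int (n : R) (s : C) : 0 < n -> 0 < Re s -> ctame (mel n s) /\ clint (mel n s) = (rpw n (- s) * Mel s)%C.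
Proof.
  intros Hn Hs. destruct (clint_shift (mel 1 s) (ln n) (mel_tame_1 s Hs)) as [T E]. split.
  - apply ctame_ext with (fun v => rpw n (- s) * mel 1 s (v + ln n))%C; [intros; symmetry; now apply mel_scale|exact (ctame_scal _ _ T)].
  - rewrite (clint_ext _ (fun v => rpw n (- s) * mel 1 s (v + ln n))%C) by (intros; now apply mel_scale).
    rewrite (clint_scal (fun v => mel 1 s (v + ln n)) _ T). now rewrite E.
Qed.

Lemma Mel_rec (s : C) : 0 < Re s -> (s * Mel s = RtoC (2 * PI) * Mel (s + RtoC 2))%C.
Proof.
  intros Hs. assert (Hs2 : 0 < Re (s + RtoC 2)) by (rewrite Re_plus; simpl; lra).
  pose proof (mel_tame_1 s Hs) as T1. pose proof (mel_tame_1 _ Hs2) as T2.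
  pose proof (clint_deriv_0 (mel 1 s) _ (mel_path 1 s) T1) as Z.
  rewrite clint_plus, !clint_scal in Z; try easy; try now apply ctame_scal.
  specialize (Z ltac:(apply ctame_plus; now apply ctame_scal)).
  fold (Mel s) (Mel (s + RtoC 2)) in Z.
  replace (s * Mel s)%C with ((s * Mel s + RtoC (- 2 * PI * 1 ^ 2) * Mel (s + RtoC 2)) + RtoC (2 * PI) * Mel (s + RtoC 2))%C.
  - rewrite Z. ring.
  - replace (RtoC (- 2 * PI * 1 ^ 2)) with (- RtoC (2 * PI))%C by (rewrite <- RtoC_opp; f_equal; ring). ring.
Qed.

Lemma tame_exp_abs (K k : R) : 0 < k -> 0 <= K -> tame (fun v => K * exp (- k * Rabs v)).
Proof.
  intros Hk HK. split.
  - intros x. apply (continuousR_mult (fun _ => K)); [apply continuous_const|].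
    apply (continuous_comp (fun v => - k * Rabs v) exp); [|apply continuous_exp].
    apply (continuousR_mult (fun _ => - k)); [apply continuous_const|apply continuous_Rabs].
  - exists K, k. split; [easy|]. intros x. rewrite Rabs_right; [lra|]. apply Rle_ge, Rmult_le_pos; [easy|pos].
Qed.

Lemma gint_le_id (y : R) : 0 <= y -> 0 <= gint y <= y.
Proof.
  intros Hy. split; [now apply gint_bound|].
  pose proof (RInt_abs_le gauss 0 y 1 Hy gauss_cont) as B.
  assert (B' := B ltac:(intros x Hx; pose proof (gauss_pos x); rewrite Rabs_right by lra; rewrite <- gauss_0; apply gauss_decr; lra)).
  fold (gint y) in B'. pose proof (Rle_abs (gint y)). lra.
Qed.

Section FE.
Variables (s : C) (N : nat).
Hypothesis Hs : 0 < Re s < 1.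
Hypothesis HN : (1 <= N)%nat.

Let HF (v : R) : C := (RtoC (gint (INR N * exp v)) * cexp (RtoC v * (s - RtoC 1)))%C.

Lemma exp_shift_1 (v : R) : (RtoC (exp v) * cexp (RtoC v * (s - RtoC 1)))%C = cexp (RtoC v * s).
Proof. rewrite <- cexp_RtoC, <- cexp_plus. f_equal. ring. Qed.

Lemma HF_path (v : R) : cpath HF v ((s - RtoC 1) * HF v + RtoC (INR N) * mel (INR N) s v)%C.
Proof.
  assert (D : is_derive (fun v => gint (INR N * exp v)) v (INR N * exp v * gauss (INR N * exp v))).
  { eapply derR_eq; [apply (derR_comp gint); [apply gint_deriv|auto_derive; [easy|reflexivity]]|]. ring. }
  pose proof (cpath_rmul _ _ v _ _ D (cexp_line (s - RtoC 1) v)) as P.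
  replace ((s - RtoC 1) * HF v + RtoC (INR N) * mel (INR N) s v)%C with
    (RtoC (INR N * exp v * gauss (INR N * exp v)) * cexp (RtoC v * (s - RtoC 1)) + RtoC (gint (INR N * exp v)) * ((s - RtoC 1) * cexp (RtoC v * (s - RtoC 1))))%C; [exact P|].
  unfold HF, mel. rewrite <- exp_shift_1, !RtoC_mult. ring.
Qed.

Lemma HF_tame : ctame HF.
Proof.
  pose proof (pos_INR N) as PN.
  apply ctame_of with (fun v => (2 + INR N) * exp (- Rmin (Re s) (1 - Re s) * Rabs v)).
  - apply tame_exp_abs; [apply Rmin_glb_lt; lra|lra].
  - intros x. eapply cpath_cont, HF_path.
  - intros v. unfold HF. rewrite Cmod_mult, Cmod_R, Cmod_cexp, Re_mult, Re_minus. simpl. rewrite Rmult_0_l, Rminus_0_r.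
    pose proof (exp_pos v) as PE. assert (P0 : 0 <= INR N * exp v) by pos.
    destruct (gint_le_id _ P0) as [G0 G1]. destruct (gint_bound _ P0) as [_ G2]. rewrite Rabs_right by lra.
    pose proof (Rmin_l (Re s) (1 - Re s)). pose proof (Rmin_r (Re s) (1 - Re s)).
    destruct (Rle_lt_dec v 0) as [Hv|Hv].
    + rewrite Rabs_left1 by easy. apply Rle_trans with (INR N * exp v * exp (v * (Re s - 1))).
      { apply Rmult_le_compat_r; [pos|easy]. }
      rewrite Rmult_assoc, <- exp_plus. apply Rmult_le_compat; [easy|pos|lra|apply exp_le; nra].
    + rewrite Rabs_right by lra. apply Rmult_le_compat; [easy|pos|lra|apply exp_le; nra].
Qed.

Lemma HF_int : ((s - RtoC 1) * clint HF = - (RtoC (INR N) * (rpw (INR N) (- s) * Mel s)))%C.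
Proof.
  assert (PN : 0 < INR N) by (apply lt_0_INR; lia).
  destruct (mel_int (INR N) s PN ltac:(lra)) as [T E].
  pose proof HF_tame as TH.
  pose proof (clint_deriv_0 HF _ HF_path TH) as Z.
  rewrite clint_plus, !clint_scal, E in Z; try easy; try now apply ctame_scal.
  specialize (Z ltac:(apply ctame_plus; now apply ctame_scal)).
  replace ((s - RtoC 1) * clint HF)%C with (((s - RtoC 1) * clint HF + RtoC (INR N) * (rpw (INR N) (- s) * Mel s)) - RtoC (INR N) * (rpw (INR N) (- s) * Mel s))%C by ring.
  rewrite Z. ring.
Qed.

Lemma gsum_int (n : nat) : ctame (fun v => RtoC (gsum n (exp v)) * cexp (RtoC v * s))%C /\
  clint (fun v => RtoC (gsum n (exp v)) * cexp (RtoC v * s))%C = (dsum n s * Mel s)%C.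
Proof.
  induction n as [|n [T E]].
  - split.
    + apply ctame_ext with (fun v => RtoC 0 * mel 1 s v)%C; [intros; simpl gsum; ring|]. apply ctame_scal, mel_tame_1; lra.
    + rewrite (clint_ext _ (fun v => RtoC 0 * mel 1 s v)%C) by (intros; simpl gsum; ring).
      rewrite clint_scal by (apply mel_tame_1; lra). simpl dsum. ring.
  - assert (PN : 0 < INR (S n)) by (apply lt_0_INR; lia).
    destruct (mel_int (INR (S n)) s PN ltac:(lra)) as [T' E'].
    assert (X : forall v, (RtoC (gsum n (exp v)) * cexp (RtoC v * s) + mel (INR (S n)) s v)%C = (RtoC (gsum (S n) (exp v)) * cexp (RtoC v * s))%C).
    { intros v. change (gsum (S n) (exp v)) with (gsum n (exp v) + gauss (INR (S n) * exp v)). unfold mel. rewrite RtoC_plus. ring. }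
    split; [eapply ctame_ext; [exact X|now apply ctame_plus]|].
    rewrite <- (clint_ext _ _ X), clint_plus, E, E' by easy. change (dsum (S n) s) with (dsum n s + rpw (INR (S n)) (- s))%C. ring.
Qed.

Definition errF (v : R) : C := (RtoC (gerr N (exp v)) * cexp (RtoC v * s))%C.

(** The finite Gaussian sum transforms into the Dirichlet sum times [Mel], and the subtracted
    integral into the missing term with N^(1 - s); the truncated theta function thus corresponds
    exactly to [kN], without error term. The integral part decays like exp(v Re s) on the left and
    like exp(v (Re s - 1)) on the right, which is where the strip 0 < Re s < 1 comes from. *)
Lemma errF_int : ctame errF /\ ((s - RtoC 1) * clint errF)%C = (kN N s * Mel s)%C.
Proof.
  destruct (gsum_int N) as [T E]. pose proof HF_tame as TH. pose proof HF_int as EH.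
  assert (X : forall v, (RtoC (gsum N (exp v)) * cexp (RtoC v * s) + RtoC (-1) * HF v)%C = errF v).
  { intros v. unfold errF, gerr, HF. rewrite <- exp_shift_1, RtoC_minus. pose proof (exp_pos v).
    replace (gint (INR N * exp v)) with (gint (INR N * exp v) / exp v * exp v) at 1 by (field; lra).
    rewrite RtoC_mult. replace (RtoC (-1)) with (- RtoC 1)%C by (rewrite <- RtoC_opp; f_equal). ring. }
  split; [eapply ctame_ext; [exact X|apply ctame_plus; [exact T|now apply ctame_scal]]|].
  rewrite <- (clint_ext _ _ X), clint_plus, clint_scal, E; try easy; [|now apply ctame_scal].
  replace (RtoC (-1)) with (- RtoC 1)%C by (rewrite <- RtoC_opp; f_equal).
  replace ((s - RtoC 1) * (dsum N s * Mel s + - RtoC 1 * clint HF))%C with ((s - RtoC 1) * dsum N s * Mel s - (s - RtoC 1) * clint HF)%C by ring.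
  rewrite EH. unfold kN. assert (PN : 0 < INR N) by (apply lt_0_INR; lia).
  replace (RtoC 1 - s)%C with (RtoC 1 + - s)%C by ring. rewrite rpw_plus, rpw_1 by easy. ring.
Qed.
End FE.

Lemma ker_scale_int (n a : R) : 0 < n -> 0 < a -> tame (fun v => gauss (n * exp v) * exp (a * v)) /\
  lint (fun v => gauss (n * exp v) * exp (a * v)) = Rpower n (- a) * lint (ker a).
Proof.
  intros Hn Ha. destruct (lint_shift (ker a) (ln n) (ker_tame a Ha)) as [T E].
  assert (X : forall v, Rpower n (- a) * ker a (v + ln n) + 0 * ker a (v + ln n) = gauss (n * exp v) * exp (a * v)).
  { intros v. unfold ker. rewrite exp_plus, exp_ln by easy. unfold Rpower. rewrite Rmult_plus_distr_l, exp_plus.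
    replace (- a * ln n) with (- (a * ln n)) by ring. rewrite exp_Ropp. rewrite (Rmult_comm n). field. pose proof (exp_pos (a * ln n)); lra. }
  split; [eapply tame_ext; [exact X|exact (tame_lin _ _ _ _ T T)]|].
  rewrite <- (lint_ext _ _ X), (lint_lin _ _ _ _ T T), E. ring.
Qed.

(** The substitution v -> -v exchanges s and 1 - s, and [gerr_reflect] bounds the pointwise
    difference by two Gaussians whose transforms are powers of N. *)
Lemma errF_reflect (s : C) (N : nat) : 0 < Re s < 1 -> (1 <= N)%nat ->
  Cmod (clint (errF s N) - clint (errF (RtoC 1 - s) N)) <=
  2 * (Rpower (INR N) (- Re s) * lint (ker (Re s)) + Rpower (INR N) (- (1 - Re s)) * lint (ker (1 - Re s))).
Proof.
  intros Hs HN. assert (PN : 0 < INR N) by (apply lt_0_INR; lia).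
  assert (Hs' : 0 < Re (RtoC 1 - s) < 1) by (rewrite Re_minus; simpl; lra).
  destruct (errF_int s N Hs HN) as [T _]. destruct (errF_int _ N Hs' HN) as [T' _].
  destruct (clint_flip _ T') as [T2 E2]. rewrite <- E2.
  destruct (ker_scale_int (INR N) (Re s) PN ltac:(lra)) as [K1 I1].
  destruct (ker_scale_int (INR N) (1 - Re s) PN ltac:(lra)) as [K2 I2].
  destruct (lint_flip _ K2) as [K3 I3].
  assert (D : (clint (errF s N) - clint (fun x => errF (RtoC 1 - s) N (- x)))%C =
    clint (fun x => errF s N x + RtoC (-1) * errF (RtoC 1 - s) N (- x))%C).
  { rewrite clint_plus, clint_scal; [|exact T2|exact T|exact (ctame_scal _ _ T2)].
    replace (RtoC (-1)) with (- RtoC 1)%C by (rewrite <- RtoC_opp; f_equal). ring. }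
  rewrite D.
  pose proof (clint_le (fun x => errF s N x + RtoC (-1) * errF (RtoC 1 - s) N (- x))%C
    (fun v => 1 * (gauss (INR N * exp v) * exp (Re s * v)) + 1 * (gauss (INR N * exp (- v)) * exp ((1 - Re s) * - v)))
    (ctame_plus _ _ T (ctame_scal _ _ T2)) (tame_lin _ _ _ _ K1 K3)) as L.
  rewrite (lint_lin _ _ _ _ K1 K3), I3, I1, I2 in L. rewrite !Rmult_1_l in L. apply L.
  intros v. unfold errF.
  assert (E : cexp (RtoC (- v) * (RtoC 1 - s)) = (RtoC (/ exp v) * cexp (RtoC v * s))%C).
  { rewrite <- exp_Ropp, <- cexp_RtoC, <- cexp_plus. f_equal. rewrite RtoC_opp. ring. }
  rewrite E, exp_Ropp.
  replace (RtoC (gerr N (exp v)) * cexp (RtoC v * s) + RtoC (-1) * (RtoC (gerr N (/ exp v)) * (RtoC (/ exp v) * cexp (RtoC v * s))))%C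
    with (RtoC (gerr N (exp v) - / exp v * gerr N (/ exp v)) * cexp (RtoC v * s))%C.
  2:{ rewrite RtoC_minus, RtoC_mult. replace (RtoC (-1)) with (- RtoC 1)%C by (rewrite <- RtoC_opp; f_equal). ring. }
  rewrite Cmod_mult, Cmod_R, Cmod_cexp, Re_mult. simpl (Re (RtoC v)). rewrite Rmult_0_l, Rminus_0_r.
  pose proof (gerr_reflect (exp v) N (exp_pos v)) as G.
  replace (exp ((1 - Re s) * - v)) with (/ exp v * exp (v * Re s)).
  2:{ rewrite <- exp_Ropp, <- exp_plus. f_equal; ring. }
  replace (Re s * v) with (v * Re s) by ring.
  eapply Rle_trans; [apply Rmult_le_compat_r; [pos|exact G]|]. right; ring.
Qed.

(** Since s (s - 1) is invariant under s -> 1 - s, [errF_int] and [errF_reflect] give the relation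
    for [kN] up to terms that vanish as N grows; [kz_approx] replaces [kN] by [kz]. The resulting
    difference Z does not depend on N and is therefore 0. *)
Lemma kz_functional (s : C) : 0 < Re s < 1 -> (s * kz s * Mel s = (RtoC 1 - s) * kz (RtoC 1 - s) * Mel (RtoC 1 - s))%C.
Proof.
  intros Hs. set (s' := (RtoC 1 - s)%C). assert (Rs' : Re s' = 1 - Re s) by (unfold s'; rewrite Re_minus; reflexivity).
  assert (Hs' : 0 < Re s' < 1) by lra.
  set (Z := (s * kz s * Mel s - s' * kz s' * Mel s')%C).
  set (A1 := Cmod s * Cmod (s - RtoC 1) * (2 * lint (ker (Re s)))). set (A2 := Cmod s * Cmod (s - RtoC 1) * (2 * lint (ker (Re s')))).
  set (B1 := Cmod s * Cmod (Mel s) * (Cmod s * Cmod (s - RtoC 1) * (2 / Re s))).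
  set (B2 := Cmod s' * Cmod (Mel s') * (Cmod s' * Cmod (s' - RtoC 1) * (2 / Re s'))).
  assert (Bd : forall N, (1 <= N)%nat -> Cmod Z <= (A1 + B1) * Rpower (INR N) (- Re s) + (A2 + B2) * Rpower (INR N) (- Re s')).
  { intros N HN.
    destruct (errF_int s N Hs HN) as [_ E1]. destruct (errF_int s' N Hs' HN) as [_ E2].
    assert (E : Z = (s * Mel s * (kz s - kN N s) + - (s' * Mel s' * (kz s' - kN N s')) + s * (s - RtoC 1) * (clint (errF s N) - clint (errF s' N)))%C).
    { replace (s * (s - RtoC 1) * (clint (errF s N) - clint (errF s' N)))%C with (s * ((s - RtoC 1) * clint (errF s N)) - s' * ((s' - RtoC 1) * clint (errF s' N)))%C by (unfold s'; ring).
      rewrite E1, E2. unfold Z. ring. }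
    rewrite E. eapply Rle_trans; [apply Cmod_triangle|]. eapply Rle_trans; [apply Rplus_le_compat_r, Cmod_triangle|].
    rewrite Cmod_opp, !Cmod_mult.
    pose proof (kz_approx s N ltac:(lra) HN) as K1. pose proof (kz_approx s' N ltac:(lra) HN) as K2.
    pose proof (errF_reflect s N Hs HN) as K3. rewrite <- Rs' in K3.
    assert (X1 : Cmod s * Cmod (Mel s) * Cmod (kz s - kN N s) <= B1 * Rpower (INR N) (- Re s)).
    { unfold B1. rewrite Rmult_assoc with (r1 := Cmod s * Cmod (Mel s)). apply Rmult_le_compat_l; [apply Rmult_le_pos; apply Cmod_ge_0|].
      eapply Rle_trans; [exact K1|]. right; unfold Rdiv; ring. }
    assert (X2 : Cmod s' * Cmod (Mel s') * Cmod (kz s' - kN N s') <= B2 * Rpower (INR N) (- Re s')).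
    { unfold B2. rewrite Rmult_assoc with (r1 := Cmod s' * Cmod (Mel s')). apply Rmult_le_compat_l; [apply Rmult_le_pos; apply Cmod_ge_0|].
      eapply Rle_trans; [exact K2|]. right; unfold Rdiv; ring. }
    assert (X3 : Cmod s * Cmod (s - RtoC 1) * Cmod (clint (errF s N) - clint (errF s' N)) <= A1 * Rpower (INR N) (- Re s) + A2 * Rpower (INR N) (- Re s')).
    { eapply Rle_trans; [apply Rmult_le_compat_l; [apply Rmult_le_pos; apply Cmod_ge_0|exact K3]|]. right; unfold A1, A2; ring. }
    lra. }
  assert (L : is_lim_seq (fun N => (A1 + B1) * Rpower (INR (S N)) (- Re s) + (A2 + B2) * Rpower (INR (S N)) (- Re s')) 0).
  { replace (Finite 0) with (Finite ((A1 + B1) * 0 + (A2 + B2) * 0)) by (f_equal; ring).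
    apply is_lim_seq_plus'; [apply (is_lim_seq_scal_l _ (A1 + B1) 0)|apply (is_lim_seq_scal_l _ (A2 + B2) 0)]; apply Rpower_lim_0; lra. }
  assert (C0 : Cmod Z <= 0).
  { apply (is_lim_seq_le (fun _ => Cmod Z) _ (Cmod Z) 0 (fun N => Bd (S N) ltac:(lia))); [apply is_lim_seq_const|exact L]. }
  assert (Z0 : Z = RtoC 0) by (apply Cmod_eq_0; pose proof (Cmod_ge_0 Z); lra).
  replace (s * kz s * Mel s)%C with (Z + s' * kz s' * Mel s')%C by (unfold Z; ring). rewrite Z0. ring.
Qed.

Lemma lint_pos (f : R -> R) : tame f -> (forall x, 0 < f x) -> 0 < lint f.
Proof.
  intros T P. assert (C := tame_cont f T).
  apply Rlt_le_trans with (RInt f (- INR 1) (INR 1)).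
  - apply RInt_gt_0; [simpl; lra|intros; apply P|]. intros; apply C.
  - apply (is_lim_seq_le_loc (fun _ => RInt f (- INR 1) (INR 1)) (fun N => RInt f (- INR N) (INR N)) (RInt f (- INR 1) (INR 1)) (lint f));
      [|apply is_lim_seq_const|now apply lint_lim].
    exists 1%nat. intros n Hn. apply le_INR in Hn.
    pose proof (RInt_Chasles f (- INR n) (- INR 1) (INR 1) ltac:(apply ex_RInt_cont, C) ltac:(apply ex_RInt_cont, C)) as C1.
    pose proof (RInt_Chasles f (- INR n) (INR 1) (INR n) ltac:(apply ex_RInt_cont, C) ltac:(apply ex_RInt_cont, C)) as C2.
    rewrite <- C2, <- C1. change plus with Rplus.
    assert (0 <= RInt f (- INR n) (- INR 1)) by (apply RInt_ge_0; [lra|apply ex_RInt_cont, C|intros; left; apply P]).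
    assert (0 <= RInt f (INR 1) (INR n)) by (apply RInt_ge_0; [lra|apply ex_RInt_cont, C|intros; left; apply P]). lra.
Qed.

(** * Asymptotics of the Mellin transform far to the right *)

Definition rMel (a : R) : R := lint (ker a).

Lemma rMel_rec (a : R) : 0 < a -> a * rMel a = 2 * PI * rMel (a + 2).
Proof.
  intros Ha. pose proof (ker_tame a Ha) as T1. pose proof (ker_tame (a + 2) ltac:(lra)) as T2.
  assert (D : forall v, is_derive (ker a) v (a * ker a v + (- (2 * PI)) * ker (a + 2) v)).
  { intros v. unfold ker.
    eapply derR_eq; [apply (derR_mult (fun v => gauss (exp v)))|].
    - apply (derR_comp gauss); [apply gauss_deriv|auto_derive; [easy|reflexivity]].
    - auto_derive; [easy|reflexivity].
    - rewrite Rmult_plus_distr_r, exp_plus. replace (exp (2 * v)) with (exp v * exp v) by (rewrite <- exp_plus; f_equal; ring). ring. }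
  pose proof (lint_deriv_0 _ _ D T1 (tame_lin _ _ _ _ T1 T2)) as Z. rewrite (lint_lin _ _ _ _ T1 T2) in Z. unfold rMel. lra.
Qed.

Lemma rMel_pos (a : R) : 0 < a -> 0 < rMel a.
Proof. intros Ha. apply lint_pos; [now apply ker_tame|]. intros; apply Rmult_lt_0_compat; apply exp_pos. Qed.

(** The bound is built from functions whose integrals against [ker] follow from the recurrence
    [rMel_rec] alone. The free parameter [kap] balances a constant against the exponential moment;
    it comes from the arithmetic-geometric mean inequality. *)
Lemma cexp_minus_1_moment (s : C) (u kap : R) : 0 < kap -> Rabs (Re s) <= 1 ->
  Cmod (cexp (RtoC u * s) - RtoC 1) <= kap + (2 * Cmod s + Cmod s ^ 2 / kap) * (exp (2 * u) + exp (- (2 * u)) - 2).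
Proof.
  intros Hk Hs. pose proof (Cmod_ge_0 s) as P0.
  set (S := exp (Rabs u) - exp (- Rabs u)). pose proof (Rabs_pos u) as Pu.
  assert (E2 : exp (2 * u) + exp (- (2 * u)) - 2 = S ^ 2).
  { assert (X : exp (2 * Rabs u) + exp (- (2 * Rabs u)) - 2 = S ^ 2).
    { unfold S. replace (exp (2 * Rabs u)) with (exp (Rabs u) ^ 2) by (rewrite exp_pow; f_equal; simpl; ring).
      replace (exp (- (2 * Rabs u))) with (exp (- Rabs u) ^ 2) by (rewrite exp_pow; f_equal; simpl; ring).
      assert (exp (Rabs u) * exp (- Rabs u) = 1) by (rewrite <- exp_plus, Rplus_opp_r; apply exp_0). nra. }
    rewrite <- X. unfold Rabs. destruct (Rcase_abs u); [|easy]. replace (2 * - u) with (- (2 * u)) by ring. rewrite Ropp_involutive. ring. }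
  assert (S1 : Rabs u <= S).
  { unfold S. pose proof (exp_ineq1_le (Rabs u)). assert (exp (- Rabs u) <= exp 0) by (apply exp_le; lra). rewrite exp_0 in *. lra. }
  assert (S2 : exp (Rabs u) <= S + 1).
  { unfold S. assert (exp (- Rabs u) <= exp 0) by (apply exp_le; lra). rewrite exp_0 in *. lra. }
  assert (M : Cmod (cexp (RtoC u * s) - RtoC 1) <= 2 * (Cmod s * Rabs u * exp (Rabs u))).
  { assert (Gen : forall g, (g = Re \/ g = Im) -> Rabs (g (cexp (RtoC u * s)) - g (cexp (RtoC 0 * s))) <= Cmod s * exp (Rabs u) * Rabs u).
    { intros g Hg.
      assert (D : forall y, is_derive (fun y => g (cexp (RtoC y * s))) y (g (s * cexp (RtoC y * s))%C)) by (intros y; destruct Hg; subst g; apply cexp_line).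
      assert (B : forall y, Rabs y <= Rabs u -> Rabs (g (s * cexp (RtoC y * s))%C) <= Cmod s * exp (Rabs u)).
      { intros y Hy. apply Rle_trans with (Cmod (s * cexp (RtoC y * s))); [destruct Hg; subst g; [apply re_le_Cmod|apply im_le_Cmod]|].
        rewrite Cmod_mult, Cmod_cexp. apply Rmult_le_compat_l; [easy|]. apply exp_le. rewrite Re_mult. simpl. rewrite Rmult_0_l, Rminus_0_r.
        eapply Rle_trans; [apply Rle_abs|]. rewrite Rabs_mult. pose proof (Rabs_pos y). nra. }
      destruct (Rle_lt_dec 0 u) as [Hu|Hu].
      - assert (E : Rabs u = u - 0) by (rewrite Rabs_right; lra).
        apply Rle_trans with (Cmod s * exp (Rabs u) * (u - 0)); [|rewrite <- E; lra].
        apply (MVT_abs_le (fun y => g (cexp (RtoC y * s))) (fun y => g (s * cexp (RtoC y * s))%C) 0 u); [easy|intros; apply D|].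
        intros y Hy. apply B. rewrite !Rabs_right; lra.
      - assert (E : Rabs u = 0 - u) by (rewrite Rabs_left; lra). rewrite Rabs_minus_sym.
        apply Rle_trans with (Cmod s * exp (Rabs u) * (0 - u)); [|rewrite <- E; lra].
        apply (MVT_abs_le (fun y => g (cexp (RtoC y * s))) (fun y => g (s * cexp (RtoC y * s))%C) u 0); [lra|intros; apply D|].
        intros y Hy. apply B. rewrite !Rabs_left1; lra. }
    assert (Z : cexp (RtoC 0 * s) = RtoC 1) by (rewrite Cmult_0_l; apply cexp_0).
    pose proof (Gen Re (or_introl eq_refl)) as A. pose proof (Gen Im (or_intror eq_refl)) as B. rewrite Z in A, B.
    eapply Rle_trans; [apply Cmod_le_sum|]. rewrite Re_minus, Im_minus. lra. }
  rewrite E2. eapply Rle_trans; [exact M|].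
  assert (M2 : Rabs u * exp (Rabs u) <= S * (S + 1)) by (apply Rmult_le_compat; try easy; left; apply exp_pos).
  assert (M3 : 2 * (Cmod s * S) <= kap + Cmod s ^ 2 / kap * S ^ 2).
  { assert (Q : 0 <= (Cmod s * S - kap) ^ 2 / kap) by pos.
    replace ((Cmod s * S - kap) ^ 2 / kap) with (Cmod s ^ 2 / kap * S ^ 2 - 2 * (Cmod s * S) + kap) in Q by (field; lra). lra. }
  assert (M4 : Cmod s * (Rabs u * exp (Rabs u)) <= Cmod s * (S * (S + 1))) by (apply Rmult_le_compat_l; easy).
  lra.
Qed.

(** A Stirling estimate from moments. The weight [ker] (2m) concentrates near a = log(m / pi) / 2,
    and under it exp(2(v - a)) + exp(-2(v - a)) - 2 has mean exactly 1 / (m - 1): the two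
    exponentials have means 1 and m / (m - 1) by [rMel_rec]. Inserting [cexp_minus_1_moment] gives
    the error e. *)
Lemma Mel_asymp (s : C) (n : nat) (kap : R) : 0 < Re s <= 1 -> (2 <= n)%nat -> 0 < kap ->
  let e := 2 * (kap + (2 * Cmod s + Cmod s ^ 2 / kap) / (INR n - 1)) in
  let W := Rpower (INR n / PI) (Re s / 2) * rMel (2 * INR n) in
  W * (1 - e) <= Cmod (Mel (s + RtoC (2 * INR n))) <= W * (1 + e).
Proof.
  intros Hs Hn Hk e W. apply le_INR in Hn. simpl (INR 2) in Hn. pose proof PI_RGT_0 as PP.
  set (m := INR n) in *. set (a := / 2 * ln (m / PI)).
  assert (Q : 0 < m / PI) by pos.
  assert (E1 : exp (2 * a) = m / PI) by (unfold a; rewrite <- Rmult_assoc, Rinv_r, Rmult_1_l by lra; now apply exp_ln).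
  pose proof (ker_tame (2 * m) ltac:(lra)) as T0. pose proof (ker_tame (2 * m + 2) ltac:(lra)) as T1. pose proof (ker_tame (2 * m - 2) ltac:(lra)) as T2.
  set (D := 2 * Cmod s + Cmod s ^ 2 / kap) in *.
  set (g := fun v => (kap - 2 * D) * ker (2 * m) v + D * ((PI / m) * ker (2 * m + 2) v + (m / PI) * ker (2 * m - 2) v)).
  assert (Tg : tame g) by (apply (tame_lin _ _ _ _ T0 (tame_lin _ _ _ _ T1 T2))).
  assert (Ig : lint g = (kap + D / (m - 1)) * rMel (2 * m)).
  { unfold g. rewrite (lint_lin _ _ _ _ T0 (tame_lin _ _ _ _ T1 T2)), (lint_lin _ _ _ _ T1 T2). fold (rMel (2 * m)) (rMel (2 * m + 2)) (rMel (2 * m - 2)).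
    pose proof (rMel_rec (2 * m) ltac:(lra)) as R1. pose proof (rMel_rec (2 * m - 2) ltac:(lra)) as R2.
    replace (2 * m - 2 + 2) with (2 * m) in R2 by ring.
    replace (rMel (2 * m + 2)) with (m / PI * rMel (2 * m)) by (apply Rmult_eq_reg_l with (2 * PI); [rewrite <- R1; field; lra|lra]).
    replace (rMel (2 * m - 2)) with (PI / (m - 1) * rMel (2 * m)).
    2:{ apply Rmult_eq_reg_l with (2 * m - 2); [rewrite R2; field; lra|lra]. }
    field; lra. }
  set (Z := cexp (RtoC a * s)).
  assert (EZ : Cmod Z = Rpower (m / PI) (Re s / 2)).
  { unfold Z. rewrite Cmod_cexp, Re_mult. unfold Rpower, a. simpl. f_equal. field. }
  assert (Ts : ctame (mel 1 (s + RtoC (2 * m)))) by (apply mel_tame_1; rewrite Re_plus; simpl; lra).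
  assert (Tk : ctame (fun v => RtoC (ker (2 * m) v))).
  { split; [exact T0|]. apply tame_ext with (fun v => 0 * ker (2 * m) v + 0 * ker (2 * m) v); [intros; simpl; ring|now apply tame_lin]. }
  assert (Ik : clint (fun v => RtoC (ker (2 * m) v)) = RtoC (rMel (2 * m))).
  { unfold clint, RtoC, rMel; simpl. f_equal. rewrite (lint_ext _ (fun v => 0 * ker (2 * m) v + 0 * ker (2 * m) v)) by (intros; simpl; ring). rewrite lint_lin by easy. ring. }
  assert (Diff : (Mel (s + RtoC (2 * m)) - Z * RtoC (rMel (2 * m)))%C = clint (fun v => mel 1 (s + RtoC (2 * m)) v + (- Z) * RtoC (ker (2 * m) v))%C).
  { rewrite clint_plus, clint_scal, Ik; [fold (Mel (s + RtoC (2 * m))); ring|exact Tk|exact Ts|exact (ctame_scal _ _ Tk)]. }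
  assert (Bd : Cmod (Mel (s + RtoC (2 * m)) - Z * RtoC (rMel (2 * m))) <= Cmod Z * (e * rMel (2 * m))).
  { rewrite Diff.
    eapply Rle_trans; [apply (clint_le _ (fun v => Cmod Z * g v + 0 * g v))|].
    - apply ctame_plus; [exact Ts|exact (ctame_scal _ _ Tk)].
    - now apply tame_lin.
    - intros v.
      assert (X : (mel 1 (s + RtoC (2 * m)) v + - Z * RtoC (ker (2 * m) v))%C = (Z * RtoC (ker (2 * m) v) * (cexp (RtoC (v - a) * s) - RtoC 1))%C).
      { unfold mel, Z, ker. rewrite Rmult_1_l, Cmult_plus_distr_l, cexp_plus, <- RtoC_mult, cexp_RtoC.
        replace (RtoC (v - a) * s)%C with (RtoC v * s + - (RtoC a * s))%C by (rewrite RtoC_minus; ring). rewrite cexp_plus.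
        assert (Y : (cexp (RtoC a * s) * cexp (- (RtoC a * s)))%C = RtoC 1) by (rewrite <- cexp_plus, Cplus_opp_r; apply cexp_0).
        rewrite !RtoC_mult. rewrite (Rmult_comm v).
        transitivity (RtoC (gauss (exp v)) * RtoC (exp (2 * m * v)) * (cexp (RtoC v * s) * (cexp (RtoC a * s) * cexp (- (RtoC a * s))) - cexp (RtoC a * s)))%C; [rewrite Y; ring|ring]. }
      rewrite X, !Cmod_mult, Cmod_R. rewrite Rabs_right by pos.
      rewrite Rmult_0_l, Rplus_0_r, Rmult_assoc. apply Rmult_le_compat_l; [apply Cmod_ge_0|].
      pose proof (cexp_minus_1_moment s (v - a) kap Hk ltac:(rewrite Rabs_right; lra)) as B.
      assert (PK : 0 < ker (2 * m) v) by pos.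
      apply Rle_trans with (ker (2 * m) v * (kap + D * (exp (2 * (v - a)) + exp (- (2 * (v - a))) - 2))); [apply Rmult_le_compat_l; [lra|exact B]|].
      right. unfold g, ker.
      replace (exp ((2 * m + 2) * v)) with (exp (2 * m * v) * exp (2 * v)) by (rewrite <- exp_plus; f_equal; ring).
      replace (exp ((2 * m - 2) * v)) with (exp (2 * m * v) * / exp (2 * v)) by (rewrite <- exp_Ropp, <- exp_plus; f_equal; ring).
      replace (exp (- (2 * (v - a)))) with (exp (2 * a) * / exp (2 * v)) by (rewrite <- exp_Ropp, <- exp_plus; f_equal; ring).
      replace (exp (2 * (v - a))) with (exp (2 * v) * / exp (2 * a)) by (rewrite <- exp_Ropp, <- exp_plus; f_equal; ring).
      rewrite E1. pose proof (exp_pos (2 * v)). field. repeat split; lra.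
    - rewrite lint_lin, Ig by easy. unfold e. right; ring. }
  rewrite EZ in Bd. set (P := Rpower (m / PI) (Re s / 2)) in *. pose proof (rMel_pos (2 * m) ltac:(lra)) as PM.
  assert (EM : Cmod (Z * RtoC (rMel (2 * m))) = W) by (rewrite Cmod_mult, Cmod_R, EZ, Rabs_right by lra; easy).
  pose proof (Cmod_rev_triangle (Mel (s + RtoC (2 * m))) (Z * RtoC (rMel (2 * m)))) as U1.
  pose proof (Cmod_rev_triangle (Z * RtoC (rMel (2 * m))) (Mel (s + RtoC (2 * m)))) as U2.
  rewrite (Cmod_sub_sym (Z * RtoC (rMel (2 * m)))) in U2.
  replace (P * (e * rMel (2 * m))) with (W * e) in Bd by (unfold W; ring). lra.
Qed.

(** * Quotients of gamma factors *)

(** The moduli of the factors s + 2, ..., s + 2n collected when [Mel_rec] is iterated; the factor s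
    itself is kept apart because it already occurs in the completed zeta function. *)
Fixpoint gprod (n : nat) (s : C) : R :=
  match n with O => 1 | S k => gprod k s * Cmod (s + RtoC (2 * INR (S k))) end.

Lemma gprod_S (n : nat) (s : C) : gprod (S n) s = gprod n s * Cmod (s + RtoC (2 * INR (S n))).
Proof. easy. Qed.

Lemma Cmod_shift_pos (s : C) (n : nat) : 0 < Re s -> 2 * INR n < Cmod (s + RtoC (2 * INR n)).
Proof.
  intros Hs. pose proof (re_le_Cmod (s + RtoC (2 * INR n))) as A. rewrite Re_plus in A. change (Re (RtoC (2 * INR n))) with (2 * INR n) in A.
  pose proof (pos_INR n). rewrite Rabs_right in A; lra.
Qed.

Lemma gprod_pos (n : nat) (s : C) : 0 < Re s -> 0 < gprod n s.
Proof.
  intros Hs. induction n as [|n IH]; [simpl; lra|]. apply Rmult_lt_0_compat; [easy|].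
  pose proof (Cmod_shift_pos s (S n) Hs). pose proof (pos_INR (S n)). lra.
Qed.

Lemma Mel_gprod (n : nat) (s : C) : 0 < Re s ->
  Cmod s * gprod n s * Cmod (Mel s) = (2 * PI) ^ S n * Cmod (Mel (s + RtoC (2 * INR (S n)))).
Proof.
  intros Hs. pose proof PI_RGT_0 as PP.
  assert (Step : forall w, 0 < Re w -> Cmod w * Cmod (Mel w) = 2 * PI * Cmod (Mel (w + RtoC 2))).
  { intros w Hw. rewrite <- Cmod_mult, Mel_rec, Cmod_mult, Cmod_R, Rabs_right by lra. easy. }
  induction n as [|n IH].
  - rewrite Rmult_1_r, Step by easy. rewrite pow_1. now rewrite Rmult_1_r.
  - rewrite gprod_S. replace (Cmod s * (gprod n s * Cmod (s + RtoC (2 * INR (S n)))) * Cmod (Mel s))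
      with (Cmod (s + RtoC (2 * INR (S n))) * (Cmod s * gprod n s * Cmod (Mel s))) by ring.
    rewrite IH. replace (Cmod (s + RtoC (2 * INR (S n))) * ((2 * PI) ^ S n * Cmod (Mel (s + RtoC (2 * INR (S n))))))
      with ((2 * PI) ^ S n * (Cmod (s + RtoC (2 * INR (S n))) * Cmod (Mel (s + RtoC (2 * INR (S n)))))) by ring.
    rewrite Step.
    + replace (s + RtoC (2 * INR (S n)) + RtoC 2)%C with (s + RtoC (2 * INR (S (S n))))%C.
      * rewrite <- (tech_pow_Rmult _ (S n)). ring.
      * rewrite <- Cplus_assoc, <- RtoC_plus. f_equal. f_equal. rewrite (S_INR (S n)). ring.
    + rewrite Re_plus. change (Re (RtoC (2 * INR (S n)))) with (2 * INR (S n)). pose proof (pos_INR (S n)). lra.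
Qed.

(* The limit of [gquot n h z] is the modulus of the quotient of the gamma factors at [z - h] and [z + h]. *)
Definition gquot (n : nat) (h : R) (z : C) : R :=
  Rpower (INR (S n) / PI) (- h) * (gprod n (z + RtoC h) / gprod n (z - RtoC h)).

Lemma ln_succ_lower (m : R) : 0 < m -> / (m + 1) <= ln (m + 1) - ln m.
Proof.
  intros Hm. rewrite <- ln_div by lra.
  assert (E : ln (m / (m + 1)) <= m / (m + 1) - 1).
  { pose proof (exp_ineq1_le (m / (m + 1) - 1)) as I. replace (1 + (m / (m + 1) - 1)) with (m / (m + 1)) in I by ring.
    apply ln_le in I; [rewrite ln_exp in I; lra|pos]. }
  replace ((m + 1) / m) with (/ (m / (m + 1))) by (field; lra). rewrite ln_Rinv by pos.
  replace (m / (m + 1) - 1) with (- / (m + 1)) in E by (field; lra). lra.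
Qed.

(** The k-th quotient is at most 1 + h / k <= exp(h / k), and log(n + 1) + 1 - 1/(n + 1) bounds the
    n-th harmonic number. *)
Lemma gprod_quot_bound (n : nat) (h : R) (z : C) : 0 < h <= 1 / 4 -> 1 / 2 <= Re z ->
  gprod n (z + RtoC h) <= exp (h * (ln (INR (S n)) + 1 - / INR (S n))) * gprod n (z - RtoC h).
Proof.
  intros Hh Hz. assert (Rm : 0 < Re (z - RtoC h)) by (rewrite Re_minus; simpl; lra).
  assert (Rp : 0 < Re (z + RtoC h)) by (rewrite Re_plus; simpl; lra).
  induction n as [|n IH].
  - simpl gprod. change (INR 1) with 1. rewrite ln_1, Rinv_1. replace (h * (0 + 1 - 1)) with 0 by ring. rewrite exp_0. lra.
  - rewrite !gprod_S. set (m := INR (S n)) in *. assert (Pm : 1 <= m) by (apply (le_INR 1); lia).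
    pose proof (Cmod_shift_pos _ (S n) Rm) as L. fold m in L. set (B := Cmod (z - RtoC h + RtoC (2 * m))) in *.
    assert (A : Cmod (z + RtoC h + RtoC (2 * m)) <= exp (h / m) * B).
    { apply Rle_trans with (B + 2 * h).
      - replace (z + RtoC h + RtoC (2 * m))%C with ((z - RtoC h + RtoC (2 * m)) + RtoC (2 * h))%C by (rewrite !RtoC_mult; ring).
        eapply Rle_trans; [apply Cmod_triangle|]. rewrite Cmod_R, Rabs_right by lra. fold B. lra.
      - pose proof (exp_ineq1_le (h / m)) as I. apply Rle_trans with ((1 + h / m) * B); [|apply Rmult_le_compat_r; lra].
        assert (2 * h <= h / m * B); [|lra]. replace (2 * h) with (h / m * (2 * m)) by (field; lra).
        apply Rmult_le_compat_l; [apply Rlt_le, Rdiv_lt_0_compat|]; lra. }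
    assert (E : exp (h * (ln m + 1 - / m)) * exp (h / m) <= exp (h * (ln (INR (S (S n))) + 1 - / INR (S (S n))))).
    { rewrite <- exp_plus. apply exp_le. rewrite (S_INR (S n)). fold m. pose proof (ln_succ_lower m ltac:(lra)).
      replace (h * (ln m + 1 - / m) + h / m) with (h * (ln m + 1)) by (field; lra). apply Rmult_le_compat_l; lra. }
    pose proof (gprod_pos n _ Rm) as P1. pose proof (gprod_pos n _ Rp) as P2.
    apply Rle_trans with (exp (h * (ln m + 1 - / m)) * gprod n (z - RtoC h) * (exp (h / m) * B)).
    + apply Rmult_le_compat; [lra|apply Cmod_ge_0|exact IH|exact A].
    + replace (exp (h * (ln m + 1 - / m)) * gprod n (z - RtoC h) * (exp (h / m) * B)) with (exp (h * (ln m + 1 - / m)) * exp (h / m) * (gprod n (z - RtoC h) * B)) by ring.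
      apply Rmult_le_compat_r; [pos|exact E].
Qed.

(** Uniform in n and z, so that in the Phragmen-Lindelof argument the size of the rectangle can be
    fixed before n. *)
Lemma gquot_bound (n : nat) (h : R) (z : C) : 0 < h <= 1 / 4 -> 1 / 2 <= Re z -> 0 < gquot n h z <= 3.
Proof.
  intros Hh Hz. assert (Rm : 0 < Re (z - RtoC h)) by (rewrite Re_minus; simpl; lra).
  assert (Rp : 0 < Re (z + RtoC h)) by (rewrite Re_plus; simpl; lra).
  pose proof (gprod_pos n _ Rm) as P1. pose proof (gprod_pos n _ Rp) as P2. pose proof PI_RGT_0 as PP.
  assert (Pm : 0 < INR (S n)) by (apply lt_0_INR; lia). split.
  - apply Rmult_lt_0_compat; [apply exp_pos|pos].
  - pose proof (gprod_quot_bound n h z Hh Hz) as B.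
    apply Rle_trans with (Rpower (INR (S n) / PI) (- h) * exp (h * (ln (INR (S n)) + 1 - / INR (S n)))).
    + apply Rmult_le_compat_l; [pos|]. now apply Rle_div_l.
    + unfold Rpower. rewrite <- exp_plus. rewrite ln_div by easy. apply Rle_trans with (exp 1); [|apply exp_le_3]. apply exp_le.
      assert (LP : ln PI <= 2).
      { rewrite <- (ln_exp 2). apply ln_le; [easy|]. pose proof PI_4. pose proof (exp_ineq1_le 1). replace 2 with (1 + 1) by ring. rewrite exp_plus.
        assert (4 <= exp 1 * exp 1) by nra. lra. }
      assert (0 < / INR (S n)) by now apply Rinv_0_lt_compat. nra.
Qed.

Lemma Mel_conj (s : C) : 0 < Re s -> Mel (Cconj s) = Cconj (Mel s).
Proof.
  intros Hs. destruct (mel_tame_1 s Hs) as [_ B]. unfold Mel, clint.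
  assert (E : forall v, mel 1 (Cconj s) v = Cconj (mel 1 s v)).
  { intros v. unfold mel, cexp, Cconj, RtoC, Cmult; simpl.
    replace (0 * snd s) with 0 by ring.
    replace (v * fst s - 0 * - snd s) with (v * fst s - 0) by ring. replace (v * - snd s + 0 * fst s) with (- (v * snd s + 0 * fst s)) by ring.
    rewrite cos_neg, sin_neg. f_equal; ring. }
  change (Cconj (lint (fun x => Re (mel 1 s x)), lint (fun x => Im (mel 1 s x)))) with (lint (fun x => Re (mel 1 s x)), - lint (fun x => Im (mel 1 s x))).
  f_equal.
  - apply lint_ext. intros v. now rewrite E.
  - rewrite (lint_ext _ (fun v => (-1) * Im (mel 1 s v) + 0 * Im (mel 1 s v))).
    + rewrite lint_lin by easy. ring.
    + intros v. rewrite E. simpl. ring.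
Qed.

Lemma boundary_limit (h Z eps : R) : 0 < h <= 1 / 4 -> 0 < Z -> 0 < eps <= 1 -> exists N0, forall n z, (N0 <= n)%nat ->
  Re z = 1 / 2 -> Cmod z <= Z ->
  Cmod (kz (z - RtoC h)) * gquot n h z <= (1 + eps) * Cmod (kz (z + RtoC h)).
Proof.
  intros Hh HZ He. set (Y := Z + 1). set (kap := eps / 16). assert (Pk : 0 < kap) by (unfold kap; lra).
  set (D := 2 * Y + Y ^ 2 / kap). assert (PD : 0 <= D).
  { assert (0 <= Y ^ 2 / kap) by pos. unfold D, Y in *; lra. }
  destruct (nfloor_ex (16 * D / eps)) as [k0 Hk0]; [apply Rmult_le_pos; [lra|pos]|].
  exists (S k0). intros n z Hn Hz HzZ.
  assert (PN : D / INR n <= eps / 16 /\ 0 < INR n).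
  { apply le_INR in Hn. rewrite S_INR in Hn. pose proof (pos_INR k0). split; [|lra]. apply Rle_div_l; [lra|].
    assert (16 * D / eps <= INR n) by lra. apply (Rle_div_l _ _ eps) in H0; lra. }
  destruct PN as [PN1 PN0].
  set (s := (z + RtoC h)%C). set (w := (z - RtoC h)%C).
  assert (Rs : Re s = 1 / 2 + h) by (unfold s; rewrite Re_plus; simpl; lra).
  assert (Rw : Re w = 1 / 2 - h) by (unfold w; rewrite Re_minus; simpl; lra).
  assert (Cs : Cmod s <= Y) by (unfold s, Y; eapply Rle_trans; [apply Cmod_triangle|]; rewrite Cmod_R, Rabs_right; lra).
  assert (Cw : Cmod w <= Y).
  { unfold w, Y, Cminus; eapply Rle_trans; [apply Cmod_triangle|]; rewrite Cmod_opp, Cmod_R, Rabs_right; lra. }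
  assert (Conj : (RtoC 1 - s)%C = Cconj w).
  { destruct z as [x y]. simpl in Hz. unfold Cconj, Cminus, Cplus, Copp, RtoC; simpl. f_equal; lra. }
  pose proof (kz_functional s ltac:(lra)) as FE. rewrite Conj, kz_conj, Mel_conj in FE by lra.
  apply (f_equal Cmod) in FE. rewrite !Cmod_mult, !Cmod_conj in FE.
  pose proof (Mel_gprod n s ltac:(lra)) as Gs. pose proof (Mel_gprod n w ltac:(lra)) as Gw.
  set (N := INR (S n)) in *. assert (EN : N - 1 = INR n) by (unfold N; rewrite S_INR; ring).
  assert (Hn2 : (2 <= S n)%nat) by lia.
  pose proof (Mel_asymp s (S n) kap ltac:(lra) Hn2 Pk) as As. pose proof (Mel_asymp w (S n) kap ltac:(lra) Hn2 Pk) as Aw. fold N in As, Aw.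
  rewrite EN in As, Aw.
  assert (Er : forall u, Cmod u <= Y -> 2 * (kap + (2 * Cmod u + Cmod u ^ 2 / kap) / INR n) <= eps / 4).
  { intros u Hu. pose proof (Cmod_ge_0 u). assert (2 * Cmod u + Cmod u ^ 2 / kap <= D).
    { apply Rplus_le_compat; [lra|]. apply Rmult_le_compat_r; [pos|]. apply pow_incr; lra. }
    assert ((2 * Cmod u + Cmod u ^ 2 / kap) / INR n <= D / INR n) by (apply Rmult_le_compat_r; [pos|easy]). unfold kap in *; lra. }
  pose proof (Er s Cs) as Es. pose proof (Er w Cw) as Ew.
  rewrite Rs in As. rewrite Rw in Aw.
  pose proof (rMel_pos (2 * N) ltac:(lra)) as PM. set (rM := rMel (2 * N)) in *.
  set (Q := N / PI) in *. pose proof PI_RGT_0 as PP.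
  set (Wp := Rpower Q ((1 / 2 + h) / 2) * rM) in *. set (Wm := Rpower Q ((1 / 2 - h) / 2) * rM) in *.
  assert (PWp : 0 < Wp) by pos.
  assert (PWm : 0 < Wm) by pos.
  assert (EW : Wp = Rpower Q h * Wm).
  { unfold Wp, Wm. rewrite <- Rmult_assoc, <- Rpower_plus. f_equal; f_equal; field. }
  set (Ms := Cmod (Mel (s + RtoC (2 * N)))) in *. set (Mw := Cmod (Mel (w + RtoC (2 * N)))) in *.
  assert (Bs : Ms <= Wp * (1 + eps / 4)) by (eapply Rle_trans; [apply As|]; apply Rmult_le_compat_l; lra).
  assert (Bw : Wm * (1 - eps / 4) <= Mw) by (eapply Rle_trans; [|apply Aw]; apply Rmult_le_compat_l; lra).
  pose proof (gprod_pos n s ltac:(lra)) as Ps. pose proof (gprod_pos n w ltac:(lra)) as Pw.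
  set (ks := Cmod (kz s)) in *. set (kw := Cmod (kz w)) in *. assert (Pks : 0 <= ks) by apply Cmod_ge_0. assert (Pkw : 0 <= kw) by apply Cmod_ge_0.
  assert (Id : kw * gprod n s * Mw = ks * gprod n w * Ms).
  { apply Rmult_eq_reg_l with ((2 * PI) ^ S n); [|apply pow_nonzero; lra].
    replace ((2 * PI) ^ S n * (kw * gprod n s * Mw)) with (kw * gprod n s * ((2 * PI) ^ S n * Mw)) by ring.
    replace ((2 * PI) ^ S n * (ks * gprod n w * Ms)) with (ks * gprod n w * ((2 * PI) ^ S n * Ms)) by ring.
    rewrite <- Gs, <- Gw.
    replace (kw * gprod n s * (Cmod w * gprod n w * Cmod (Mel w))) with (gprod n s * gprod n w * (Cmod w * kw * Cmod (Mel w))) by ring.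
    rewrite <- FE. ring. }
  unfold gquot.
  assert (R1 : kw * gprod n s * (Wm * (1 - eps / 4)) <= ks * gprod n w * (Wp * (1 + eps / 4))).
  { apply Rle_trans with (kw * gprod n s * Mw); [apply Rmult_le_compat_l; [pos|exact Bw]|].
    rewrite Id. apply Rmult_le_compat_l; [pos|exact Bs]. }
  assert (R2 : kw * (Rpower Q (- h) * (gprod n s / gprod n w)) * (1 - eps / 4) <= ks * (1 + eps / 4)).
  { apply Rmult_le_reg_l with (gprod n w * Wp); [pos|].
    rewrite EW at 1. rewrite Rpower_Ropp.
    replace (gprod n w * (Rpower Q h * Wm) * (kw * (/ Rpower Q h * (gprod n s / gprod n w)) * (1 - eps / 4)))
      with (kw * gprod n s * (Wm * (1 - eps / 4))).
    - eapply Rle_trans; [exact R1|]. right; ring.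
    - field. split; [lra|]. apply Rgt_not_eq, exp_pos. }
  set (X := kw * (Rpower Q (- h) * (gprod n s / gprod n w))) in *.
  apply Rmult_le_reg_r with (1 - eps / 4); [lra|]. eapply Rle_trans; [exact R2|].
  replace ((1 + eps) * ks * (1 - eps / 4)) with (ks * ((1 + eps) * (1 - eps / 4))) by ring. apply Rmult_le_compat_l; [easy|]. nra.
Qed.

(** * Phragmen-Lindelof *)

(** Translation stays inside the syntax because exp(b (z + a)) is a constant multiple of exp(b
    z). *)
Fixpoint hshift (a : C) (e : hexp) : hexp :=
  match e with
  | HConst b => HConst b
  | HVar => HAdd HVar (HConst a)
  | HExp b => HMul (HConst (cexp (RtoC b * a))) (HExp b)
  | HAdd e1 e2 => HAdd (hshift a e1) (hshift a e2)
  | HMul e1 e2 => HMul (hshift a e1) (hshift a e2)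
  | HInv e => HInv (hshift a e)
  end.

Lemma hshift_eval (a : C) (e : hexp) (z : C) : heval (hshift a e) z = heval e (z + a) /\ (hwf e (z + a) -> hwf (hshift a e) z).
Proof.
  induction e as [b| |b|e1 [E1 W1] e2 [E2 W2]|e1 [E1 W1] e2 [E2 W2]|e [E W]]; simpl.
  - easy.
  - easy.
  - split; [|easy]. rewrite <- cexp_plus. f_equal. ring.
  - rewrite E1, E2. tauto.
  - rewrite E1, E2. tauto.
  - rewrite E. tauto.
Qed.

Fixpoint gprod_e (n : nat) (a : C) : hexp :=
  match n with O => HConst (RtoC 1) | S k => HMul (gprod_e k a) (HAdd HVar (HConst (a + RtoC (2 * INR (S k))))) end.

Lemma gprod_e_eval (n : nat) (a z : C) : Cmod (heval (gprod_e n a) z) = gprod n (z + a) /\ hwf (gprod_e n a) z.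
Proof.
  induction n as [|n [E W]]; [simpl; split; [apply Cmod_1|easy]|].
  change (heval (gprod_e (S n) a) z) with (heval (gprod_e n a) z * (z + (a + RtoC (2 * INR (S n)))))%C.
  rewrite Cmod_mult, E, gprod_S, <- Cplus_assoc. easy.
Qed.

Section PL.
Variables (h del : R) (K N n : nat).
Hypothesis Hh : 0 < h <= 1 / 4.
Hypothesis Hdel : 0 < del.
Hypothesis HN : (1 <= N)%nat.

Let base := HInv (HAdd (HConst (RtoC 1)) (HMul (HConst (RtoC del)) HVar)).
Let damp := proj1_sig (heval_pow base (S K)).

(** The quotient to be bounded, damped by (1 + del z)^(-K - 1). Polynomial damping suffices because
    the growth is polynomial, and this factor tends to 1 on bounded sets as [del] tends to 0. *)
Let plF : hexp :=
  HMul (HMul (HConst (RtoC (Rpower (INR (S n) / PI) (- h)))) (HMul (gprod_e n (RtoC h)) (HInv (gprod_e n (- RtoC h)))))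
    (HMul (HMul (hshift (- RtoC h) (kN_e N)) (HInv (hshift (RtoC h) (kN_e N)))) damp).

Lemma damp_den (z : C) : -1 / 2 < del * Re z -> 1 + del * Re z <= Cmod (RtoC 1 + RtoC del * z) /\ 0 < Cmod (RtoC 1 + RtoC del * z).
Proof.
  intros Hz. pose proof (re_le_Cmod (RtoC 1 + RtoC del * z)) as A. rewrite Re_plus, Re_mult in A. simpl in A.
  pose proof (Rle_abs (1 + (del * Re z - 0 * Im z))) as B. lra.
Qed.

Lemma plF_eval (z : C) : h < Re z -> kN N (z + RtoC h) <> RtoC 0 ->
  hwf plF z /\ Cmod (heval plF z) = gquot n h z * (Cmod (kN N (z - RtoC h)) / Cmod (kN N (z + RtoC h))) / Cmod (RtoC 1 + RtoC del * z) ^ S K.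
Proof.
  intros Hz Hk.
  destruct (damp_den z) as [_ PD]; [assert (0 <= del * Re z) by pos; lra|].
  destruct (gprod_e_eval n (RtoC h) z) as [G1 W1]. destruct (gprod_e_eval n (- RtoC h) z) as [G2 W2].
  destruct (hshift_eval (- RtoC h) (kN_e N) z) as [S1 V1]. destruct (hshift_eval (RtoC h) (kN_e N) z) as [S2 V2].
  destruct (kN_e_eval N (z + - RtoC h) HN) as [K1 U1]. destruct (kN_e_eval N (z + RtoC h) HN) as [K2 U2].
  rewrite K1 in S1. rewrite K2 in S2.
  assert (Pm : 0 < gprod n (z + - RtoC h)) by (apply gprod_pos; rewrite Re_plus; simpl; lra).
  assert (Nz1 : heval (gprod_e n (- RtoC h)) z <> RtoC 0) by (apply Cmod_pos_neq; rewrite G2; easy).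
  assert (Wb : hwf base z) by (unfold base; simpl; repeat split; now apply Cmod_pos_neq).
  pose proof (proj2_sig (heval_pow base (S K))) as Q. destruct Q as [Q1 Q2].
  split.
  - change (((True /\ (hwf (gprod_e n (RtoC h)) z /\ (hwf (gprod_e n (- RtoC h)) z /\ heval (gprod_e n (- RtoC h)) z <> RtoC 0))))
      /\ ((hwf (hshift (- RtoC h) (kN_e N)) z /\ (hwf (hshift (RtoC h) (kN_e N)) z /\ heval (hshift (RtoC h) (kN_e N)) z <> RtoC 0)) /\ hwf damp z)).
    rewrite S2. specialize (Q2 z Wb). tauto.
  - unfold plF. change (heval (HMul ?a ?b) z) with (heval a z * heval b z)%C.
    change (heval (HMul ?a ?b) z) with (heval a z * heval b z)%C.
    change (heval (HMul ?a ?b) z) with (heval a z * heval b z)%C. rewrite !Cmod_mult.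
    change (heval (HInv ?a) z) with (/ heval a z)%C. change (heval (HConst ?a) z) with a.
    rewrite Q1, S1, S2, !Cmod_inv, G1, G2, Cmod_R by (try easy; rewrite S2; easy).
    rewrite Rabs_right by pos.
    replace (Cmod (Cpow (heval base z) (S K))) with (/ Cmod (RtoC 1 + RtoC del * z) ^ S K).
    + unfold gquot, Rdiv, Cminus. ring.
    + assert (P : forall w k, Cmod (Cpow w k) = Cmod w ^ k).
      { intros w k. induction k as [|k IH]; [apply Cmod_1|]. change (Cpow w (S k)) with (w * Cpow w k)%C. rewrite Cmod_mult, IH. easy. }
      rewrite P. unfold base. change (heval (HInv ?a) z) with (/ heval a z)%C. rewrite Cmod_inv by now apply Cmod_pos_neq.
      rewrite pow_inv. easy.
Qed.

Lemma pl_rectangle (X eta B : R) (z0 : C) : 0 < eta <= h / 2 -> del * eta < 1 / 2 -> 1 / 2 < X ->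
  (forall z, in_rect (1 / 2 - eta) (X + eta) (- X - eta) (X + eta) z -> kN N (z + RtoC h) <> RtoC 0) ->
  (forall z, on_bdry (1 / 2) X (- X) X z ->
     gquot n h z * (Cmod (kN N (z - RtoC h)) / Cmod (kN N (z + RtoC h))) / Cmod (RtoC 1 + RtoC del * z) ^ S K <= B) ->
  in_rect (1 / 2) X (- X) X z0 ->
  gquot n h z0 * (Cmod (kN N (z0 - RtoC h)) / Cmod (kN N (z0 + RtoC h))) / Cmod (RtoC 1 + RtoC del * z0) ^ S K <= B.
Proof.
  intros Heta Hd HX Hnz HB Hin.
  assert (Sub : forall z, in_rect (1 / 2) X (- X) X z -> in_rect (1 / 2 - eta) (X + eta) (- X - eta) (X + eta) z).
  { intros z [A1 A2]. split; lra. }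
  rewrite <- (proj2 (plF_eval z0 ltac:(destruct Hin; lra) (Hnz _ (Sub _ Hin)))).
  apply (max_modulus plF (1 / 2) X (- X) X eta B); try lra; [| |easy].
  - intros z Hz. apply plF_eval; [destruct Hz; lra|now apply Hnz].
  - intros z Hz. destruct Hz as [Hz1 Hz2]. rewrite (proj2 (plF_eval z ltac:(destruct Hz1; lra) (Hnz _ (Sub _ Hz1)))).
    apply HB. now split.
Qed.
End PL.

(** Replaces [kz] by [kN] in numerator and denominator: m bounds the denominator from below, and a
    perturbation of one percent of m eps changes the bound c by at most eps. *)
Lemma quot_perturb (a b a' b' e m q c eps : R) : 0 < eps <= 1 -> 0 < m -> m <= b -> 0 <= a -> Rabs (a - a') <= e -> Rabs (b - b') <= e ->
  0 <= a' -> e <= m / 100 * eps -> 0 <= q <= 3 -> q * a <= c * b -> 0 <= c <= 1 + eps -> q * (a' / b') <= c + eps.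
Proof.
  intros He Hm Hb Ha A1 A2 Ha' Hsm Hq H Hc. apply Rabs_le_between in A1. apply Rabs_le_between in A2.
  assert (E1 : e <= b / 100 * eps) by (assert (m / 100 * eps <= b / 100 * eps) by (apply Rmult_le_compat_r; lra); lra).
  assert (Pb' : 0 < b') by nra.
  replace (q * (a' / b')) with (q * a' / b') by (unfold Rdiv; ring). apply Rle_div_l; [lra|].
  apply Rle_trans with (q * a + q * e); [rewrite <- Rmult_plus_distr_l; apply Rmult_le_compat_l; lra|].
  apply Rle_trans with ((c + eps) * (b - e)); [|apply Rmult_le_compat_l; lra].
  assert (q * e <= 3 * e) by (apply Rmult_le_compat_r; lra).
  assert (c * e <= 2 * e) by (apply Rmult_le_compat_r; lra). assert (eps * e <= 1 * e) by (apply Rmult_le_compat_r; lra). lra.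
Qed.

Lemma kz_quot_growth (h : R) : RH -> 0 < h <= 1 / 4 -> exists (K : nat) (A : R), 0 < A /\
  forall z, 1 / 2 <= Re z -> Cmod (kz (z - RtoC h)) <= A * (1 + Cmod z) ^ K * Cmod (kz (z + RtoC h)).
Proof.
  intros HRH Hh. destruct (kz_inv_growth h HRH Hh) as [K [A [PA HA]]].
  exists (2 + K)%nat, (36 * (A * 2 ^ K)). assert (P2 : 0 < 2 ^ K) by (apply pow_lt; lra).
  assert (PA2 : 0 < A * 2 ^ K) by now apply Rmult_lt_0_compat.
  split; [lra|]. intros z Hz. pose proof (Cmod_ge_0 z) as Pz.
  specialize (HA (z + RtoC h)%C ltac:(rewrite Re_plus; simpl; lra)).
  set (b := Cmod (kz (z + RtoC h))) in *. assert (Pb : 0 <= b) by apply Cmod_ge_0.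
  assert (C1 : 1 + Cmod (z + RtoC h) <= 2 * (1 + Cmod z)).
  { eapply Rle_trans; [apply Rplus_le_compat_l, Cmod_triangle|]. rewrite Cmod_R, Rabs_right; lra. }
  assert (C2 : 1 <= A * 2 ^ K * (1 + Cmod z) ^ K * b).
  { eapply Rle_trans; [exact HA|]. rewrite (Rmult_assoc A (2 ^ K)), <- Rpow_mult_distr.
    apply Rmult_le_compat_r; [easy|]. apply Rmult_le_compat_l; [lra|]. apply pow_incr. pose proof (Cmod_ge_0 (z + RtoC h)); lra. }
  set (s := (z - RtoC h)%C).
  assert (S1 : Cmod s <= 2 + Cmod z).
  { eapply Rle_trans; [apply Cmod_triangle|]. rewrite Cmod_opp, Cmod_R, Rabs_right; lra. }
  assert (S2 : Cmod (s - RtoC 1) <= 2 + Cmod z).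
  { eapply Rle_trans; [apply Cmod_triangle|]. eapply Rle_trans; [apply Rplus_le_compat_r, Cmod_triangle|].
    rewrite !Cmod_opp, !Cmod_R, !Rabs_right; lra. }
  assert (Rs : 1 / 4 <= Re s) by (unfold s; rewrite Re_minus; simpl; lra).
  assert (G : Cmod (kz s) <= 36 * (1 + Cmod z) ^ 2).
  { eapply Rle_trans; [apply kz_growth; lra|].
    assert (Q : 0 < 2 / Re s <= 8) by (split; [apply Rdiv_lt_0_compat|apply Rle_div_l]; lra).
    pose proof (Cmod_ge_0 s). pose proof (Cmod_ge_0 (s - RtoC 1)).
    assert (Cmod s * Cmod (s - RtoC 1) <= (2 + Cmod z) * (2 + Cmod z)) by (apply Rmult_le_compat; easy).
    nra. }
  rewrite pow_add. assert (P1 : 0 <= (1 + Cmod z) ^ 2) by apply pow2_ge_0.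
  apply Rle_trans with (36 * (1 + Cmod z) ^ 2 * (A * 2 ^ K * (1 + Cmod z) ^ K * b)); [|right; ring].
  assert (36 * (1 + Cmod z) ^ 2 * 1 <= 36 * (1 + Cmod z) ^ 2 * (A * 2 ^ K * (1 + Cmod z) ^ K * b)) by (apply Rmult_le_compat_l; lra).
  lra.
Qed.

Lemma Cmod_one_plus (d : R) (z : C) : 0 < d -> 0 <= Re z -> 1 <= Cmod (RtoC 1 + RtoC d * z) /\ d * Cmod z <= Cmod (RtoC 1 + RtoC d * z).
Proof.
  intros Hd Hz. assert (P : 0 <= d * Re z) by pos.
  assert (E : Cmod (RtoC 1 + RtoC d * z) ^ 2 = 1 + 2 * (d * Re z) + d ^ 2 * Cmod z ^ 2).
  { rewrite !Cmod_sq, Re_plus, Im_plus, Re_mult, Im_mult. simpl. ring. }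
  pose proof (pow2_ge_0 (d * Cmod z)).
  split; apply sq_le; try apply Cmod_ge_0; rewrite E; [|rewrite Rpow_mult_distr]; lra.
Qed.

(** The order of the choices matters: [del] from Z and eps, the rectangle size [X] from [del], the
    index n from [X], and only then the index of the approximating sums, since these are uniform on
    bounded sets only. *)
Lemma phragmen_lindelof (h eps Z : R) : RH -> 0 < h <= 1 / 4 -> 0 < Z -> 0 < eps <= 1 -> exists N0, forall n z0, (N0 <= n)%nat ->
  1 / 2 <= Re z0 -> Cmod z0 <= Z ->
  Cmod (kz (z0 - RtoC h)) * gquot n h z0 <= (1 + eps) * Cmod (kz (z0 + RtoC h)).
Proof.
  intros HRH Hh HZ Heps. destruct (kz_quot_growth h HRH Hh) as [K [A [PA HA]]].
  set (e1 := eps / 8). assert (He1 : 0 < e1 <= 1 / 8) by (unfold e1; lra).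
  assert (PK : 1 <= INR (S K)) by (apply (le_INR 1); lia).
  (* Makes the damping factor cost at most 1 + e1 at points with |z0| <= Z. *)
  set (del := ln (1 + e1) / (INR (S K) * (Z + 1))).
  assert (L1 : 0 < ln (1 + e1)) by (rewrite <- ln_1; apply ln_increasing; lra).
  assert (L2 : ln (1 + e1) <= e1).
  { pose proof (exp_ineq1_le e1) as I. apply ln_le in I; [rewrite ln_exp in I; lra|lra]. }
  assert (Pd : 0 < del) by pos.
  assert (Ud : del <= 1 / 8).
  { apply Rle_div_l; [pos|]. nra. }
  (* From |z| = X on, (del |z|)^(K + 1) exceeds the growth A (2 |z|)^K of the quotient times 3, the
     bound for [gquot]. *)
  set (X := Rmax (Z + 1) (3 * A * 2 ^ K / del ^ S K)).
  assert (X1 : Z + 1 <= X) by apply Rmax_l.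
  assert (X2 : 3 * A * 2 ^ K / del ^ S K <= X) by apply Rmax_r.
  destruct (boundary_limit h (2 * X) e1 Hh ltac:(lra) ltac:(lra)) as [N0 HN0].
  exists N0. intros n z0 Hn Hz0 CZ0. pose proof (Cmod_ge_0 z0) as Pz0.
  assert (D0 : Cmod (RtoC 1 + RtoC del * z0) ^ S K <= 1 + e1).
  { apply Rle_trans with (exp (del * Cmod z0) ^ S K).
    - apply pow_incr. split; [apply Cmod_ge_0|]. eapply Rle_trans; [apply Cmod_triangle|].
      rewrite Cmod_mult, !Cmod_R, !Rabs_right by lra. apply exp_ineq1_le.
    - rewrite exp_pow. rewrite <- (exp_ln (1 + e1)) by lra. apply exp_le.
      replace (ln (1 + e1)) with (INR (S K) * (del * (Z + 1))) by (unfold del; field; lra).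
      apply Rmult_le_compat_l; [lra|]. apply Rmult_le_compat_l; lra. }
  assert (Bdry : forall z, on_bdry (1 / 2) X (- X) X z ->
    gquot n h z / Cmod (RtoC 1 + RtoC del * z) ^ S K * Cmod (kz (z - RtoC h)) <= (1 + e1) * Cmod (kz (z + RtoC h))).
  { intros z [[R1 R2] Side]. destruct (Cmod_one_plus del z Pd ltac:(lra)) as [M1 M2].
    destruct (gquot_bound n h z Hh ltac:(lra)) as [Q1 Q2].
    set (D := Cmod (RtoC 1 + RtoC del * z)) in *.
    assert (PD : 1 <= D ^ S K) by (apply pow_R1_Rle; easy).
    pose proof (Cmod_ge_0 (kz (z - RtoC h))) as Pa. pose proof (Cmod_ge_0 (kz (z + RtoC h))) as Pb.
    destruct (Req_dec (Re z) (1 / 2)) as [EL|NL].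
    - assert (Cz : Cmod z <= 2 * X).
      { eapply Rle_trans; [apply Cmod_le_sum|]. rewrite EL, (Rabs_right (1 / 2)) by lra. assert (Rabs (Im z) <= X) by (apply Rabs_le; lra). lra. }
      pose proof (HN0 n z Hn EL Cz) as B.
      apply Rle_trans with (gquot n h z * Cmod (kz (z - RtoC h))); [|lra].
      apply Rmult_le_compat_r; [easy|]. apply Rle_div_l; [lra|]. nra.
    - assert (Cz : X <= Cmod z).
      { destruct Side as [S|[S|[S|S]]]; [lra| | |].
        - rewrite <- S. eapply Rle_trans; [apply Rle_abs|apply re_le_Cmod].
        - apply Rle_trans with (Rabs (Im z)); [rewrite S, Rabs_Ropp, Rabs_right; lra|apply im_le_Cmod].
        - apply Rle_trans with (Rabs (Im z)); [rewrite S, Rabs_right; lra|apply im_le_Cmod]. }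
      specialize (HA z ltac:(lra)).
      assert (PdK : 0 < del ^ S K) by now apply pow_lt. assert (P2K : 0 < 2 ^ K) by (apply pow_lt; lra).
      assert (Far : 3 * (A * (1 + Cmod z) ^ K) <= D ^ S K).
      { apply Rle_trans with ((del * Cmod z) ^ S K); [|apply pow_incr; split; [pos|easy]].
        rewrite Rpow_mult_distr. apply Rle_trans with (3 * (A * (2 * Cmod z) ^ K)).
        - apply Rmult_le_compat_l; [lra|]. apply Rmult_le_compat_l; [lra|]. apply pow_incr; lra.
        - rewrite Rpow_mult_distr. change (Cmod z ^ S K) with (Cmod z * Cmod z ^ K).
          assert (0 < Cmod z ^ K) by (apply pow_lt; lra).
          replace (3 * (A * (2 ^ K * Cmod z ^ K))) with (3 * A * 2 ^ K * Cmod z ^ K) by ring.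
          replace (del ^ S K * (Cmod z * Cmod z ^ K)) with (del ^ S K * Cmod z * Cmod z ^ K) by ring.
          apply Rmult_le_compat_r; [lra|]. assert (Y : 3 * A * 2 ^ K / del ^ S K <= Cmod z) by lra. apply (Rle_div_l _ _ (del ^ S K)) in Y; lra. }
      unfold Rdiv. rewrite (Rmult_comm (gquot n h z)), Rmult_assoc. apply Rmult_le_reg_l with (D ^ S K); [lra|].
      rewrite <- Rmult_assoc, Rinv_r, Rmult_1_l by lra.
      apply Rle_trans with (3 * (A * (1 + Cmod z) ^ K * Cmod (kz (z + RtoC h)))); [apply Rmult_le_compat; lra|].
      apply Rle_trans with (D ^ S K * Cmod (kz (z + RtoC h))).
      + replace (3 * (A * (1 + Cmod z) ^ K * Cmod (kz (z + RtoC h)))) with (3 * (A * (1 + Cmod z) ^ K) * Cmod (kz (z + RtoC h))) by ring. now apply Rmult_le_compat_r.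
      + apply Rmult_le_compat_l; [lra|]. nra. }
  destruct (kz_lower_rect (1 / 2 + h / 2) (X + 1) (- X - 1) (X + 1)) as [m [Pm Hm]]; try lra.
  { intros z [[R1 _] _]. apply kz_nonzero; [easy|lra]. }
  destruct (gquot_bound n h z0 Hh ltac:(lra)) as [Q1 Q2].
  set (q0 := gquot n h z0) in *. set (a0 := Cmod (kz (z0 - RtoC h))). set (b0 := Cmod (kz (z0 + RtoC h))).
  set (Dz := Cmod (RtoC 1 + RtoC del * z0) ^ S K) in *.
  assert (PDz : 1 <= Dz) by (apply pow_R1_Rle; apply (Cmod_one_plus del z0 Pd); lra).
  assert (Pb0 : 0 <= b0) by apply Cmod_ge_0.
  assert (Hlim : a0 * q0 <= (1 + 2 * e1) * Dz * b0).
  { apply le_epsilon. intros e He.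
    set (e' := Rmin (m / 100 * e1) (e / 7)).
    assert (Pe' : 0 < e') by (apply Rmin_glb_lt; [apply Rmult_lt_0_compat|]; lra).
    assert (U1 : e' <= m / 100 * e1) by apply Rmin_l. assert (U2 : e' <= e / 7) by apply Rmin_r.
    assert (U3 : e' <= m / 2) by nra.
    destruct (kz_unif (1 / 8) (3 * (X + 1)) e' ltac:(lra) Pe') as [N [HN Ap]].
    assert (Rect : forall z, in_rect (1 / 2 - h / 2) (X + h / 2) (- X - h / 2) (X + h / 2) z ->
      Rabs (Cmod (kz (z - RtoC h)) - Cmod (kN N (z - RtoC h))) <= e' /\ Rabs (Cmod (kz (z + RtoC h)) - Cmod (kN N (z + RtoC h))) <= e' /\ m <= Cmod (kz (z + RtoC h))).
    { intros z [R1 R2].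
      assert (Cz : Cmod z <= 2 * X + 1).
      { eapply Rle_trans; [apply Cmod_le_sum|]. rewrite (Rabs_right (Re z)) by lra. assert (Rabs (Im z) <= X + h / 2) by (apply Rabs_le; lra). lra. }
      assert (Cp : Cmod (z + RtoC h) <= 3 * (X + 1)) by (eapply Rle_trans; [apply Cmod_triangle|]; rewrite Cmod_R, Rabs_right; lra).
      assert (Cm : Cmod (z - RtoC h) <= 3 * (X + 1)).
      { unfold Cminus; eapply Rle_trans; [apply Cmod_triangle|]; rewrite Cmod_opp, Cmod_R, Rabs_right; lra. }
      assert (T : forall u v e, Cmod (u - v) <= e -> Rabs (Cmod u - Cmod v) <= e).
      { intros u v e2 H2. pose proof (Cmod_rev_triangle u v). pose proof (Cmod_rev_triangle v u). rewrite (Cmod_sub_sym v u) in H0. apply Rabs_le; lra. }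
      repeat split.
      - apply T, Ap; [lia|rewrite Re_minus; simpl; lra|easy].
      - apply T, Ap; [lia|rewrite Re_plus; simpl; lra|easy].
      - apply Hm. split; [rewrite Re_plus; simpl; lra|rewrite Im_plus; simpl; lra]. }
    assert (In0 : in_rect (1 / 2) X (- X) X z0).
    { pose proof (re_le_Cmod z0) as A1. pose proof (im_le_Cmod z0) as A2. apply Rabs_le_between in A1. apply Rabs_le_between in A2. split; lra. }
    assert (Fin : q0 * (Cmod (kN N (z0 - RtoC h)) / Cmod (kN N (z0 + RtoC h))) / Dz <= 1 + 2 * e1).
    { apply (pl_rectangle h del K N n Hh Pd HN X (h / 2)); try lra; [nra| |  |easy].
      - intros z Hz. destruct (Rect z Hz) as [_ [B1 B2]]. apply Rabs_le_between in B1. apply Cmod_pos_neq. lra.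
      - intros z Hz. pose proof (Bdry z Hz) as BB. destruct Hz as [[R1 R2] _].
        destruct (Rect z ltac:(split; lra)) as [B1 [B2 B3]].
        destruct (gquot_bound n h z Hh ltac:(lra)) as [G1 G2]. destruct (Cmod_one_plus del z Pd ltac:(lra)) as [M1 _].
        set (D := Cmod (RtoC 1 + RtoC del * z) ^ S K) in *. assert (PD : 1 <= D) by (apply pow_R1_Rle; easy).
        replace (gquot n h z * (Cmod (kN N (z - RtoC h)) / Cmod (kN N (z + RtoC h))) / D) with (gquot n h z / D * (Cmod (kN N (z - RtoC h)) / Cmod (kN N (z + RtoC h)))) by (unfold Rdiv; ring).
        replace (1 + 2 * e1) with ((1 + e1) + e1) by ring.
        apply (quot_perturb (Cmod (kz (z - RtoC h))) (Cmod (kz (z + RtoC h))) _ _ e' m); try easy; try apply Cmod_ge_0; try lra.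
        split; [pos|]. apply Rle_div_l; nra. }
    destruct (Rect z0 ltac:(destruct In0; split; lra)) as [B1 [B2 B3]]. fold a0 in B1. fold b0 in B2, B3.
    set (a' := Cmod (kN N (z0 - RtoC h))) in *. set (b' := Cmod (kN N (z0 + RtoC h))) in *.
    apply Rabs_le_between in B1. apply Rabs_le_between in B2. assert (Pb' : 0 < b') by lra.
    assert (Fin2 : q0 * a' <= (1 + 2 * e1) * Dz * b').
    { apply (Rle_div_l _ _ Dz) in Fin; [|lra]. replace (q0 * (a' / b')) with (q0 * a' / b') in Fin by (unfold Rdiv; ring).
      apply (Rle_div_l _ _ b') in Fin; lra. }
    assert (F1 : a0 * q0 <= q0 * a' + 3 * e') by nra.
    assert (F2 : (1 + 2 * e1) * Dz * b' <= (1 + 2 * e1) * Dz * (b0 + e')) by (apply Rmult_le_compat_l; [apply Rmult_le_pos|]; lra).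
    assert (F3 : (1 + 2 * e1) * Dz <= 4) by nra.
    assert (F4 : (1 + 2 * e1) * Dz * e' <= 4 * e') by (apply Rmult_le_compat_r; lra). lra. }
  eapply Rle_trans; [exact Hlim|]. apply Rmult_le_compat_r; [easy|]. unfold e1 in *. nra.
Qed.

(** * Size of the gamma quotient *)

Definition lnorm (t v : R) : R := ln (v ^ 2 + t ^ 2) / 2.

Lemma ln_Cmod_lnorm (v t : R) : t <> 0 -> ln (Cmod (v, t)) = lnorm t v.
Proof.
  intros Ht. unfold lnorm.
  pose proof (Cmod_sq (v, t)) as E. simpl Re in E. simpl Im in E. rewrite <- E.
  assert (0 < Cmod (v, t)).
  { apply Cmod_gt_0. intros Q. injection Q; easy. }
  simpl. rewrite Rmult_1_r, ln_mult by easy. field.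
Qed.

Lemma lnorm_deriv (t v : R) : t <> 0 -> is_derive (lnorm t) v (v / (v ^ 2 + t ^ 2)).
Proof.
  intros Ht. assert (P : 0 < t ^ 2) by (apply pow2_gt_0; easy). pose proof (pow2_ge_0 v).
  unfold lnorm. auto_derive; [simpl in *; lra|]. simpl. field. simpl in *; lra.
Qed.

Lemma lnorm_slope_lip (t a b w : R) : t <> 0 -> 0 <= w -> w <= a -> w <= b ->
  Rabs (b / (b ^ 2 + t ^ 2) - a / (a ^ 2 + t ^ 2)) <= / (w ^ 2 + t ^ 2) * Rabs (b - a).
Proof.
  intros Ht Hw Ha Hb. assert (P : 0 < t ^ 2) by (apply pow2_gt_0; easy).
  assert (Gen : forall a b, w <= a -> a <= b -> Rabs (b / (b ^ 2 + t ^ 2) - a / (a ^ 2 + t ^ 2)) <= / (w ^ 2 + t ^ 2) * (b - a)).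
  { clear a b Ha Hb. intros a b Ha Hab.
    apply (MVT_abs_le (fun v => v / (v ^ 2 + t ^ 2)) (fun v => (t ^ 2 - v ^ 2) / (v ^ 2 + t ^ 2) ^ 2) a b); [easy| |].
    - intros x _. pose proof (pow2_ge_0 x). auto_derive; [simpl in *; lra|]. field. lra.
    - intros x Hx. assert (w ^ 2 <= x ^ 2) by (apply pow_incr; lra). pose proof (pow2_ge_0 w).
      unfold Rdiv. rewrite Rabs_mult, (Rabs_right (/ _)) by (apply Rle_ge; left; apply Rinv_0_lt_compat, pow_lt; lra).
      apply Rle_trans with ((x ^ 2 + t ^ 2) * / (x ^ 2 + t ^ 2) ^ 2).
      + apply Rmult_le_compat_r; [left; apply Rinv_0_lt_compat, pow_lt; lra|]. apply Rabs_le; lra.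
      + replace ((x ^ 2 + t ^ 2) * / (x ^ 2 + t ^ 2) ^ 2) with (/ (x ^ 2 + t ^ 2)) by (field; lra). apply Rinv_le_contravar; lra. }
  destruct (Rle_lt_dec a b) as [H|H].
  - rewrite (Rabs_right (b - a)) by lra. now apply Gen.
  - rewrite Rabs_minus_sym, (Rabs_minus_sym b), (Rabs_right (a - b)) by lra. apply Gen; lra.
Qed.

Lemma lnorm_sym_diff (t v u w : R) : t <> 0 -> 0 <= w -> w <= v - 1 -> 0 <= u <= 1 ->
  Rabs (lnorm t (v + u) - lnorm t (v - u) - 2 * u * (v / (v ^ 2 + t ^ 2))) <= 2 * / (w ^ 2 + t ^ 2) * u.
Proof.
  intros Ht Hw Hv Hu. set (g := fun x => x / (x ^ 2 + t ^ 2)).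
  pose proof (MVT_abs_le (fun u => lnorm t (v + u) - lnorm t (v - u) - 2 * u * g v) (fun u => g (v + u) + g (v - u) - 2 * g v) 0 u (2 * / (w ^ 2 + t ^ 2)) (proj1 Hu)) as M.
  cbv beta in M. rewrite !Rplus_0_r, !Rminus_0_r in M. replace (lnorm t v - lnorm t v - 2 * 0 * g v) with 0 in M by ring. rewrite Rminus_0_r in M.
  apply M.
  - intros x _. pose proof (lnorm_deriv t (v + x) Ht) as D1. pose proof (lnorm_deriv t (v - x) Ht) as D2.
    eapply derR_eq; [apply (derR_plus (fun u => lnorm t (v + u) - lnorm t (v - u)) (fun u => - (2 * u * g v))); [apply (derR_plus (fun u => lnorm t (v + u)) (fun u => - lnorm t (v - u)))|]|].
    + apply (derR_comp (lnorm t)); [exact D1|auto_derive; [easy|reflexivity]].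
    + apply (derR_comp (fun y => - lnorm t y)); [apply (is_derive_opp (lnorm t) _ _ D2)|auto_derive; [easy|reflexivity]].
    + auto_derive; [easy|reflexivity].
    + unfold g. change (opp ?a) with (- a). ring.
  - intros x Hx. replace (g (v + x) + g (v - x) - 2 * g v) with ((g (v + x) - g v) + (g (v - x) - g v)) by ring.
    eapply Rle_trans; [apply Rabs_triang|].
    pose proof (lnorm_slope_lip t v (v + x) w Ht Hw ltac:(lra) ltac:(lra)) as A. pose proof (lnorm_slope_lip t v (v - x) w Ht Hw ltac:(lra) ltac:(lra)) as B.
    replace (v + x - v) with x in A by ring. replace (v - x - v) with (- x) in B by ring. rewrite Rabs_Ropp in B. rewrite (Rabs_right x) in A, B by lra.
    assert (0 < t ^ 2) by (apply pow2_gt_0; easy). pose proof (pow2_ge_0 w).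
    assert (0 < / (w ^ 2 + t ^ 2)) by pos. fold (g (v + x)) (g (v - x)) (g v) in A, B. nra.
Qed.

(** The factors are spaced by 2, so log |v + 1 + it| - log |v - 1 + it| telescopes exactly. By
    [lnorm_sym_diff] with u = h and u = 1, the difference with shift h is h times this one, up to an
    error that is summable in n and of order h / t in total. *)
Lemma gprod_ln_telescope (x t h : R) (n : nat) : 0 < t -> 1 / 2 <= x -> 0 < h <= 1 / 4 ->
  Rabs (ln (gprod n ((x, t) + RtoC h)) - ln (gprod n ((x, t) - RtoC h)) - h * (lnorm t (x + 2 * INR n + 1) - lnorm t (x + 1)))
  <= 8 * h * (/ t - / (INR n + t)).
Proof.
  intros Ht Hx Hh.
  assert (Rm : 0 < Re ((x, t) - RtoC h)) by (rewrite Re_minus; simpl; lra).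
  assert (Rp : 0 < Re ((x, t) + RtoC h)) by (rewrite Re_plus; simpl; lra).
  induction n as [|n IH].
  - simpl gprod. rewrite Rmult_0_r, !Rplus_0_r, Rplus_0_l, ln_1, !Rminus_diag, Rmult_0_r, Rminus_diag, Rabs_R0, Rmult_0_r. lra.
  - rewrite !gprod_S. pose proof (Cmod_shift_pos _ (S n) Rm) as L1. pose proof (Cmod_shift_pos _ (S n) Rp) as L2.
    pose proof (pos_INR (S n)) as PN. rewrite !ln_mult by (try apply gprod_pos; lra).
    assert (EP : ((x, t) + RtoC h + RtoC (2 * INR (S n)))%C = (x + 2 * INR (S n) + h, t)).
    { unfold RtoC, Cplus; cbn [fst snd]. f_equal; ring. }
    assert (EM : ((x, t) - RtoC h + RtoC (2 * INR (S n)))%C = (x + 2 * INR (S n) - h, t)).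
    { unfold RtoC, Cminus, Copp, Cplus; cbn [fst snd]. f_equal; ring. }
    rewrite EP, EM, !ln_Cmod_lnorm by lra.
    set (v := x + 2 * INR (S n)) in *. pose proof (pos_INR n) as Pn.
    assert (Ev : x + 2 * INR n + 1 = v - 1) by (unfold v; rewrite S_INR; ring). rewrite Ev in IH.
    set (w := INR (S n)) in *. assert (Ew : w = INR n + 1) by apply S_INR.
    pose proof (lnorm_sym_diff t v h w ltac:(lra) ltac:(lra) ltac:(unfold v; lra) ltac:(lra)) as A.
    pose proof (lnorm_sym_diff t v 1 w ltac:(lra) ltac:(lra) ltac:(unfold v; lra) ltac:(lra)) as B.
    assert (Tel : / (w ^ 2 + t ^ 2) <= 2 * (/ (INR n + t) - / (w + t))).
    { rewrite Ew. apply Rle_trans with (2 * / ((INR n + t) * (INR n + 1 + t))); [|right; field; lra].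
      replace (2 * / ((INR n + t) * (INR n + 1 + t))) with (/ ((INR n + t) * (INR n + 1 + t) / 2)) by (field; lra).
      apply Rinv_le_contravar; [apply Rdiv_lt_0_compat; [apply Rmult_lt_0_compat|]; lra|].
      pose proof (pow2_ge_0 (INR n + 1 - t)). nra. }
    set (D := 2 * / (w ^ 2 + t ^ 2)) in *. set (g := v / (v ^ 2 + t ^ 2)) in *. set (b1 := lnorm t (v + 1)) in *. set (b2 := lnorm t (v - 1)) in *.
    apply Rabs_le_between in A. apply Rabs_le_between in B. apply Rabs_le_between in IH.
    assert (HB : h * (- (D * 1)) <= h * (b1 - b2 - 2 * 1 * g) <= h * (D * 1)) by (split; apply Rmult_le_compat_l; lra).
    assert (HT : h * D <= h * (4 * (/ (INR n + t) - / (w + t)))) by (apply Rmult_le_compat_l; unfold D; lra).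
    apply Rabs_le. lra.
Qed.

Lemma ln_near_1 (y : R) : Rabs y <= 1 / 2 -> Rabs (ln (1 + y)) <= 2 * Rabs y.
Proof.
  intros Hy. pose proof (Rabs_le_between y (1 / 2)) as [B _]. specialize (B Hy).
  assert (U : ln (1 + y) <= y).
  { pose proof (exp_ineq1_le y) as I. apply ln_le in I; [rewrite ln_exp in I; lra|lra]. }
  assert (L : - (2 * Rabs y) <= ln (1 + y)).
  { pose proof (exp_ineq1_le (- y / (1 + y))) as I.
    replace (1 + - y / (1 + y)) with (/ (1 + y)) in I by (field; lra).
    apply ln_le in I; [|pos]. rewrite ln_exp, ln_Rinv in I by lra.
    assert (Rabs (- y / (1 + y)) <= 2 * Rabs y).
    { unfold Rdiv. rewrite Rabs_mult, Rabs_Ropp, (Rabs_right (/ (1 + y))) by (apply Rle_ge; pos).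
      rewrite (Rmult_comm 2). apply Rmult_le_compat_l; [apply Rabs_pos|]. replace 2 with (/ (1 / 2)) by field. apply Rinv_le_contravar; lra. }
    pose proof (Rle_abs (- y / (1 + y))). lra. }
  pose proof (Rle_abs y). apply Rabs_le; lra.
Qed.

(** In the telescoped sum the upper end is h log(2N) up to a vanishing error; together with the
    normalisation (N / pi)^(-h) it leaves h log(2 pi), and the lower end gives the main term. *)
Lemma gquot_ln (h Z eta : R) : 0 < h <= 1 / 4 -> 1 <= Z -> 0 < eta -> exists N0, forall n x t, (N0 <= n)%nat ->
  1 / 2 <= x <= Z -> 0 < t <= Z ->
  Rabs (- ln (gquot n h (x, t)) - h * (lnorm t (x + 1) - ln (2 * PI))) <= 8 * h / t + eta.
Proof.
  intros Hh HZ He. set (B := 2 * (Z + Z ^ 2)).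
  destruct (nfloor_ex (B / Rmin eta 1)) as [k Hk].
  { apply Rmult_le_pos; [unfold B; nra|]. left; apply Rinv_0_lt_compat, Rmin_glb_lt; lra. }
  exists (S k). intros n x t Hn Hx Ht.
  pose proof PI_RGT_0 as PP. assert (PB : 4 <= B) by (unfold B; nra).
  assert (Pm : 0 < Rmin eta 1) by (apply Rmin_glb_lt; lra). pose proof (Rmin_l eta 1) as Ml. pose proof (Rmin_r eta 1) as Mr.
  set (N := INR (S n)). assert (HN : INR k + 1 < N) by (unfold N; rewrite S_INR; apply le_INR in Hn; rewrite S_INR in Hn; lra).
  assert (HB : B <= N * Rmin eta 1).
  { assert (Q : B / Rmin eta 1 <= N) by lra. apply (Rle_div_l _ _ (Rmin eta 1)) in Q; lra. }
  assert (PN : 0 < N) by (pose proof (pos_INR k); lra).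
  assert (NB : B <= N) by nra.
  assert (Rm : 0 < Re ((x, t) - RtoC h)) by (rewrite Re_minus; simpl; lra).
  assert (Rp : 0 < Re ((x, t) + RtoC h)) by (rewrite Re_plus; simpl; lra).
  pose proof (gprod_pos n _ Rm) as G1. pose proof (gprod_pos n _ Rp) as G2.
  pose proof (gprod_ln_telescope x t h n (proj1 Ht) (proj1 Hx) Hh) as T.
  assert (T2 : 8 * h * (/ t - / (INR n + t)) <= 8 * h / t).
  { assert (0 < / (INR n + t)) by (apply Rinv_0_lt_compat; pose proof (pos_INR n); lra). nra. }
  unfold gquot. fold N. rewrite ln_mult; [|apply exp_pos|pos].
  rewrite ln_div by easy. unfold Rpower. rewrite ln_exp, ln_div by easy. rewrite ln_mult by lra.
  assert (EX : x + 2 * INR n + 1 = 2 * N + (x - 1)) by (unfold N; rewrite S_INR; ring). rewrite EX in T.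
  set (y := (4 * N * (x - 1) + (x - 1) ^ 2 + t ^ 2) / (4 * N ^ 2)).
  assert (EL : lnorm t (2 * N + (x - 1)) = ln 2 + ln N + ln (1 + y) / 2).
  { unfold lnorm. assert (E : (2 * N + (x - 1)) ^ 2 + t ^ 2 = (2 * N) * (2 * N) * (1 + y)) by (unfold y; field; lra).
    rewrite E, !ln_mult; try lra; nra. }
  assert (Yb : Rabs y <= B / 2 / N).
  { unfold y, Rdiv. rewrite Rabs_mult, (Rabs_right (/ (4 * N ^ 2))) by (apply Rle_ge; left; apply Rinv_0_lt_compat; nra).
    apply Rle_trans with ((4 * N * Z + 2 * Z ^ 2) * / (4 * N ^ 2)).
    - apply Rmult_le_compat_r; [left; apply Rinv_0_lt_compat; nra|]. apply Rabs_le. split; nra.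
    - apply Rmult_le_reg_r with (4 * N ^ 2); [nra|]. rewrite Rmult_assoc, Rinv_l by nra.
      replace (B * / 2 * / N * (4 * N ^ 2)) with (2 * B * N) by (field; lra). unfold B in *. nra. }
  assert (Yh : B / 2 / N <= 1 / 2) by (apply Rle_div_l; lra).
  pose proof (ln_near_1 y ltac:(lra)) as LN.
  assert (Ye : B / 2 / N <= eta / 2) by (apply Rle_div_l; nra).
  rewrite EL in T. set (l1 := ln (1 + y)) in *.
  assert (HL : Rabs (h * (l1 / 2)) <= eta).
  { rewrite Rabs_mult, (Rabs_right h) by lra. unfold Rdiv. rewrite Rabs_mult, (Rabs_right (/ 2)) by lra. nra. }
  apply Rabs_le_between in T. apply Rabs_le_between in HL. apply Rabs_le. lra.
Qed.

(** * The weight on the inner circle and its mean square *)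

(** Bounds 1 / (Re z - h - 1) on the circle of radius 3 about 9/2 + 2h + it, where Re z = 9/2 + 2h -
    3 cos th. *)
Definition rho0 (th : R) : R := / (7 / 2 - 3 * cos th).

Lemma rho0_bounds (th : R) : 2 / 13 <= rho0 th <= 2.
Proof.
  pose proof (COS_bound th). split.
  - replace (2 / 13) with (/ (13 / 2)) by field. apply Rinv_le_contravar; lra.
  - replace 2 with (/ (1 / 2)) by field. apply Rinv_le_contravar; lra.
Qed.

(** The Poisson formula for the constant function e, whose logarithmic modulus is 1, with cosh tau =
    a and sinh tau = b. *)
Lemma RInt_inv_cos (a b : R) : 1 < a -> 0 < b -> b ^ 2 = a ^ 2 - 1 ->
  RInt (fun th => / (a - cos th)) (- PI) PI = 2 * PI / b.
Proof.
  intros Ha Hb E. set (tau := ln (a + b)).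
  assert (Pt : 0 < tau) by (unfold tau; rewrite <- ln_1; apply ln_increasing; lra).
  assert (E1 : exp tau = a + b) by (apply exp_ln; lra).
  assert (E2 : exp (- tau) = a - b) by (rewrite exp_Ropp, E1; apply Rmult_eq_reg_l with (a + b); [rewrite Rinv_r; nra|lra]).
  assert (Ec : cosh tau = a) by (unfold cosh; rewrite E1, E2; field). assert (Es : sinh tau = b) by (unfold sinh; rewrite E1, E2; field).
  pose proof (poisson_formula (HConst (RtoC (exp 1))) (RtoC 0) 2) as P.
  assert (P' := P ltac:(easy) ltac:(intros; simpl; apply Cmod_pos_neq; rewrite Cmod_R, Rabs_right; [apply exp_pos|pos]) 1 tau ltac:(lra) Pt).
  assert (LM : forall z, logmod (HConst (RtoC (exp 1))) z = 1).
  { intros z. unfold logmod. simpl heval. rewrite Cmod_R, Rabs_right by pos. apply ln_exp. }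
  rewrite LM in P'. rewrite (RInt_ext _ (fun th => b * / (a - cos th))) in P'.
  - rewrite RIntR_scal in P'.
    + apply Rmult_eq_reg_l with b; [|lra]. rewrite P'. field; lra.
    + apply ex_RInt_cont. intros x. apply (ex_derive_continuous (fun th => / (a - cos th))). pose proof (COS_bound x). eexists. auto_derive; [lra|reflexivity].
  - intros th _. rewrite LM. unfold poisson. rewrite Ec, Es. rewrite Rmult_1_l. reflexivity.
Qed.

Lemma rho0_cont (th : R) : continuous rho0 th.
Proof. apply (ex_derive_continuous rho0). pose proof (COS_bound th). unfold rho0. eexists. auto_derive; [lra|reflexivity]. Qed.

(* Replaces the exact value [(7/2) / (13/4)^(3/2)] of the mean of [rho0^2] by a difference quotient of [RInt_inv_cos]. *)
Lemma RInt_rho0_sqr : RInt (fun th => rho0 th * rho0 th) (- PI) PI <= 2 * PI * 0.617.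
Proof.
  set (a := 7 / 6). set (a' := 29 / 25). set (b := sqrt (13 / 36)). set (b' := sqrt (216 / 625)).
  assert (Eb : b ^ 2 = 13 / 36) by (unfold b; rewrite pow2_sqrt; lra). assert (Eb' : b' ^ 2 = 216 / 625) by (unfold b'; rewrite pow2_sqrt; lra).
  assert (Pb : 0 < b) by (apply sqrt_lt_R0; lra). assert (Pb' : 0 < b') by (apply sqrt_lt_R0; lra).
  pose proof (RInt_inv_cos a b ltac:(unfold a; lra) Pb ltac:(unfold a; lra)) as J.
  pose proof (RInt_inv_cos a' b' ltac:(unfold a'; lra) Pb' ltac:(unfold a'; lra)) as J'.
  assert (Cn : forall c, 1 < c -> forall x, continuous (fun th => / (c - cos th)) x).
  { intros c Hc x. apply (ex_derive_continuous (fun th => / (c - cos th))). pose proof (COS_bound x). eexists. auto_derive; [lra|reflexivity]. }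
  pose proof PI_RGT_0 as PP.
  apply Rle_trans with (RInt (fun th => 50 / 3 * (/ (a' - cos th) - / (a - cos th))) (- PI) PI).
  - apply RInt_le; [lra| | |].
    + apply ex_RInt_cont; intros x; apply continuousR_mult; apply rho0_cont.
    + apply ex_RInt_cont; intros x; apply (continuousR_mult (fun _ => 50 / 3)); [apply continuous_const|]. apply continuousR_minus; apply Cn; unfold a, a'; lra.
    + intros th _. pose proof (COS_bound th) as CB. unfold rho0.
      replace (50 / 3 * (/ (a' - cos th) - / (a - cos th))) with (/ 9 * / ((a' - cos th) * (a - cos th))) by (unfold a, a' in *; field; lra).
      replace (/ (7 / 2 - 3 * cos th) * / (7 / 2 - 3 * cos th)) with (/ 9 * / ((a - cos th) * (a - cos th))) by (unfold a; field; lra).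
      apply Rmult_le_compat_l; [lra|]. apply Rinv_le_contravar; [apply Rmult_lt_0_compat; unfold a, a'; lra|].
      apply Rmult_le_compat_r; unfold a, a'; lra.
  - rewrite RIntR_scal, RIntR_minus, J, J'.
    + assert (B1 : / b' <= (17011 / 10000)).
      { replace (17011 / 10000) with (/ (10000 / 17011)) by field. apply Rinv_le_contravar; [lra|]. apply sq_le; lra. }
      assert (B2 : (16641 / 10000) <= / b).
      { replace (16641 / 10000) with (/ (10000 / 16641)) by field. apply Rinv_le_contravar; [easy|]. apply sq_le; lra. }
      replace (50 / 3 * (2 * PI / b' - 2 * PI / b)) with (2 * PI * (50 / 3 * (/ b' - / b))) by (field; lra).
      apply Rmult_le_compat_l; lra.
    + apply ex_RInt_cont, Cn; unfold a'; lra.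
    + apply ex_RInt_cont, Cn; unfold a; lra.
    + apply ex_RInt_cont; intros x; apply continuousR_minus; apply Cn; unfold a, a'; lra.
Qed.

(** * The estimate on a disc *)

Ltac rfield := match goal with |- ?a = ?b => change (@eq R a b); field end.

Lemma RInt_cos_n (k : nat) : RInt (fun th => cos (INR k * th)) (- PI) PI = if Nat.eqb k 0 then 2 * PI else 0.
Proof.
  destruct (Nat.eqb_spec k 0) as [E|E].
  - subst k. rewrite (RInt_ext _ (fun _ => 1)) by (intros; simpl; rewrite Rmult_0_l; apply cos_0).
    rewrite RInt_const. change (scal ?a ?b) with (a * b). rring.
  - assert (P : 0 < INR k) by (apply lt_0_INR; lia).
    rewrite (RInt_deriv (fun th => sin (INR k * th) / INR k)).
    + replace (INR k * - PI) with (- (INR k * PI)) by ring. rewrite sin_neg, sin_nPI. rfield; lra.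
    + intros x. auto_derive; [easy|]. field; lra.
    + apply continuous_cosn.
Qed.

Lemma RInt_cos_cos (a b : nat) : RInt (fun th => cos (INR a * th) * cos (INR b * th)) (- PI) PI =
  if Nat.eqb a b then (if Nat.eqb a 0 then 2 * PI else PI) else 0.
Proof.
  assert (Gen : forall a b, (a <= b)%nat -> RInt (fun th => cos (INR a * th) * cos (INR b * th)) (- PI) PI =
    / 2 * (RInt (fun th => cos (INR (b - a) * th)) (- PI) PI + RInt (fun th => cos (INR (a + b) * th)) (- PI) PI)).
  { clear a b. intros a b H. rewrite <- RIntR_plus, <- RIntR_scal.
    - apply RInt_ext. intros x _. rewrite minus_INR, plus_INR by easy.
      rewrite Rmult_minus_distr_r, Rmult_plus_distr_r, cos_minus, cos_plus.
      rfield.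
    - apply ex_RInt_cont; intros; apply continuousR_plus; apply continuous_cosn.
    - apply ex_RInt_cont, continuous_cosn.
    - apply ex_RInt_cont, continuous_cosn. }
  destruct (Nat.eqb_spec a b) as [E|E].
  - subst b. rewrite Gen, !RInt_cos_n by lia. rewrite Nat.sub_diag.
    destruct a; simpl Nat.eqb; cbv iota; rfield.
  - destruct (Nat.le_gt_cases a b) as [H|H].
    + rewrite Gen, !RInt_cos_n by lia. destruct (Nat.eqb_spec (b - a) 0); [lia|]. destruct (Nat.eqb_spec (a + b) 0); [lia|]. lra.
    + rewrite (RInt_ext _ (fun th => cos (INR b * th) * cos (INR a * th))) by (intros; apply Rmult_comm).
      rewrite Gen, !RInt_cos_n by lia. destruct (Nat.eqb_spec (a - b) 0); [lia|]. destruct (Nat.eqb_spec (b + a) 0); [lia|]. lra.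
Qed.

Lemma tpart_fourier (k : nat -> R) (m n : nat) :
  RInt (fun th => tpart k m th * cos (INR n * th)) (- PI) PI = if Nat.leb n m then 2 * PI * k n else 0.
Proof.
  induction m as [|m IH].
  - rewrite (RInt_ext _ (fun th => k O * cos (INR n * th))) by easy.
    rewrite RIntR_scal, RInt_cos_n by (apply ex_RInt_cont, continuous_cosn).
    destruct n; simpl; rring.
  - rewrite (RInt_ext _ (fun th => tpart k m th * cos (INR n * th) + 2 * k (S m) * (cos (INR (S m) * th) * cos (INR n * th))))
      by (intros; rewrite tpart_S; rring).
    rewrite RIntR_plus, RIntR_scal, IH, RInt_cos_cos.
    + destruct (Nat.eqb_spec (S m) n) as [E|E].
      * subst n. destruct (Nat.leb_spec (S m) m); [lia|]. rewrite Nat.leb_refl. simpl Nat.eqb. cbv iota. rring.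
      * destruct (Nat.leb_spec n m); destruct (Nat.leb_spec n (S m)); try lia; rring.
    + apply ex_RInt_cont; intros; apply continuousR_mult; apply continuous_cosn.
    + apply ex_RInt_cont; intros; apply continuousR_mult; [apply tpart_cont|apply continuous_cosn].
    + apply ex_RInt_cont; intros; apply (continuousR_mult (fun _ => _)); [apply continuous_const|]; apply continuousR_mult; apply continuous_cosn.
Qed.

Lemma tcoef_ext (k a b : nat -> R) (m : nat) : (forall n, (n <= m)%nat -> a n = b n) -> tcoef k a m = tcoef k b m.
Proof.
  induction m as [|m IH]; intros H.
  - simpl. now rewrite H.
  - rewrite !tcoef_S, IH, H by (intros; apply H || idtac; lia). easy.
Qed.

Lemma RInt_tpart_sqr (k : nat -> R) (m : nat) : RInt (fun th => tpart k m th * tpart k m th) (- PI) PI = 2 * PI * tcoef k k m.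
Proof.
  rewrite RInt_tpart by apply tpart_cont.
  rewrite (tcoef_ext _ _ (fun n => 2 * PI * k n)).
  - induction m as [|m IH]; [simpl; rring|]. rewrite !tcoef_S, IH. rring.
  - intros n Hn. rewrite tpart_fourier. destruct (Nat.leb_spec n m); [easy|lia].
Qed.

Lemma sinh_le_cosh (m : nat) (x : R) : 0 <= x -> 0 <= sinh (INR m * x) <= INR m * (sinh x * cosh (INR m * x)).
Proof.
  intros Hx. assert (S0 : forall y, 0 <= y -> 0 <= sinh y).
  { intros y Hy. unfold sinh. assert (exp (- y) <= exp y) by (apply exp_le; lra). lra. }
  assert (C1 : forall y, 1 <= cosh y).
  { intros y. unfold cosh. pose proof (exp_ineq1_le y). pose proof (exp_ineq1_le (- y)). lra. }
  pose proof (pos_INR m) as Pm. split; [apply S0, Rmult_le_pos; lra|].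
  induction m as [|m IH].
  - simpl. rewrite !Rmult_0_l, sinh_0. lra.
  - specialize (IH (pos_INR m)). rewrite S_INR, Rmult_plus_distr_r, Rmult_1_l.
    set (y := INR m * x) in *. pose proof (pos_INR m) as P0. assert (Py : 0 <= y) by pos.
    assert (Es : sinh (y + x) = sinh y * cosh x + cosh y * sinh x) by (unfold sinh, cosh; rewrite Ropp_plus_distr, !exp_plus; field).
    assert (Ec : cosh (y + x) = cosh y * cosh x + sinh y * sinh x) by (unfold sinh, cosh; rewrite Ropp_plus_distr, !exp_plus; field). pose proof (S0 x Hx). pose proof (S0 y Py). pose proof (C1 x). pose proof (C1 y).
    assert (0 <= sinh x * (sinh y * sinh x)) by pos.
    assert (cosh y * sinh x * 1 <= cosh y * sinh x * cosh x) by (apply Rmult_le_compat_l; [apply Rmult_le_pos|]; lra).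
    nra.
Qed.

(** sinh is convex on the positive axis and vanishes at 0, so sinh(k x) / k increases with k; the
    increment from k to k + 1 uses sinh(k x) <= k sinh x cosh(k x). *)
Lemma sinh_ratio (m n : nat) (x : R) : (m <= n)%nat -> (1 <= n)%nat -> 0 <= x -> sinh (INR m * x) <= INR m / INR n * sinh (INR n * x).
Proof.
  intros H Hn Hx. destruct m as [|m]; [simpl; rewrite Rmult_0_l, sinh_0; lra|].
  assert (Mono : forall d, sinh (INR (S m) * x) / INR (S m) <= sinh (INR (S m + d) * x) / INR (S m + d)).
  { induction d as [|d IH]; [rewrite Nat.add_0_r; lra|]. eapply Rle_trans; [exact IH|].
    rewrite Nat.add_succ_r. set (k := (S m + d)%nat). assert (Pk : 0 < INR k) by (apply lt_0_INR; unfold k; lia).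
    destruct (sinh_le_cosh k x Hx) as [A B]. rewrite S_INR, Rmult_plus_distr_r, Rmult_1_l. set (y := INR k * x) in *.
    assert (Es : sinh (y + x) = sinh y * cosh x + cosh y * sinh x) by (unfold sinh, cosh; rewrite Ropp_plus_distr, !exp_plus; field).
    assert (C1 : 1 <= cosh x) by (unfold cosh; pose proof (exp_ineq1_le x); pose proof (exp_ineq1_le (- x)); lra).
    assert (sinh y * 1 <= sinh y * cosh x) by (apply Rmult_le_compat_l; easy).
    apply Rle_div_l; [easy|]. apply (Rmult_le_reg_r (INR k + 1)); [lra|]. rewrite Es.
    replace ((sinh y * cosh x + cosh y * sinh x) / (INR k + 1) * INR k * (INR k + 1)) with (INR k * (sinh y * cosh x) + INR k * (sinh x * cosh y)) by (field; lra).
    nra. }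
  specialize (Mono (n - S m)%nat). replace (S m + (n - S m))%nat with n in Mono by lia.
  assert (0 < INR (S m)) by (apply lt_0_INR; lia). apply (Rle_div_l _ _ (INR (S m))) in Mono; [|lra].
  eapply Rle_trans; [exact Mono|]. right. field. apply not_0_INR; lia.
Qed.

(** Majorant, independent of tau, of the n-th coefficient of [kernel] divided by sinh(N tau) after
    transport from radius 4 to radius 3: the transport contributes (4/3)^n, and the ratio of
    hyperbolic sines is at most 1 - n / N. *)
Definition wgt (N n : nat) : R := (1 - INR n / INR N) * (4 / 3) ^ n.

Definition wsum (N : nat) : R := tcoef (wgt N) (wgt N) (pred N).

Lemma wsum_ge_1 (N : nat) : 1 <= wsum N.
Proof.
  unfold wsum. induction (pred N) as [|m IH].
  - simpl. unfold wgt. simpl. lra.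
  - rewrite tcoef_S. nra.
Qed.

(** The Cauchy-Schwarz inequality in the form of a weighted arithmetic-geometric mean; 0.7855 is
    just above the square root of 0.617, the bound for the mean square of [rho0]. *)
Lemma RInt_weighted (g T : R -> R) (A D : R) : (forall x, continuous g x) -> (forall x, continuous T x) ->
  0 <= A -> 0 < D -> (forall th, Rabs (g th) <= A * rho0 th) -> RInt (fun th => T th * T th) (- PI) PI <= 2 * PI * D ^ 2 ->
  Rabs (RInt (fun th => g th * T th) (- PI) PI) <= 2 * PI * (A * 0.7855 * D).
Proof.
  intros Cg CT HA HD Hg HT. pose proof PI_RGT_0 as PP.
  set (lam := D / 0.7855). assert (Pl : 0 < lam) by pos.
  assert (Cgt : forall x, continuous (fun th => g th * T th) x) by (intros; now apply continuousR_mult).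
  assert (Crr : forall x, continuous (fun th => rho0 th * rho0 th) x) by (intros; apply continuousR_mult; apply rho0_cont).
  assert (Ctt : forall x, continuous (fun th => T th * T th) x) by (intros; now apply continuousR_mult).
  eapply Rle_trans; [apply (abs_RInt_le (fun th => g th * T th)); [lra|apply ex_RInt_cont, Cgt]|].
  apply Rle_trans with (RInt (fun th => A * lam / 2 * (rho0 th * rho0 th) + A / (2 * lam) * (T th * T th)) (- PI) PI).
  - apply RInt_le; [lra| | |].
    + apply ex_RInt_cont; intros x; apply (continuous_comp _ Rabs); [apply Cgt|apply continuous_Rabs].
    + apply ex_RInt_cont; intros x; apply continuousR_plus; apply (continuousR_mult (fun _ => _)); try apply continuous_const; [apply Crr|apply Ctt].
    + intros th _. rewrite Rabs_mult.
      apply Rle_trans with (A * rho0 th * Rabs (T th)); [apply Rmult_le_compat_r; [apply Rabs_pos|apply Hg]|].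
      assert (Q : 0 <= (lam * rho0 th - Rabs (T th)) ^ 2 / lam) by pos.
      assert (E : Rabs (T th) * Rabs (T th) = T th * T th) by (rewrite <- Rabs_mult; apply Rabs_right; nra).
      replace (A * lam / 2 * (rho0 th * rho0 th) + A / (2 * lam) * (T th * T th))
        with (A * rho0 th * Rabs (T th) + A / 2 * ((lam * rho0 th - Rabs (T th)) ^ 2 / lam)); [nra|].
      rewrite <- E. field; lra.
  - rewrite RIntR_plus, !RIntR_scal.
    + pose proof RInt_rho0_sqr as RR. set (I1 := RInt (fun th => rho0 th * rho0 th) _ _) in *. set (I2 := RInt (fun th => T th * T th) _ _) in *.
      assert (X1 : A * lam / 2 * I1 <= A * lam / 2 * (2 * PI * 0.617)) by (apply Rmult_le_compat_l; [|easy]; assert (0 <= A * lam) by pos; lra).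
      assert (X2 : A / (2 * lam) * I2 <= A / (2 * lam) * (2 * PI * D ^ 2)) by (apply Rmult_le_compat_l; [|easy]; apply Rmult_le_pos; [easy|pos]).
      replace (A / (2 * lam) * (2 * PI * D ^ 2)) with (2 * PI * (A * (0.7855 / 2) * D)) in X2 by (unfold lam; field; lra).
      assert (X3 : A * lam / 2 * (2 * PI * 0.617) <= 2 * PI * (A * (0.7855 / 2) * D)).
      { replace (A * lam / 2 * (2 * PI * 0.617)) with (2 * PI * (A * D * (0.617 / 0.7855 / 2))) by (unfold lam; field; lra).
        apply Rmult_le_compat_l; [lra|]. assert (0 <= A * D) by pos.
        replace (A * (0.7855 / 2) * D) with (A * D * (0.7855 / 2)) by ring. apply Rmult_le_compat_l; lra. }
      lra.
    + apply ex_RInt_cont, Ctt.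
    + apply ex_RInt_cont, Crr.
    + apply ex_RInt_cont; intros x; apply (continuousR_mult (fun _ => _)); [apply continuous_const|apply Crr].
    + apply ex_RInt_cont; intros x; apply (continuousR_mult (fun _ => _)); [apply continuous_const|apply Ctt].
Qed.

Lemma tcoef_sqr_le (k w : nat -> R) (c : R) (m : nat) : (forall n, (n <= m)%nat -> 0 <= k n <= c * w n) -> tcoef k k m <= c ^ 2 * tcoef w w m.
Proof.
  induction m as [|m IH]; intros H.
  - simpl. specialize (H O ltac:(lia)). nra.
  - rewrite !tcoef_S. specialize (IH ltac:(intros; apply H; lia)). specialize (H (S m) ltac:(lia)). nra.
Qed.

Section DiscEstimate.
Variables (f g : hexp) (c : C) (R1 A b1 b2 : R) (N : nat).
Hypothesis HR1 : 4 < R1.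
Hypothesis Wf : forall z, Cmod (z - c) < R1 -> hwf f z /\ heval f z <> RtoC 0.
Hypothesis Wg : forall z, Cmod (z - c) < R1 -> hwf g z /\ heval g z <> RtoC 0.
Hypothesis Pos : forall th, 0 <= logmod f (pt c 4 th).
Hypothesis Bd : forall th, b1 <= logmod f (pt c 4 th) - logmod g (pt c 4 th) <= b2.
Hypothesis HA : 0 <= A.
Hypothesis Gd : forall th, Rabs (logmod g (pt c 3 th)) <= A * rho0 th.
Hypothesis HN : (1 <= N)%nat.

(** f is g times the gamma part. The gamma part lies between b1 and b2 on the outer circle and is
    integrated against a nonnegative kernel of mass 2 pi sinh q. About g only the inner circle is
    known; its Fourier coefficients of order below N are moved there by [fcoef_scale], and
    Parseval's identity turns the transported kernel into [wsum]. *)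
Lemma disc_estimate (tau : R) : 0 < tau -> let q := INR N * tau in let w := logmod f (pt c (4 * exp (- tau)) 0) in
  let K := A * 0.7855 * sqrt (wsum N) in
  w * (cosh q - 1) <= sinh q * (b2 + K) /\ sinh q * (b1 - K) <= w * (cosh q + 1).
Proof.
  intros Ht q w K. pose proof PI_RGT_0 as PP.
  assert (Cf : forall r, 0 <= r < R1 -> forall x, continuous (fun th => logmod f (pt c r th)) x).
  { intros r Hr x. apply (logmod_cont f c R1); [intros; now apply Wf|intros; now apply Wf|rewrite Rabs_right; lra]. }
  assert (Cg : forall r, 0 <= r < R1 -> forall x, continuous (fun th => logmod g (pt c r th)) x).
  { intros r Hr x. apply (logmod_cont g c R1); [intros; now apply Wg|intros; now apply Wg|rewrite Rabs_right; lra]. }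
  destruct (kernel_sandwich f c R1 ltac:(intros; now apply Wf) ltac:(intros; now apply Wf) N 4 tau HN ltac:(lra) Ht Pos) as [S1 S2].
  fold w q in S1, S2.
  set (kk := fun n => sinh ((INR N - INR n) * tau)). set (m := pred N).
  assert (PN : 0 < INR N) by (apply lt_0_INR; lia).
  assert (Pq : 0 < sinh q) by (apply sinh_pos, Rmult_lt_0_compat; lra).
  assert (KP : forall th, 0 <= kernel N tau th).
  { intros th. destruct (poisson_le_kernel N tau th HN Ht) as [L _]. eapply Rle_trans; [|exact L].
    apply Rmult_le_pos.
    - apply Rmult_le_pos; [left; now apply sinh_pos|]. left; apply Rinv_0_lt_compat. pose proof (cosh_gt_1 tau Ht). pose proof (COS_bound th); lra.
    - pose proof (cosh_gt_1 q ltac:(apply Rmult_lt_0_compat; lra)). unfold q in *; lra. }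
  assert (CK : forall x, continuous (kernel N tau) x) by (intros; apply tpart_cont).
  assert (IK : RInt (kernel N tau) (- PI) PI = 2 * PI * sinh q).
  { unfold kernel. rewrite RInt_tpart_const. now rewrite Rminus_0_r. }
  set (bt := fun th => logmod f (pt c 4 th) - logmod g (pt c 4 th)).
  assert (Cb : forall x, continuous bt x) by (intros; apply continuousR_minus; [apply Cf|apply Cg]; lra).
  assert (Spl : RInt (fun th => logmod f (pt c 4 th) * kernel N tau th) (- PI) PI =
    RInt (fun th => logmod g (pt c 4 th) * kernel N tau th) (- PI) PI + RInt (fun th => bt th * kernel N tau th) (- PI) PI).
  { rewrite <- RIntR_plus.
    - apply RInt_ext. intros th _. unfold bt. rring.
    - apply ex_RInt_cont; intros; apply continuousR_mult; [apply Cg; lra|apply CK].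
    - apply ex_RInt_cont; intros; apply continuousR_mult; [apply Cb|apply CK]. }
  assert (IB : forall b, RInt (fun th => b * kernel N tau th) (- PI) PI = b * (2 * PI * sinh q)).
  { intros b. rewrite RIntR_scal, IK by (apply ex_RInt_cont, CK). easy. }
  assert (B2 : RInt (fun th => bt th * kernel N tau th) (- PI) PI <= b2 * (2 * PI * sinh q)).
  { rewrite <- IB. apply RInt_le; [lra| | |].
    - apply ex_RInt_cont; intros; apply continuousR_mult; [apply Cb|apply CK].
    - apply ex_RInt_cont; intros; apply (continuousR_mult (fun _ => _)); [apply continuous_const|apply CK].
    - intros th _. apply Rmult_le_compat_r; [apply KP|apply Bd]. }
  assert (B1 : b1 * (2 * PI * sinh q) <= RInt (fun th => bt th * kernel N tau th) (- PI) PI).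
  { rewrite <- IB. apply RInt_le; [lra| | |].
    - apply ex_RInt_cont; intros; apply (continuousR_mult (fun _ => _)); [apply continuous_const|apply CK].
    - apply ex_RInt_cont; intros; apply continuousR_mult; [apply Cb|apply CK].
    - intros th _. apply Rmult_le_compat_r; [apply KP|apply Bd]. }
  set (ka := fun n => kk n * (4 / 3) ^ n).
  assert (Move : RInt (fun th => logmod g (pt c 4 th) * kernel N tau th) (- PI) PI = RInt (fun th => logmod g (pt c 3 th) * tpart ka m th) (- PI) PI).
  { unfold kernel. fold kk m. rewrite (RInt_tpart _ kk), (RInt_tpart _ ka) by (apply Cg; lra).
    assert (Sc : forall n, RInt (fun th => logmod g (pt c 4 th) * cos (INR n * th)) (- PI) PI = RInt (fun th => logmod g (pt c 3 th) * cos (INR n * th)) (- PI) PI * (4 / 3) ^ n).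
    { intros n. pose proof (fcoef_scale g c R1 ltac:(intros; now apply Wg) ltac:(intros; now apply Wg) n 3 4 ltac:(lra) HR1) as F.
      unfold fcoef in F. unfold Rdiv. rewrite Rpow_mult_distr, pow_inv. assert (0 < 3 ^ n) by (apply pow_lt; lra).
      apply Rmult_eq_reg_r with (3 ^ n); [|lra]. rewrite F. field; lra. } induction m as [|j IH].
    - unfold tcoef. rewrite (Sc O). unfold ka. rring.
    - rewrite !tcoef_S, IH, Sc. unfold ka. rring. }
  assert (S0 : 0 < sqrt (wsum N)) by (apply sqrt_lt_R0; pose proof (wsum_ge_1 N); lra).
  assert (TT : RInt (fun th => tpart ka m th * tpart ka m th) (- PI) PI <= 2 * PI * (sinh q * sqrt (wsum N)) ^ 2).
  { rewrite RInt_tpart_sqr. apply Rmult_le_compat_l; [lra|]. rewrite Rpow_mult_distr, pow2_sqrt by (pose proof (wsum_ge_1 N); lra). fold m. apply tcoef_sqr_le. intros n Hn. unfold ka, kk, wgt.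
    assert (P43 : 0 < (4 / 3) ^ n) by (apply pow_lt; lra).
    assert (E : INR N - INR n = INR (N - n)) by (rewrite minus_INR; [easy|unfold m in Hn; lia]). rewrite E.
    pose proof (sinh_ratio (N - n) N tau ltac:(lia) HN ltac:(lra)) as SR. pose proof (proj1 (sinh_le_cosh (N - n) tau ltac:(lra))) as SP.
    split; [pos|]. rewrite <- Rmult_assoc. apply Rmult_le_compat_r; [lra|].
    replace (sinh q * (1 - INR n / INR N)) with (INR (N - n) / INR N * sinh q) by (rewrite <- E; field; lra). easy. }
  pose proof (RInt_weighted (fun th => logmod g (pt c 3 th)) (tpart ka m) A (sinh q * sqrt (wsum N)) ltac:(apply Cg; lra) ltac:(apply tpart_cont) HA
    ltac:(now apply Rmult_lt_0_compat) Gd TT) as RW. apply Rabs_le_between in RW.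
  replace (A * 0.7855 * (sinh q * sqrt (wsum N))) with (sinh q * K) in RW by (unfold K; ring).
  split; apply Rmult_le_reg_l with (2 * PI); try lra.
Qed.
End DiscEstimate.

Lemma ln_Cmod_close (u v : C) (m e : R) : 0 < m -> 0 < e <= 1 -> m <= Cmod u -> Cmod (u - v) <= m * e / 2 ->
  0 < Cmod v /\ Rabs (ln (Cmod v) - ln (Cmod u)) <= e.
Proof.
  intros Hm He Hu Hd. pose proof (Cmod_rev_triangle u v) as A. pose proof (Cmod_rev_triangle v u) as B. rewrite (Cmod_sub_sym v u) in B.
  assert (D : m * e / 2 <= Cmod u * e / 2) by (assert (m * e <= Cmod u * e) by (apply Rmult_le_compat_r; lra); lra).
  assert (Pv : 0 < Cmod v) by nra. split; [easy|].
  rewrite <- ln_div by lra. replace (Cmod v / Cmod u) with (1 + (Cmod v - Cmod u) / Cmod u) by (field; lra).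
  assert (Q : Rabs ((Cmod v - Cmod u) / Cmod u) <= e / 2).
  { unfold Rdiv. rewrite Rabs_mult, (Rabs_right (/ Cmod u)) by (apply Rle_ge; pos).
    apply (Rle_div_l _ _ (Cmod u)); [lra|]. apply Rabs_le. lra. }
  pose proof (ln_near_1 _ ltac:(apply Rle_trans with (e / 2); [exact Q|lra])). lra.
Qed.

Lemma lnorm_half_slope (t a b : R) : 0 < t -> 0 <= a <= b -> 0 <= lnorm t b - lnorm t a <= (b - a) / (2 * t).
Proof.
  intros Ht H. unfold lnorm. assert (P : 0 < t ^ 2) by now apply pow_lt.
  assert (M : a ^ 2 <= b ^ 2) by (apply pow_incr; lra). pose proof (pow2_ge_0 a).
  assert (L : ln (a ^ 2 + t ^ 2) <= ln (b ^ 2 + t ^ 2)) by (apply ln_le; lra). split; [lra|].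
  pose proof (MVT_abs_le (lnorm t) (fun v => v / (v ^ 2 + t ^ 2)) a b (/ (2 * t)) ltac:(lra) ltac:(intros; apply lnorm_deriv; lra)) as Q.
  assert (Q' := Q ltac:(idtac; intros x Hx; cbv beta; pose proof (pow2_ge_0 x); pose proof (pow2_ge_0 (x - t)); rewrite Rabs_right by pos;
    apply Rle_div_l; [lra|]; apply (Rmult_le_reg_l (2 * t)); [lra|]; rewrite <- Rmult_assoc, Rinv_r, Rmult_1_l by lra; nra)).
  unfold lnorm in Q'. pose proof (Rle_abs (ln (b ^ 2 + t ^ 2) / 2 - ln (a ^ 2 + t ^ 2) / 2)). lra.
Qed.

Lemma ln_kz_zeta (x y : R) : 1 < x -> 0 < y -> ln (Cmod (kz (x, y))) = ln (Cmod (zeta (x, y))) + lnorm y (x - 1).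
Proof.
  intros Hx Hy. assert (ND : (x, y) <> RtoC 1) by (intros F; injection F; intros; lra).
  assert (E : ((x, y) - RtoC 1)%C = (x - 1, y)) by (unfold RtoC, Cminus, Copp, Cplus; cbn [fst snd]; f_equal; ring).
  rewrite (kz_zeta _ ND), Cmod_mult, E.
  assert (0 < Cmod (x - 1, y)) by (apply Cmod_gt_0; intros Q; injection Q; intros; lra).
  rewrite ln_mult, ln_Cmod_lnorm by (try apply zeta_pos; lra). ring.
Qed.

(** sinh q / (cosh q - 1) = 1 + 2 / (exp q - 1) and sinh q / (cosh q + 1) = 1 - 2 / (exp q + 1). *)
Lemma sinh_quot_bounds (q w B : R) : 0 < q ->
  (w * (cosh q - 1) <= sinh q * B -> w <= B * (1 + 2 / (exp q - 1))) /\
  (sinh q * B <= w * (cosh q + 1) -> B * (1 - 2 / (exp q + 1)) <= w).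
Proof.
  intros Hq. assert (E : 1 < exp q) by (rewrite <- exp_0; now apply exp_increasing).
  unfold sinh, cosh. rewrite exp_Ropp. set (e := exp q) in *. split; intros H.
  - apply (Rmult_le_reg_r ((e + / e) / 2 - 1)).
    + replace ((e + / e) / 2 - 1) with ((e - 1) ^ 2 / (2 * e)) by (field; lra). apply Rdiv_lt_0_compat; [apply pow_lt|]; lra.
    + eapply Rle_trans; [exact H|]. right. field; lra.
  - apply (Rmult_le_reg_r ((e + / e) / 2 + 1)).
    + assert (0 < / e) by pos. lra.
    + eapply Rle_trans; [|exact H]. right. field; lra.
Qed.

Lemma exp_quadratic (y : R) : 0 <= y -> 1 + y + y ^ 2 / 2 <= exp y.
Proof.
  intros Hy. assert (Der : forall x, is_derive (fun x => exp x - 1 - x - x ^ 2 / 2) x (exp x - 1 - x)) by (intros x; auto_derive; [easy|simpl; field]).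
  destruct (MVT_gen (fun x => exp x - 1 - x - x ^ 2 / 2) 0 y (fun x => exp x - 1 - x)) as [x [_ Hx]].
  - intros; apply Der.
  - intros x _. apply continuity_pt_filterlim, (ex_derive_continuous (fun x => exp x - 1 - x - x ^ 2 / 2)). eexists; apply Der.
  - rewrite exp_0 in Hx. pose proof (exp_ineq1_le x). nra.
Qed.

(** * A single step of length 2h *)

Section Step.
Variables (t h del : R) (N : nat).
Hypothesis HRH : RH.
Hypothesis Ht : 3200 <= t.
Hypothesis Hh : 0 < h <= 1 / 16.
Hypothesis Hdel : 0 < del <= 2.
Hypothesis HN : (1 <= N)%nat.

(** The disc of radius 4 ends at real part 1/2 + 2h, so z - h stays at distance h from the critical
    line, and at distance h / 2 for the slightly larger radius [R1]. The circle of radius 3 lies in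
    Re z >= 3/2 + 2h. *)
Let c : C := (9 / 2 + 2 * h, t).
Let R1 : R := 4 + h / 2.
Let b : R := ln (t / (2 * PI)).
Let e1 : R := h / 10000.

Lemma disc_coords (z : C) : Cmod (z - c) < R1 -> 1 / 2 + 3 / 2 * h <= Re z <= 9 /\ t - 5 <= Im z <= t + 5 /\ Cmod z <= t + 15.
Proof.
  intros Hz. unfold c, R1 in Hz.
  pose proof (re_le_Cmod (z - (9 / 2 + 2 * h, t))) as A. pose proof (im_le_Cmod (z - (9 / 2 + 2 * h, t))) as B.
  rewrite Re_minus in A. rewrite Im_minus in B. cbn [Re Im fst snd] in A, B. apply Rabs_le_between in A. apply Rabs_le_between in B.
  repeat split; try lra. eapply Rle_trans; [apply Cmod_le_sum|]. rewrite !Rabs_right; lra.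
Qed.

(** 0.0065 collects 12 / t <= 0.00376 for the variation of log |z| over the disc, 8 / y <= 0.0026
    from [gquot_ln], and the freely chosen 0.0001. *)
Lemma gquot_disc_bound : exists n, (forall z, Cmod (z - c) < R1 -> Rabs (- ln (gquot n h z) - h * b) <= h * 0.0065) /\
  (forall z, Cmod (z - c) < R1 -> ln (Cmod (kz (z - RtoC h))) + ln (gquot n h z) <= ln (Cmod (kz (z + RtoC h))) + e1).
Proof.
  pose proof PI_RGT_0 as PP.
  destruct (gquot_ln h (t + 20) (h / 10000) ltac:(lra) ltac:(lra) ltac:(lra)) as [N1 H1].
  destruct (phragmen_lindelof h e1 (t + 20) HRH ltac:(lra) ltac:(lra) ltac:(unfold e1; lra)) as [N2 H2].
  exists (N1 + N2)%nat. split; intros z Hz; destruct (disc_coords z Hz) as [A [B D]].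
  - destruct z as [x y]. cbn [Re Im fst snd] in A, B.
    specialize (H1 (N1 + N2)%nat x y ltac:(lia) ltac:(lra) ltac:(lra)).
    assert (L1 : ln (t - 5) <= lnorm y (x + 1)).
    { unfold lnorm. assert ((t - 5) ^ 2 <= (x + 1) ^ 2 + y ^ 2) by (assert ((t - 5) ^ 2 <= y ^ 2) by (apply pow_incr; lra); pose proof (pow2_ge_0 (x + 1)); lra).
      assert (L : ln ((t - 5) ^ 2) <= ln ((x + 1) ^ 2 + y ^ 2)) by (apply ln_le; [apply pow_lt; lra|easy]).
      rewrite <- (Rpower_pow 2) in L by lra. unfold Rpower in L. rewrite ln_exp in L. simpl INR in L. lra. }
    assert (L2 : lnorm y (x + 1) <= ln (t + 6)).
    { unfold lnorm. assert ((x + 1) ^ 2 + y ^ 2 <= (t + 6) ^ 2).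
      { assert (y ^ 2 <= (t + 5) ^ 2) by (apply pow_incr; lra). assert ((x + 1) ^ 2 <= 10 ^ 2) by (apply pow_incr; lra). lra. }
      assert (L : ln ((x + 1) ^ 2 + y ^ 2) <= ln ((t + 6) ^ 2)) by (apply ln_le; [pose proof (pow2_ge_0 (x + 1)); assert (0 < y ^ 2) by (apply pow_lt; lra); lra|easy]).
      rewrite <- (Rpower_pow 2 (t + 6)) in L by lra. unfold Rpower in L. rewrite ln_exp in L. simpl INR in L. lra. }
    assert (U : forall d, Rabs d <= 6 -> Rabs (ln (t + d) - ln t) <= 12 / t).
    { intros d Hd. rewrite <- ln_div by (apply Rabs_le_between in Hd; lra). replace ((t + d) / t) with (1 + d / t) by (field; lra).
      assert (Rabs (d / t) <= 6 / t).
      { unfold Rdiv. rewrite Rabs_mult, (Rabs_right (/ t)) by (apply Rle_ge; pos). apply Rmult_le_compat_r; [pos|easy]. }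
      assert (6 / t <= 1 / 2) by (apply Rle_div_l; lra).
      pose proof (ln_near_1 (d / t) ltac:(lra)). replace (12 / t) with (2 * (6 / t)) by (field; lra). lra. }
    pose proof (U (-5) ltac:(rewrite Rabs_left; lra)) as U1. pose proof (U 6 ltac:(rewrite Rabs_right; lra)) as U2.
    replace (t + -5) with (t - 5) in U1 by ring.
    assert (T12 : 12 / t <= 0.00376) by (apply Rle_div_l; lra).
    assert (T8 : 8 * h / y <= h * 0.0026) by (apply Rle_div_l; nra).
    assert (Eb : b = ln t - ln (2 * PI)) by (unfold b; rewrite ln_div; lra).
    apply Rabs_le_between in U1. apply Rabs_le_between in U2. apply Rabs_le_between in H1. rewrite Eb.
    assert (X1 : h * (ln t - 0.00376 - ln (2 * PI)) <= h * (lnorm y (x + 1) - ln (2 * PI))) by (apply Rmult_le_compat_l; lra).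
    assert (X2 : h * (lnorm y (x + 1) - ln (2 * PI)) <= h * (ln t + 0.00376 - ln (2 * PI))) by (apply Rmult_le_compat_l; lra).
    apply Rabs_le. lra.
  - specialize (H2 (N1 + N2)%nat z ltac:(lia) ltac:(lra) ltac:(lra)).
    destruct (gquot_bound (N1 + N2) h z ltac:(lra) ltac:(lra)) as [G _].
    assert (P1 : 0 < Cmod (kz (z - RtoC h))) by (apply Cmod_gt_0, kz_nonzero; [easy|rewrite Re_minus; simpl; lra]).
    assert (P2 : 0 < Cmod (kz (z + RtoC h))) by (apply Cmod_gt_0, kz_nonzero; [easy|rewrite Re_plus; simpl; lra]).
    apply ln_le in H2; [|pos]. rewrite !ln_mult in H2; try easy; [|unfold e1; lra].
    pose proof (exp_ineq1_le e1) as I. apply ln_le in I; [rewrite ln_exp in I; lra|unfold e1; lra].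
Qed.

Lemma log_kz_quot_right (z : C) : 3 / 2 + 2 * h <= Re z -> t - 5 <= Im z ->
  Rabs (ln (Cmod (kz (z + RtoC h))) - ln (Cmod (kz (z - RtoC h)))) <= 2 * h / (Re z - h - 1) + h / (t - 5).
Proof.
  intros Hx Hy. destruct z as [x y]. cbn [Re Im fst snd] in Hx, Hy.
  replace ((x, y) + RtoC h)%C with (x + h, y) by (unfold RtoC, Cplus; cbn [fst snd]; f_equal; ring).
  replace ((x, y) - RtoC h)%C with (x - h, y) by (unfold RtoC, Cminus, Copp, Cplus; cbn [fst snd]; f_equal; ring).
  cbn [Re fst]. rewrite !ln_kz_zeta by lra.
  pose proof (log_zeta_ratio (x - h) (x + h) y ltac:(lra) ltac:(lra)) as A.
  replace (x + h - (x - h)) with (2 * h) in A by ring.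
  destruct (lnorm_half_slope y (x - h - 1) (x + h - 1) ltac:(lra) ltac:(lra)) as [B1 B2].
  replace (x + h - 1 - (x - h - 1)) with (2 * h) in B2 by ring. replace (2 * h / (2 * y)) with (h / y) in B2 by (field; lra).
  assert (h / y <= h / (t - 5)) by (apply Rmult_le_compat_l; [lra|]; apply Rinv_le_contravar; lra).
  apply Rabs_le_between in A. apply Rabs_le; lra.
Qed.

(** [disc_estimate] at the point at distance [del] from the left end of the disc. With q = N tau >=
    y the first part of [sinh_quot_bounds] gives the upper bound; the second leaves only b (2
    exp(-y)), because there the gamma contribution h b nearly cancels against the one subtracted
    when passing from f back to zeta. *)
Lemma zeta_step : let K1 := 0.79 * sqrt (wsum N) in let y := INR N * del / 4 in
  let W := ln (Cmod (kz (1 / 2 + 3 * h + del, t))) - ln (Cmod (kz (1 / 2 + h + del, t))) in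
  W <= h * (0.015 + 2 * K1 + (b + 0.007 + 2 * K1) * (2 / (y + y ^ 2 / 2))) /\
  - W <= h * (0.015 + 2 * K1 + b * (2 * exp (- y))).
Proof.
  intros K1 y W. pose proof PI_RGT_0 as PP. pose proof PI_4 as P4.
  destruct gquot_disc_bound as [n [Gb Gp]].
  assert (Bb : 1 <= b).
  { rewrite <- (ln_exp 1). apply ln_le; [apply exp_pos|]. pose proof exp_le_3. apply (Rle_div_r _ _ (2 * PI)); [lra|]. nra. }
  assert (K0 : 0 < K1) by (unfold K1; apply Rmult_lt_0_compat; [lra|]; apply sqrt_lt_R0; pose proof (wsum_ge_1 N); lra).
  destruct (kz_lower_rect (1 / 2 + h / 2) 10 (t - 5) (t + 5)) as [m [Pm Hm]]; try lra.
  { intros z [[A _] _]. apply kz_nonzero; [easy|lra]. }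
  destruct (kz_unif (1 / 2) (t + 20) (m * e1 / 2) ltac:(lra)) as [M [HM Ap]]; [unfold e1; nra|].
  assert (Close : forall z, Cmod (z - c) < R1 -> forall s, (s = RtoC h \/ s = (- RtoC h)%C) ->
    0 < Cmod (kN M (z + s)) /\ Rabs (ln (Cmod (kN M (z + s))) - ln (Cmod (kz (z + s)))) <= e1).
  { intros z Hz s Hs. destruct (disc_coords z Hz) as [A [B D]].
    assert (Rs : Rabs (Re s) <= h /\ Im s = 0 /\ Cmod s <= h).
    { assert (Ah : Rabs h = h) by (apply Rabs_right; lra). destruct Hs; subst s; rewrite ?Cmod_opp, Cmod_R; simpl; rewrite ?Rabs_Ropp, Ah; repeat split; lra. }
    destruct Rs as [R1s [R2s R3s]]. apply Rabs_le_between in R1s.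
    apply (ln_Cmod_close _ _ m e1 Pm); [unfold e1; lra| |].
    - apply Hm. split; [rewrite Re_plus; lra|rewrite Im_plus, R2s; lra].
    - apply (Ap M _ (le_n M)); [rewrite Re_plus; lra|]. eapply Rle_trans; [apply Cmod_triangle|]. lra. }
  set (g := HMul (hshift (RtoC h) (kN_e M)) (HInv (hshift (- RtoC h) (kN_e M)))).
  (* The factor exp(3 e1) restores the nonnegativity of log |f|: e1 is lost in each of the two
     approximations by [kN] and once in [gquot_disc_bound]. *)
  set (C0 := exp (3 * e1) / Rpower (INR (S n) / PI) (- h)).
  assert (PC0 : 0 < C0) by pos.
  set (f := HMul (HConst (RtoC C0)) (HMul g (HMul (gprod_e n (- RtoC h)) (HInv (gprod_e n (RtoC h)))))).
  assert (Facts : forall z, Cmod (z - c) < R1 -> (hwf f z /\ heval f z <> RtoC 0) /\ (hwf g z /\ heval g z <> RtoC 0) /\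
    logmod g z = ln (Cmod (kN M (z + RtoC h))) - ln (Cmod (kN M (z - RtoC h))) /\ logmod f z = logmod g z + (3 * e1 - ln (gquot n h z))).
  { intros z Hz. destruct (disc_coords z Hz) as [A [B D]].
    destruct (Close z Hz _ (or_introl eq_refl)) as [Pp _]. destruct (Close z Hz _ (or_intror eq_refl)) as [Pn _].
    destruct (gprod_e_eval n (RtoC h) z) as [G1 W1]. destruct (gprod_e_eval n (- RtoC h) z) as [G2 W2].
    destruct (hshift_eval (- RtoC h) (kN_e M) z) as [S1 V1]. destruct (hshift_eval (RtoC h) (kN_e M) z) as [S2 V2].
    destruct (kN_e_eval M (z + - RtoC h) HM) as [X1 U1]. destruct (kN_e_eval M (z + RtoC h) HM) as [X2 U2]. rewrite X1 in S1. rewrite X2 in S2.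
    assert (Pg1 : 0 < gprod n (z + RtoC h)) by (apply gprod_pos; rewrite Re_plus; simpl; lra).
    assert (Pg2 : 0 < gprod n (z + - RtoC h)) by (apply gprod_pos; rewrite Re_plus; simpl; lra).
    assert (Eg : Cmod (heval g z) = Cmod (kN M (z + RtoC h)) / Cmod (kN M (z + - RtoC h))).
    { unfold g. change (heval (HMul ?a (HInv ?d)) z) with (heval a z * / heval d z)%C. rewrite Cmod_mult, Cmod_inv, S1, S2; [easy|rewrite S1; now apply Cmod_pos_neq]. }
    assert (Pg : 0 < Cmod (heval g z)) by (rewrite Eg; now apply Rdiv_lt_0_compat).
    assert (Ef : Cmod (heval f z) = C0 * (Cmod (heval g z) * (gprod n (z + - RtoC h) / gprod n (z + RtoC h)))).
    { unfold f. change (heval (HMul (HConst ?k) (HMul ?a (HMul ?d (HInv ?e)))) z) with (k * (heval a z * (heval d z * / heval e z)))%C.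
      rewrite !Cmod_mult, Cmod_inv, G1, G2, Cmod_R, Rabs_right by (lra || (apply Cmod_pos_neq; rewrite G1; lra)). easy. }
    assert (Pf : 0 < Cmod (heval f z)) by (rewrite Ef; apply Rmult_lt_0_compat; [easy|apply Rmult_lt_0_compat; [easy|pos]]).
    assert (Wg : hwf g z).
    { change (hwf (hshift (RtoC h) (kN_e M)) z /\ (hwf (hshift (- RtoC h) (kN_e M)) z /\ heval (hshift (- RtoC h) (kN_e M)) z <> RtoC 0)).
      rewrite S1. repeat split; [now apply V2|now apply V1|now apply Cmod_pos_neq]. }
    split; [split; [|now apply Cmod_pos_neq]|split; [split; [exact Wg|now apply Cmod_pos_neq]|split]].
    - change (True /\ (hwf g z /\ (hwf (gprod_e n (- RtoC h)) z /\ (hwf (gprod_e n (RtoC h)) z /\ heval (gprod_e n (RtoC h)) z <> RtoC 0)))).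
      assert (NZ : heval (gprod_e n (RtoC h)) z <> RtoC 0) by (apply Cmod_pos_neq; now rewrite G1). tauto.
    - unfold logmod. rewrite Eg, ln_div by easy. easy.
    - unfold logmod. rewrite Ef. unfold gquot. change (z - RtoC h)%C with (z + - RtoC h)%C.
      assert (PR : 0 < Rpower (INR (S n) / PI) (- h)) by apply exp_pos.
      assert (Pgg : 0 < gprod n (z + - RtoC h) / gprod n (z + RtoC h)) by now apply Rdiv_lt_0_compat.
      rewrite (ln_mult C0), (ln_mult (Cmod _)), !ln_div, (ln_mult (Rpower _ _)), ln_div by (try easy; try (now apply Rmult_lt_0_compat); now apply Rdiv_lt_0_compat).
      unfold C0. rewrite ln_div, ln_exp by pos. ring. }
  assert (Beta : forall z, Cmod (z - c) < R1 -> h * (b - 0.007) <= 3 * e1 - ln (gquot n h z) <= h * (b + 0.007)).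
  { intros z Hz. pose proof (Gb z Hz) as G. apply Rabs_le_between in G. unfold e1. lra. }
  assert (InP : forall r th, 0 <= r < R1 -> Cmod (pt c r th - c) < R1) by (intros r th Hr; rewrite Cmod_pt, Rabs_right; lra).
  (* Then 4 exp(-tau) = 4 - del, the distance of the evaluation point from the centre. *)
  set (tau := ln (4 / (4 - del))).
  assert (Qd : 1 < 4 / (4 - del)) by (apply (Rlt_div_r _ _ (4 - del)); lra).
  assert (Ptau : 0 < tau) by (unfold tau; rewrite <- ln_1; apply ln_increasing; lra).
  assert (Etau : exp (- tau) = (4 - del) / 4) by (unfold tau; rewrite exp_Ropp, exp_ln by lra; field; lra).
  assert (Ltau : del / 4 <= tau).
  { pose proof (exp_ineq1_le (- tau)) as I. lra. }
  (* 2h [rho0] comes from [log_kz_quot_right]; the extra 0.4 percent absorbs h / (t - 5) and 2 e1,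
     because [rho0] is at least 2/13. *)
  set (A := 2 * h * 1.004).
  pose proof (disc_estimate f g c R1 A (h * (b - 0.007)) (h * (b + 0.007)) N) as DE.
  assert (DE' := DE ltac:(unfold R1; lra) ltac:(intros z Hz; apply (Facts z Hz)) ltac:(intros z Hz; apply (Facts z Hz))). clear DE.
  assert (Pos : forall th, 0 <= logmod f (pt c 4 th)).
  { intros th. pose proof (InP 4 th ltac:(unfold R1; lra)) as Hz. set (z := pt c 4 th) in *. destruct (Facts z Hz) as [_ [_ [F1 F2]]].
    destruct (Close z Hz _ (or_introl eq_refl)) as [_ C1]. destruct (Close z Hz _ (or_intror eq_refl)) as [_ C2]. pose proof (Gp z Hz) as G.
    change (z + - RtoC h)%C with (z - RtoC h)%C in C2. apply Rabs_le_between in C1. apply Rabs_le_between in C2. lra. }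
  specialize (DE' Pos).
  assert (Bd : forall th, h * (b - 0.007) <= logmod f (pt c 4 th) - logmod g (pt c 4 th) <= h * (b + 0.007)).
  { intros th. pose proof (InP 4 th ltac:(unfold R1; lra)) as Hz. destruct (Facts _ Hz) as [_ [_ [_ F2]]]. pose proof (Beta _ Hz). lra. }
  specialize (DE' Bd ltac:(unfold A; lra)).
  assert (Gd : forall th, Rabs (logmod g (pt c 3 th)) <= A * rho0 th).
  { intros th. pose proof (InP 3 th ltac:(unfold R1; lra)) as Hz. destruct (disc_coords _ Hz) as [A1 [A2 _]].
    destruct (Facts _ Hz) as [_ [_ [F1 _]]].
    destruct (Close _ Hz _ (or_introl eq_refl)) as [_ C1]. destruct (Close _ Hz _ (or_intror eq_refl)) as [_ C2].
    change (pt c 3 th + - RtoC h)%C with (pt c 3 th - RtoC h)%C in C2.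
    assert (RE : Re (pt c 3 th) = 9 / 2 + 2 * h - 3 * cos th).
    { simpl. ring. }
    pose proof (COS_bound th) as CB.
    pose proof (log_kz_quot_right (pt c 3 th) ltac:(rewrite RE; lra) ltac:(lra)) as Q. rewrite RE in Q.
    assert (Q1 : 2 * h / (9 / 2 + 2 * h - 3 * cos th - h - 1) <= 2 * h * rho0 th).
    { apply Rmult_le_compat_l; [lra|]. apply Rinv_le_contravar; lra. }
    assert (Q2 : h / (t - 5) <= h * 0.00032) by (apply Rle_div_l; nra).
    destruct (rho0_bounds th) as [RB _].
    apply Rabs_le_between in C1. apply Rabs_le_between in C2. apply Rabs_le_between in Q.
    assert (Q3 : h * 0.00052 <= h * (0.008 * rho0 th)) by (apply Rmult_le_compat_l; lra).
    unfold A. apply Rabs_le. unfold e1 in *. lra. }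
  specialize (DE' Gd HN tau Ptau). rewrite Etau in DE'. replace (4 * ((4 - del) / 4)) with (4 - del) in DE' by field.
  assert (EP : pt c (4 - del) 0 = (1 / 2 + 2 * h + del, t)).
  { unfold pt, cis, c, RtoC, Cminus, Copp, Cplus, Cmult. rewrite cos_0, sin_0. cbn [fst snd]. f_equal; field. }
  pose proof (InP (4 - del) 0 ltac:(unfold R1; lra)) as Hz. rewrite EP in DE', Hz.
  destruct (Facts _ Hz) as [_ [_ [F1 F2]]]. pose proof (Beta _ Hz) as BZ.
  destruct (Close _ Hz _ (or_introl eq_refl)) as [_ C1]. destruct (Close _ Hz _ (or_intror eq_refl)) as [_ C2].
  set (z0 := (1 / 2 + 2 * h + del, t) : C) in *. change (z0 + - RtoC h)%C with (z0 - RtoC h)%C in C2.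
  assert (EW : W = ln (Cmod (kz (z0 + RtoC h))) - ln (Cmod (kz (z0 - RtoC h)))).
  { unfold W, z0. do 2 f_equal; [| f_equal]; f_equal; f_equal; unfold RtoC, Cminus, Copp, Cplus; cbn [fst snd]; f_equal; ring. }
  set (w := logmod f z0) in *. set (q := INR N * tau) in *. set (KK := A * 0.7855 * sqrt (wsum N)) in *.
  assert (PN : 1 <= INR N) by (apply (le_INR 1); lia).
  assert (Pq : 0 < q) by pos.
  assert (Hy : 0 < y <= q).
  { unfold y, q. split; [apply Rdiv_lt_0_compat; [apply Rmult_lt_0_compat|]; lra|]. replace (INR N * del / 4) with (INR N * (del / 4)) by field. apply Rmult_le_compat_l; lra. }
  assert (HK : 0 <= KK <= 2 * h * K1).
  { unfold KK, K1, A. assert (0 <= sqrt (wsum N)) by apply sqrt_pos. split; nra. }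
  destruct DE' as [D1 D2]. destruct (sinh_quot_bounds q w (h * (b + 0.007) + KK) Pq) as [E1 _]. destruct (sinh_quot_bounds q w (h * (b - 0.007) - KK) Pq) as [_ E2].
  specialize (E1 D1). specialize (E2 D2). apply Rabs_le_between in C1. apply Rabs_le_between in C2.
  assert (Eq1 : 1 + y + y ^ 2 / 2 <= exp q).
  { apply Rle_trans with (exp y); [|apply exp_le; lra].
    apply exp_quadratic; lra. }
  assert (Py2 : 0 <= y ^ 2) by apply pow2_ge_0.
  assert (T1 : 2 / (exp q - 1) <= 2 / (y + y ^ 2 / 2)) by (apply Rmult_le_compat_l; [lra|]; apply Rinv_le_contravar; lra).
  assert (T0 : 0 < 2 / (exp q - 1)) by pos.
  assert (T3 : 2 / (exp q + 1) <= 2 * exp (- y)).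
  { apply Rmult_le_compat_l; [lra|]. rewrite exp_Ropp. apply Rinv_le_contravar; [apply exp_pos|]. assert (exp y <= exp q) by (apply exp_le; lra). lra. }
  assert (T4 : 0 < 2 / (exp q + 1) <= 1).
  { split; [pos|]. apply Rle_div_l; lra. }
  set (u1 := 2 / (exp q - 1)) in *. set (u2 := 2 / (exp q + 1)) in *. set (v1 := 2 / (y + y ^ 2 / 2)) in *. set (v2 := 2 * exp (- y)) in *.
  rewrite EW. unfold e1 in *. split.
  - assert (Z1 : (h * (b + 0.007) + KK) * (1 + u1) <= h * (b + 0.007 + 2 * K1) * (1 + v1)) by (apply Rmult_le_compat; nra).
    nra.
  - assert (Z2 : h * (b - 0.007) * u2 <= h * (b - 0.007) * v2) by (apply Rmult_le_compat_l; [pos|easy]).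
    assert (Z3 : KK * (1 - u2) <= KK * 1) by (apply Rmult_le_compat_l; lra).
    assert (Z4 : h * (b - 0.007) * v2 <= h * b * v2) by (apply Rmult_le_compat_r; [unfold v2; pose proof (exp_pos (- y)); lra|]; nra).
    nra.
Qed.
End Step.

(** * Summation over small steps *)

(** 1 / (y + y^2 / 2) is minus the derivative of log(1 + 2 / y) and decreases, so d times its value
    at y is at most its integral over the preceding interval of length d. *)
Lemma ln_ratio_step (y d : R) : 0 < d < y -> d / (y + y ^ 2 / 2) <= ln (1 + 2 / (y - d)) - ln (1 + 2 / y).
Proof.
  intros H. assert (P1 : 0 < 2 / (y - d)) by pos. assert (P2 : 0 < 2 / y) by pos.
  rewrite <- ln_div by lra.
  set (v := 2 * d / ((y - d) * (y + 2))).
  assert (PV : 0 < v) by pos.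
  replace ((1 + 2 / (y - d)) / (1 + 2 / y)) with (1 + v) by (unfold v; field; lra).
  pose proof (exp_ineq1_le (- v / (1 + v))) as I. replace (1 + - v / (1 + v)) with (/ (1 + v)) in I by (field; lra).
  apply ln_le in I; [|pos]. rewrite ln_exp, ln_Rinv in I by lra.
  apply Rle_trans with (v / (1 + v)); [|unfold Rdiv in *; lra].
  replace (v / (1 + v)) with (2 * d / ((y - d) * (y + 2) + 2 * d)).
  2:{ unfold v. field. repeat split; nra. }
  replace (d / (y + y ^ 2 / 2)) with (2 * d / (y * (y + 2))) by (field; split; nra).
  apply Rmult_le_compat_l; [lra|]. apply Rinv_le_contravar; nra.
Qed.

Lemma exp_step (y d : R) : d * exp (- y) <= exp (- (y - d)) - exp (- y).
Proof.
  replace (- (y - d)) with (- y + d) by ring. rewrite exp_plus. pose proof (exp_ineq1_le d). pose proof (exp_pos (- y)). nra.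
Qed.

Section Chain.
Variables (t sg : R) (N : nat).
Hypothesis HRH : RH.
Hypothesis Ht : 3200 <= t.
Hypothesis Hsg : 1 / 2 < sg < 3 / 2.
Hypothesis HN : (1 <= N)%nat.

Let b : R := ln (t / (2 * PI)).
Let K1 : R := 0.79 * sqrt (wsum N).
Let s : R := sg - 1 / 2.
Let u (x : R) : R := ln (Cmod (kz (x, t))).

Lemma b_ge_1 : 1 <= b.
Proof.
  pose proof PI_RGT_0. pose proof PI_4. rewrite <- (ln_exp 1). apply ln_le; [apply exp_pos|]. pose proof exp_le_3.
  apply (Rle_div_r _ _ (2 * PI)); [lra|]. nra.
Qed.

Lemma K1_pos : 0 < K1.
Proof. apply Rmult_lt_0_compat; [lra|]. apply sqrt_lt_R0. pose proof (wsum_ge_1 N); lra. Qed.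

(** y advances by N h / 2 in each step, so the bounds of [zeta_step] telescope through
    [ln_ratio_step] and [exp_step]. The comparison uses the preceding value of y, hence 3h rather
    than h in y0. The one-sided estimate sums exponentials only; this is why the upper bound for log
    |zeta| carries no logarithm. *)
Lemma chain_partial (h : R) (j : nat) : 0 < h <= 1 / 16 -> 3 * h < s -> sg + 2 * h * INR j <= 3 / 2 ->
  let yl := INR N * (s - 3 * h + 2 * h * INR j) / 4 in let y0 := INR N * (s - 3 * h) / 4 in
  Rabs (u (sg + 2 * h * INR j) - u sg) <= INR j * h * (0.015 + 2 * K1) + 4 / INR N * (b + 0.007 + 2 * K1) * (ln (1 + 2 / y0) - ln (1 + 2 / yl)) /\
  u sg - u (sg + 2 * h * INR j) <= INR j * h * (0.015 + 2 * K1) + 4 / INR N * b * (exp (- y0) - exp (- yl)).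
Proof.
  intros Hh Hs. assert (PN : 1 <= INR N) by (apply (le_INR 1); lia). pose proof b_ge_1 as Bb. pose proof K1_pos as PK.
  induction j as [|j IH]; intros Hj yl y0.
  - unfold yl. simpl INR. rewrite !Rmult_0_r, !Rplus_0_r. fold y0. rewrite !Rminus_diag, Rabs_R0. lra.
  - rewrite S_INR in *. pose proof (pos_INR j) as Pj. assert (P2 : 0 <= 2 * h * INR j) by pos.
    specialize (IH ltac:(lra)). fold y0 in IH. set (yp := INR N * (s - 3 * h + 2 * h * INR j) / 4) in *.
    set (del := s - h + 2 * h * INR j). set (d := INR N * h / 2).
    assert (Ey : yl = yp + d) by (unfold yl, yp, d; rewrite ?S_INR; field).
    assert (Hy : 0 < yp) by (unfold yp; apply Rdiv_lt_0_compat; [apply Rmult_lt_0_compat|]; lra).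
    assert (Hd : 0 < d) by (unfold d; apply Rdiv_lt_0_compat; [apply Rmult_lt_0_compat|]; lra).
    pose proof (zeta_step t h del N HRH Ht Hh ltac:(unfold del, s in *; lra) HN) as Z. cbv zeta in Z. fold b K1 in Z.
    replace (INR N * del / 4) with yl in Z by (unfold yl, del; rewrite ?S_INR; field).
    replace (1 / 2 + 3 * h + del) with (sg + 2 * h * (INR j + 1)) in Z by (unfold del, s; ring).
    replace (1 / 2 + h + del) with (sg + 2 * h * INR j) in Z by (unfold del, s; field).
    fold (u (sg + 2 * h * (INR j + 1))) (u (sg + 2 * h * INR j)) in Z.
    pose proof (ln_ratio_step yl d ltac:(lra)) as L. pose proof (exp_step yl d) as E. replace (yl - d) with yp in L, E by lra.
    destruct IH as [IH1 IH2]. apply Rabs_le_between in IH1.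
    set (v := yl + yl ^ 2 / 2) in *. assert (Pv : 0 < v) by (unfold v; assert (0 <= yl ^ 2) by apply pow2_ge_0; lra).
    assert (X1 : h * ((b + 0.007 + 2 * K1) * (2 / v)) <= 4 / INR N * (b + 0.007 + 2 * K1) * (ln (1 + 2 / yp) - ln (1 + 2 / yl))).
    { replace (h * ((b + 0.007 + 2 * K1) * (2 / v))) with (4 / INR N * (b + 0.007 + 2 * K1) * (d / v)) by (unfold d; field; lra).
      apply Rmult_le_compat_l; [|exact L]. apply Rmult_le_pos; [|lra]. pos. }
    (* Because exp y >= y + y^2 / 2, the downward estimate is also covered by the logarithmic one,
       and a single bound serves for the absolute value. *)
    assert (X3 : h * (b * (2 * exp (- yl))) <= h * ((b + 0.007 + 2 * K1) * (2 / v))).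
    { apply Rmult_le_compat_l; [lra|]. pose proof (exp_pos (- yl)). apply Rmult_le_compat; try lra. apply Rmult_le_compat_l; [lra|].
      rewrite exp_Ropp. apply Rinv_le_contravar; [easy|]. unfold v. apply Rle_trans with (1 + yl + yl ^ 2 / 2); [lra|]. apply exp_quadratic; lra. }
    assert (X2 : h * (b * (2 * exp (- yl))) <= 4 / INR N * b * (exp (- yp) - exp (- yl))).
    { replace (h * (b * (2 * exp (- yl)))) with (4 / INR N * b * (d * exp (- yl))) by (unfold d; field; lra).
      apply Rmult_le_compat_l; [|exact E]. apply Rmult_le_pos; [|lra]. pos. }
    split; [apply Rabs_le|]; lra.
Qed.

(** The number of steps times h is at most 1/2, so the constant part of the steps adds up to half of
    0.015 + 2 [K1]; the logarithm at sg - 3h tends to the one at sg as h tends to 0. *)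
Lemma kz_chain :
  Rabs (u (3 / 2) - u sg) <= 0.0075 + K1 + 4 / INR N * (b + 0.007 + 2 * K1) * ln (1 + 8 / (INR N * s)) /\
  u sg - u (3 / 2) <= 0.0075 + K1 + 4 / INR N * b.
Proof.
  assert (PN : 1 <= INR N) by (apply (le_INR 1); lia). pose proof b_ge_1 as Bb. pose proof K1_pos as PK.
  assert (Ps : 0 < s <= 1) by (unfold s; lra).
  assert (P4 : 0 < 4 / INR N) by pos.
  assert (Step : forall e, 0 < e -> exists h, 0 < h <= e /\ h <= 1 / 16 /\ 6 * h <= s /\ exists M, sg + 2 * h * INR M = 3 / 2 /\ INR M * h <= 1 / 2).
  { intros e He. set (e' := Rmin e (Rmin (1 / 16) (s / 6))).
    assert (Pe : 0 < e') by (apply Rmin_glb_lt; [easy|apply Rmin_glb_lt; lra]).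
    assert (E1 : e' <= e) by apply Rmin_l. assert (E2 : e' <= 1 / 16) by (eapply Rle_trans; [apply Rmin_r|apply Rmin_l]).
    assert (E3 : e' <= s / 6) by (eapply Rle_trans; [apply Rmin_r|apply Rmin_r]).
    destruct (nfloor_ex ((3 / 2 - sg) / 2 / e')) as [k Hk]; [apply Rmult_le_pos; [lra|pos]|].
    assert (PM : 0 < INR (S k)) by (apply lt_0_INR; lia).
    (* An integral number of steps has to end exactly at real part 3/2. *)
    set (h := (3 / 2 - sg) / 2 / INR (S k)).
    assert (Ph : 0 < h) by pos.
    assert (Hh : h <= e').
    { apply Rle_div_l; [easy|]. rewrite S_INR. assert (Q : (3 / 2 - sg) / 2 / e' <= INR k + 1) by lra. apply (Rle_div_l _ _ e') in Q; lra. }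
    exists h. repeat split; try lra. exists (S k). split; unfold h; [field; lra|].
    replace (INR (S k) * ((3 / 2 - sg) / 2 / INR (S k))) with ((3 / 2 - sg) / 2) by (field; lra). lra. }
  split.
  - apply le_epsilon. intros e He.
    set (C := 4 / INR N * (b + 0.007 + 2 * K1)). assert (PC : 0 < C) by pos.
    destruct (Step (e * s / (6 * C))) as [h [[H1 H2] [H3 [H4 [M [HM1 HM2]]]]]].
    { apply Rdiv_lt_0_compat; [apply Rmult_lt_0_compat|]; lra. }
    destruct (chain_partial h M ltac:(lra) ltac:(lra) ltac:(lra)) as [A _]. fold C in A. rewrite HM1 in A.
    set (y0 := INR N * (s - 3 * h) / 4) in *. set (yl := INR N * (s - 3 * h + 2 * h * INR M) / 4) in *.
    assert (Py : 0 < yl) by (unfold yl; apply Rdiv_lt_0_compat; [apply Rmult_lt_0_compat|]; lra).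
    assert (Py0 : 0 < y0) by (unfold y0; apply Rdiv_lt_0_compat; [apply Rmult_lt_0_compat|]; lra).
    assert (L0 : 0 <= ln (1 + 2 / yl)) by (rewrite <- ln_1; apply ln_le; [lra|]; assert (0 < 2 / yl) by pos; lra).
    set (q := 8 / (INR N * s)). assert (PNs : 0 < INR N * s) by pos. assert (Pq : 0 < q) by pos.
    assert (L1 : ln (1 + 2 / y0) <= ln (1 + q) + 6 * h / s).
    { assert (Rt : 1 + 2 / y0 <= (1 + q) * exp (6 * h / s)).
      { apply Rle_trans with ((1 + q) * (1 + 6 * h / s)); [|apply Rmult_le_compat_l; [lra|apply exp_ineq1_le]].
        assert (Q1 : s / (s - 3 * h) <= 1 + 6 * h / s).
        { apply Rle_div_l; [lra|]. replace ((1 + 6 * h / s) * (s - 3 * h)) with (s + 3 * h * ((s - 6 * h) / s)) by (field; lra).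
          assert (0 <= (s - 6 * h) / s) by pos. assert (0 <= 3 * h * ((s - 6 * h) / s)) by pos. lra. }
        replace (2 / y0) with (q * (s / (s - 3 * h))) by (unfold q, y0; field; lra).
        assert (0 < 6 * h / s) by pos.
        assert (q * (s / (s - 3 * h)) <= q * (1 + 6 * h / s)) by (apply Rmult_le_compat_l; lra). lra. }
      apply ln_le in Rt; [|assert (0 < 2 / y0) by pos; lra]. rewrite ln_mult, ln_exp in Rt; [lra|lra|apply exp_pos]. }
    assert (HC : C * (6 * h / s) <= e).
    { apply Rle_trans with (C * (6 * (e * s / (6 * C)) / s)); [|right; field; lra].
      apply Rmult_le_compat_l; [lra|]. apply Rmult_le_compat_r; [pos|]. lra. }
    assert (X : C * (ln (1 + 2 / y0) - ln (1 + 2 / yl)) <= C * (ln (1 + q) + 6 * h / s)) by (apply Rmult_le_compat_l; lra).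
    assert (Y : INR M * h * (0.015 + 2 * K1) <= 1 / 2 * (0.015 + 2 * K1)) by (apply Rmult_le_compat_r; lra).
    lra.
  - destruct (Step 1 ltac:(lra)) as [h [[H1 H2] [H3 [H4 [M [HM1 HM2]]]]]].
    destruct (chain_partial h M ltac:(lra) ltac:(lra) ltac:(lra)) as [_ A]. rewrite HM1 in A.
    set (y0 := INR N * (s - 3 * h) / 4) in *. set (yl := INR N * (s - 3 * h + 2 * h * INR M) / 4) in *.
    assert (Py0 : 0 < y0) by (unfold y0; apply Rdiv_lt_0_compat; [apply Rmult_lt_0_compat|]; lra).
    assert (E0 : exp (- y0) <= 1) by (rewrite <- exp_0; apply exp_le; lra). pose proof (exp_pos (- yl)).
    assert (X : 4 / INR N * b * (exp (- y0) - exp (- yl)) <= 4 / INR N * b * 1) by (apply Rmult_le_compat_l; [apply Rmult_le_pos|]; lra).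
    assert (Y : INR M * h * (0.015 + 2 * K1) <= 1 / 2 * (0.015 + 2 * K1)) by (apply Rmult_le_compat_r; lra).
    lra.
Qed.
End Chain.

Lemma ln_kz_zeta_crit (x t : R) : RH -> 1 / 2 < x -> 0 < t -> ln (Cmod (kz (x, t))) = ln (Cmod (zeta (x, t))) + lnorm t (x - 1).
Proof.
  intros HRH Hx Ht. assert (ND : (x, t) <> RtoC 1) by (intros F; injection F; intros; lra).
  assert (P : 0 < Cmod (kz (x, t))) by (apply Cmod_gt_0, kz_nonzero; [easy|simpl; lra]).
  assert (E : ((x, t) - RtoC 1)%C = (x - 1, t)) by (unfold RtoC, Cminus, Copp, Cplus; cbn [fst snd]; f_equal; ring).
  rewrite (kz_zeta _ ND), Cmod_mult, E in *.
  assert (Q : 0 < Cmod (x - 1, t)) by (apply Cmod_gt_0; intros Q; injection Q; intros; lra).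
  assert (Z : 0 < Cmod (zeta (x, t))) by (pose proof (Cmod_ge_0 (zeta (x, t))); nra).
  rewrite ln_mult, ln_Cmod_lnorm by lra. ring.
Qed.

(** The chain is anchored at real part 3/2, where |log |zeta|| <= log 3; between the two ends the
    factor |s - 1| contained in [kz] changes its logarithm by at most 0.001. *)
Lemma log_zeta_main (t sg : R) (N : nat) : RH -> 3200 <= t -> 1 / 2 < sg <= 3 / 2 -> (1 <= N)%nat ->
  let b := ln (t / (2 * PI)) in let K1 := 0.79 * sqrt (wsum N) in
  Rabs (ln (Cmod (zeta (sg, t)))) <= ln 3 + 0.01 + K1 + 4 / INR N * (b + 0.007 + 2 * K1) * ln (1 + 8 / (INR N * (sg - 1 / 2))) /\
  ln (Cmod (zeta (sg, t))) <= ln 3 + 0.01 + K1 + 4 / INR N * b.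
Proof.
  intros HRH Ht Hsg HN b K1.
  assert (PN : 1 <= INR N) by (apply (le_INR 1); lia). pose proof (b_ge_1 t Ht) as Bb. fold b in Bb. pose proof (K1_pos N) as PK. fold K1 in PK.
  assert (P4 : 0 < 4 / INR N) by pos.
  pose proof (log_zeta_bound (3 / 2) t ltac:(lra)) as Z. replace (3 / 2 / (3 / 2 - 1)) with 3 in Z by field. apply Rabs_le_between in Z.
  destruct (Req_dec sg (3 / 2)) as [E|E].
  - subst sg. assert (0 < 4 / INR N * b) by pos.
    assert (0 <= ln (1 + 8 / (INR N * (3 / 2 - 1 / 2)))).
    { rewrite <- ln_1. apply ln_le; [lra|]. assert (0 < 8 / (INR N * (3 / 2 - 1 / 2))) by pos. lra. }
    assert (0 <= 4 / INR N * (b + 0.007 + 2 * K1) * ln (1 + 8 / (INR N * (3 / 2 - 1 / 2)))) by pos.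
    split; [apply Rabs_le|]; lra.
  - destruct (kz_chain t sg N HRH Ht ltac:(lra) HN) as [A B]. fold b K1 in A, B. apply Rabs_le_between in A.
    rewrite !ln_kz_zeta_crit in A, B by (try exact HRH; lra). replace (3 / 2 - 1) with (1 / 2) in A, B by field.
    assert (Sq : (sg - 1) ^ 2 <= (1 / 2) ^ 2) by nra. assert (T2 : 10000000 <= t ^ 2) by nra. pose proof (pow2_ge_0 (sg - 1)) as S0.
    assert (L1 : lnorm t (sg - 1) <= lnorm t (1 / 2)) by (unfold lnorm; apply Rmult_le_compat_r; [lra|]; apply ln_le; lra).
    assert (L2 : lnorm t (1 / 2) <= lnorm t (sg - 1) + 0.001).
    { unfold lnorm. assert (Q : (1 / 2) ^ 2 + t ^ 2 <= ((sg - 1) ^ 2 + t ^ 2) * exp 0.001).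
      { pose proof (exp_ineq1_le 0.001). apply Rle_trans with (((sg - 1) ^ 2 + t ^ 2) * (1 + 0.001)); [|apply Rmult_le_compat_l; lra]. lra. }
      apply ln_le in Q; [|lra]. rewrite ln_mult, ln_exp in Q; [lra|lra|apply exp_pos]. }
    split; [apply Rabs_le|]; lra.
Qed.

(** * Numerical bounds *)

Lemma exp_cubic (x : R) : 0 <= x -> 1 + x + x ^ 2 / 2 + x ^ 3 / 6 <= exp x.
Proof.
  intros Hx.
  assert (S : sum_f_R0 (fun i => / INR (Factorial.fact i) * x ^ i) 3 <= exp x).
  { apply sum_incr.
    - exact (proj2_sig (exist_exp x)).
    - intros n. apply Rmult_le_pos; [left; apply Rinv_0_lt_compat, INR_fact_lt_0|now apply pow_le]. }
  simpl in S. simpl. lra.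
Qed.

Lemma exp_upper_cubic (x : R) : 0 <= x -> exp x * (1 - x + x ^ 2 / 2 - x ^ 3 / 6) <= 1.
Proof.
  intros Hx. set (g := fun x => exp x * (1 - x + x ^ 2 / 2 - x ^ 3 / 6)).
  assert (D : forall y, is_derive g y (- (exp y * (y ^ 3 / 6)))) by (intros y; unfold g; auto_derive; [easy|simpl; field]).
  destruct (MVT_gen g 0 x (fun y => - (exp y * (y ^ 3 / 6)))) as [y [Hy E]].
  - intros; apply D.
  - intros y _. apply continuity_pt_filterlim, (ex_derive_continuous g). eexists; apply D.
  - rewrite Rmin_left, Rmax_right in Hy by lra. assert (G0 : g 0 = 1) by (unfold g; rewrite exp_0; simpl; lra).
    fold (g x). assert (0 <= exp y * (y ^ 3 / 6)) by (apply Rmult_le_pos; [pos|]; assert (0 <= y ^ 3) by (apply pow_le; lra); lra). nra.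
Qed.

(** exp x = exp(x / n)^n with a cubic Taylor bound at x / n: a numerical bound becomes rational
    arithmetic, and n sets the precision. *)
Lemma exp_ge_pow (x q : R) (n : nat) : 0 <= x -> (1 <= n)%nat -> 0 <= q -> let u := x / INR n in q <= (1 + u + u ^ 2 / 2 + u ^ 3 / 6) ^ n -> q <= exp x.
Proof.
  intros Hx Hn Hq u H. assert (P : 0 < INR n) by (apply lt_0_INR; lia).
  assert (Pu : 0 <= u) by pos.
  replace x with (INR n * u) by (unfold u; field; lra). rewrite <- exp_pow. eapply Rle_trans; [exact H|].
  apply pow_incr. split; [|now apply exp_cubic]. assert (0 <= u ^ 2) by apply pow2_ge_0. assert (0 <= u ^ 3) by now apply pow_le. lra.
Qed.

Lemma exp_le_pow (x q : R) (n : nat) : 0 <= x -> (1 <= n)%nat -> let u := x / INR n in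
  0 < 1 - u + u ^ 2 / 2 - u ^ 3 / 6 -> 1 <= q * (1 - u + u ^ 2 / 2 - u ^ 3 / 6) ^ n -> exp x <= q.
Proof.
  intros Hx Hn u Hp H. assert (P : 0 < INR n) by (apply lt_0_INR; lia).
  assert (Pu : 0 <= u) by pos.
  replace x with (INR n * u) by (unfold u; field; lra). rewrite <- exp_pow.
  set (p := 1 - u + u ^ 2 / 2 - u ^ 3 / 6) in *. assert (Ppn : 0 < p ^ n) by now apply pow_lt.
  apply (Rmult_le_reg_r (p ^ n)); [easy|]. eapply Rle_trans; [|exact H]. rewrite <- Rpow_mult_distr, <- (pow1 n).
  apply pow_incr. split; [apply Rmult_le_pos; [pos|lra]|]. now apply exp_upper_cubic.
Qed.

Ltac exp_lower n := apply (exp_ge_pow _ _ n); [lra|lia|lra|simpl INR; lra].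
Ltac exp_upper n := apply (exp_le_pow _ _ n); [lra|lia|simpl INR; lra|simpl INR; lra].

Lemma exp_2_lower : 7.387 <= exp 2.
Proof. exp_lower 16%nat. Qed.

Lemma exp_exp_2_lower : 1600 <= exp (exp 2).
Proof.
  apply Rle_trans with (exp 7.387); [|apply exp_le, exp_2_lower]. exp_lower 64%nat.
Qed.

Lemma ln_3_bounds : 1.09 <= ln 3 <= 1.1.
Proof.
  split.
  - rewrite <- (ln_exp 1.09). apply ln_le; [apply exp_pos|]. exp_upper 4%nat.
  - rewrite <- (ln_exp 1.1). apply ln_le; [lra|]. exp_lower 4%nat.
Qed.

Lemma ln_10_lower : 2.29 <= ln 10.
Proof. rewrite <- (ln_exp 2.29). apply ln_le; [apply exp_pos|]. exp_upper 8%nat. Qed.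

(* Summation by parts against the quadratic [p] with [p x - (9/16) p (x + 1) = x^2]. *)
Lemma wsum_closed (N : nat) : (1 <= N)%nat ->
  wsum N = 1 + 2 / INR N ^ 2 * (3600 / 343 * (16 / 9) ^ N - (16 / 7 * INR N ^ 2 + 288 / 49 * INR N + 3600 / 343)).
Proof.
  intros HN. assert (P : 0 < INR N) by (apply lt_0_INR; lia).
  set (p := fun x => 16 / 7 * x ^ 2 + 288 / 49 * x + 3600 / 343).
  assert (G : forall m, tcoef (wgt N) (wgt N) m = 1 + 2 / INR N ^ 2 * ((16 / 9) ^ m * p (INR N - INR m) - p (INR N))).
  { induction m as [|m IH].
    - unfold wgt. simpl. unfold p. field. lra.
    - rewrite tcoef_S, IH. unfold wgt, p. rewrite S_INR.
      assert (E : (4 / 3) ^ S m * (4 / 3) ^ S m = (16 / 9) ^ S m) by (rewrite <- Rpow_mult_distr; f_equal; field).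
      replace (2 * ((1 - (INR m + 1) / INR N) * (4 / 3) ^ S m) * ((1 - (INR m + 1) / INR N) * (4 / 3) ^ S m))
        with (2 * (1 - (INR m + 1) / INR N) ^ 2 * ((4 / 3) ^ S m * (4 / 3) ^ S m)) by ring.
      rewrite E. change ((16 / 9) ^ S m) with (16 / 9 * (16 / 9) ^ m). field. lra. }
  unfold wsum. rewrite G. unfold p. destruct N as [|n]; [lia|]. simpl pred. change ((16 / 9) ^ S n) with (16 / 9 * (16 / 9) ^ n).
  replace (INR (S n) - INR n) with 1 by (rewrite S_INR; ring). field. lra.
Qed.

Definition K1 (N : nat) : R := 0.79 * sqrt (wsum N).

Lemma K1_le (N : nat) (k : R) : 0 <= k -> wsum N <= (k / (79 / 100)) ^ 2 -> K1 N <= k.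
Proof.
  intros Hk H. unfold K1. assert (sqrt (wsum N) <= k / (79 / 100)).
  { rewrite <- (sqrt_pow2 (k / (79 / 100))) by pos. now apply sqrt_le_1_alt. }
  lra.
Qed.

Lemma K1_9 : K1 9 <= 5.05.
Proof. apply K1_le; [lra|]. rewrite wsum_closed by lia. simpl INR. lra. Qed.

Lemma K1_12 : K1 12 <= 9.4.
Proof. apply K1_le; [lra|]. rewrite wsum_closed by lia. simpl INR. lra. Qed.

(** 3.621 slightly exceeds 0.79 times the square root of 7200 / 343, the leading constant of
    [wsum_closed]. *)
Lemma K1_general (N : nat) : (1 <= N)%nat -> K1 N <= 79 / 100 + 3621 / 1000 * (4 / 3) ^ N / INR N.
Proof.
  intros HN. assert (P : 0 < INR N) by (apply lt_0_INR; lia). assert (Q : 0 < (4 / 3) ^ N) by (apply pow_lt; lra).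
  assert (PQ : 0 < (4 / 3) ^ N / INR N) by pos.
  apply K1_le; [unfold Rdiv in *; lra|].
  rewrite wsum_closed by easy.
  assert (E : (16 / 9) ^ N = (4 / 3) ^ N * (4 / 3) ^ N) by (rewrite <- Rpow_mult_distr; f_equal; field). rewrite E.
  set (z := (4 / 3) ^ N / INR N) in *. replace (3621 / 1000 * (4 / 3) ^ N / INR N) with (3621 / 1000 * z) by (unfold z; field; lra).
  apply Rle_trans with (1 + 2 * (3600 / 343) * z ^ 2).
  - replace (2 / INR N ^ 2 * (3600 / 343 * ((4 / 3) ^ N * (4 / 3) ^ N) - (16 / 7 * INR N ^ 2 + 288 / 49 * INR N + 3600 / 343)))
      with (2 * (3600 / 343) * z ^ 2 - 2 * (16 / 7 * INR N ^ 2 + 288 / 49 * INR N + 3600 / 343) / INR N ^ 2) by (unfold z; field; lra).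
    assert (0 < 2 * (16 / 7 * INR N ^ 2 + 288 / 49 * INR N + 3600 / 343) / INR N ^ 2) by (apply Rdiv_lt_0_compat; nra). lra.
  - nra.
Qed.

(** Here l = log log T. The conjuncts keep the factor of the logarithm below the claimed 2 phi log T
    / log log T, the argument of the logarithm below 1 + 3.2 / x, and [K1] below what the two claims
    can absorb: 2.1 is what 3.24 leaves after log 3 and 0.01, 21.8 / (l + 25) is the gain of
    [ln_gap] from 3.2 to 25, and 2.98 = 4.9 - 1.92. For small l the values 9 and 12 replace the
    general choice just above 3l. *)
Lemma choose_N (l phi : R) : (213 / 100) <= l -> (75 / 100) <= phi <= (96 / 100) -> (l < (86 / 10) -> phi = (96 / 100)) ->
  exists N, (1 <= N)%nat /\ let L := exp l in
  4 / INR N * (L - (217 / 100) + 2 * K1 N) <= 2 * phi * L / l /\ 8 * l / INR N <= (32 / 10) /\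
  K1 N <= (21 / 10) + 2 * phi * L / l * ((218 / 10) / (l + 25)) /\ K1 N <= (21 / 10) + (298 / 100) * L / l.
Proof.
  intros Hl Hp Hphi.
  assert (EL : exp 1 * l <= exp l).
  { replace l with (1 + (l - 1)) at 2 by ring. rewrite exp_plus. apply Rmult_le_compat_l; [pos|]. pose proof (exp_ineq1_le (l - 1)); lra. }
  assert (E1 : (27 / 10) <= exp 1) by exp_lower 4%nat.
  assert (XL : (27 / 10) <= exp l / l) by (apply (Rle_div_r _ _ l); nra).
  assert (Fr : forall l0, l <= l0 -> (218 / 10) / (l0 + 25) <= (218 / 10) / (l + 25)) by (intros; apply Rmult_le_compat_l; [lra|]; apply Rinv_le_contravar; lra).
  assert (Lo : forall a c, 0 <= a <= l -> 0 <= c -> c <= exp a -> c * (1 + (l - a) + (l - a) ^ 2 / 2 + (l - a) ^ 3 / 6) <= exp l).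
  { intros a c Ha Hc Hca. replace l with (a + (l - a)) at 4 by ring. rewrite exp_plus. pose proof (exp_cubic (l - a) ltac:(lra)).
    apply Rmult_le_compat; try easy. assert (0 <= (l - a) ^ 3) by (apply pow_le; lra). pose proof (pow2_ge_0 (l - a)). lra. }
  destruct (Rle_lt_dec l (33 / 10)) as [H1|H1]; [|destruct (Rle_lt_dec l (48 / 10)) as [H2|H2]].
  - exists 9%nat. split; [lia|]. intros L. pose proof K1_9 as K. rewrite (Hphi ltac:(lra)). simpl INR.
    set (X := L / l) in *. fold L X in XL.
    replace (2 * (96 / 100) * L / l) with ((192 / 100) * X) by (unfold X; field; lra). replace ((298 / 100) * L / l) with ((298 / 100) * X) by (unfold X; field; lra).
    repeat split; try lra.
    + assert (C : (84 / 10) <= exp (213 / 100)) by exp_lower 8%nat. pose proof (Lo (213 / 100) (84 / 10) ltac:(lra) ltac:(lra) C) as B. fold L in B.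
      set (x := l - (213 / 100)) in *. assert (Hx : 0 <= x <= (117 / 100)) by (unfold x; lra).
      assert (Q : (793 / 100) * l <= L * ((432 / 100) - l)).
      { apply Rle_trans with ((84 / 10) * (1 + x + x ^ 2 / 2 + x ^ 3 / 6) * ((432 / 100) - l)); [|apply Rmult_le_compat_r; lra].
        replace l with ((213 / 100) + x) by (unfold x; ring).
        assert (X2 : 0 <= x ^ 2 <= (117 / 100) * x) by (split; nra). nra. }
      assert (E : L = X * l) by (unfold X; field; lra).
      assert (Q2 : (793 / 100) + X * l <= X * (432 / 100)) by (apply (Rmult_le_reg_r l); nra). lra.
    + pose proof (Fr (33 / 10) H1) as F. nra.
  - exists 12%nat. split; [lia|]. intros L. pose proof K1_12 as K. rewrite (Hphi ltac:(lra)). simpl INR.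
    set (X := L / l) in *.
    assert (C : (269 / 10) <= exp (33 / 10)) by exp_lower 8%nat. pose proof (Lo (33 / 10) (269 / 10) ltac:(lra) ltac:(lra) C) as B. fold L in B.
    set (x := l - (33 / 10)) in *. assert (Hx : 0 <= x <= (15 / 10)) by (unfold x; lra).
    assert (X3 : 0 <= x ^ 3) by (apply pow_le; lra). assert (X2 : 0 <= x ^ 2 <= (15 / 10) * x) by (split; nra).
    assert (XB : 8 <= X).
    { apply (Rle_div_r _ _ l); [lra|]. replace l with ((33 / 10) + x) by (unfold x; ring). lra. }
    replace (2 * (96 / 100) * L / l) with ((192 / 100) * X) by (unfold X; field; lra). replace ((298 / 100) * L / l) with ((298 / 100) * X) by (unfold X; field; lra).
    repeat split; try lra.
    + assert (Q : (167 / 10) * l <= L * ((576 / 100) - l)).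
      { apply Rle_trans with ((269 / 10) * (1 + x + x ^ 2 / 2) * ((576 / 100) - l)); [|apply Rmult_le_compat_r; lra].
        replace l with ((33 / 10) + x) by (unfold x; ring). nra. }
      assert (E : L = X * l) by (unfold X; field; lra).
      assert (Q2 : (167 / 10) + X * l <= X * (576 / 100)) by (apply (Rmult_le_reg_r l); nra). lra.
    + pose proof (Fr (48 / 10) H2) as F. nra.
  - destruct (nfloor_ex (3 * l) ltac:(lra)) as [k Hk]. exists (S k).
    assert (HN : 3 * l < INR (S k) <= 3 * l + 1) by (rewrite S_INR; lra). set (N := S k) in *. split; [lia|]. intros L.
    pose proof (K1_general N ltac:(lia)) as K. assert (PL : 0 < L) by apply exp_pos.
    (* 3 log(4/3) <= 0.864, so (4/3)^(3l) is at most exp(0.864 l) = L z. *)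
    set (z := exp (- ((136 / 1000) * l))). assert (Pz : 0 < z) by apply exp_pos.
    assert (PN : (4 / 3) ^ N <= 4 / 3 * (L * z)).
    { replace ((4 / 3) ^ N) with (4 / 3 * (4 / 3) ^ k) by easy. apply Rmult_le_compat_l; [lra|].
      assert (C : 64 / 27 <= exp (864 / 1000)) by exp_lower 4%nat.
      rewrite <- (Rpower_pow k) by lra. unfold Rpower, L, z. rewrite <- exp_plus. apply exp_le.
      assert (L43 : ln (4 / 3) * 3 <= (864 / 1000)).
      { rewrite <- (ln_exp (864 / 1000)). replace (ln (4 / 3) * 3) with (ln (64 / 27)); [apply ln_le; lra|].
        replace (64 / 27) with (4 / 3 * (4 / 3 * (4 / 3))) by field. rewrite !ln_mult by lra. ring. } nra. }
    set (X := L / l). assert (PX : 0 < X) by pos.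
    assert (KB : K1 N <= (79 / 100) + (161 / 100) * (X * z)).
    { eapply Rle_trans; [exact K|]. apply Rplus_le_compat_l. apply Rle_trans with ((3621 / 1000) * (4 / 3 * (L * z)) / (3 * l)).
      - assert (P1 : 0 < (4 / 3) ^ N) by (apply pow_lt; lra). apply Rmult_le_compat; [lra|pos|lra|].
        apply Rinv_le_contravar; lra.
      - replace ((3621 / 1000) * (4 / 3 * (L * z)) / (3 * l)) with ((3621 / 1000) * (4 / 9) * (X * z)) by (unfold X; field; lra).
        apply Rmult_le_compat_r; [pos|lra]. }
    assert (Z48 : z * (1 + (136 / 1000) * (l - (48 / 10))) <= (53 / 100)).
    { assert (C : (1887 / 1000) <= exp (6528 / 10000)) by exp_lower 2%nat.
      assert (E : z = / exp (6528 / 10000) * / exp ((136 / 1000) * (l - (48 / 10)))).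
      { rewrite <- !exp_Ropp, <- exp_plus. unfold z. f_equal. lra. }
      rewrite E. pose proof (exp_ineq1_le ((136 / 1000) * (l - (48 / 10)))) as I. set (v := exp ((136 / 1000) * (l - (48 / 10)))) in *.
      assert (B : / exp (6528 / 10000) <= / (1887 / 1000)) by (apply Rinv_le_contravar; lra).
      assert (D : / v * (1 + (136 / 1000) * (l - (48 / 10))) <= 1) by (apply (Rmult_le_reg_l v); [lra|]; rewrite <- Rmult_assoc, Rinv_r; lra).
      rewrite Rmult_assoc. apply Rle_trans with (/ (1887 / 1000) * 1); [|lra].
      apply Rmult_le_compat; [left; apply Rinv_0_lt_compat, exp_pos| |easy|easy]. apply Rmult_le_pos; [pos|lra]. }
    assert (Z1 : z <= (53 / 100)) by nra.
    assert (N1 : 1 + (322 / 100) * z / l <= (15 / 10) * phi).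
    { destruct (Rlt_dec l (86 / 10)) as [S|S].
      - assert ((322 / 100) * z / l <= (44 / 100)); [apply Rle_div_l; nra|lra].
      - assert (Z2 : z <= (32 / 100)).
        { assert (C : (3125 / 1000) <= exp (11696 / 10000)) by exp_lower 2%nat. unfold z. rewrite exp_Ropp. replace (32 / 100) with (/ (3125 / 1000)) by lra.
          apply Rinv_le_contravar; [lra|]. eapply Rle_trans; [exact C|]. apply exp_le; lra. }
        assert ((322 / 100) * z / l <= (125 / 1000)); [apply Rle_div_l; nra|lra]. }
    replace (2 * phi * L / l) with (2 * phi * X) by (unfold X; field; lra). replace ((298 / 100) * L / l) with ((298 / 100) * X) by (unfold X; field; lra).
    assert (XZ : X * z <= X * (53 / 100)) by (apply Rmult_le_compat_l; lra).
    assert (P0 : 0 < X * z) by pos.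
    repeat split.
    + apply Rle_trans with (4 / (3 * l) * (L + (322 / 100) * (X * z))).
      * assert (0 < 4 / INR N) by pos.
        apply Rle_trans with (4 / INR N * (L + (322 / 100) * (X * z))); [apply Rmult_le_compat_l; lra|].
        apply Rmult_le_compat_r; [lra|]. apply Rmult_le_compat_l; [lra|]. apply Rinv_le_contravar; lra.
      * replace (4 / (3 * l) * (L + (322 / 100) * (X * z))) with (4 / 3 * X * (1 + (322 / 100) * z / l)) by (unfold X; field; lra).
        apply Rle_trans with (4 / 3 * X * ((15 / 10) * phi)); [apply Rmult_le_compat_l; lra|lra].
    + apply Rle_div_l; lra.
    + assert (Q : (161 / 100) * z <= (15 / 10) * ((218 / 10) / (l + 25))).
      { replace ((15 / 10) * ((218 / 10) / (l + 25))) with ((327 / 10) / (l + 25)) by (field; lra). apply (Rle_div_r _ _ (l + 25)); [lra|]. lra. } set (fr := (218 / 10) / (l + 25)) in *.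
      assert (X * ((161 / 100) * z) <= X * ((15 / 10) * fr)) by (apply Rmult_le_compat_l; lra).
      assert (X * ((15 / 10) * fr) <= X * (2 * phi * fr)) by (apply Rmult_le_compat_l; [lra|]; apply Rmult_le_compat_r; lra). lra.
    + lra.
Qed.

(** * Lower bounds for the terms of Omega and for phi *)

(** At x = 0 this is the convention / 0 = 0, so that [gamma1] >= 0 is enough for the quotients
    below. *)
Lemma inv_nonneg (x : R) : 0 <= x -> 0 <= / x.
Proof. intros [H|H]; [pos|]. rewrite <- H, Rinv_0. lra. Qed.

Lemma div_nonneg (x y : R) : 0 <= x -> 0 <= y -> 0 <= x / y.
Proof. intros. apply Rmult_le_pos; [easy|now apply inv_nonneg]. Qed.

Lemma real_lim_nonneg (u : nat -> R) : (forall n, 0 <= u n) -> 0 <= real (Lim_seq u).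
Proof.
  intros H. pose proof (Lim_seq_le_loc (fun _ => 0) u) as L. rewrite Lim_seq_const in L.
  specialize (L (filter_forall _ H)). destruct (Lim_seq u); simpl in *; lra.
Qed.

(** An infimum p_infty, that of the empty set, would be sent to 0 by [real]. *)
Lemma gamma1_nonneg : 0 <= gamma1.
Proof.
  unfold gamma1. set (E := fun t => _). destruct (Glb_Rbar_correct E) as [_ G].
  assert (B : Rbar_le 0 (Glb_Rbar E)) by (apply G; intros x [Hx _]; simpl; lra).
  destruct (Glb_Rbar E); simpl in *; lra.
Qed.

Lemma ln_nonneg (x : R) : 1 <= x -> 0 <= ln x.
Proof. intros H. rewrite <- ln_1. apply ln_le; lra. Qed.

(** Holds for every real x because [ln] takes the value 0 at nonpositive arguments. *)
Lemma ln_pos_inv (x : R) : 0 < ln x -> 1 < x.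
Proof.
  intros H. destruct (Rlt_le_dec 0 x) as [P|P].
  - destruct (Rlt_le_dec 1 x) as [Q|Q]; [easy|]. apply ln_le in Q; [rewrite ln_1 in Q; lra|easy].
  - unfold ln in H. destruct (Rlt_dec 0 x); lra.
Qed.

(** On the range of integration u <= [gamma1] <= t0 / 2, so the denominator is at least 3/4. If
    [gamma1] were 0, all the truncated integrals would run over a single point. *)
Lemma R1_integral_nonneg (t0 : R) : 0 < t0 -> 2 * gamma1 <= t0 -> 0 <= R1_integral t0.
Proof.
  intros Ht0 Hg. pose proof gamma1_nonneg as G0. apply real_lim_nonneg. intros n.
  destruct (Req_dec gamma1 0) as [E|E].
  { rewrite E. replace (0 / INR (S n)) with 0 by (unfold Rdiv; ring). rewrite RInt_point. apply Rle_refl. }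
  assert (PS : 1 <= INR (S n)) by (apply (le_INR 1); lia).
  assert (Hs : 0 < gamma1 / INR (S n) <= gamma1).
  { split; [pos|]. apply Rle_div_l; nra. }
  assert (Den : forall u, gamma1 / INR (S n) <= u <= gamma1 -> 3 / 4 <= 1 - (u / t0) ^ 2).
  { intros u Hu. assert (0 <= u / t0 <= 1 / 2) by (split; [apply div_nonneg|apply Rle_div_l]; lra). nra. }
  apply RInt_ge_0; [lra| |].
  - apply (ex_RInt_continuous (V := R_CompleteNormedModule)). intros u Hu. rewrite Rmin_left, Rmax_right in Hu by lra.
    pose proof (Den u Hu) as D. pose proof PI_RGT_0.
    apply (continuousR_mult (fun u => Rabs (ln (2 * PI * exp 1 / u))) (fun u => / (1 - (u / t0) ^ 2))).
    + apply (continuous_comp (fun u => ln (2 * PI * exp 1 / u)) Rabs); [|apply continuous_Rabs].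
      apply (ex_derive_continuous (fun u => ln (2 * PI * exp 1 / u))). eexists. auto_derive; [|reflexivity].
      split; [lra|]. split; [|easy]. pose proof (exp_pos 1). apply Rmult_lt_0_compat; [pos|]. apply Rinv_0_lt_compat; lra.
    + apply (ex_derive_continuous (fun u => / (1 - (u / t0) ^ 2))). eexists. auto_derive; [|reflexivity]. simpl in D; lra.
  - intros u Hu. specialize (Den u ltac:(lra)). apply div_nonneg; [apply Rabs_pos|lra].
Qed.

Lemma R1_nonneg (t0 : R) : 1 < t0 -> 2 * gamma1 <= t0 -> 0 <= Defs.R1 t0.
Proof.
  intros Ht0 Hg. pose proof PI_RGT_0 as PP. pose proof PI_4 as P4.
  pose proof (R1_integral_nonneg t0 ltac:(lra) Hg) as I.
  assert (D : 0 <= delta t0 / PI) by pos.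
  assert (E : 1 <= 2 * exp 1 / PI) by (pose proof (exp_ineq1_le 1); apply (Rle_div_r _ _ PI); lra).
  apply ln_nonneg in E.
  assert (F : 1 <= 2 * t0 / (2 * t0 - 1)) by (apply (Rle_div_r _ _ (2 * t0 - 1)); lra).
  apply ln_nonneg in F.
  assert (A1 : 0 <= delta t0 / PI * R1_integral t0) by now apply Rmult_le_pos.
  assert (A2 : 0 <= (7 + 2 * t0) / 4 * ln (2 * t0 / (2 * t0 - 1))) by pos.
  assert (A3 : 0 <= 1 / (6 * t0)) by pos.
  assert (A4 : 0 <= 4 / (45 * t0 ^ 3)) by (apply div_nonneg; [lra|]; assert (0 < t0 ^ 3) by (apply pow_lt; lra); lra).
  pose proof (Rabs_pos (ln (Rabs (xi_real (1 / 2))))). pose proof (Rabs_pos (ln (1 / gamma1 ^ 2 - 1 / t0 ^ 2))).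
  unfold Defs.R1. lra.
Qed.

Lemma delta_ge_1 (t0 : R) : 0 < t0 -> 1 <= delta t0.
Proof. intros H. unfold delta. assert (0 < 1 / t0) by pos. nra. Qed.

(** [delta] is bounded below by 1 and (3 + e) / e by 2, which gives 117/4 + 3 + 8. *)
Lemma a1_lower (t0 : R) : 0 < t0 -> 40.25 <= a1 t0.
Proof.
  intros Ht0. unfold a1. pose proof (delta_ge_1 t0 Ht0) as D. set (d := delta t0) in *.
  assert (A : 0 <= t0 / exp (exp 2)) by pos.
  assert (B : 2 <= (3 + exp 1) / exp 1) by (pose proof (exp_pos 1); pose proof exp_le_3; apply (Rle_div_r _ _ (exp 1)); lra).
  assert (C : 4 * 2 <= (3 + d) * (t0 / exp (exp 2) + (3 + exp 1) / exp 1)) by (apply Rmult_le_compat; lra).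
  apply Rle_trans with (1 * (117 / 4 + 3 * d + (3 + d) * (t0 / exp (exp 2) + (3 + exp 1) / exp 1))); [lra|].
  apply Rmult_le_compat_r; lra.
Qed.

Lemma a2_nonneg (t0 : R) : 0 < t0 -> 0 <= a2 t0.
Proof.
  intros Ht0. pose proof (delta_ge_1 t0 Ht0). pose proof gamma1_nonneg.
  assert (0 <= t0 / (2 * gamma1)) by (apply div_nonneg; lra). assert (0 <= 1 / exp 1) by (apply div_nonneg; [lra|left; apply exp_pos]). apply Rmult_le_pos; lra.
Qed.

Lemma a3_lower (t0 : R) : 1 < t0 -> 2 * gamma1 <= t0 -> 3.24 <= a3 t0.
Proof.
  intros Ht0 Hg. pose proof gamma1_nonneg as G0. pose proof (R1_nonneg t0 Ht0 Hg). pose proof (delta_ge_1 t0 ltac:(lra)) as D.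
  unfold a3.
  assert (0 <= 3 * (1 + t0) ^ 2 / (gamma1 * (t0 ^ 2 - gamma1 ^ 2))).
  { apply div_nonneg; [pose proof (pow2_ge_0 (1 + t0)); lra|]. apply Rmult_le_pos; nra. }
  nra.
Qed.

Lemma a4_nonneg (t0 : R) : 0 < t0 -> 0 <= a4 t0.
Proof.
  intros Ht0. pose proof (delta_ge_1 t0 Ht0).
  apply Rmult_le_pos; [apply div_nonneg; [lra|]; pose proof (exp_pos 1); lra|lra].
Qed.

Lemma Mfun_bounds (a b c T0 T q : R) : 0 < b -> 0 < c -> 0 < T0 <= T -> 1 < ln T0 -> 0 < q -> q <= Rpower (ln T0) c * ln (ln T0) ->
  a < Mfun a b c T <= Mfun a b c T0 /\ Mfun a b c T0 <= a + b / q.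
Proof.
  intros Hb Hc HT H0 Hq HqT. unfold Mfun.
  assert (L : ln T0 <= ln T) by (apply ln_le; lra). assert (LL : ln (ln T0) <= ln (ln T)) by (apply ln_le; lra).
  assert (P : Rpower (ln T0) c * ln (ln T0) <= Rpower (ln T) c * ln (ln T)).
  { apply Rmult_le_compat; [pos|rewrite <- ln_1; apply ln_le; lra|apply Rle_Rpower_l; lra|easy]. }
  set (D0 := Rpower (ln T0) c * ln (ln T0)) in *. set (D := Rpower (ln T) c * ln (ln T)) in *.
  assert (0 < b / D) by pos.
  assert (b / D <= b / D0) by (apply Rmult_le_compat_l; [lra|]; apply Rinv_le_contravar; lra).
  assert (b / D0 <= b / q) by (apply Rmult_le_compat_l; [lra|]; apply Rinv_le_contravar; lra). lra.
Qed.

Lemma ln_pow_10 (n : nat) (l : R) : exp l <= INR n * 2.29 ->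
  exp l <= ln (10 ^ n) /\ l <= ln (ln (10 ^ n)) /\ 0 < 10 ^ n.
Proof.
  intros He. assert (P : 0 < 10 ^ n) by (apply pow_lt; lra). rewrite ln_pow by lra.
  pose proof ln_10_lower as L10. pose proof (pos_INR n).
  assert (E : exp l <= INR n * ln 10) by (assert (INR n * 2.29 <= INR n * ln 10) by (apply Rmult_le_compat_l; lra); lra).
  split; [exact E|split; [|easy]]. rewrite <- (ln_exp l) at 1. apply ln_le; [apply exp_pos|easy].
Qed.

(** log log 10^2465 is about 8.64, whence the threshold 8.6; beyond it at most 20.1911 / 96.2 < 0.21
    is lost from 0.96. *)
Lemma phi1_bounds (T : R) : 0.75 <= phi1 T <= 0.96 /\ (1 < ln T -> ln (ln T) < 8.6 -> phi1 T = 0.96).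
Proof.
  unfold phi1, M1. set (n := 2465%nat).
  assert (E86 : exp 8.6 <= INR n * 2.29).
  { replace (INR n) with 2465 by (unfold n; rewrite INR_IZR_INZ; reflexivity). exp_upper 32%nat. }
  destruct (ln_pow_10 n 8.6 E86) as [A [B P]]. clearbody n.
  assert (E1 : 1 < ln (10 ^ n)) by (pose proof (exp_ineq1_le 8.6); lra).
  destruct (Rlt_dec T (10 ^ n)) as [H|H]; [split; [lra|easy]|]. split.
  - assert (R : 96.2 <= Rpower (ln (10 ^ n)) 0.285 * ln (ln (10 ^ n))).
    { apply Rle_trans with (11.2 * 8.6); [lra|]. apply Rmult_le_compat; [lra|lra| |easy]. apply Rle_trans with (exp (0.285 * 8.6)); [|apply exp_le; lra]. exp_lower 4%nat. }
    pose proof (Mfun_bounds 0.759282 20.1911 0.285 (10 ^ n) T 96.2 ltac:(lra) ltac:(lra) ltac:(lra) E1 ltac:(lra) R). lra.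
  - intros H1 H2. exfalso. assert (ln (10 ^ n) <= ln T) by (apply ln_le; lra).
    assert (ln (ln (10 ^ n)) <= ln (ln T)) by (apply ln_le; lra). lra.
Qed.

(** log log 10^208 is about 6.17, and 2.491 - 60.12 / 31.85 > 0.6. *)
Lemma phi2_lower (T : R) : 0.6 <= phi2 T.
Proof.
  unfold phi2, M2. set (n := 208%nat).
  assert (E : exp 6.15 <= INR n * 2.29).
  { replace (INR n) with 208 by (unfold n; rewrite INR_IZR_INZ; reflexivity). exp_upper 32%nat. }
  destruct (ln_pow_10 n 6.15 E) as [A [B P]]. clearbody n.
  assert (E1 : 1 < ln (10 ^ n)) by (pose proof (exp_ineq1_le 6.15); lra).
  destruct (Rlt_dec T (10 ^ n)) as [H|H]; [lra|].
  assert (R : 31.85 <= Rpower (ln (10 ^ n)) 0.2705 * ln (ln (10 ^ n))).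
  { apply Rle_trans with (5.18 * 6.15); [lra|]. apply Rmult_le_compat; [lra|lra| |easy]. apply Rle_trans with (exp (0.2705 * 6.15)); [|apply exp_le; lra]. exp_lower 4%nat. }
  pose proof (Mfun_bounds 0.653 60.12 0.2705 (10 ^ n) T 31.85 ltac:(lra) ltac:(lra) ltac:(lra) E1 ltac:(lra) R). lra.
Qed.

(** * Comparison of logarithms and conclusion *)

(** The estimate obtained from the discs does not contain lambda. It is matched with the claim at
    lambda = B, and passing to an arbitrary lambda costs B / lambda, which the term with [a1] in
    [Omega] pays for. *)
Lemma ln_tradeoff (x lam B : R) : 0 < x -> 0 < lam -> 0 < B -> ln (1 + 2 * B / x) <= ln (1 + 2 * lam / x) + B / lam.
Proof.
  intros Hx Hl HB. assert (P : 0 < B / lam) by pos. assert (Q : 0 < 2 * lam / x) by pos.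
  assert (R : 1 + 2 * B / x <= (1 + 2 * lam / x) * exp (B / lam)).
  { pose proof (exp_ineq1_le (B / lam)). apply Rle_trans with ((1 + 2 * lam / x) * (1 + B / lam)); [|apply Rmult_le_compat_l; lra].
    replace ((1 + 2 * lam / x) * (1 + B / lam)) with (1 + 2 * B / x + (2 * lam / x + B / lam)) by (field; lra). lra. }
  apply ln_le in R; [|assert (0 < 2 * B / x) by pos; lra].
  rewrite ln_mult, ln_exp in R; [lra|lra|apply exp_pos].
Qed.

(** The difference is the integral of 1 / (x + u) over a <= u <= b, and the integrand is at least 1
    / (l + b). *)
Lemma ln_gap (x l a b : R) : 0 < x <= l -> 0 < a <= b -> (b - a) / (l + b) <= ln (1 + b / x) - ln (1 + a / x).
Proof.
  intros Hx Ha. assert (P1 : 0 < a / x) by pos. assert (P2 : 0 < b / x) by pos.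
  rewrite <- ln_div by lra. replace ((1 + b / x) / (1 + a / x)) with (/ (1 - (b - a) / (x + b))) by (field; lra).
  assert (Q : 0 < 1 - (b - a) / (x + b)) by (replace (1 - (b - a) / (x + b)) with ((x + a) / (x + b)) by (field; lra); apply Rdiv_lt_0_compat; lra).
  rewrite ln_Rinv by easy. pose proof (exp_ineq1_le (- ((b - a) / (x + b)))) as I. apply ln_le in I; [|lra]. rewrite ln_exp in I.
  replace (1 + - ((b - a) / (x + b))) with (1 - (b - a) / (x + b)) in I by ring.
  assert ((b - a) / (l + b) <= (b - a) / (x + b)) by (apply Rmult_le_compat_l; [lra|]; apply Rinv_le_contravar; lra). lra.
Qed.

Theorem theorem3 :
  RH ->
  forall sigma t t0 lam : R,
    1 / 2 < sigma <= 3 / 2 ->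
    2 * gamma1 <= t0 ->
    Rmax (2 * exp (exp 2)) t0 <= t ->
    0 < lam <= t0 / 2 * ln (ln (3 * t0 / 2)) ->
    let T := 3 * t / 2 in
    Rabs (ln (Cmod (zeta (sigma, t)))) <=
      2 * (phi1 T * ln T / ln (ln T) + 1 / (75 * t))
        * ln (1 + 2 * lam / ((sigma - 1 / 2) * ln (ln T)))
      + Omega t0 lam t
    /\
    ln (Cmod (zeta (sigma, t))) <=
      lam * ln T / (PI * ln (ln T)) + Omega t0 lam t.
Proof.
  intros HRH sigma t t0 lam Hsig Hg Ht Hlam T.
  pose proof gamma1_nonneg as G0. pose proof PI_RGT_0 as PP. pose proof PI_4 as P4.
  (* The admissible range of [lam] is nonempty, so log log(3 t0 / 2) > 0 and 3 t0 / 2 exceeds e. *)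
  assert (Pt0 : 1 < t0).
  { assert (Z : 0 < ln (ln (3 * t0 / 2))) by nra. apply ln_pos_inv in Z.
    pose proof (exp_ineq1_le 1) as E. assert (Z2 : exp 1 < 3 * t0 / 2).
    { pose proof (ln_pos_inv (3 * t0 / 2) ltac:(lra)). destruct (Rlt_le_dec (exp 1) (3 * t0 / 2)) as [Q|Q]; [easy|].
      apply ln_le in Q; [rewrite ln_exp in Q; lra|lra]. }
    lra. }
  pose proof exp_exp_2_lower as EE. pose proof exp_2_lower as E2. pose proof ln_3_bounds as L3.
  assert (Ht1 : 2 * exp (exp 2) <= t) by (eapply Rle_trans; [apply Rmax_l|exact Ht]).
  assert (Ht2 : 3200 <= t) by lra.
  set (L := ln T). set (l := ln L).
  assert (HL : 8.477 <= L).
  { unfold L. apply Rle_trans with (ln (3 * exp (exp 2))); [rewrite ln_mult, ln_exp by lra; lra|apply ln_le; unfold T; lra]. }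
  assert (El : exp l = L) by (apply exp_ln; lra).
  assert (Hl : 2.13 <= l).
  { unfold l. rewrite <- (ln_exp 2.13). apply ln_le; [apply exp_pos|]. apply Rle_trans with 8.477; [|easy]. exp_upper 8%nat. }
  destruct (phi1_bounds T) as [Hphi Hphi2]. specialize (Hphi2 ltac:(fold L; lra)). fold L in Hphi2. fold l in Hphi2.
  pose proof (phi2_lower T) as Hp2.
  destruct (choose_N l (phi1 T) Hl ltac:(lra) ltac:(intros; rewrite Hphi2; lra)) as [N [HN [N1 [N2 [N3 N4]]]]].
  rewrite El in N1, N3, N4.
  destruct (log_zeta_main t sigma N HRH Ht2 Hsig HN) as [Z1 Z2]. fold (K1 N) in Z1, Z2.
  set (b := ln (t / (2 * PI))) in *. pose proof (K1_pos N) as PK. fold (K1 N) in PK.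
  (* t / (2 pi) <= T / 9 because pi >= 3, and log 9 >= 2.18. *)
  assert (Hb : b + 0.007 <= L - 2.17).
  { assert (Q : b <= ln (T / 9)).
    { pose proof PI2_3_2. apply ln_le; [apply Rdiv_lt_0_compat; lra|]. apply Rle_div_l; [lra|]. unfold T. nra. }
    rewrite ln_div in Q by (unfold T; lra). replace 9 with (3 * 3) in Q by ring. rewrite ln_mult in Q by lra. fold L in Q. lra. }
  set (X := L / l) in *. assert (PX : 0 < X) by (apply Rdiv_lt_0_compat; lra).
  set (Q := 2 * phi1 T * X) in *.
  replace (2 * phi1 T * L / l) with Q in N1, N3 by (unfold Q, X; field; lra).
  replace (298 / 100 * L / l) with (298 / 100 * X) in N4 by (unfold X, Rdiv; ring).
  assert (PQ : 0 < Q) by (unfold Q; apply Rmult_lt_0_compat; lra).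
  assert (PN : 1 <= INR N) by (apply (le_INR 1); lia). assert (P4N : 0 < 4 / INR N) by (apply Rdiv_lt_0_compat; lra).
  assert (N1' : 4 / INR N * (b + 0.007 + 2 * K1 N) <= Q) by (eapply Rle_trans; [|exact N1]; apply Rmult_le_compat_l; lra).
  set (s := sigma - 1 / 2) in *. assert (Hs : 0 < s <= 1) by (unfold s; lra).
  set (x := s * l). assert (Hx : 0 < x <= l) by (unfold x; split; nra).
  (* 24.15 = 40.25 times 0.6, from [a1_lower] and [phi2_lower]. *)
  set (P := a1 t0 * phi2 T). assert (HP : 24.15 <= P).
  { pose proof (a1_lower t0 ltac:(lra)). unfold P. apply Rle_trans with (40.25 * 0.6); [lra|]. apply Rmult_le_compat; lra. }
  assert (HO : P * X / lam + 3.24 <= Omega t0 lam t).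
  { assert (U1 : 0 <= a2 t0 * l / lam) by (apply div_nonneg; [apply Rmult_le_pos; [apply a2_nonneg|]|]; lra).
    assert (U2 : 0 <= 12 * (phi1 (t / 2) * ln (t / 2) / (t * ln (ln (t / 2))) + 1 / (75 * t ^ 2)) * lam / l).
    { destruct (phi1_bounds (t / 2)) as [F _].
      assert (V1 : exp 2 <= ln (t / 2)) by (rewrite <- (ln_exp (exp 2)); apply ln_le; [apply exp_pos|lra]).
      assert (V2 : 2 <= ln (ln (t / 2))) by (apply Rle_trans with (ln (exp 2)); [rewrite ln_exp; lra|apply ln_le; [apply exp_pos|easy]]).
      assert (V3 : 0 <= phi1 (t / 2) * ln (t / 2) / (t * ln (ln (t / 2)))) by (apply div_nonneg; apply Rmult_le_pos; lra).
      assert (V4 : 0 <= 1 / (75 * t ^ 2)) by (apply div_nonneg; [lra|pose proof (pow2_ge_0 t); lra]).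
      apply div_nonneg; [|lra]. apply Rmult_le_pos; lra. }
    assert (U3 : 0 <= a4 t0 * phi2 T / l ^ 2) by (apply div_nonneg; [apply Rmult_le_pos; [apply a4_nonneg|]; lra|apply pow2_ge_0]).
    pose proof (a3_lower t0 Pt0 Hg) as U4.
    unfold Omega. fold T. cbv zeta. fold L. fold l.
    replace (a1 t0 * phi2 T * L / (lam * l)) with (P * X / lam) by (unfold P, X; field; lra). lra. }
  assert (PPX : 24.15 * X / lam <= P * X / lam).
  { apply Rmult_le_compat_r; [left; apply Rinv_0_lt_compat; lra|]. apply Rmult_le_compat_r; lra. }
  split.
  - eapply Rle_trans; [exact Z1|].
    assert (W1 : Q * ln (1 + 2 * lam / x) <= 2 * (phi1 T * L / l + 1 / (75 * t)) * ln (1 + 2 * lam / x)).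
    { apply Rmult_le_compat_r.
      - apply ln_nonneg. assert (0 <= 2 * lam / x) by (apply div_nonneg; lra). lra.
      - assert (0 <= 1 / (75 * t)) by (apply div_nonneg; lra). replace (phi1 T * L / l) with (phi1 T * X) by (unfold X; field; lra). unfold Q. lra. }
    (* With phi at most 0.96 the cost Q (25/2) / lam is at most 24 X / lam, just below the available
       24.15 X / lam. *)
    pose proof (ln_tradeoff x lam (25 / 2) ltac:(lra) ltac:(lra) ltac:(lra)) as W2. replace (2 * (25 / 2)) with 25 in W2 by field.
    (* Enlarging 3.2 to 25 inside the logarithm yields the gain that absorbs [K1] N. *)
    pose proof (ln_gap x l (16 / 5) 25 Hx ltac:(lra)) as W3. replace ((25 - 16 / 5) / (l + 25)) with (21.8 / (l + 25)) in W3 by (apply Rmult_eq_compat_r; lra).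
    assert (W4 : ln (1 + 8 / (INR N * s)) <= ln (1 + 16 / 5 / x)).
    { apply ln_le; [assert (0 < 8 / (INR N * s)) by (apply Rdiv_lt_0_compat; [|apply Rmult_lt_0_compat]; lra); lra|].
      apply Rplus_le_compat_l. replace (8 / (INR N * s)) with (8 * l / INR N * / x) by (unfold x; field; lra).
      unfold Rdiv at 2. apply Rmult_le_compat_r; [left; apply Rinv_0_lt_compat; lra|lra]. }
    assert (W5 : 0 <= ln (1 + 8 / (INR N * s))).
    { apply ln_nonneg. assert (0 <= 8 / (INR N * s)) by (apply div_nonneg; [|apply Rmult_le_pos]; lra). lra. }
    assert (W6 : 4 / INR N * (b + 0.007 + 2 * K1 N) * ln (1 + 8 / (INR N * s)) <= Q * ln (1 + 16 / 5 / x)) by (apply Rmult_le_compat; try lra; apply Rmult_le_pos; [lra|pose proof (b_ge_1 t Ht2) as Bb; fold b in Bb; lra]).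
    assert (W7 : Q * (25 / 2 / lam) <= 24.15 * X / lam).
    { unfold Q. replace (2 * phi1 T * X * (25 / 2 / lam)) with (25 * phi1 T * X / lam) by (field; lra).
      apply Rmult_le_compat_r; [left; apply Rinv_0_lt_compat; lra|]. apply Rmult_le_compat_r; lra. }
    assert (W8 : Q * (21.8 / (l + 25)) <= Q * (ln (1 + 25 / x) - ln (1 + 16 / 5 / x))) by (apply Rmult_le_compat_l; lra).
    assert (W9 : Q * ln (1 + 25 / x) <= Q * (ln (1 + 2 * lam / x) + 25 / 2 / lam)) by (apply Rmult_le_compat_l; lra).
    lra.
  - eapply Rle_trans; [exact Z2|].
    assert (W1 : 4 / INR N * b <= 1.92 * X).
    { apply Rle_trans with Q; [|unfold Q; apply Rmult_le_compat_r; lra]. eapply Rle_trans; [|exact N1']. apply Rmult_le_compat_l; lra. }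
    assert (W2 : lam * L / (PI * l) = lam / PI * X) by (unfold X; field; lra). rewrite W2.
    assert (W3 : lam / 4 * X <= lam / PI * X).
    { apply Rmult_le_compat_r; [lra|]. apply Rmult_le_compat_l; [lra|]. apply Rinv_le_contravar; lra. }
    (* AM-GM: [lam / 4 + 24.15 / lam >= sqrt 24.15 > 4.9] *)
    assert (W4 : 4.9 * X <= lam / 4 * X + 24.15 * X / lam).
    { replace (lam / 4 * X + 24.15 * X / lam) with (X * (lam / 4 + 24.15 / lam)) by (unfold Rdiv; ring). rewrite (Rmult_comm 4.9).
      apply Rmult_le_compat_l; [lra|]. replace (lam / 4 + 24.15 / lam) with ((lam * lam / 4 + 24.15) / lam) by (unfold Rdiv; rewrite Rmult_plus_distr_r; field; lra).
      apply (Rle_div_r _ _ lam); [lra|]. pose proof (pow2_ge_0 (lam - 9.8)). nra. }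
    lra.
Qed.
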